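(* Let $F=(f,K,m)$ be an $L$-datum, with associated $L$-function $L_F(s)=\sum_{n=1}^\infty a_F(n)n^{-s}$. Then the following are equivalent: (i) $F=(0,0,0)$; (ii) $\sum_{n=2}^\infty\frac{|f(n)|}{\log n}<\infty$; (iii) $\sum_{n=1}^\infty\frac{|a_F(n)|}{\sqrt n}<\infty$; (iv) $L_F(s)$ is a ratio of Dirichlet polynomials; (v) $\sum_{z\in\operatorname{supp}(m),\,|\Re(z)|\le T}|m(z)|=o(T)$ as $T\to\infty$.
   Context: An $L$-datum is a triple $F=(f,K,m)$ of functions $f:\mathbb{Z}_{>0}\to\mathbb{C}$, $K:\mathbb{R}_{>0}\to\mathbb{C}$, $m:\mathbb{C}\to\mathbb{R}$ satisfying: (A1) $f(1)\in\mathbb{R}$; $f(n)\log^k n\ll_k 1$ for all $k>0$; and $\sum_{n\le x}|f(n)|^2\ll_\varepsilon x^\varepsilon$ for all $\varepsilon>0$. (A2) $xK(x)$ extends to a Schwartz function on $\mathbb{R}$, and $\lim_{x\to0^+}xK(x)\in\mathbb{R}$. (A3) $\operatorname{supp}(m)=\{z\in\mathbb{C}:m(z)\ne0\}$ is discrete and contained in a horizontal strip $\{z:|\Im(z)|\le y\}$ for some $y\ge0$; $\sum_{z\in\operatorname{supp}(m),\,|\Re(z)|\le T}|m(z)|\ll 1+T^A$ for some $A\ge0$; and $\#\{z\in\operatorname{supp}(m):m(z)\notin\mathbb{Z}\}<\infty$. (A4) For every smooth compactly supported $g:\mathbb{R}\to\mathbb{C}$ whose Fourier transform $h(z)=\int_{\mathbb{R}}g(x)e^{ixz}\,dx$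 satisfies $h(\mathbb{R})\subseteq\mathbb{R}$, $$\sum_{z\in\operatorname{supp}(m)}m(z)h(z)=2\Re\Bigl[\int_0^\infty K(x)(g(0)-g(x))\,dx-\sum_{n=1}^\infty f(n)g(\log n)\Bigr].$$ The $L$-function of $F$ is $L_F(s)=\sum_{n=1}^\infty a_F(n)n^{-s}=\exp\Bigl(\sum_{n=2}^\infty\frac{f(n)}{\log n}n^{\frac12-s}\Bigr)$ for $\Re(s)>1$; this defines the coefficients $a_F(n)$. A Dirichlet polynomial is a finite sum $\sum_{n\le N}c_n n^{-s}$ with $c_n\in\mathbb{C}$. *)

(* Defs.v *)
From HB Require Import structures.
From mathcomp Require Import all_boot all_order all_algebra.
From mathcomp Require Import complex.
From mathcomp Require Import all_classical all_reals all_analysis.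
From mathcomp Require Import summability.

Set Implicit Arguments.
Unset Strict Implicit.
Unset Printing Implicit Defensive.

Import Order.TTheory GRing.Theory Num.Theory.
Export numFieldNormedType.Exports.

Local Open Scope classical_set_scope.
Local Open Scope ring_scope.
Local Open Scope complex_scope.

(* The topology of R[i] induced by its norm. *)
HB.instance Definition _ (R : rcfType) := NormedModule.copy R[i] R[i]^o.

(* The norm `|z| of z : R[i] lives in R[i]; real-valued moduli are written
   with [normc]. *)
Notation Re := complex.Re.
Notation Im := complex.Im.
Notation normc := Normc.normc.

Section ComplexFunctions.
Variable R : realType.
Implicit Types (z s : R[i]) (u g phi : R -> R[i]) (n : nat).

Definition cexp z : R[i] := (expR (Re z))%:C * (cos (Im z) +i* sin (Im z)).

(* n ^ s := exp (s log n), for n > 0 *)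
Definition cpow n s : R[i] := cexp (s * (ln (n%:R : R))%:C).

Definition cintegral (D : set R) u : R[i] :=
  (\int[lebesgue_measure]_(x in D) Re (u x)) +i*
  (\int[lebesgue_measure]_(x in D) Im (u x)).

Definition smooth (v : R -> R) : Prop :=
  forall k (x : R), derivable (v^`(k)%classic) x 1.

Definition csmooth u : Prop :=
  smooth (fun x => Re (u x)) /\ smooth (fun x => Im (u x)).

Definition schwartz (v : R -> R) : Prop :=
  smooth v /\
  forall j k : nat, exists C : R, forall x : R, `|x ^+ j * v^`(k)%classic x| <= C.

Definition cschwartz u : Prop :=
  schwartz (fun x => Re (u x)) /\ schwartz (fun x => Im (u x)).

Definition compactly_supported g : Prop :=
  compact (closure [set x | g x != 0]).

Definition fourier g z : R[i] :=
  cintegral setT (fun x => g x * cexp ('i * x%:C * z)).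

End ComplexFunctions.

Section LDatum.
Variable R : realType.
(* The values of [f] at 0 and of [K] outside of ]0, +oo[ are junk: no
   definition below refers to them. *)
Implicit Types (f a : nat -> R[i]) (K : R -> R[i]) (m : R[i] -> R).

Definition supp m : set R[i] := [set z | m z != 0].

Definition mass_upto m (T : R) : \bar R :=
  \esum_(z in supp m `&` [set z | `|Re z| <= T]) (`|m z|)%:E.

Definition axiom_A1 f : Prop :=
  [/\ Im (f 1%N) = 0,
      forall k : R, 0 < k -> exists C : R, forall n : nat, (0 < n)%N ->
        normc (f n) * ln (n%:R : R) `^ k <= C
    & forall eps : R, 0 < eps -> exists C : R, forall x : R, 1 <= x ->
        \sum_(1 <= n < (Num.truncn x).+1) normc (f n) ^+ 2 <= C * x `^ eps].

Definition axiom_A2 K : Prop :=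
  (exists2 phi : R -> R[i],
     cschwartz phi & forall x : R, 0 < x -> phi x = x%:C * K x) /\
  (exists l : R, x%:C * K x @[x --> (0 : R)^'+] --> (l%:C : R[i])).

Definition axiom_A3 m : Prop :=
  [/\ supp m `<=` isolated (supp m),
      exists2 y : R, 0 <= y & forall z, supp m z -> `|Im z| <= y,
      exists2 A : R, 0 <= A & exists C : R, forall T : R, 0 <= T ->
        (mass_upto m T <= (C * (1 + T `^ A))%:E)%E
    & finite_set (supp m `&` [set z | m z \isn't a Num.int])].

(* The sum over supp m is the limit of the net of finite partial sums; the
   terms outside of supp m vanish, so the index can range over all of R[i]. *)
Definition axiom_A4 f K m : Prop :=
  forall g : R -> R[i], csmooth g -> compactly_supported g ->
    (forall x : R, Im (fourier g x%:C) = 0) ->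
    partial_sum (fun z : R[i] => (m z)%:C * fourier g z) @ totally -->
      (2 * Re (cintegral `]0, +oo[ (fun x => K x * (g 0 - g x))
               - \big[+%R/0]_(1 <= n <oo) (f n * g (ln (n%:R : R)))))%:C.

Definition L_datum f K m : Prop :=
  [/\ axiom_A1 f, axiom_A2 K, axiom_A3 m & axiom_A4 f K m].

(* Only meaningful for Re s > 1. *)
Definition L_function f (s : R[i]) : R[i] :=
  cexp (\big[+%R/0]_(2 <= n <oo)
          (f n / (ln (n%:R : R))%:C * cpow n (2^-1 - s))).

Definition is_L_coef f a : Prop :=
  forall s : R[i], 1 < Re s ->
    (fun N => \sum_(1 <= n < N) a n * cpow n (- s)) @ \oo --> L_function f s.

(* The coefficients a_F(n), n > 0, characterized by their Dirichlet series. *)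
Definition L_coef f : nat -> R[i] := xget (fun=> 0) [set a | is_L_coef f a].

Definition dirichlet_poly (P : R[i] -> R[i]) : Prop :=
  exists (N : nat) (c : nat -> R[i]),
    forall s, P s = \sum_(1 <= n < N.+1) c n * cpow n (- s).

(* P / Q may have removable singularities at zeros of Q, where the library's
   convention x / 0 = 0 would make the equation below fail. *)
Definition ratio_of_dirichlet_polys (L : R[i] -> R[i]) : Prop :=
  exists P Q : R[i] -> R[i],
    [/\ dirichlet_poly P, dirichlet_poly Q, exists s, Q s != 0
      & forall s, 1 < Re s -> Q s != 0 -> L s = P s / Q s].

End LDatum.

(* Main.v *)
(** Put [A n = a_F(n) / sqrt n]. By (A4) for a small bump translated by [t >= 0],
the sum of [c_z e^(itz)] over the zeros, with [c_z] a multiple of [m z], is a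
series of spikes at the points [log n] plus a decaying term; Laplace transforms
of high order show that it vanishes if the spikes are summable against
[1 / (1 + t)]: (ii) implies (i). Under (iii), convolving with [A] first makes
[L(1/2 + iz)] vanish at the zeros [z] and gives [L(1/2 + it)] the phase of
[e^(-i Theta(t))] up to a constant for large [t]; since [Theta'] varies slowly,
Bohr means give [A n = 0] for large [n], which is (iv). Under (iv), [f] is
supported on smooth numbers, whence (ii). Under (v), bumps shrinking to [log n]
give [f n = 0] for [n >= 2]. *)
Require Import Defs.
From HB Require Import structures.
From mathcomp Require Import all_boot all_order all_algebra complex finmap.
From mathcomp Require Import all_classical all_reals all_analysis summability.
From mathcomp Require Import measurable_realfun ring lra zify.

Set Implicit Arguments.
Unset Strict Implicit.

Import Order.TTheory GRing.Theory Num.Theory.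

Local Open Scope classical_set_scope.
Local Open Scope ring_scope.
Local Open Scope complex_scope.
Local Notation Re := complex.Re.
Local Notation Im := complex.Im.
Local Notation mu := (@lebesgue_measure _).
Local Notation cint := (@cintegral _).
Local Notation RintZl := (@RintegralZl _ _ _ mu).
Local Notation RintD := (@RintegralD _ _ _ mu).
Local Notation RintB := (@RintegralB _ _ _ mu).
Local Notation le_Rint := (@le_Rintegral _ _ _ mu).
Local Notation Rint_cst := (@Rintegral_cst _ _ _ mu).
Local Notation cvgc_unique := (@cvg_unique _ (@norm_hausdorff _ _) _ _ _ _).

(** The exponentials are isolated by integrating against t^k e^(-st) with k growing: suitably
    normalised, only the pole nearest to s survives, while a term integrable against 1/(1+t)
    contributes amounts summable against 1/(k+1), and the divergence of the harmonic series forbids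
    these to stay bounded below. Under (iii) the spikes themselves are not known to be summable in
    this sense. The identity log n A n = (f * A)(n), the coefficient form of L' = (L'/L) L, replaces
    the weight f n by log n A n, which is summable after division by log n; the price is a factor L
    at each zero. No continuation of L past the critical line is available, so the phase there is a
    limit along the lines Re s = 1/2 + r^2: on them L'/L is a sum over zeros plus a transform of the
    kernel, zeros on the line are divided out with integral multiplicities, and the symmetry of the
    zeros together with the evenness of the bump leaves - Theta' as the limit of the real part. A
    zero z is represented by w = i z, so that 1/2 + w is its place in the s-plane and Re w = - Im
    z. *)

Lemma le_of_eq (R : realType) (x y : R) : x = y -> x <= y. Proof. by move->. Qed.
Lemma sum0_nat (V : nmodType) m n (P : pred nat) (F : nat -> V) :
  (forall i, P i -> (m <= i < n)%N -> F i = 0) -> \sum_(m <= i < n | P i) F i = 0.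
Proof. by move=> h; rewrite big1_seq // => i /andP[Pi]; rewrite mem_index_iota; exact: h. Qed.

(** * Complex numbers, the complex exponential and limits of complex functions *)

Section ComplexNumbers.
Variable R : realType.
Implicit Types (z w s : R[i]).

Lemma ReD z w : Re (z + w) = Re z + Re w. Proof. by case: z; case: w. Qed.
Lemma ImD z w : Im (z + w) = Im z + Im w. Proof. by case: z; case: w. Qed.
Lemma ReN z : Re (- z) = - Re z. Proof. by case: z. Qed.
Lemma ImN z : Im (- z) = - Im z. Proof. by case: z. Qed.
Lemma ReB z w : Re (z - w) = Re z - Re w. Proof. by rewrite ReD ReN. Qed.
Lemma ImB z w : Im (z - w) = Im z - Im w. Proof. by rewrite ImD ImN. Qed.
Lemma ReM z w : Re (z * w) = Re z * Re w - Im z * Im w.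
Proof. by case: z; case: w. Qed.
Lemma ImM z w : Im (z * w) = Re z * Im w + Im z * Re w.
Proof. by case: z => a b; case: w => c d /=; rewrite [b * c]mulrC. Qed.
Lemma Re_sum (I : Type) (r : seq I) (P : pred I) (F : I -> R[i]) :
  Re (\sum_(i <- r | P i) F i) = \sum_(i <- r | P i) Re (F i).
Proof. by elim/big_rec2: _ => // i a b _ <-; rewrite ReD. Qed.
Lemma Im_sum (I : Type) (r : seq I) (P : pred I) (F : I -> R[i]) :
  Im (\sum_(i <- r | P i) F i) = \sum_(i <- r | P i) Im (F i).
Proof. by elim/big_rec2: _ => // i a b _ <-; rewrite ImD. Qed.
Lemma Re_conjc z : Re (conjc z) = Re z. Proof. by case: z. Qed.
Lemma Im_conjc z : Im (conjc z) = - Im z. Proof. by case: z. Qed.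
Lemma complex_ext z w : Re z = Re w -> Im z = Im w -> z = w.
Proof. by case: z => a b; case: w => c d /= -> ->. Qed.
Lemma Re_rC x z : Re (x%:C * z) = x * Re z.
Proof. by rewrite ReM /= mul0r subr0. Qed.
Lemma Im_rC x z : Im (x%:C * z) = x * Im z.
Proof. by rewrite ImM /= mul0r addr0. Qed.
Lemma Re_rCr x z : Re (z * x%:C) = Re z * x.
Proof. by rewrite mulrC Re_rC mulrC. Qed.
Lemma Im_rCr x z : Im (z * x%:C) = Im z * x.
Proof. by rewrite mulrC Im_rC mulrC. Qed.
Lemma rCM x y : (x * y)%:C = x%:C * y%:C :> R[i].
Proof. exact: rmorphM. Qed.
Lemma rCD x y : (x + y)%:C = x%:C + y%:C :> R[i].
Proof. exact: rmorphD. Qed.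
Lemma rCN x : (- x)%:C = - x%:C :> R[i].
Proof. exact: rmorphN. Qed.
Lemma rCV x : (x^-1)%:C = x%:C^-1 :> R[i].
Proof. exact: fmorphV. Qed.
Lemma rCX x n : (x ^+ n)%:C = x%:C ^+ n :> R[i].
Proof. exact: rmorphXn. Qed.
Lemma normcEsqrt z : normc z = Num.sqrt (Re z ^+ 2 + Im z ^+ 2).
Proof. by case: z. Qed.
Lemma normc_ge0 z : 0 <= normc z.
Proof. by rewrite normcEsqrt sqrtr_ge0. Qed.
Lemma normc_sqr z : normc z ^+ 2 = Re z ^+ 2 + Im z ^+ 2.
Proof. by rewrite normcEsqrt sqr_sqrtr // addr_ge0 ?sqr_ge0. Qed.
Lemma ler_normc_Re z : `|Re z| <= normc z.
Proof. by rewrite normcEsqrt -sqrtr_sqr ler_wsqrtr // lerDl sqr_ge0. Qed.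
Lemma ler_normc_Im z : `|Im z| <= normc z.
Proof. by rewrite normcEsqrt -sqrtr_sqr ler_wsqrtr // lerDr sqr_ge0. Qed.

Lemma normc_le_ReIm z : normc z <= `|Re z| + `|Im z|.
Proof.
rewrite -(ler_pXn2r (n:=2)) ?nnegrE ?normc_ge0 // normc_sqr sqrrD.
rewrite !real_normK ?num_real // -addrA lerD2l lerDr.
by rewrite mulrn_wge0 // mulr_ge0.
Qed.

Lemma normc_rC x : normc (x%:C : R[i]) = `|x|.
Proof. by rewrite normcEsqrt /= expr0n /= addr0 sqrtr_sqr. Qed.
Lemma normc_nat n : normc (n%:R : R[i]) = n%:R.
Proof. by rewrite (_ : n%:R = (n%:R)%:C) ?normc_rC ?ger0_norm // rmorph_nat. Qed.
Lemma normcD z w : normc (z + w) <= normc z + normc w.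
Proof. exact: le_normcD. Qed.
Lemma normcB z w : normc (z - w) <= normc z + normc w.
Proof. by rewrite -(normcN w) normcD. Qed.
Lemma normc_distC z w : normc (z - w) = normc (w - z).
Proof. by rewrite -normcN opprB. Qed.

Lemma normc_eq0 z : (normc z == 0) = (z == 0).
Proof.
apply/eqP/eqP => [/Normc.eq0_normc //|->].
by rewrite normcEsqrt /= expr0n /= addr0 sqrtr0.
Qed.

Lemma normc0_ : normc (0 : R[i]) = 0. Proof. by apply/eqP; rewrite normc_eq0. Qed.
Lemma normc1_ : normc (1 : R[i]) = 1.
Proof. by rewrite (_ : 1 = 1%:C) // normc_rC normr1. Qed.
Lemma normc_gt0 z : (0 < normc z) = (z != 0).
Proof. by rewrite lt0r normc_eq0 normc_ge0 andbT. Qed.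
Lemma normcM_ z w : normc (z * w) = normc z * normc w.
Proof. exact: Normc.normcM. Qed.
Lemma normcV_ z : normc z^-1 = (normc z)^-1.
Proof. exact: Normc.normcV. Qed.
Lemma normcX_ z n : normc (z ^+ n) = normc z ^+ n.
Proof. by elim: n => [|n IH]; rewrite ?expr0 ?normc1_ // !exprS normcM_ IH. Qed.
Lemma normc_conjc z : normc (conjc z) = normc z.
Proof. by rewrite !normcEsqrt Re_conjc Im_conjc sqrrN. Qed.

Lemma normc_sum (I : Type) (r : seq I) (P : pred I) (F : I -> R[i]) :
  normc (\sum_(i <- r | P i) F i) <= \sum_(i <- r | P i) normc (F i).
Proof.
elim/big_rec2: _ => [|i a b _ H]; first by rewrite normc0_.
by rewrite (le_trans (normcD _ _)) // lerD2l.
Qed.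

Lemma ler_normc_dist z w : normc z - normc w <= normc (z - w).
Proof. by rewrite lerBlDr -{1}(subrK w z) normcD. Qed.
Lemma cexp0 : cexp (0 : R[i]) = 1.
Proof. by rewrite /cexp /= expR0 cos0 sin0 mul1r. Qed.

Lemma cexpD z w : cexp (z + w) = cexp z * cexp w.
Proof.
rewrite /cexp ReD ImD expRD rCM; set a := expR _; set b := expR _.
rewrite mulrACA; congr (_ * _); apply: complex_ext; rewrite /=.
  by rewrite cosD.
by rewrite sinD addrC.
Qed.

Lemma normc_cexp z : normc (cexp z) = expR (Re z).
Proof.
rewrite /cexp normcM_ normc_rC ger0_norm ?expR_ge0 //.
by rewrite normcEsqrt /= cos2Dsin2 sqrtr1 mulr1.
Qed.

Lemma cexp_neq0 z : cexp z != 0.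
Proof. by rewrite -normc_gt0 normc_cexp expR_gt0. Qed.

Lemma cexpN z : cexp (- z) = (cexp z)^-1.
Proof.
apply: (mulfI (cexp_neq0 z)); rewrite -cexpD subrr cexp0 mulfV //.
exact: cexp_neq0.
Qed.

Lemma cexp_rC x : cexp (x%:C : R[i]) = (expR x)%:C.
Proof. by rewrite /cexp /= cos0 sin0 mulr1. Qed.

Lemma cexp_conjc z : cexp (conjc z) = conjc (cexp z).
Proof.
by apply: complex_ext; rewrite ?Re_conjc ?Im_conjc /cexp !(Re_rC, Im_rC) Re_conjc
  Im_conjc ?cosN ?sinN ?mulrN.
Qed.

Lemma Re_cexp z : Re (cexp z) = expR (Re z) * cos (Im z).
Proof. by rewrite Re_rC. Qed.
Lemma Im_cexp z : Im (cexp z) = expR (Re z) * sin (Im z).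
Proof. by rewrite Im_rC. Qed.

Lemma cexpXn z n : cexp z ^+ n = cexp (n%:R * z).
Proof.
elim: n => [|n IH]; first by rewrite mul0r cexp0.
by rewrite exprS IH -cexpD -natr1 mulrDl mul1r addrC.
Qed.

Lemma cpowD n s w : cpow n (s + w) = cpow n s * cpow n w.
Proof. by rewrite /cpow mulrDl cexpD. Qed.
Lemma cpow0 n : cpow n (0 : R[i]) = 1.
Proof. by rewrite /cpow mul0r cexp0. Qed.
Lemma cpow1n s : cpow 1 s = 1.
Proof. by rewrite /cpow ln1 mulr0 cexp0. Qed.
Lemma cpowM k n s : (0 < k)%N -> (0 < n)%N -> cpow (k * n) s = cpow k s * cpow n s.
Proof.
move=> k0 n0; rewrite /cpow natrM lnM ?posrE ?ltr0n //.
by rewrite rCD mulrDr cexpD.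
Qed.
Lemma normc_cpow n s : normc (cpow n s) = expR (Re s * ln (n%:R : R)).
Proof. by rewrite /cpow normc_cexp Re_rCr. Qed.
Lemma cpow_neq0 n s : cpow n s != 0. Proof. exact: cexp_neq0. Qed.
Lemma cpowN n s : cpow n (- s) = (cpow n s)^-1.
Proof. by rewrite /cpow mulNr cexpN. Qed.
Lemma cpow_nat n (k : nat) : (0 < n)%N -> cpow n (k%:R : R[i]) = n%:R ^+ k.
Proof.
move=> n0; rewrite /cpow -cexpXn cexp_rC lnK ?posrE ?ltr0n //.
by rewrite rmorph_nat.
Qed.

Lemma cvg_normcP {T : Type} (F : set_system T) (FF : Filter F) (u : T -> R[i]) l :
  (u @ F --> l) <-> (forall e : R, 0 < e -> \forall x \near F, normc (l - u x) < e).
Proof.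
split=> [/cvgrPdist_lt H e e0|H].
  have e0' : (0 : R[i]) < e%:C by rewrite ltcR.
  apply: filterS (H _ e0') => x.
  by rewrite normc_def ltcR -normcEsqrt.
apply/cvgrPdist_lt => e; rewrite ltcE /= => /andP[/eqP e1 e0].
apply: filterS (H _ e0) => x.
by rewrite normc_def ltcE /= -normcEsqrt e1 eqxx.
Qed.

Lemma cvg_normc0P {T : Type} (F : set_system T) (FF : Filter F) (u : T -> R[i]) (l : R[i]) :
  (u @ F --> l) <-> ((fun x : T => normc (u x - l)) @ F --> (0 : R)).
Proof.
split=> [/(cvg_normcP FF) H|H].
  apply/cvgrPdist_lt => e e0; apply: filterS (H _ e0) => x.
  by rewrite sub0r normrN ger0_norm ?normc_ge0 // normc_distC.
apply/cvg_normcP => e e0; move/cvgrPdist_lt : H => /(_ _ e0).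
apply: filterS => x.
by rewrite sub0r normrN ger0_norm ?normc_ge0 // normc_distC.
Qed.

Lemma cvg_ReIm {T : Type} (F : set_system T) (FF : Filter F) (u : T -> R[i]) (l : R[i]) :
  (u @ F --> l) <->
  ((fun x : T => Re (u x)) @ F --> Re l /\ (fun x : T => Im (u x)) @ F --> Im l).
Proof.
split=> [/cvg_normcP H|[H1 H2]].
  split; apply/cvgrPdist_lt => e e0; apply: filterS (H _ e0) => x; apply: le_lt_trans.
    by rewrite -ReB ler_normc_Re.
  by rewrite -ImB ler_normc_Im.
apply/cvg_normcP => e e0; have e2 : 0 < e / 2 by rewrite divr_gt0.
move/cvgrPdist_lt : H1 => /(_ _ e2) H1; move/cvgrPdist_lt : H2 => /(_ _ e2) H2.
apply: filterS2 H1 H2 => x h1 h2; rewrite (splitr e).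
by apply: le_lt_trans (normc_le_ReIm _) _; rewrite ReB ImB ltrD.
Qed.

End ComplexNumbers.

(** * Derivatives of complex functions of a real variable *)

Section Derivative.
Variable R : realType.
Implicit Types (t : R).

Definition cderiv u t (d : R[i]) : Prop :=
  is_derive t 1 (fun x => Re (u x)) (Re d) /\ is_derive t 1 (fun x => Im (u x)) (Im d).

Lemma is_derive_nondecr (f df : R -> R) (a b : R) : a <= b ->
  (forall x : R, a <= x <= b -> is_derive x 1 f (df x)) ->
  (forall x : R, a <= x <= b -> 0 <= df x) -> f a <= f b.
Proof.
move=> ab fd fp.
have [] := @MVT_segment _ f df a b ab.
- by move=> x; rewrite in_itv /= => /andP[/ltW ax /ltW xb]; apply: fd; rewrite ax xb.
- apply: derivable_within_continuous => x; rewrite in_itv /= => xab.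
  by have [] := fd _ xab.
move=> c; rewrite in_itv /= => cab E.
by rewrite -subr_ge0 E mulr_ge0 ?fp // subr_ge0.
Qed.

(** Both [g - f] and [g + f] are nondecreasing. Complex functions are handled by applying this to
    real and imaginary parts. *)
Lemma is_derive_bound (f df g dg : R -> R) (a b : R) : a <= b ->
  (forall x : R, a <= x <= b -> is_derive x 1 f (df x)) ->
  (forall x : R, a <= x <= b -> is_derive x 1 g (dg x)) ->
  (forall x : R, a <= x <= b -> `|df x| <= dg x) -> `|f b - f a| <= g b - g a.
Proof.
move=> ab fd gd le; rewrite ler_norml; apply/andP; split.
  have := @is_derive_nondecr (fun x => g x + f x) (fun x => dg x + df x) a b ab.
  have -> : (- (g b - g a) <= f b - f a) = (g a + f a <= g b + f b) by apply/idP/idP; lra.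
  apply=> x xab; first exact: is_deriveD (gd _ xab) (fd _ xab).
  by have := le _ xab; rewrite ler_norml => /andP[]; lra.
have := @is_derive_nondecr (fun x => g x - f x) (fun x => dg x - df x) a b ab.
have -> : (f b - f a <= g b - g a) = (g a - f a <= g b - f b) by apply/idP/idP; lra.
apply=> x xab; first exact: is_deriveB (gd _ xab) (fd _ xab).
by have := le _ xab; rewrite ler_norml => /andP[]; lra.
Qed.

Lemma is_derive_pow n (t : R) : is_derive t 1 (fun x : R => x ^+ n) (n%:R * t ^+ n.-1).
Proof.
elim: n => [|n IH]; first by rewrite mul0r; apply: is_derive_cst.
rewrite (_ : (fun x : R => _) = (fun x : R => x * x ^+ n)); last by apply/funext=> x; rewrite exprS.
apply: (is_derive_eq (is_deriveM (is_derive_id t (1 : R)) IH)).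
rewrite /GRing.scale /=; case: n {IH} => [|n /=]; first by rewrite expr0 mul0r mulr0 add0r.
by rewrite -[n.+2]add1n natrD exprS; ring.
Qed.

Lemma cderiv_eq u t d d' : cderiv u t d -> d = d' -> cderiv u t d'.
Proof. by move=> H <-. Qed.
Lemma cderiv_cst (c : R[i]) t : cderiv (fun=> c) t 0.
Proof. by split; apply: is_derive_cst. Qed.

Lemma cderivD u v t du dv : cderiv u t du -> cderiv v t dv ->
  cderiv (fun x => u x + v x) t (du + dv).
Proof.
move=> [ur ui] [vr vi]; split.
  rewrite (_ : (fun x => _) = fun x => Re (u x) + Re (v x)); last by apply/funext=> x; rewrite ReD.
  by rewrite ReD; apply: is_deriveD.
rewrite (_ : (fun x => _) = fun x => Im (u x) + Im (v x)); last by apply/funext=> x; rewrite ImD.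
by rewrite ImD; apply: is_deriveD.
Qed.

Lemma cderivN u t du : cderiv u t du -> cderiv (fun x => - u x) t (- du).
Proof.
move=> [ur ui]; split.
  rewrite (_ : (fun x => _) = fun x => - Re (u x)); last by apply/funext=> x; rewrite ReN.
  by rewrite ReN; apply: is_deriveN.
rewrite (_ : (fun x => _) = fun x => - Im (u x)); last by apply/funext=> x; rewrite ImN.
by rewrite ImN; apply: is_deriveN.
Qed.

Lemma cderivM u v t du dv : cderiv u t du -> cderiv v t dv ->
  cderiv (fun x => u x * v x) t (du * v t + u t * dv).
Proof.
move=> [ur ui] [vr vi]; split.
  rewrite (_ : (fun x => _) = fun x => Re (u x) * Re (v x) - Im (u x) * Im (v x)).
    apply: (is_derive_eq (is_deriveB (is_deriveM ur vr) (is_deriveM ui vi))).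
    by rewrite /GRing.scale /= ReD !ReM; ring.
  by apply/funext=> x; rewrite ReM.
rewrite (_ : (fun x => _) = fun x => Re (u x) * Im (v x) + Im (u x) * Re (v x)).
  apply: (is_derive_eq (is_deriveD (is_deriveM ur vi) (is_deriveM ui vr))).
  by rewrite /GRing.scale /= ImD !ImM; ring.
by apply/funext=> x; rewrite ImM.
Qed.

Lemma cderivZ (c : R[i]) u t du : cderiv u t du -> cderiv (fun x => c * u x) t (c * du).
Proof.
by move=> H; apply: (cderiv_eq (cderivM (cderiv_cst c t) H)); rewrite mul0r add0r.
Qed.

Lemma cderiv_real (f : R -> R) t d : is_derive t 1 f d -> cderiv (fun x => (f x)%:C) t d%:C.
Proof. by move=> H; split => //=; apply: is_derive_cst. Qed.

Lemma cderiv_lin (w : R[i]) t : cderiv (fun x => x%:C * w) t w.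
Proof.
apply: (cderiv_eq (cderivM (cderiv_real (is_derive_id t 1)) (cderiv_cst w t))).
by rewrite mulr0 addr0 mul1r.
Qed.

Lemma cderiv_comp_cexp u t du : cderiv u t du ->
  cderiv (fun x => cexp (u x)) t (du * cexp (u t)).
Proof.
move=> [ur ui].
have He := cderiv_real (is_derive1_comp (is_derive_expR (Re (u t))) ur).
have Hc : cderiv (fun x => cos (Im (u x)) +i* sin (Im (u x))) t
    (- (Im du * sin (Im (u t))) +i* (Im du * cos (Im (u t)))).
  split => /=.
    by apply: (is_derive_eq (is_derive1_comp (is_derive_cos (Im (u t))) ui)); ring.
  by apply: (is_derive_eq (is_derive1_comp (is_derive_sin (Im (u t))) ui)); ring.
apply: (cderiv_eq (cderivM He Hc)); rewrite /cexp.
by apply: complex_ext; rewrite ?(ReD, ImD, ReM, ImM) /=; ring.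
Qed.

Lemma cderiv_sum (I : Type) (r : seq I) (P : pred I) (F : I -> R -> R[i]) (dF : I -> R[i]) t :
  (forall i, P i -> cderiv (F i) t (dF i)) ->
  cderiv (fun x => \sum_(i <- r | P i) F i x) t (\sum_(i <- r | P i) dF i).
Proof.
move=> H; elim: r => [|i r IH].
  rewrite big_nil (_ : (fun x => _) = fun=> 0); first exact: cderiv_cst.
  by apply/funext => x; rewrite big_nil.
rewrite big_cons (_ : (fun x => _) = (fun x =>
   if P i then F i x + \sum_(j <- r | P j) F j x else \sum_(j <- r | P j) F j x)).
  by case: ifP => Pi //; apply: cderivD => //; apply: H.
by apply/funext => x; rewrite big_cons.
Qed.

Lemma cderivX u t du n : cderiv u t du ->
  cderiv (fun x => u x ^+ n) t (n%:R * du * u t ^+ n.-1).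
Proof.
move=> ud; elim: n => [|n IH].
  by rewrite mul0r mul0r; apply: cderiv_cst.
rewrite (_ : (fun x => _) = fun x => u x * u x ^+ n); last by apply/funext=> x; rewrite exprS.
apply: (cderiv_eq (cderivM ud IH)); rewrite /=; case: n {IH} => [|n /=].
  by rewrite expr0 !mul0r mulr0 addr0 mul1r.
by rewrite -[n.+2]add1n natrD exprS; ring.
Qed.

Lemma cderivV u t du : u t != 0 -> cderiv u t du ->
  cderiv (fun x => (u x)^-1) t (- du / u t ^+ 2).
Proof.
move=> u0 [ur ui].
have n0 : Re (u t) * Re (u t) + Im (u t) * Im (u t) != 0.
  by rewrite -!expr2 -normc_sqr expf_eq0 /= normc_eq0.
have Hn : is_derive t 1 (fun x => Re (u x) * Re (u x) + Im (u x) * Im (u x))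
   (2 * (Re du * Re (u t) + Im du * Im (u t))).
  apply: (is_derive_eq (is_deriveD (is_deriveM ur ur) (is_deriveM ui ui))).
  by rewrite /GRing.scale /=; ring.
have Hi : is_derive t 1 (fun x => (Re (u x) * Re (u x) + Im (u x) * Im (u x))^-1)
   (- (Re (u t) * Re (u t) + Im (u t) * Im (u t)) ^- 2 * (2 * (Re du * Re (u t) + Im du * Im (u t)))).
  exact: is_deriveV Hn.
have Hc : cderiv (fun x => conjc (u x)) t (conjc du).
  split.
    by rewrite (_ : (fun x => _) = fun x => Re (u x)) ?Re_conjc //; apply/funext=> x; rewrite Re_conjc.
  rewrite (_ : (fun x => _) = fun x => - Im (u x)) ?Im_conjc; first exact: is_deriveN.
  by apply/funext=> x; rewrite Im_conjc.
have H := cderivM Hc (cderiv_real Hi).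
rewrite (_ : (fun x => (u x)^-1) = (fun x => conjc (u x) * ((Re (u x) * Re (u x) + Im (u x) * Im (u x))^-1)%:C)).
  apply: (cderiv_eq H); apply: (mulIf (expf_neq0 2 u0)); rewrite mulfVK ?expf_neq0 //.
  by apply: complex_ext; rewrite ?(ReD, ImD, ReM, ImM, ReN, ImN, Re_conjc, Im_conjc, expr2) /=; field.
apply/funext => x; case: (u x) => a b /=.
by apply: complex_ext; rewrite ?(ReM, ImM) /= !expr2; ring.
Qed.

End Derivative.

Section CexpTaylor.
Variable R : realType.

(** Induction on [K]: the derivative in [t] of the remainder of order [K + 1] is [X] times the
    remainder of order [K]. Each step bounds real and imaginary part separately, which costs the
    factor [2] attached to [normc X]. *)
Lemma cexp_taylor_bound (X : R[i]) K (t : R) : 0 <= t <= 1 ->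
  normc (cexp (t%:C * X) - \sum_(k < K) (k`!%:R)^-1 * (t%:C * X) ^+ k) <=
   2 * (expR (normc X) * (2 * normc X) ^+ K * (t ^+ K / K`!%:R)).
Proof.
set F := fun K t => cexp (t%:C * X) - \sum_(k < K) (k`!%:R)^-1 * (t%:C * X) ^+ k.
set M := expR (normc X).
suff [H1 H2] : (forall t, 0 <= t <= 1 -> `|Re (F K t)| <= M * (2 * normc X) ^+ K * (t ^+ K / K`!%:R)) /\
    (forall t, 0 <= t <= 1 -> `|Im (F K t)| <= M * (2 * normc X) ^+ K * (t ^+ K / K`!%:R)).
  by move=> t01; apply: (le_trans (normc_le_ReIm _)); rewrite mulr2n mulrDl mul1r lerD ?H1 ?H2.
clear t; elim: K => [|K [IH1 IH2]].
  have H t : 0 <= t <= 1 -> normc (F 0%N t) <= M.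
    move=> /andP[t0 t1]; rewrite /F big_ord0 subr0 normc_cexp ler_expR Re_rC.
    apply: (le_trans (ler_norm _)); rewrite normrM ger0_norm // -[leRHS]mul1r.
    by rewrite ler_pM // ler_normc_Re.
  split => t ht; rewrite !expr0 fact0 divr1 !mulr1; apply: le_trans (H _ ht).
    exact: ler_normc_Re.
  exact: ler_normc_Im.
have dF t : cderiv (F K.+1) t (X * F K t).
  have H1 := cderiv_comp_cexp (cderiv_lin X t).
  have H2 := @cderiv_sum _ _ (index_enum 'I_K.+1) xpredT
    (fun k x => (k`!%:R)^-1 * (x%:C * X) ^+ k) _ t
    (fun k _ => cderivZ (k`!%:R)^-1 (cderivX k (cderiv_lin X t))).
  apply: (cderiv_eq (cderivD H1 (cderivN H2))); rewrite mulrBr; congr (_ - _).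
  rewrite big_ord_recl /= !mul0r mulr0 add0r mulr_sumr; apply: eq_bigr => k _.
  rewrite /bump leq0n add1n factS natrM.
  have k0 : k.+1%:R != 0 :> R[i] by rewrite pnatr_eq0.
  have k1 : k`!%:R != 0 :> R[i] by rewrite pnatr_eq0 -lt0n fact_gt0.
  by move: k0 k1; move: (_.+1%:R) (_`!%:R) => p q p0 q0; field; rewrite p0 q0.
have F0 : F K.+1 0 = 0.
  rewrite /F mul0r cexp0 big_ord_recl expr0 fact0 invr1 mulr1 big1 ?addr0 ?subrr // => k _.
  by rewrite expr0n /= mulr0.
have bnd t : 0 <= t <= 1 -> `|Re (X * F K t)| <= M * (2 * normc X) ^+ K.+1 * (t ^+ K / K`!%:R) /\
   `|Im (X * F K t)| <= M * (2 * normc X) ^+ K.+1 * (t ^+ K / K`!%:R).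
  move=> t01.
  have N : normc (X * F K t) <= M * (2 * normc X) ^+ K.+1 * (t ^+ K / K`!%:R).
    rewrite normcM_; apply: le_trans (ler_wpM2l (normc_ge0 _) (normc_le_ReIm _)) _.
    apply: le_trans (ler_wpM2l (normc_ge0 _) (lerD (IH1 _ t01) (IH2 _ t01))) _.
    by apply: le_of_eq; rewrite exprS; ring.
  by split; apply: le_trans N; [apply: ler_normc_Re|apply: ler_normc_Im].
have key (f df : R -> R) : f 0 = 0 -> (forall x : R, is_derive x 1 f (df x)) ->
    (forall t, 0 <= t <= 1 -> `|df t| <= M * (2 * normc X) ^+ K.+1 * (t ^+ K / K`!%:R)) ->
    forall t, 0 <= t <= 1 -> `|f t| <= M * (2 * normc X) ^+ K.+1 * (t ^+ K.+1 / K.+1`!%:R).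
  move=> f0 fd le t /andP[t0 t1]; set C := M * _.
  have := @is_derive_bound _ f df (fun x => C * (x ^+ K.+1 / K.+1`!%:R))
    (fun x => C * (x ^+ K / K`!%:R)) 0 t t0.
  rewrite f0 subr0 expr0n /= mul0r mulr0 subr0; apply => y /andP[y0 yt] //; last first.
    by apply: le; rewrite y0 (le_trans yt).
  rewrite (_ : (fun x => _) = fun x => C / K.+1`!%:R * x ^+ K.+1); last first.
    by apply/funext => z; ring.
  apply: (is_derive_eq (is_deriveZ (C / K.+1`!%:R) (is_derive_pow K.+1 y))).
  rewrite /GRing.scale /= factS natrM.
  have k0 : K.+1%:R != 0 :> R by rewrite pnatr_eq0.
  have k1 : K`!%:R != 0 :> R by rewrite pnatr_eq0 -lt0n fact_gt0.
  by move: k0 k1; move: (_.+1%:R) (_`!%:R) => p q p0 q0; field; rewrite p0 q0.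
split.
  apply: (key (fun t => Re (F K.+1 t)) (fun t => Re (X * F K t))).
  - by rewrite F0.
  - by move=> x; have [] := dF x.
  - by move=> t ht; have [] := bnd _ ht.
apply: (key (fun t => Im (F K.+1 t)) (fun t => Im (X * F K t))).
- by rewrite F0.
- by move=> x; have [] := dF x.
- by move=> t ht; have [] := bnd _ ht.
Qed.

Lemma cexp_series_cvg (X : R[i]) :
  (fun K => \sum_(k < K) (k`!%:R)^-1 * X ^+ k) @ \oo --> cexp X.
Proof.
apply/cvg_normc0P.
apply: (@squeeze_cvgr nat \oo _ R (fun=> 0) (fun K => 2 * expR (normc X) * exp_coeff (2 * normc X) K)).
- near=> K; rewrite normc_ge0 /= normc_distC.
  have := @cexp_taylor_bound X K 1; rewrite mul1r expr1n => /(_ _) /le_trans; apply.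
    by rewrite ler01 lexx.
  by apply: le_of_eq; rewrite /exp_coeff /=; ring.
- exact: cvg_cst.
- rewrite -[X in _ --> X](mulr0 (2 * expR (normc X))).
  by apply: cvgM; [apply: cvg_cst|apply: cvg_exp_coeff].
Unshelve. all: by end_near. Qed.

End CexpTaylor.

#[local] Hint Extern 0 (is_true (0 <= normc _)) => exact: normc_ge0 : core.
#[local] Hint Extern 0 (is_true (0 <= expR _)) => exact: expR_ge0 : core.

(** * Dirichlet convolution and its exponential *)

Section Convolution.
Variable V : comPzRingType.

(** The pairs are cut out of a square by the condition [d * e == n] instead of being indexed by
    divisors, so that sums can be exchanged freely. The value at [0] is an empty sum, hence 0. *)
Definition dconv x y n : V :=
  \sum_(1 <= d < n.+1) \sum_(1 <= e < n.+1 | (d * e == n)%N) x d * y e.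

Lemma big_nat_eq (P : pred nat) (F : nat -> V) a b k : (a <= k < b)%N ->
  \sum_(a <= e < b | (k == e) && P e) F e = if P k then F k else 0.
Proof.
move=> kab; rewrite big_mkcond (bigD1_seq k) ?mem_index_iota ?iota_uniq //= eqxx /=.
by rewrite big1 ?addr0 // => i /negbTE; rewrite eq_sym => ->.
Qed.

Lemma dconv_widen x y n M : (0 < n < M)%N ->
  dconv x y n = \sum_(1 <= d < M) \sum_(1 <= e < M | (d * e == n)%N) x d * y e.
Proof.
move=> /andP[n0 nM]; rewrite /dconv.
rewrite [RHS](big_cat_nat _ (n := n.+1)) //= [X in _ + X]sum0_nat ?addr0; last first.
  move=> d _ /andP[d1 dM].
  rewrite sum0_nat // => e /eqP de /andP[e1 eM].
  by exfalso; nia.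
apply: eq_big_nat => d /andP[d1 dn].
rewrite [RHS](big_cat_nat _ (n := n.+1)) //= [X in _ + X]sum0_nat ?addr0 // => e /eqP de /andP[e1 eM].
by exfalso; nia.
Qed.

Lemma eq_dconv x x' y y' n : (forall d, (0 < d <= n)%N -> x d = x' d) ->
  (forall d, (0 < d <= n)%N -> y d = y' d) -> dconv x y n = dconv x' y' n.
Proof.
move=> xx yy; apply: eq_big_nat => d hd.
rewrite big_seq_cond [RHS]big_seq_cond; apply: eq_bigr => e.
by rewrite mem_index_iota => /andP[he _]; rewrite xx // yy.
Qed.

Lemma dconv1n x n : (0 < n)%N -> dconv (fun k => (k == 1)%:R) x n = x n.
Proof.
move=> n0; rewrite /dconv big_ltn // [X in _ + X]sum0_nat ?addr0; last first.
  move=> d _ /andP[d2 _].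
  by rewrite big1 // => e _; rewrite gtn_eqF // mul0r.
rewrite (eq_bigl (fun e => (n == e)%N && true)); last by move=> e; rewrite andbT mul1n eq_sym.
by rewrite (big_nat_eq xpredT) ?n0 ?ltnSn // mul1r.
Qed.

Lemma dconvC x y n : dconv x y n = dconv y x n.
Proof.
rewrite /dconv (exchange_big_dep xpredT) //=; apply: eq_bigr => d _.
by apply: eq_big => [e|e _]; [rewrite mulnC|rewrite mulrC].
Qed.

Lemma dconv_dconv x y z n : (0 < n)%N -> dconv x (dconv y z) n =
  \sum_(1 <= d < n.+1) \sum_(1 <= a < n.+1) \sum_(1 <= b < n.+1 | (d * (a * b) == n)%N)
     x d * (y a * z b).
Proof.
move=> n0; rewrite [LHS]/dconv; apply: eq_big_nat => d /andP[d1 dn].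
transitivity (\sum_(1 <= e < n.+1 | (d * e == n)%N) \sum_(1 <= a < n.+1)
    \sum_(1 <= b < n.+1 | (a * b == e)%N) x d * (y a * z b)).
  rewrite big_seq_cond [RHS]big_seq_cond; apply: eq_bigr => e.
  rewrite mem_index_iota => /andP[/andP[e1 en] /eqP de].
  rewrite (@dconv_widen _ _ _ n.+1) ?e1 //.
  rewrite mulr_sumr; apply: eq_bigr => a _; by rewrite mulr_sumr.
rewrite exchange_big /=; apply: eq_big_nat => a /andP[a1 an].
rewrite (exchange_big_dep xpredT) //= [RHS]big_mkcond; apply: eq_big_nat => b /andP[b1 bn].
case: (leqP (a * b) n) => [abn|nab].
  rewrite (eq_bigl (fun e => (a * b == e)%N && (d * e == n)%N)); last by move=> e; rewrite andbC.
  by rewrite (big_nat_eq (fun e => d * e == n)%N) // ltnS abn muln_gt0 a1 b1.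
rewrite sum0_nat; last first.
  by move=> e /andP[_ /eqP ae] /andP[_ en]; exfalso; lia.
by case: eqP => // H; exfalso; nia.
Qed.

Lemma dconvCA x y z n : (0 < n)%N -> dconv x (dconv y z) n = dconv y (dconv x z) n.
Proof.
move=> n0; rewrite !dconv_dconv // exchange_big /=; apply: eq_bigr => a _.
apply: eq_bigr => d _; apply: eq_big => [b|b _]; first by rewrite mulnCA.
by rewrite mulrCA.
Qed.

Lemma dconv_sumr (I : Type) (r : seq I) (P : pred I) x (F : I -> nat -> V) n :
  dconv x (fun m => \sum_(i <- r | P i) F i m) n = \sum_(i <- r | P i) dconv x (F i) n.
Proof.
rewrite /dconv exchange_big /=; apply: eq_bigr => d _.
rewrite exchange_big /=; apply: eq_bigr => e _.
by rewrite mulr_sumr.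
Qed.

Lemma dconvZr x y c n : dconv x (fun m => c * y m) n = c * dconv x y n.
Proof.
rewrite /dconv mulr_sumr; apply: eq_bigr => d _.
by rewrite mulr_sumr; apply: eq_bigr => e _; rewrite mulrCA.
Qed.

(** A completely multiplicative twist is a morphism of the convolution ring; it is used for
    [chi n = n^(-s)]. *)
Lemma dconv_twist (chi : nat -> V) x y n :
  (forall d e, (0 < d)%N -> (0 < e)%N -> chi (d * e)%N = chi d * chi e) ->
  dconv (fun m => x m * chi m) (fun m => y m * chi m) n = dconv x y n * chi n.
Proof.
move=> chiM; rewrite /dconv mulr_suml; apply: eq_big_nat => d /andP[d1 _].
rewrite mulr_suml big_seq_cond [RHS]big_seq_cond.
apply: eq_bigr => e; rewrite mem_index_iota => /andP[/andP[e1 _] /eqP <-].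
by rewrite chiM // mulrACA.
Qed.

(** A completely additive function acts as a derivation; with the logarithm this is differentiation
    of Dirichlet series up to sign. *)
Lemma dconv_derivation (L : nat -> V) x y n :
  (forall d e, (0 < d)%N -> (0 < e)%N -> L (d * e)%N = L d + L e) ->
  L n * dconv x y n =
  dconv (fun m => L m * x m) y n + dconv x (fun m => L m * y m) n.
Proof.
move=> LD; rewrite /dconv mulr_sumr -big_split /=; apply: eq_big_nat => d /andP[d1 _].
rewrite mulr_sumr -big_split /=.
rewrite big_seq_cond [RHS]big_seq_cond.
apply: eq_bigr => e; rewrite mem_index_iota => /andP[/andP[e1 _] /eqP <-].
by rewrite LD // mulrDl mulrA; congr (_ + _); rewrite mulrCA.
Qed.

Lemma dconv_sum x y N : \sum_(1 <= n < N) dconv x y n =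
  \sum_(1 <= d < N) \sum_(1 <= e < N | (d * e < N)%N) x d * y e.
Proof.
transitivity (\sum_(1 <= n < N) \sum_(1 <= d < N) \sum_(1 <= e < N | (d * e == n)%N) x d * y e).
  by apply: eq_big_nat => n hn; apply: dconv_widen.
rewrite exchange_big /=; apply: eq_big_nat => d /andP[d1 dn].
rewrite (exchange_big_dep xpredT) //= [RHS]big_mkcond; apply: eq_big_nat => e /andP[e1 en].
case: ifP => deN.
  rewrite (eq_bigl (fun n => (d * e == n)%N && true)); last by move=> i; rewrite andbT.
  by rewrite big_nat_eq // muln_gt0 d1 e1.
rewrite sum0_nat // => n /eqP den /andP[_].
by rewrite -den deN.
Qed.

Fixpoint dpow x k : nat -> V :=
  if k is k'.+1 then dconv x (dpow x k') else fun n => (n == 1)%:R.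

(** With [x 1 = 0] every factor of a product counted by the [k]-fold power is at least 2, so the
    product exceeds [k]. *)
Lemma dpow_eq0 x k n : x 1%N = 0 -> (0 < n <= k)%N -> dpow x k n = 0.
Proof.
move=> x1; elim: k n => [|k IH] n /andP[n0 nk]; first by exfalso; lia.
rewrite /= /dconv sum0_nat // => d _ /andP[d1 dn].
rewrite sum0_nat // => e /eqP de /andP[e1 en].
have [->|d2] : (d = 1 \/ 1 < d)%N by lia.
  by rewrite x1 mul0r.
by rewrite IH ?mulr0 //; nia.
Qed.

Lemma dpow_derivation (L : nat -> V) x k n : (0 < n)%N ->
  (forall d e, (0 < d)%N -> (0 < e)%N -> L (d * e)%N = L d + L e) ->
  L n * dpow x k.+1 n = k.+1%:R * dconv (fun m => L m * x m) (dpow x k) n.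
Proof.
move=> n0 LD; elim: k n n0 => [|k IH] n n0.
  rewrite mul1r /= dconv_derivation // [X in _ + X](_ : _ = 0) ?addr0 //.
  rewrite /dconv big1_seq // => d _; rewrite big1_seq // => e _.
  have L1 : L 1%N = 0 by apply: (@addrI _ (L 1%N)); rewrite -LD // muln1 addr0.
  by case: (e =P 1%N) => [->|]; rewrite ?L1 ?mul0r ?mulr0.
rewrite [dpow x k.+2]/= dconv_derivation //.
rewrite (@eq_dconv x x _ (fun m => k.+1%:R * dconv (fun m => L m * x m) (dpow x k) m)) //.
  by rewrite dconvZr dconvCA // -[k.+2]add1n natrD mulrDl mul1r.
by move=> d /andP[d0 dn]; apply: IH.
Qed.

Lemma dpow_twist (chi : nat -> V) x k n : (0 < n)%N -> chi 1%N = 1 ->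
  (forall d e, (0 < d)%N -> (0 < e)%N -> chi (d * e)%N = chi d * chi e) ->
  dpow (fun m => x m * chi m) k n = dpow x k n * chi n.
Proof.
move=> n0 chi1 chiM; elim: k n n0 => [|k IH] n n0 /=.
  by case: eqP => [->|]; rewrite ?chi1 ?mul1r ?mul0r.
by rewrite -dconv_twist //; apply: eq_dconv => // d /andP[d0 _]; rewrite IH.
Qed.

End Convolution.

Section DirichletExp.
Variable R : realType.

(** The exponential series of the convolution ring, cut at [n]: when [x 1 = 0] the higher powers
    vanish at [n], so the finite sum is the full one. *)
Definition dexp x n : R[i] := \sum_(k < n.+1) (k`!%:R)^-1 * dpow x k n.

Lemma dexp_widen x n M : x 1%N = 0 -> (0 < n <= M)%N ->
  dexp x n = \sum_(k < M) (k`!%:R)^-1 * dpow x k n.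
Proof.
move=> x1 /andP[n0 nM]; rewrite /dexp.
have E k : (n <= k)%N -> \sum_(i < k) (i`!%:R)^-1 * dpow x i n =
    \sum_(i < n) (i`!%:R)^-1 * dpow x i n :> R[i].
  elim: k => [|k IH] nk; first by move: nk; rewrite leqn0 => /eqP ->.
  move: nk; rewrite leq_eqVlt => /orP[/eqP <- //|nk].
  by rewrite big_ord_recr /= IH // dpow_eq0 ?n0 // mulr0 addr0.
by rewrite E // E.
Qed.

(** This is (exp X)' = X' exp X on coefficients. The power rule turns the term of index [k + 1] on
    the left into the term of index [k] on the right, and the constant term is killed by
    [L 1 = 0]. *)
Lemma dexp_derivation (L : nat -> R[i]) x n : x 1%N = 0 -> (0 < n)%N ->
  (forall d e, (0 < d)%N -> (0 < e)%N -> L (d * e)%N = L d + L e) ->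
  L n * dexp x n = dconv (fun m => L m * x m) (dexp x) n.
Proof.
move=> x1 n0 LD.
rewrite (@eq_dconv _ _ (fun m => L m * x m) _
  (fun m => \sum_(k < n) (k`!%:R)^-1 * dpow x k m)) //; last first.
  by move=> d hd; rewrite (@dexp_widen _ _ n).
rewrite dconv_sumr /dexp big_ord_recl /= mulrDr mulr_sumr.
have -> : L n * (0`!%:R^-1 * (n == 1)%:R) = 0.
  have L1 : L 1%N = 0 by apply: (@addrI _ (L 1%N)); rewrite -LD // muln1 addr0.
  by case: eqP => [->|]; rewrite ?L1 ?mul0r ?mulr0.
rewrite add0r; apply: eq_bigr => k _.
rewrite dconvZr (_ : bump 0 k = k.+1) // mulrCA -[dconv x _ n]/(dpow x k.+1 n).
rewrite dpow_derivation // mulrA; congr (_ * _).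
rewrite factS natrM invfM mulrAC mulVf ?mul1r //.
Qed.

Lemma dexp_twist (chi : nat -> R[i]) x n : (0 < n)%N -> chi 1%N = 1 ->
  (forall d e, (0 < d)%N -> (0 < e)%N -> chi (d * e)%N = chi d * chi e) ->
  dexp (fun m => x m * chi m) n = dexp x n * chi n.
Proof.
move=> n0 chi1 chiM; rewrite /dexp mulr_suml; apply: eq_bigr => k _.
by rewrite dpow_twist // mulrA.
Qed.

Lemma dexp1 x : x 1%N = 0 -> dexp x 1 = 1.
Proof.
move=> x1; rewrite /dexp !big_ord_recl big_ord0 /= /dconv !big_nat1 /= big_mkcond big_nat1 /=.
by rewrite x1 mul0r mulr0 !addr0 invr1 mulr1.
Qed.

End DirichletExp.

Opaque cexp cpow.

Lemma cvg_ext {T : Type} {U : topologicalType} (F : set_system T) (u v : T -> U) (l : U) :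
  u =1 v -> u @ F --> l -> v @ F --> l.
Proof. by move=> /funext ->. Qed.

(** * Absolutely convergent sums and products of Dirichlet series *)

Section AbsSums.
Variable R : realType.
Implicit Types (x y : nat -> R[i]) (u : nat -> R).

Lemma ler_sum_nat_mono u a M N : (forall n, 0 <= u n) -> (M <= N)%N ->
  \sum_(a <= n < M) u n <= \sum_(a <= n < N) u n.
Proof.
move=> u0 MN; case: (leqP a M) => [aM|Ma].
  by rewrite [leRHS](big_cat_nat _ (n := M)) //= lerDl sumr_ge0.
by rewrite big_geq ?(ltnW Ma) // sumr_ge0.
Qed.

Lemma nneg_sum_tail u a B : (forall n, 0 <= u n) ->
  (forall N, \sum_(a <= n < N) u n <= B) ->
  forall e, 0 < e -> exists M, forall N, \sum_(a <= n < N | (M <= n)%N) u n <= e.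
Proof.
move=> u0 uB e e0; set s := fun N => \sum_(a <= n < N) u n.
have nd : nondecreasing_seq s by move=> M N MN; apply: ler_sum_nat_mono.
have cs : cvgn s by apply: nondecreasing_is_cvgn => //; exists B => _ [N _ <-]; apply: uB.
have /cvgrPdist_lt /(_ _ e0) [M _ HM] : s @ \oo --> limn s by [].
exists M => N; have le := nondecreasing_cvgn_le nd cs.
have /= := HM M (leqnn M); rewrite ger0_norm ?subr_ge0 ?le // => hM.
case: (leqP M N) => MN; last first.
  rewrite sum0_nat ?ltW // => n Mn /andP[_ nN]; exfalso; lia.
have E : s N = s M + \sum_(a <= n < N | (M <= n)%N) u n.
  rewrite /s (bigID (fun n => (M <= n)%N)) /= addrC; congr (_ + _).
  case: (leqP a M) => aM; last first.
    rewrite [RHS]big_geq ?(ltnW aM) // sum0_nat // => n nM /andP[an _].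
    by exfalso; lia.
  rewrite (big_cat_nat _ (n := M)) //= [X in _ + X]sum0_nat ?addr0; last first.
    by move=> n nM /andP[an _]; exfalso; lia.
  rewrite big_seq_cond [RHS]big_seq; apply: eq_bigl => n.
  by rewrite mem_index_iota; case: (leqP M n) => h; rewrite ?andbT ?andbF //; apply/esym/negbTE; lia.
have := le N; rewrite E; set w := \sum_(_ <= _ < _ | _) _; move: hM; rewrite /s; lra.
Qed.

Definition psum x N : R[i] := \sum_(1 <= n < N) x n.
Definition nsum_le x B := forall N, \sum_(1 <= n < N) normc (x n) <= B.

Lemma nsum_le_ge0 x B : nsum_le x B -> 0 <= B.
Proof. by move=> /(_ 0%N); rewrite big_geq. Qed.

Lemma nsum_le_leW x y B : (forall n, (0 < n)%N -> normc (x n) <= normc (y n)) ->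
  nsum_le y B -> nsum_le x B.
Proof.
move=> xy yB N; apply: le_trans (yB N).
by apply: ler_sum_nat => n /andP[n1 _]; apply: xy.
Qed.

Lemma psum_tail x (l : R[i]) N M e : psum x @ \oo --> l ->
  (forall N, \sum_(1 <= n < N | (M <= n)%N) normc (x n) <= e) ->
  (0 < N)%N -> (M <= N)%N -> normc (psum x N - l) <= e.
Proof.
move=> xl he N0 MN; apply/ler_addgt0Pr => d d0.
move/cvg_normcP : xl => /(_ _ d0) [P _ HP].
have /= hP := HP (maxn P N) (leq_maxl _ _).
have E : psum x (maxn P N) - psum x N = \sum_(N <= n < maxn P N) x n.
  by rewrite /psum (big_cat_nat _ (n := N)) //= ?leq_maxr // addrAC subrr add0r.
have -> : psum x N - l = (psum x (maxn P N) - l) - (psum x (maxn P N) - psum x N) by ring.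
apply: le_trans (normcB _ _) _; rewrite addrC lerD //; last by rewrite normc_distC ltW.
rewrite E; apply: le_trans (normc_sum _ _ _) _; apply: le_trans (he (maxn P N)).
rewrite [leRHS]big_mkcond [leRHS](big_cat_nat _ (n := N)) ?leq_maxr //= -[leLHS]add0r lerD //.
  by apply: sumr_ge0 => i _; case: ifP; rewrite //.
by apply: ler_sum_nat => n /andP[Nn _]; rewrite (leq_trans MN Nn).
Qed.

Lemma nsum_cvg x B : nsum_le x B -> exists l : R[i], psum x @ \oo --> l.
Proof.
move=> xB.
have pos (u : nat -> R) : (forall n, `|u n| <= normc (x n)) ->
    exists l : R, (fun N => \sum_(1 <= n < N) u n) @ \oo --> l.
  move=> ux.
  have c1 : cvgn (fun N => \sum_(1 <= n < N) (u n + normc (x n))).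
    apply: nondecreasing_is_cvgn.
      move=> M N MN; apply: ler_sum_nat_mono => // n.
      by have := ux n; rewrite ler_norml => /andP[]; lra.
    exists (B + B) => _ [N _ <-]; rewrite big_split lerD //.
    apply: le_trans (xB N); apply: ler_sum => n _; apply: le_trans (ux n); exact: ler_norm.
  have c2 : cvgn (fun N => \sum_(1 <= n < N) normc (x n)).
    apply: nondecreasing_is_cvgn.
      by move=> M N MN; apply: ler_sum_nat_mono => //.
    by exists B => _ [N _ <-].
  eexists; apply: cvg_ext (cvgB c1 c2) => N.
  by rewrite /= -[LHS]sumrB; apply: eq_bigr => n _; rewrite addrK.
have [a ha] := pos (fun n => Re (x n)) (fun n => ler_normc_Re (x n)).
have [b hb] := pos (fun n => Im (x n)) (fun n => ler_normc_Im (x n)).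
exists (a +i* b); apply/cvg_ReIm; split => /=.
  by apply: cvg_ext ha => N; rewrite /psum Re_sum.
by apply: cvg_ext hb => N; rewrite /psum Im_sum.
Qed.

Lemma normc_dconv x y n :
  normc (dconv x y n) <= dconv (fun d => normc (x d)) (fun d => normc (y d)) n.
Proof.
apply: le_trans (normc_sum _ _ _) _; apply: ler_sum => d _.
apply: le_trans (normc_sum _ _ _) _; apply: ler_sum => e _.
by rewrite normcM_.
Qed.

Lemma dconv_nsum_le x y Bx By : nsum_le x Bx -> nsum_le y By ->
  nsum_le (dconv x y) (Bx * By).
Proof.
move=> xB yB N; apply: (@le_trans _ _ (\sum_(1 <= n < N) dconv (fun d => normc (x d)) (fun d => normc (y d)) n)).
  by apply: ler_sum => n _; apply: normc_dconv.
rewrite dconv_sum; apply: (@le_trans _ _ (\sum_(1 <= d < N) normc (x d) * By)).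
  apply: ler_sum => d _ /=; rewrite -mulr_sumr ler_wpM2l //.
  apply: le_trans (yB N); rewrite big_mkcond; apply: ler_sum => e _.
  by case: ifP; rewrite //.
by rewrite -mulr_suml ler_wpM2r ?(nsum_le_ge0 yB).
Qed.

End AbsSums.

Section Series.
Variable R : realType.

Definition csum u N : R[i] := \sum_(0 <= i < N) u i.

Lemma abs_csum_cvg u (B : R) : (forall N, \sum_(0 <= i < N) normc (u i) <= B) ->
  exists l : R[i], csum u @ \oo --> l.
Proof.
move=> uB.
have [|l ul] := @nsum_cvg R (fun n => u n.-1) B.
  by case=> [|N]; [rewrite big_geq // (le_trans _ (uB 0%N)) // big_geq|rewrite big_add1; exact: uB].
exists l; apply: (cvg_ext (u := fun N => psum (fun n => u n.-1) N.+1)).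
  by move=> N; rewrite /csum /psum big_add1.
by have := ul; rewrite -cvg_shiftS.
Qed.

Lemma normc_csum u N : normc (csum u N) <= \sum_(0 <= i < N) normc (u i).
Proof. exact: normc_sum. Qed.
Lemma csumD u v N : csum (fun i => u i + v i) N = csum u N + csum v N.
Proof. exact: big_split. Qed.
Lemma csumZ (c : R[i]) u N : csum (fun i => c * u i) N = c * csum u N.
Proof. by rewrite /csum mulr_sumr. Qed.

Lemma normc_lim_le {T : Type} (F : set_system T) (FF : ProperFilter F) (f : T -> R[i]) (l : R[i]) (B : R) :
  (forall x, normc (f x) <= B) -> f @ F --> l -> normc l <= B.
Proof.
move=> fB /cvg_normcP fl; rewrite leNgt; apply/negP => h.
have h0 : 0 < normc l - B by rewrite subr_gt0.
have [x /=] := filter_ex (fl _ h0); have := ler_normc_dist l (f x); have := fB x; lra.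
Qed.

Lemma normr_sum_cvg0 {T : Type} (F : set_system T) (FF : Filter F) (w : T -> nat -> R[i]) M :
  (forall i, (fun x => w x i) @ F --> (0 : R[i])) ->
  (fun x => \sum_(0 <= i < M) normc (w x i)) @ F --> (0 : R).
Proof.
move=> w0; elim: M => [|M IH].
  by apply: (cvg_ext (u := fun=> 0)); [move=> x; rewrite big_geq|exact: cvg_cst].
apply: (cvg_ext (u := fun x => \sum_(0 <= i < M) normc (w x i) + normc (w x M))).
  by move=> x; rewrite big_nat_recr.
rewrite -[X in _ --> X](addr0 0); apply: cvgD; first exact: IH.
have /cvg_normc0P := w0 M; apply: cvg_ext => x.
by rewrite subr0.
Qed.

(** Dominated convergence for series along an arbitrary filter: the tail is small uniformly in [x]
    by domination, and the finitely many remaining terms tend to 0. *)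
Lemma tannery {T : Type} (F : set_system T) (FF : Filter F) (w : T -> nat -> R[i]) (S : T -> R[i])
    b (B : R) : (forall N, \sum_(0 <= i < N) b i <= B) -> (forall x i, normc (w x i) <= b i) ->
  (forall i, (fun x => w x i) @ F --> (0 : R[i])) -> (forall x, csum (w x) @ \oo --> S x) ->
  S @ F --> (0 : R[i]).
Proof.
move=> bB wb w0 wS; apply/cvg_normcP => e e0.
(* An inhabitant of [T] is what makes the majorant [b] nonnegative; without one the claim is
   vacuous. *)
have [x0|noT] := pselect (exists x0 : T, True); last first.
  by apply: filterE => x; exfalso; apply: noT; exists x.
have b0 i : 0 <= b i by case: x0 => x0 _; apply: le_trans (normc_ge0 _) (wb x0 i).
have e2 : 0 < e / 2 by rewrite divr_gt0.
have [M HM] := nneg_sum_tail b0 bB e2.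
have := @normr_sum_cvg0 T F FF w M w0; move/cvgrPdist_lt => /(_ _ e2).
apply: filterS => x; rewrite sub0r normrN ger0_norm; last by apply: sumr_ge0.
move=> h; rewrite normc_distC subr0.
have H N : normc (csum (w x) N) <= \sum_(0 <= i < M) normc (w x i) + e / 2.
  apply: le_trans (normc_csum _ _) _; rewrite (bigID (fun i => (M <= i)%N)) /= addrC lerD //.
    have [NM|MN] := leqP N M.
      apply: le_trans (ler_sum_nat_mono 0 _ NM) => [|i]; last exact: normc_ge0.
      by rewrite big_mkcond; apply: ler_sum => i _; case: ifP => //.
    rewrite (big_nat_widen 0 M N) ?(ltnW MN) //.
    by rewrite (eq_bigl (fun i => (i < M)%N)) // => i; rewrite ltnNge.
  by apply: le_trans (HM N); apply: ler_sum.
have H2 : normc (S x) <= \sum_(0 <= i < M) normc (w x i) + e / 2 by apply: normc_lim_le H (wS x).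
by move: H2 => /le_lt_trans; apply; rewrite -ltrBrDr (lt_le_trans h) //; lra.
Qed.

End Series.

Section DirichletSums.
Variable R : realType.
Implicit Types (B : R).

Lemma csum_window (F : nat -> R[i]) N M : (N <= M)%N ->
  csum (fun d => if (0 < d < N)%N then F d else 0) M = \sum_(1 <= d < N) F d.
Proof.
move=> NM; rewrite (big_nat_widenl 1 0) // (big_nat_widen 0 N M) // [RHS]big_mkcond.
by apply: eq_bigr => d _; rewrite andTb.
Qed.

(** With the sum over [d] outside, the inner sum over the [e] with [d * e < N] tends to [Y] for each
    fixed [d], and dominated convergence in [d] gives the product. *)
Lemma dconv_psum_cvg x y Bx By (X Y : R[i]) : nsum_le x Bx -> nsum_le y By ->
  psum x @ \oo --> X -> psum y @ \oo --> Y -> psum (dconv x y) @ \oo --> X * Y.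
Proof.
move=> xB yB xX yY; pose s d N : R[i] := \sum_(1 <= e < N | (d * e < N)%N) y e.
have sB d N : normc (s d N) <= By.
  apply: le_trans (normc_sum _ _ _) _; apply: le_trans (yB N); rewrite big_mkcond.
  by apply: ler_sum => e _; case: ifP => //.
have sY d : (0 < d)%N -> s d @ \oo --> Y.
  (* For [d > 0] and [N > 0] the condition [d * e < N] means [e <= (N - 1) / d], so [s d N] is a
     partial sum of [y] whose end goes to infinity. *)
  move=> d0; have h : (fun N => (N.-1 %/ d).+1) @ \oo --> \oo.
    move=> P [M _ HM]; exists (M * d).+1 => // N /= NM; apply: HM => /=.
    by apply: leqW; rewrite leq_divRL //; case: N NM.
  apply: (cvg_ext (u := fun N => psum y (N.-1 %/ d).+1)); last exact: (cvg_comp _ _ h yY).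
  case=> [|N]; first by rewrite /psum div0n /s !big_geq.
  rewrite /s /psum (big_nat_widen 1 _ N.+1) ?ltnS ?leq_div //.
  by apply: eq_bigl => e; rewrite /= !ltnS leq_divRL // mulnC.
(* These are the terms of [psum (dconv x y) N - psum x N * Y], extended by 0 so that all [N] share
   one index set. *)
pose w N d := if (0 < d < N)%N then x d * (s d N - Y) else 0.
have D : (fun N => psum (dconv x y) N - psum x N * Y) @ \oo --> (0 : R[i]).
  apply: (@tannery R nat \oo _ w _ (fun d => if d is 0%N then 0 else normc (x d) * (By + normc Y)) (Bx * (By + normc Y))).
  - have c0 : 0 <= By + normc Y by rewrite addr_ge0 ?normc_ge0 ?(nsum_le_ge0 yB).
    case=> [|M]; first by rewrite big_geq // mulr_ge0 // (nsum_le_ge0 xB).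
    rewrite big_ltn // add0r; apply: le_trans (ler_wpM2r c0 (xB M.+1)); rewrite mulr_suml.
    by rewrite big_nat [leRHS]big_nat; apply: ler_sum; case.
  - move=> N [|d]; rewrite /w; first by rewrite normc0_.
    have b0 : 0 <= normc (x d.+1) * (By + normc Y).
      by rewrite mulr_ge0 // addr_ge0 ?normc_ge0 ?(nsum_le_ge0 yB).
    case: ifP => _; last by rewrite normc0_.
    rewrite normcM_ ler_wpM2l //; apply: le_trans (normcB _ _) _; exact: lerD.
  - case=> [|d]; first by apply: cvg_ext (cvg_cst _) => N; rewrite /w.
    have h : (fun N => x d.+1 * (s d.+1 N - Y)) @ \oo --> x d.+1 * (Y - Y).
      by apply: cvgM; [exact: cvg_cst|apply: cvgB; [exact: sY|exact: cvg_cst]].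
    rewrite subrr mulr0 in h; apply: cvg_trans h; apply: near_eq_cvg; exists d.+2 => // N /= dN.
    by rewrite /w dN.
  - move=> N; apply: cvg_near_cst; exists N => // M /= NM; rewrite csum_window //.
    rewrite /psum dconv_sum mulr_suml -sumrB; apply: eq_bigr => d _.
    by rewrite mulrBr mulr_sumr.
have h : (fun N => psum (dconv x y) N - psum x N * Y + psum x N * Y) @ \oo --> 0 + X * Y.
  by apply: cvgD; [exact: D|apply: cvgM; [exact: xX|exact: cvg_cst]].
by rewrite add0r in h; apply: cvg_ext h => N; rewrite subrK.
Qed.

Lemma dpow_nsum_le x B k : nsum_le x B -> nsum_le (dpow x k) (B ^+ k).
Proof.
move=> xB; elim: k => [|k IH]; last by rewrite exprS; apply: dconv_nsum_le.
move=> N; rewrite expr0 /=; case: N => [|[|N]]; [by rewrite big_geq|by rewrite big_geq|].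
rewrite big_ltn // eqxx mulr1n normc1_ sum0_nat ?addr0 // => n _ /andP[n2 _].
by rewrite (_ : (n == 1)%N = false) ?normc0_ //; apply/negbTE; lia.
Qed.

Lemma dpow_psum_cvg x B (X : R[i]) k : nsum_le x B -> psum x @ \oo --> X ->
  psum (dpow x k) @ \oo --> X ^+ k.
Proof.
move=> xB xX; elim: k => [|k IH].
  rewrite expr0; apply: cvg_near_cst; exists 2%N => // N /= N2.
  rewrite /psum big_ltn //= sum0_nat ?addr0 // => n _ /andP[n2 _].
  by rewrite (_ : (n == 1)%N = false) //; apply/negbTE; lia.
by rewrite exprS; apply: (dconv_psum_cvg xB (dpow_nsum_le k xB)).
Qed.

Lemma expR_sum_le (B : R) N : 0 <= B -> \sum_(0 <= k < N) B ^+ k / k`!%:R <= expR B.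
Proof.
move=> B0; have := @nondecreasing_cvgn_le _ (series (exp_coeff B)) _ (is_cvg_series_exp_coeff B) N.
apply; move=> M P MP; apply: ler_sum_nat_mono => // n.
by rewrite /exp_coeff /= divr_ge0 ?exprn_ge0.
Qed.

Lemma dexp_nsum_le x B : x 1%N = 0 -> nsum_le x B -> nsum_le (dexp x) (expR B).
Proof.
move=> x1 xB N; have B0 := nsum_le_ge0 xB.
apply: (@le_trans _ _ (\sum_(1 <= n < N) \sum_(0 <= k < N) normc (dpow x k n) / k`!%:R)).
  apply: ler_sum_nat => n /andP[n1 nN]; rewrite (@dexp_widen _ _ _ N) ?n1 ?(ltnW nN) //.
  rewrite big_mkord; apply: le_trans (normc_sum _ _ _) _; apply: ler_sum => k _.
  rewrite normcM_ normcV_ mulrC (_ : (k`!%:R : R[i]) = (k`!%:R)%:C) ?normc_rC ?ger0_norm //.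
  by rewrite rmorph_nat.
rewrite exchange_big /=; apply: le_trans (expR_sum_le N B0); apply: ler_sum => k _.
by rewrite -mulr_suml ler_wpM2r ?invr_ge0 //; apply: dpow_nsum_le.
Qed.

(** The difference between the two exponential series is taken power by power: its [k]-th term is
    dominated by [2 B^k / k!] and tends to 0, because the partial sums of a convolution power tend
    to the power of [X]. *)
Lemma dexp_psum_cvg x B (X : R[i]) : x 1%N = 0 -> nsum_le x B -> psum x @ \oo --> X ->
  psum (dexp x) @ \oo --> cexp X.
Proof.
move=> x1 xB xX; have B0 := nsum_le_ge0 xB.
have nfact k : normc ((k`!%:R)^-1 : R[i]) = (k`!%:R)^-1.
  by rewrite normcV_ (_ : (k`!%:R : R[i]) = (k`!%:R)%:C) ?normc_rC ?ger0_norm // rmorph_nat.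
have pB k N : normc (psum (dpow x k) N) <= B ^+ k := le_trans (normc_sum _ _ _) (dpow_nsum_le k xB N).
have D : (fun N => psum (dexp x) N - cexp X) @ \oo --> (0 : R[i]).
  apply: (@tannery R nat \oo _ (fun N k => (k`!%:R)^-1 * (psum (dpow x k) N - X ^+ k)) _
    (fun k => 2 * (B ^+ k / k`!%:R)) (2 * expR B)).
  - by move=> N; rewrite -mulr_sumr ler_wpM2l // expR_sum_le.
  - move=> N k; rewrite normcM_ nfact [leLHS]mulrC [leRHS]mulrA; apply: ler_wpM2r; first by rewrite invr_ge0.
    apply: le_trans (normcB _ _) _; rewrite mulr2n mulrDl !mul1r lerD //.
    exact: (@normc_lim_le R nat \oo _ _ _ _ (pB k) (dpow_psum_cvg (k := k) xB xX)).
  - move=> k; have h : (fun N => (k`!%:R)^-1 * (psum (dpow x k) N - X ^+ k)) @ \oo --> (k`!%:R)^-1 * (X ^+ k - X ^+ k).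
      by apply: cvgM; [exact: cvg_cst|apply: cvgB; [exact: dpow_psum_cvg xB xX|exact: cvg_cst]].
    by rewrite subrr mulr0 in h.
  - move=> N; have h : (fun M => psum (dexp x) N - \sum_(k < M) (k`!%:R)^-1 * X ^+ k) @ \oo --> psum (dexp x) N - cexp X.
      by apply: cvgB; [exact: cvg_cst|exact: cexp_series_cvg].
    apply: cvg_trans h; apply: near_eq_cvg; exists N => // M /= NM.
    rewrite /psum (eq_big_seq (fun n => \sum_(0 <= k < M) (k`!%:R)^-1 * dpow x k n)).
      rewrite exchange_big /csum big_mkord -sumrB big_mkord; apply: eq_bigr => k _.
      by rewrite mulrBr mulr_sumr.
    move=> n; rewrite mem_index_iota => /andP[n1 nN]; rewrite big_mkord.
    by apply: dexp_widen; rewrite // n1 (leq_trans (ltnW nN)).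
have h : (fun N => psum (dexp x) N - cexp X + cexp X) @ \oo --> 0 + cexp X.
  by apply: cvgD; [exact: D|exact: cvg_cst].
by rewrite add0r in h; apply: cvg_ext h => N; rewrite subrK.
Qed.

End DirichletSums.

(** * Dirichlet series at large integers *)

Section DirichletSeries.
Variable R : realType.
Implicit Types (u w c r : nat -> R).

(** On the block [2^j <= n < 2^(j+1)] the weight is at most [r j], and the mass of the block is at
    most that of everything below [2^(j+1)]. *)
Lemma dyadic_sum u w c r J : (forall n, 0 <= u n) ->
  (forall J, \sum_(1 <= n < 2 ^ J) u n <= c J) ->
  (forall j n, (2 ^ j <= n)%N -> w n <= r j) -> (forall j, 0 <= r j) ->
  \sum_(1 <= n < 2 ^ J) u n * w n <= \sum_(0 <= j < J) c j.+1 * r j.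
Proof.
move=> u0 uc wr r0; elim: J => [|J IH]; first by rewrite expn0 !big_geq.
rewrite (big_cat_nat _ (n := 2 ^ J)) ?expn_gt0 ?leq_pexp2l //=.
rewrite [leRHS]big_nat_recr // lerD //.
apply: (@le_trans _ _ (\sum_(2 ^ J <= n < 2 ^ J.+1) u n * r J)).
  by apply: ler_sum_nat => n /andP[nJ _]; rewrite ler_wpM2l // wr.
rewrite -mulr_suml ler_wpM2r //; apply: le_trans (uc J.+1).
rewrite [leRHS](big_cat_nat _ (n := 2 ^ J)) ?expn_gt0 ?leq_pexp2l //= lerDr.
by apply: sumr_ge0.
Qed.

Lemma geometric_sum_le (q : R) J : 0 <= q < 1 -> \sum_(0 <= j < J) q ^+ j <= (1 - q)^-1.
Proof.
move=> /andP[q0 q1].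
have E : (1 - q) * \sum_(0 <= j < J) q ^+ j = 1 - q ^+ J.
  by rewrite big_mkord -opprB -[X in _ = X]opprB subrX1 mulNr.
have q1' : 0 < 1 - q by rewrite subr_gt0.
by rewrite -(ler_pM2l q1') E mulfV ?gt_eqF // lerBlDr lerDl exprn_ge0.
Qed.

(** The dyadic blocks give a geometric series of ratio [2^(a-b) < 1]. *)
Lemma power_weighted_sum u (C a b : R) : (forall n, 0 <= u n) -> 0 <= C -> a < b -> 0 <= b ->
  (forall J, \sum_(1 <= n < 2 ^ J) u n <= C * expR (a * ln 2) ^+ J) ->
  exists B, forall N, \sum_(1 <= n < N) u n * expR (- b * ln (n%:R : R)) <= B.
Proof.
move=> u0 C0 ab b0 hu; have l2 : 0 < ln 2 :> R by rewrite ln_gt0 // ltr1n.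
set q := expR (a * ln 2) * expR (- b * ln 2).
have q1 : 0 <= q < 1.
  by rewrite mulr_ge0 //= /q -expRD expR_lt1; nra.
exists (C * expR (a * ln 2) * (1 - q)^-1) => N.
apply: (@le_trans _ _ (\sum_(1 <= n < 2 ^ N) u n * expR (- b * ln n%:R))).
  apply: ler_sum_nat_mono; first by move=> n; rewrite mulr_ge0.
  by apply/ltnW/ltn_expl.
apply: le_trans (@dyadic_sum _ _ _ (fun j => expR (- b * ln 2) ^+ j) N u0 hu _ _) _.
- move=> j n jn; rewrite -expRM_natl ler_expR !mulNr mulrN lerN2 mulrCA ler_wpM2l //.
  rewrite mulr_natl -lnXn ?ler_ln ?posrE // ?ltr0n; first by rewrite -natrX ler_nat.
  by apply: leq_trans jn; rewrite expn_gt0.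
- by move=> j; rewrite exprn_ge0.
rewrite (eq_bigr (fun j => C * expR (a * ln 2) * q ^+ j)); last first.
  by move=> j _; rewrite exprS /q exprMn; ring.
by rewrite -mulr_sumr ler_wpM2l ?geometric_sum_le // mulr_ge0.
Qed.

Lemma sum_inv_sqr_le N : \sum_(1 <= m < N) ((m%:R : R) ^+ 2)^-1 <= 2.
Proof.
(* The sharper bound makes the induction telescope, since 1/m^2 is at most 1/(m-1) - 1/m. *)
suff H : \sum_(1 <= m < N.+2) ((m%:R : R) ^+ 2)^-1 <= 2 - (N.+1%:R)^-1.
  apply: (@le_trans _ _ (\sum_(1 <= m < N.+2) (m%:R ^+ 2)^-1)).
    apply: ler_sum_nat_mono; first by move=> n; rewrite invr_ge0 sqr_ge0.
    by rewrite -addn2 leq_addr.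
  by apply: le_trans H _; rewrite lerBlDr lerDl invr_ge0.
elim: N => [|N IH]; first by rewrite big_nat1 expr1n invr1; lra.
rewrite big_nat_recr //; apply: le_trans (lerD IH (lexx _)) _.
have n0 : 0 < N.+1%:R :> R by rewrite ltr0n.
rewrite -[N.+2]addn1 natrD; move: n0; move: (N.+1%:R : R) => p p0.
rewrite -subr_ge0 (_ : _ - _ = (p * (p + 1) ^+ 2)^-1).
  by rewrite invr_ge0 mulr_ge0 ?sqr_ge0 ?ltW.
by field; rewrite ?gt_eqF // ltr_wpDl // ltW.
Qed.

(* Multiplying by n^k isolates the first nonzero coefficient as k grows. *)
Lemma dirichlet_leading x (X : nat -> R[i]) n k0 (C : R) : (0 < n)%N ->
  (forall m, (0 < m)%N -> normc (x m) <= C * m%:R ^+ k0) ->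
  (forall j, (0 < j < n)%N -> x j = 0) ->
  (forall k, (k0 + 2 <= k)%N -> psum (fun m => x m / m%:R ^+ k) @ \oo --> X k) ->
  exists D, 0 <= D /\ forall k, (k0 + 2 <= k)%N ->
    normc (n%:R ^+ k * X k - x n) <= D * (n%:R / n.+1%:R) ^+ k.
Proof.
move=> n0 xC x0 xX.
have C0 : 0 <= C by have := le_trans (normc_ge0 _) (xC 1%N isT); rewrite expr1n mulr1.
have nC m j : normc ((m%:R : R[i]) ^+ j) = m%:R ^+ j.
  by rewrite normcX_ normc_nat.
exists (C * n.+1%:R ^+ (k0 + 2) * 2); split.
  by rewrite !mulr_ge0 // exprn_ge0.
move=> k hk; have xk := xX _ hk.
have nk : (n%:R : R[i]) ^+ k != 0 by rewrite expf_neq0 // pnatr_eq0 -lt0n.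
have nk' : 0 < (n%:R : R) ^+ k by rewrite exprn_gt0 // ltr0n.
have -> : n%:R ^+ k * X k - x n = n%:R ^+ k * (X k - x n / n%:R ^+ k).
  by rewrite mulrBr mulrCA mulfV ?mulr1.
rewrite normcM_ nC expr_div_n mulrCA ler_pM2l //.
have -> : x n / n%:R ^+ k = psum (fun m => x m / m%:R ^+ k) n.+1.
  rewrite /psum big_nat_recr //= big1_seq ?add0r // => j; rewrite mem_index_iota => hj.
  by rewrite x0 ?mul0r //; case/andP: hj.
rewrite normc_distC; apply: (psum_tail (M := n.+1) xk) => //.
move=> N.
apply: (@le_trans _ _ (\sum_(1 <= m < N) C * n.+1%:R ^+ (k0 + 2) / n.+1%:R ^+ k * (m%:R ^+ 2)^-1)).
  rewrite big_mkcond; apply: ler_sum_nat => m /andP[m1 mN]; case: ifP => nm; last first.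
    by rewrite !mulr_ge0 // ?invr_ge0 ?exprn_ge0.
  have m0 : 0 < m%:R :> R by rewrite ltr0n.
  rewrite normcM_ normcV_ nC; apply: (@le_trans _ _ (C * m%:R ^+ k0 / m%:R ^+ k)).
    by rewrite ler_wpM2r ?invr_ge0 ?exprn_ge0 // xC.
  rewrite -!mulrA ler_wpM2l //.
  have -> : (m%:R : R) ^+ k0 * (m%:R ^+ k)^-1 = (m%:R ^+ (k - (k0 + 2)))^-1 * (m%:R ^+ 2)^-1.
    rewrite -{1}(subnK hk) !exprD; field.
    by rewrite !expf_neq0 // gt_eqF.
  rewrite mulrA ler_wpM2r ?invr_ge0 ?sqr_ge0 //.
  have -> : (n.+1%:R : R) ^+ (k0 + 2) * (n.+1%:R ^+ k)^-1 = (n.+1%:R ^+ (k - (k0 + 2)))^-1.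
    have -> : (n.+1%:R : R) ^+ k = n.+1%:R ^+ (k - (k0 + 2)) * n.+1%:R ^+ (k0 + 2).
      by rewrite -exprD subnK.
    by rewrite invfM mulrCA mulfV ?mulr1.
  rewrite lef_pV2 ?posrE ?exprn_gt0 ?ltr0n //.
  by rewrite lerXn2r ?nnegrE ?ler0n // ler_nat.
rewrite -mulr_sumr; apply: (@le_trans _ _ (C * n.+1%:R ^+ (k0 + 2) / n.+1%:R ^+ k * 2)).
  by rewrite ler_wpM2l ?sum_inv_sqr_le // !mulr_ge0 // ?invr_ge0 exprn_ge0.
by apply: le_of_eq; ring.
Qed.

(** A term of a convergent series is a difference of two partial sums, hence eventually at most 2;
    the constant also adds up all earlier terms. *)
Lemma dirichlet_psum_bounded x k0 (X : R[i]) : psum (fun m => x m / m%:R ^+ k0) @ \oo --> X ->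
  exists C, forall m, (0 < m)%N -> normc (x m) <= C * m%:R ^+ k0.
Proof.
move=> /cvg_normcP /(_ _ ltr01) [M _ HM].
set y := fun m => x m / m%:R ^+ k0.
exists (\sum_(0 <= j < M.+1) normc (y j) + 2) => m m0.
have mk : 0 < (m%:R : R) ^+ k0 by rewrite exprn_gt0 // ltr0n.
have -> : normc (x m) = normc (y m) * m%:R ^+ k0.
  by rewrite /y normcM_ normcV_ normcX_ normc_nat mulfVK // gt_eqF.
rewrite ler_pM2r //; case: (leqP m M) => mM.
  rewrite (bigD1_seq m) ?mem_index_iota ?iota_uniq //= -addrA lerDl addr_ge0 //.
  by apply: sumr_ge0.
rewrite -[leLHS]add0r lerD //; first by apply: sumr_ge0.
have -> : y m = (X - psum y m) - (X - psum y m.+1).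
  by rewrite /psum big_nat_recr //=; ring.
apply: le_trans (normcB _ _) _; have -> : 2 = 1 + 1 :> R by [].
by rewrite lerD // ltW //; apply: HM => /=; lia.
Qed.

Lemma ratio_pow_cvg0 n (e D : R) : 0 < e -> exists K, forall k, (K <= k)%N ->
  D * (n%:R / n.+1%:R) ^+ k < e.
Proof.
move=> e0; have : (fun k => D * (n%:R / n.+1%:R : R) ^+ k) @ \oo --> (0 : R).
  rewrite -[X in _ --> X](mulr0 D); apply: cvgM; first exact: cvg_cst.
  apply: cvg_expr; rewrite ger0_norm ?divr_ge0 //.
  by rewrite ltr_pdivrMr ?ltr0n // mul1r ltr_nat.
move=> /cvgrPdist_lt /(_ _ e0) [K _ HK]; exists K => k Kk.
by have := HK k Kk; rewrite /= sub0r normrN; apply: le_lt_trans; rewrite ler_norm.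
Qed.

(** Strong induction: once the earlier coefficients vanish, [n^k] times the value at [k] tends to
    [x n], and that value is 0. Large integer arguments suffice, which keeps all the points inside
    the half-plane of convergence. *)
Lemma dirichlet_uniq x k0 :
  (forall k, (k0 <= k)%N -> psum (fun m => x m / m%:R ^+ k) @ \oo --> (0 : R[i])) ->
  forall n, (0 < n)%N -> x n = 0.
Proof.
move=> xX; have [C xC] := dirichlet_psum_bounded (xX _ (leqnn _)).
elim/ltn_ind => n IH n0; apply/eqP; rewrite -normc_eq0; apply/eqP.
have [||D [D0 HD]] := @dirichlet_leading x (fun=> 0) n k0 C n0 xC.
- by move=> j /andP[j0 jn]; apply: IH.
- by move=> k hk; apply: xX; lia.
apply/eqP; rewrite eq_le normc_ge0 andbT; apply/ler_addgt0Pr => e e0; rewrite add0r.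
have [K HK] := ratio_pow_cvg0 n D e0.
have := HD (maxn K (k0 + 2)) (leq_maxr _ _); rewrite mulr0 sub0r normcN => /le_trans; apply.
by apply/ltW/HK; rewrite leq_maxl.
Qed.

(** The leading term is taken at the least index [m] with [x m != 0], which need not be the given
    [n]. *)
Lemma dirichlet_leading_neq0 x (X : nat -> R[i]) n k0 : (0 < n)%N -> x n != 0 ->
  (forall k, (k0 <= k)%N -> psum (fun m => x m / m%:R ^+ k) @ \oo --> X k) ->
  exists K, forall k, (K <= k)%N -> X k != 0.
Proof.
move=> n0 xn xX; have [C xC] := dirichlet_psum_bounded (xX _ (leqnn _)).
have : exists m, (0 < m)%N && (x m != 0) by exists n; rewrite n0.
move=> /ex_minnP[m /andP[m0 xm] mmin].
have [||D [D0 HD]] := @dirichlet_leading x X m k0 C m0 xC.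
- move=> j /andP[j0 jm]; apply/eqP/negP => /negP xj.
  by have := mmin j; rewrite j0 xj => /(_ isT); lia.
- by move=> k hk; apply: xX; lia.
have xm0 : 0 < normc (x m) by rewrite normc_gt0.
have [K HK] := ratio_pow_cvg0 m D xm0.
exists (maxn K (k0 + 2)) => k; rewrite geq_max => /andP[Kk hk].
apply/eqP => X0; have := HD k hk; rewrite X0 mulr0 sub0r normcN.
by move=> /le_lt_trans /(_ (HK _ Kk)); rewrite ltxx.
Qed.

End DirichletSeries.

Lemma nneseries_ltyP (R : realType) (u : nat -> R) a : (forall n, 0 <= u n) ->
  (\sum_(a <= n <oo) (u n)%:E < +oo)%E <-> exists B, forall N, \sum_(a <= n < N) u n <= B.
Proof.
move=> u0; split=> [H|[B HB]].
  exists (fine (\sum_(a <= n <oo) (u n)%:E)%E) => N.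
  rewrite -lee_fin fineK; last first.
    by rewrite ge0_fin_numE // nneseries_ge0 // => n _ _; rewrite lee_fin.
  by rewrite -sumEFin; apply: nneseries_lim_ge => n _ _; rewrite lee_fin.
apply: (@le_lt_trans _ _ B%:E); last exact: ltry.
apply: lime_le; first by apply: is_cvg_nneseries => n _ _; rewrite lee_fin.
by near=> N; rewrite sumEFin lee_fin.
Unshelve. all: by end_near. Qed.

(** * The coefficients of the L-function *)

Section LCoefficients.
Variable R : realType.
Implicit Types (f a : nat -> R[i]).

Lemma ln_nat_ge0 n : 0 <= ln (n%:R : R).
Proof. by case: n => [|n]; [rewrite ln0|rewrite ln_ge0 // ler1n]. Qed.
Lemma ln_nat_gt0 n : (1 < n)%N -> 0 < ln (n%:R : R).
Proof. by move=> n1; rewrite ln_gt0 // ltr1n. Qed.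
Lemma ln2_gt0 : 0 < ln (2 : R). Proof. exact: (@ln_nat_gt0 2). Qed.

(** The Dirichlet coefficients of log L. The convention [0^-1 = 0] gives the value 0 at [n = 1], so
    that sums may start there. *)
Definition bcoef f n : R[i] := f n / (ln (n%:R : R))%:C * cpow n 2^-1.

Lemma bcoef1 f : bcoef f 1 = 0.
Proof. by rewrite /bcoef ln1 invr0 mulr0 mul0r. Qed.
Lemma expR_sqr_half_ge (a b : R) : a * b <= a ^+ 2 + b ^+ 2.
Proof. nra. Qed.

(** With [2 d = Re s - 1] a term splits, up to the logarithm, as f(n) n^(-d) times n^(-1/2-d). The
    inequality a b <= a^2 + b^2 leaves two series, one controlled by the mean square in (A1) at
    exponent [d], the other by counting integers. *)
Lemma bcoef_nsum f s : axiom_A1 f -> 1 < Re s ->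
  exists B, nsum_le (fun n => bcoef f n * cpow n (- s)) B.
Proof.
move=> [_ _ A1] s1; set d := (Re s - 1) / 2.
have d0 : 0 < d by rewrite divr_gt0 // subr_gt0.
have [C HC] := A1 d d0.
have [||||J|B1 HB1] := @power_weighted_sum R (fun n => normc (f n) ^+ 2) `|C| d (2 * d).
- by move=> n; rewrite sqr_ge0.
- by [].
- by lra.
- by lra.
- have := HC (2 ^+ J) _; rewrite -natrX Num.Theory.natrK => /(_ _) H.
  apply: (@le_trans _ _ (\sum_(1 <= n < (2 ^ J).+1) normc (f n) ^+ 2)).
    by apply: ler_sum_nat_mono => // n; rewrite sqr_ge0.
  apply: le_trans (H _) _; first by rewrite ler1n expn_gt0.
  rewrite /powR pnatr_eq0 expn_eq0 /= natrX lnXn // -expRM_natl.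
  by rewrite mulr_natl mulrnAr ler_wpM2r // ler_norm.
have [||||J|B2 HB2] := @power_weighted_sum R (fun=> 1) 1 1 (1 + 2 * d).
- by [].
- by [].
- by lra.
- by lra.
- rewrite mul1r mul1r lnK ?posrE // big_const_nat iter_addr_0 -natrX ler_nat.
  by rewrite leq_subr.
exists ((ln 2)^-1 * (B1 + B2)) => N.
apply: (@le_trans _ _ (\sum_(1 <= n < N) (ln 2)^-1 * (normc (f n) ^+ 2 * expR (- (2 * d) * ln n%:R)
   + 1 * expR (- (1 + 2 * d) * ln n%:R)))); last first.
  by rewrite -mulr_sumr big_split ler_wpM2l ?invr_ge0 ?(ltW ln2_gt0) ?lerD.
apply: ler_sum_nat => n /andP[n1 _].
have [->|n2] : n = 1%N \/ (1 < n)%N by lia.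
  rewrite bcoef1 mul0r normc0_ mulr_ge0 ?invr_ge0 ?(ltW ln2_gt0) //.
  by apply: addr_ge0; apply: mulr_ge0; rewrite ?expR_ge0 ?sqr_ge0.
rewrite /bcoef 3!normcM_ normcV_ !normc_cpow normc_rC (ger0_norm (ln_nat_ge0 n)).
have -> : Re (2^-1 : R[i]) = 2^-1 by rewrite (_ : 2^-1 = (2^-1)%:C) // rCV rmorph_nat.
rewrite ReN; set l := ln (n%:R : R).
have ll : ln 2 <= l by rewrite ler_ln ?posrE ?ltr0n ?ler_nat // (ltn_trans _ n2).
rewrite -mulrA -expRD [X in X * _]mulrC -mulrA ler_pM ?invr_ge0 ?ln_nat_ge0 //.
- by rewrite mulr_ge0.
- by rewrite lef_pV2 ?posrE ?ln_nat_gt0 ?ln2_gt0.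
have := expR_sqr_half_ge (normc (f n) * expR (- d * l)) (expR (- (2^-1 + d) * l)).
rewrite -mulrA -expRD exprMn -!expRM_natl mul1r.
rewrite (_ : - d * l + - (2^-1 + d) * l = 2^-1 * l + - Re s * l); last by rewrite /d; field.
rewrite (_ : 2 * (- d * l) = - (2 * d) * l); last by ring.
by rewrite (_ : 2 * (- (2^-1 + d) * l) = - (1 + 2 * d) * l) //; field.
Qed.

Lemma psum2 (x : nat -> R[i]) N : x 1%N = 0 -> psum x N = \sum_(2 <= n < N) x n.
Proof.
move=> x1; rewrite /psum; case: N => [|[|N]]; [by rewrite !big_geq|by rewrite !big_geq|].
by rewrite big_ltn // x1 add0r.
Qed.

Lemma L_functionP f s : axiom_A1 f -> 1 < Re s ->
  psum (fun n => dexp (bcoef f) n * cpow n (- s)) @ \oo --> L_function f s.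
Proof.
move=> A1 s1; have [B xB] := bcoef_nsum A1 s1.
set x := fun n => _ in xB; have [X xX] := nsum_cvg xB.
have x1 : x 1%N = 0 by rewrite /x bcoef1 mul0r.
have -> : L_function f s = cexp X.
  rewrite /L_function; congr cexp; apply: cvg_lim; first exact: norm_hausdorff.
  apply: cvg_ext xX => N; rewrite psum2 //; apply: eq_bigr => n _.
  by rewrite /x /bcoef cpowD mulrA.
apply: cvg_ext (dexp_psum_cvg x1 xB xX) => N.
apply: eq_big_nat => n /andP[n0 _].
by apply: dexp_twist => //; [rewrite cpow1n|move=> d e d0 e0; rewrite cpowM].
Qed.

(** [L_coef] is a choice among all sequences with the right Dirichlet series. Uniqueness of
    Dirichlet coefficients, tested at the integers [k >= 2], identifies it with the convolution
    exponential. *)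
Lemma L_coef_dexp f n : axiom_A1 f -> (0 < n)%N -> L_coef f n = dexp (bcoef f) n.
Proof.
move=> A1 n0; have H1 : is_L_coef f (dexp (bcoef f)) by move=> s s1; apply: L_functionP.
have H2 : is_L_coef f (L_coef f).
  by rewrite /L_coef; case: xgetP => [a _ //|/(_ (dexp (bcoef f)))].
apply/eqP; rewrite -subr_eq0; apply/eqP.
apply: (@dirichlet_uniq R (fun m => L_coef f m - dexp (bcoef f) m) 2) => // k k2.
have sk : 1 < Re (k%:R : R[i]).
  by rewrite (_ : k%:R = (k%:R)%:C) /= ?ltr1n // rmorph_nat.
have H : (fun N => \sum_(1 <= m < N) L_coef f m * cpow m (- k%:R) -
    \sum_(1 <= m < N) dexp (bcoef f) m * cpow m (- k%:R)) @ \oo --> (0 : R[i]).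
  by rewrite -[X in _ --> X](subrr (L_function f k%:R)); apply: cvgB; [apply: H2|apply: H1].
apply: cvg_ext H => N.
rewrite -sumrB; apply: eq_big_nat => m /andP[m0 _].
by rewrite -mulrBl cpowN cpow_nat.
Qed.

(** The logarithmic derivative on coefficients. The value at 1 is set to 0 in accordance with
    [bcoef f 1 = 0]. *)
Lemma L_coef_conv f n : axiom_A1 f -> (0 < n)%N ->
  (ln (n%:R : R))%:C * L_coef f n =
  dconv (fun m => if m == 1%N then 0 else f m * cpow m 2^-1) (L_coef f) n.
Proof.
move=> A1 n0; rewrite L_coef_dexp //.
rewrite (@dexp_derivation _ (fun m => (ln (m%:R : R))%:C)) ?bcoef1 //; last first.
  by move=> d e d0 e0; rewrite natrM lnM ?posrE ?ltr0n // rCD.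
apply: eq_dconv => m /andP[m0 _]; last by rewrite L_coef_dexp.
case: eqP => [->|m1]; first by rewrite ln1 mul0r.
have : (ln m%:R)%:C != (0 : R)%:C by rewrite (inj_eq (@complexI R)) gt_eqF // ln_nat_gt0 //; lia.
by rewrite /bcoef => L0; field.
Qed.

Lemma L_coef_zero f : axiom_A1 f -> (forall n, (0 < n)%N -> f n = 0) ->
  forall n, (1 < n)%N -> L_coef f n = 0.
Proof.
move=> A1 f0 n n1; have ln0 : (ln (n%:R : R))%:C != 0.
  have : (ln n%:R)%:C != (0 : R)%:C by rewrite (inj_eq (@complexI R)) gt_eqF // ln_nat_gt0.
  by [].
apply: (mulfI ln0); rewrite mulr0 L_coef_conv ?(ltnW n1) //.
rewrite /dconv sum0_nat // => d _ /andP[d0 _].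
by rewrite big1 // => e _; case: eqP => _; rewrite ?f0 // mul0r ?mul0r.
Qed.

End LCoefficients.

(** * Smooth numbers and ratios of Dirichlet polynomials *)

Section SmoothNumbers.
Variable R : realType.

Definition psmooth M n := forall p, prime p -> (p %| n)%N -> (p <= M)%N.

(** The exponents of the primes up to [M] determine a smooth number, and each exponent of a number
    below [2^J] is at most [J]. *)
Lemma card_psmooth (M J : nat) (A : pred 'I_(2 ^ J)) :
  (forall n, n \in A -> (0 < n)%N /\ psmooth M n) -> (#|A| <= J.+1 ^ M.+1)%N.
Proof.
move=> AP; pose g (n : 'I_(2 ^ J)) : {ffun 'I_M.+1 -> 'I_J.+1} :=
  [ffun p : 'I_M.+1 => inord (logn p n)].
have lJ (n : 'I_(2 ^ J)) p : (0 < n)%N -> (logn p n < J.+1)%N.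
  move=> n0; rewrite ltnS; case: (boolP (prime p)) => pp; last by rewrite lognE (negbTE pp).
  have /dvdn_leq -/(_ n0) h : (p ^ logn p n %| n)%N by rewrite pfactor_dvdnn.
  rewrite -(@leq_exp2l 2) //; apply: leq_trans (ltnW (ltn_ord n)); apply: leq_trans h.
  by case: (logn p n) => [|e]; rewrite ?expn0 // leq_exp2r // prime_gt1.
have inj : {in A &, injective g}.
  move=> m n mA nA /ffunP gmn; have [m0 ms] := AP _ mA; have [n0 ns] := AP _ nA.
  apply/val_inj/eqn_from_log => // p; case: (boolP (prime p)) => pp; last first.
    have z k : logn p k = 0%N by rewrite lognE (negbTE pp).
    by rewrite !z.
  case: (leqP p M) => pM.
    have := gmn (inord p); rewrite !ffunE => /(congr1 val) /=.
    by rewrite !inordK ?lJ // ltnS.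
  have z (k : nat) : psmooth M k -> logn p k = 0%N.
    move=> sk; rewrite lognE pp; case: ifP => // /andP[_ /andP[_ pk]].
    by have := sk p pp pk; rewrite leqNgt pM.
  by rewrite !z.
rewrite -(card_in_imset inj); apply: leq_trans (max_card _) _.
by rewrite card_ffun !card_ord.
Qed.

(** The block of index [j] holds at most [(j+2)^(M+1)] smooth numbers, each with a value of order
    [j^(-(M+3))]: the two extra powers of the logarithm make the sum over blocks converge like that
    of 1/j^2. *)
Lemma psmooth_log_sum (M : nat) (v : nat -> R) (C : R) : 0 <= C -> (forall n, 0 <= v n) ->
  (forall n, (1 < n)%N -> ~ psmooth M n -> v n = 0) ->
  (forall n, (1 < n)%N -> v n * ln (n%:R : R) ^+ (M + 3) <= C) ->
  exists B, forall N, \sum_(2 <= n < N) v n <= B.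
Proof.
move=> C0 v0 vs vC; have l2 := ln2_gt0 R.
pose u n : R := (`[< psmooth M n >] && (0 < n)%N)%:R.
pose w n : R := if (1 < n)%N then C / ln n%:R ^+ (M + 3) else 0.
(* [maxn j 1] keeps the first block meaningful: it holds [n = 1], where the logarithm vanishes and
   [w] is set to 0. *)
pose r j : R := C / ((maxn j 1)%:R * ln 2) ^+ (M + 3).
pose c J : R := (J.+1 ^ M.+1)%:R.
(* [3^(M+1)] comes from [j + 2 <= 3 max(j, 1)], and the last [3] is 1 for [j = 0] plus the bound 2
   on the sum of inverse squares. *)
exists (C * 3 ^+ M.+1 / ln 2 ^+ (M + 3) * 3) => N.
have r0 j : 0 <= r j by rewrite divr_ge0 // exprn_ge0 // mulr_ge0 // ltW.
apply: (@le_trans _ _ (\sum_(1 <= n < 2 ^ N) u n * w n)).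
  apply: (@le_trans _ _ (\sum_(1 <= n < N) u n * w n)); last first.
    apply: ler_sum_nat_mono; last by apply/ltnW/ltn_expl.
    move=> n; rewrite mulr_ge0 // /w; case: ifP => // _.
    by rewrite divr_ge0 // exprn_ge0 // ln_nat_ge0.
  case: N => [|[|N]]; [by rewrite !big_geq|by rewrite !big_geq|].
  rewrite [leRHS]big_ltn // {1}/w /= mulr0 add0r; apply: ler_sum_nat => n /andP[n1 _].
  rewrite /w n1 /u (ltnW n1) andbT; case: asboolP => sm; last by rewrite vs // mul0r.
  by rewrite mul1r ler_pdivlMr ?vC // exprn_gt0 // ln_nat_gt0.
apply: le_trans (@dyadic_sum _ u w c r N _ _ _ r0) _ => //.
- move=> J; rewrite /c.
  have -> : \sum_(1 <= n < 2 ^ J) u n = \sum_(0 <= n < 2 ^ J) u n.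
    by rewrite [RHS]big_ltn ?expn_gt0 // /u andbF add0r.
  have -> : \sum_(0 <= i < 2 ^ J) u i =
     (#|[pred i : 'I_(2 ^ J) | `[< psmooth M i >] && (0 < i)%N]|)%:R.
    rewrite -sum1_card natr_sum [RHS]big_mkcond big_mkord; apply: eq_bigr => i _.
    by rewrite inE /u; case: (_ && _).
  rewrite ler_nat.
  apply: card_psmooth => n; rewrite inE => /andP[/asboolP ? ?]; by split.
- move=> j n jn; rewrite /w /r; case: ifP => n1; last by rewrite r0.
  rewrite ler_wpM2l // lef_pV2 ?posrE ?exprn_gt0 ?ln_nat_gt0 //; last first.
    by rewrite mulr_gt0 // ltr0n leq_max orbT.
  rewrite lerXn2r ?nnegrE ?ln_nat_ge0 ?mulr_ge0 ?(ltW l2) //.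
  rewrite mulr_natl -lnXn // ler_ln ?posrE ?exprn_gt0 // ?ltr0n ?(ltnW n1) //.
  rewrite -natrX ler_nat; case: j jn => [|j] jn; first by rewrite max0n expn1.
  by rewrite (maxn_idPl _).
apply: (@le_trans _ _ (\sum_(0 <= j < N) C * 3 ^+ M.+1 / ln 2 ^+ (M + 3) * ((maxn j 1)%:R ^+ 2)^-1)).
  apply: ler_sum => j _; rewrite /c /r; set p := (maxn j 1)%:R : R.
  have p0 : 0 < p by rewrite ltr0n leq_max orbT.
  have h : (j.+2 ^ M.+1)%:R <= (3 * p) ^+ M.+1 :> R.
    by rewrite natrX lerXn2r ?nnegrE ?ler0n ?mulr_ge0 ?(ltW p0) // -natrM ler_nat; lia.
  have q0 : 0 <= C / (p * ln 2) ^+ (M + 3) by rewrite divr_ge0 // exprn_ge0 // mulr_ge0 // ltW.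
  apply: le_trans (ler_wpM2r q0 h) _; apply: le_of_eq.
  have a0 k : p ^+ k != 0 by rewrite expf_neq0 // gt_eqF.
  have b0 k : ln (2 : R) ^+ k != 0 by rewrite expf_neq0 // gt_eqF.
  rewrite !exprMn -[(M + 3)%N]addSnnS !exprD; field.
  by rewrite a0 b0 (gt_eqF l2) (gt_eqF p0).
rewrite -mulr_sumr ler_wpM2l //.
  by rewrite divr_ge0 ?mulr_ge0 // exprn_ge0 // ltW.
case: N => [|N]; first by rewrite big_geq.
rewrite big_ltn // max0n expr1n invr1 (_ : 3 = 1 + 2 :> R); last by ring.
rewrite lerD2l; apply: le_trans (sum_inv_sqr_le R N.+1); apply: ler_sum_nat => n /andP[n1 _].
by rewrite (maxn_idPl n1).
Qed.

End SmoothNumbers.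

Section Ratios.
Variable R : realType.
Implicit Types (f : nat -> R[i]).

(** The identity Q L = P says that the convolution of [q] with the coefficients of L is [p], where
    [q] and [p] have finite support. A prime factor beyond both supports then forces the coefficient
    to vanish, by induction. *)
Lemma L_coef_ratio f : axiom_A1 f -> ratio_of_dirichlet_polys (L_function f) ->
  exists M, forall n, (0 < n)%N -> ~ psmooth M n -> L_coef f n = 0.
Proof.
move=> A1 [P [Q [[NP [cP HP]] [NQ [cQ HQ]] [s0 Qs0] HL]]].
pose ext N (c : nat -> R[i]) n := if (n < N.+1)%N then c n else 0.
have ext_cvg N c k : psum (fun m => ext N c m / m%:R ^+ k) @ \oo -->
    \sum_(1 <= n < N.+1) c n * cpow n (- k%:R).
  apply: cvg_near_cst; exists N.+1 => // M /= NM.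
  rewrite /psum (big_cat_nat _ (n := N.+1)) //= [X in _ + X]sum0_nat ?addr0; last first.
    move=> m _ /andP[Nm _].
    by rewrite /ext ltnNge Nm /= mul0r.
  apply: eq_big_nat => m /andP[m0 mN].
  by rewrite /ext mN cpowN cpow_nat.
pose q := ext NQ cQ; pose p := ext NP cP.
have [n1 [n10 qn1]] : exists n1, (0 < n1)%N /\ q n1 != 0.
  apply/not_existsP => H; move: Qs0; rewrite HQ sum0_nat ?eqxx // => n _ /andP[n0 nN].
  have /not_andP[//|/negP] := H n; rewrite negbK /q /ext nN => /eqP ->.
  by rewrite mul0r.
(* Q is nonzero at all large integers, and these are the points at which L = P / Q is used. *)
have [|K HK] := @dirichlet_leading_neq0 R q (fun k => Q k%:R) n1 0 n10 qn1.
  by move=> k _; rewrite HQ; exact: ext_cvg.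
have conv n : (0 < n)%N -> dconv q (L_coef f) n = p n.
  move=> n0; apply/eqP; rewrite -subr_eq0; apply/eqP.
  apply: (@dirichlet_uniq R (fun m => dconv q (L_coef f) m - p m) (maxn K 2)) => // k.
  rewrite geq_max => /andP[Kk k2].
  have sk : 1 < Re (k%:R : R[i]).
    by rewrite (_ : k%:R = (k%:R)%:C) /= ?ltr1n // rmorph_nat.
  have [B xB] := bcoef_nsum A1 sk.
  have aB : nsum_le (fun n => L_coef f n * cpow n (- k%:R)) (expR B).
    apply: nsum_le_leW (dexp_nsum_le _ xB); last by rewrite bcoef1 mul0r.
    move=> m m0; rewrite dexp_twist ?cpow1n // ?L_coef_dexp // => d e d0 e0.
    by rewrite cpowM.
  have aL : psum (fun n => L_coef f n * cpow n (- k%:R)) @ \oo --> L_function f k%:R.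
    apply: cvg_ext (L_functionP A1 sk) => N.
    by apply: eq_big_nat => m /andP[m0 _]; rewrite L_coef_dexp.
  have [Bq qB] : exists Bq, nsum_le (fun n => q n * cpow n (- k%:R)) Bq.
    exists (\sum_(1 <= m < NQ.+1) normc (q m * cpow m (- k%:R))) => N.
    apply: (@le_trans _ _ (\sum_(1 <= m < maxn N NQ.+1) normc (q m * cpow m (- k%:R)))).
      by apply: ler_sum_nat_mono; [move=> ?; apply: normc_ge0|rewrite leq_maxl].
    rewrite (big_cat_nat _ (n := NQ.+1)) ?leq_maxr //= [X in _ + X]sum0_nat ?addr0 // => m _ /andP[Nm _].
    by rewrite /q /ext ltnNge Nm /= mul0r normc0_.
  have qQ : psum (fun n => q n * cpow n (- k%:R)) @ \oo --> Q k%:R.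
    rewrite HQ; apply: cvg_ext (ext_cvg NQ cQ k) => N.
    by apply: eq_big_nat => m /andP[m0 _]; rewrite cpowN cpow_nat.
  have pP : psum (fun n => p n / n%:R ^+ k) @ \oo --> P k%:R by rewrite HP; apply: ext_cvg.
  have H : (fun N => psum (dconv (fun n => q n * cpow n (- k%:R))
      (fun n => L_coef f n * cpow n (- k%:R))) N - psum (fun n => p n / n%:R ^+ k) N) @ \oo --> (0 : R[i]).
    have -> : 0 = Q k%:R * L_function f k%:R - P k%:R :> R[i].
      by rewrite HL ?HK // mulrCA mulfV ?HK // mulr1 subrr.
    by apply: cvgB; [exact: (dconv_psum_cvg qB aB qQ aL)|exact: pP].
  apply: cvg_ext H => N.
  rewrite /psum -sumrB; apply: eq_big_nat => m /andP[m0 _].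
  rewrite dconv_twist; last by move=> d e d0 e0; rewrite cpowM.
  by rewrite cpowN cpow_nat // mulrBl.
have : exists n, (0 < n)%N && (q n != 0) by exists n1; rewrite n10.
move=> /ex_minnP[n2 /andP[n20 qn2] n2min].
(* Coefficients are compared at [n2 * n], where [n2] is the least index in the support of [q]. A
   large prime [r] dividing [n] exceeds every [d] in that support, so in [d * e = n2 * n] with
   [d > n2] it divides [e < n], and the induction hypothesis applies to [e]. *)
exists (maxn NP NQ); elim/ltn_ind => n IH n0 ns.
have [r [pr rn rM]] : exists r, [/\ prime r, (r %| n)%N & (maxn NP NQ < r)%N].
  apply/not_existsP => H; apply: ns => r pr rn; rewrite leqNgt; apply/negP => rM.
  by apply: (H r).
have rle : (r <= n)%N by apply: dvdn_leq.
have := conv (n2 * n)%N; rewrite muln_gt0 n20 n0 => /(_ isT).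
have -> : p (n2 * n)%N = 0.
  by rewrite /p /ext ifF //; apply/negbTE; rewrite -leqNgt; move: rM; rewrite gtn_max; nia.
have n2M : (n2 <= NQ)%N by rewrite leqNgt; apply: contra qn2 => h; rewrite /q /ext ltnNge h.
have N0 : (n2 * n != 0)%N by rewrite -lt0n muln_gt0 n20.
rewrite /dconv (bigD1_seq n2) ?iota_uniq //=; last first.
  by rewrite mem_index_iota n20 ltnS leq_pmulr.
rewrite [X in _ + X]sum0_nat ?addr0; last first.
  move=> d dn2 /andP[d0 dn].
  rewrite sum0_nat // => e /eqP de /andP[e0 en].
  have [->|qd] := eqVneq (q d) 0; first by rewrite mul0r.
  have dge : (n2 <= d)%N by apply: n2min; rewrite d0.
  have dM : (d <= NQ)%N by rewrite leqNgt; apply: contra qd => h; rewrite /q /ext ltnNge h.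
  have [dn2' en'] : (n2 < d)%N /\ (e < n)%N.
    have : (n2 < d)%N by rewrite ltn_neqAle eq_sym dn2.
    by split => //; nia.
  rewrite IH ?mulr0 // => es.
  have : (r %| d * e)%N by rewrite de dvdn_mull.
  rewrite Euclid_dvdM // => /orP[/dvdn_leq|/(es _ pr)].
    by move=> /(_ d0); move: rM; rewrite gtn_max; lia.
  by rewrite leqNgt rM.
rewrite (eq_bigl (fun e => (n == e)%N && true)); last by move=> e; rewrite andbT eqn_pmul2l // eq_sym.
rewrite (big_nat_eq xpredT) ?n0 ?ltnS ?leq_pmull // => /eqP.
by rewrite mulf_eq0 (negbTE qn2) => /eqP.
Qed.

(** The convolution identity confines [f] to smooth numbers: at a non-smooth [n], every term other
    than the one with [f n] contains a non-smooth argument, of [f] or of the coefficients. The decay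
    in (A1) with exponent [M + 3] then yields the sum. *)
Lemma ratio_summable f : axiom_A1 f -> ratio_of_dirichlet_polys (L_function f) ->
  (\sum_(2 <= n <oo) (normc (f n) / ln (n%:R : R))%:E < +oo)%E.
Proof.
move=> A1 /(L_coef_ratio A1)[M aM].
have fM n : (1 < n)%N -> ~ psmooth M n -> f n = 0.
  elim/ltn_ind: n => n IH n1 ns.
  have := L_coef_conv A1 (ltnW n1); rewrite aM ?(ltnW n1) // mulr0.
  have [r [pr rn rM]] : exists r, [/\ prime r, (r %| n)%N & (M < r)%N].
    apply/not_existsP => H; apply: ns => r pr rn; rewrite leqNgt; apply/negP => rM.
    by apply: (H r).
  rewrite /dconv (bigD1_seq n) ?iota_uniq ?mem_index_iota ?(ltnW n1) //=.
  rewrite [X in _ + X]sum0_nat ?addr0; last first.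
    move=> d dn /andP[d0 dn'].
    rewrite sum0_nat // => e /eqP de /andP[e0 en].
    case: eqP => d1; first by rewrite mul0r.
    have dn2 : (d < n)%N by rewrite ltn_neqAle dn -ltnS.
    have [ds|ds] := pselect (psmooth M d); last first.
      by rewrite IH ?mul0r //; lia.
    rewrite aM ?mulr0 // => es.
    have : (r %| d * e)%N by rewrite de.
    by rewrite Euclid_dvdM // => /orP[/(ds _ pr)|/(es _ pr)]; rewrite leqNgt rM.
  rewrite (eq_bigl (fun e => (1 == e)%N && true)); last first.
    by move=> e; rewrite andbT -{2}[n]muln1 eqn_pmul2l ?(ltnW n1) // eq_sym.
  rewrite (big_nat_eq xpredT) ?ltnS ?(ltnW n1) // (_ : (n == 1)%N = false); last by apply/negbTE; lia.
  rewrite L_coef_dexp // dexp1 ?bcoef1 // mulr1 => /esym/eqP.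
  by rewrite mulf_eq0 (negbTE (cpow_neq0 _ _)) orbF => /eqP.
case: (A1) => _ A1b _.
apply/nneseries_ltyP; first by move=> n; rewrite divr_ge0 ?normc_ge0 ?ln_nat_ge0.
have k0 : 0 < (M + 3)%:R :> R by rewrite ltr0n addn3.
have [C HC] := A1b _ k0.
apply: (@psmooth_log_sum R M _ (`|C| / ln 2)).
- by rewrite divr_ge0 // ltW // ln2_gt0.
- by move=> n; rewrite divr_ge0 ?normc_ge0 ?ln_nat_ge0.
- by move=> n n1 ns; rewrite fM // normc0_ mul0r.
- move=> n n1; rewrite mulrAC ler_pM ?invr_ge0 ?ln_nat_ge0 //.
  + by rewrite mulr_ge0 // exprn_ge0 // ln_nat_ge0.
  + apply: le_trans (ler_norm C); rewrite -powR_mulrn ?ln_nat_ge0 //.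
    by apply: HC; apply: ltnW.
  + rewrite lef_pV2 ?posrE ?ln_nat_gt0 // ler_ln ?posrE ?ltr0n ?ler_nat //.
    exact: ltnW.
Qed.

Lemma L_coef_sum_trivial f : axiom_A1 f -> (forall n, (0 < n)%N -> f n = 0) ->
  (\sum_(1 <= n <oo) (normc (L_coef f n) / Num.sqrt (n%:R : R))%:E < +oo)%E.
Proof.
move=> A1 f0; apply/nneseries_ltyP; first by move=> n; rewrite divr_ge0 ?normc_ge0 ?sqrtr_ge0.
exists (normc (L_coef f 1)) => N; case: N => [|[|N]].
- by rewrite big_geq // normc_ge0.
- by rewrite big_geq // normc_ge0.
rewrite big_ltn // sqrtr1 divr1 sum0_nat ?addr0 // => n _ /andP[n1 _].
by rewrite L_coef_zero // normc0_ mul0r.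
Qed.

Lemma dirichlet_poly_ratio f N : axiom_A1 f -> (forall n, (N < n)%N -> L_coef f n = 0) ->
  ratio_of_dirichlet_polys (L_function f).
Proof.
move=> A1 aN.
exists (fun s => \sum_(1 <= n < N.+1) L_coef f n * cpow n (- s)), (fun=> 1); split.
- by exists N, (L_coef f).
- by exists 1%N, (fun=> 1) => s; rewrite big_nat1 cpow1n mulr1.
- by exists 0; rewrite oner_neq0.
move=> s s1 _; rewrite divr1; apply: (cvgc_unique (L_functionP A1 s1)).
apply: cvg_near_cst; exists N.+1 => // M /= NM.
rewrite /psum (big_cat_nat _ (n := N.+1)) //= [X in _ + X]sum0_nat ?addr0; last first.
  move=> m _ /andP[Nm _].
  by rewrite -L_coef_dexp ?aN ?mul0r //; lia.
by apply: eq_big_nat => m /andP[m0 mN]; rewrite L_coef_dexp.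
Qed.

End Ratios.

Lemma is_derive_comp1 (R : realType) (f g : R -> R) (x df dg : R) :
  is_derive (g x) 1 f df -> is_derive x 1 g dg -> is_derive x 1 (fun y => f (g y)) (df * dg).
Proof. by move=> Hf Hg; exact: (@is_derive1_comp R f g x df dg Hf Hg). Qed.

(** * Smooth functions and bumps *)

Section SmoothFunctions.
Variable R : realType.
Implicit Types (v w : R -> R).

(** The recursion differentiates [v] first and continues on the derivative; in this form, closure
    under products and affine changes of variable is an induction on [k]. *)
Fixpoint kderivable k v : Prop :=
  (forall x, derivable v x 1) /\ (if k is k'.+1 then kderivable k' v^`()%classic else True).

Lemma kderivable_S k v : kderivable k.+1 v -> kderivable k v.
Proof.
elim: k v => [|k IH] v /= [dv H]; split; [exact: dv|exact: I|exact: dv|exact: IH].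
Qed.

Lemma kderivableP v : smooth v <-> forall k, kderivable k v.
Proof.
split=> [sv k|H k]; last first.
  elim: k v {H}(H k) => [|k IH] v /=; first by case.
  by move=> [_ /IH H] x; rewrite -derive1nS derive1Sn.
elim: k v sv => [|k IH] v sv /=; first by split => // x; apply: (sv 0%N x).
split; first by move=> x; apply: (sv 0%N x).
by apply: IH => j x; rewrite -derive1Sn; apply: sv.
Qed.

Lemma kderivableD k v w : kderivable k v -> kderivable k w -> kderivable k (fun x => v x + w x).
Proof.
elim: k v w => [|k IH] v w [dv Hv] [dw Hw]; split; try exact: I.
- by move=> x; apply: derivableD; [apply: dv|apply: dw].
- by move=> x; apply: derivableD; [apply: dv|apply: dw].
rewrite (_ : derive1 _ = fun x => v^`()%classic x + w^`()%classic x); first exact: IH.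
by apply/funext => x; rewrite !derive1E [LHS]deriveD; [by []|apply: dv|apply: dw].
Qed.

Lemma kderivableM k v w : kderivable k v -> kderivable k w -> kderivable k (fun x => v x * w x).
Proof.
elim: k v w => [|k IH] v w Hv Hw; case: (Hv) => dv Hv'; case: (Hw) => dw Hw'; split; try exact: I.
- by move=> x; apply: derivableM; [apply: dv|apply: dw].
- by move=> x; apply: derivableM; [apply: dv|apply: dw].
rewrite (_ : derive1 _ = fun x => v x * w^`()%classic x + w x * v^`()%classic x).
  by apply: kderivableD; apply: IH; [apply: kderivable_S|exact: Hw'|apply: kderivable_S|exact: Hv'].
by apply/funext => x; rewrite !derive1E [LHS]deriveM; [by []|apply: dv|apply: dw].
Qed.

Lemma kderivable_cst k (c : R) : kderivable k (fun=> c).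
Proof.
elim: k c => [|k IH] c; split; try exact: I; try by move=> x; apply: derivable_cst.
by rewrite (_ : derive1 _ = fun=> 0) //; apply/funext => x; rewrite derive1_cst.
Qed.

Lemma is_derive_affine v (a b dv x : R) : is_derive (a * x + b) 1 v dv ->
  is_derive x 1 (fun x => v (a * x + b)) (a * dv).
Proof.
move=> H.
have Ha : is_derive x 1 (fun x : R => a * x + b) a.
  apply: (is_derive_eq (is_deriveD (is_deriveZ a (is_derive_id x (1:R))) (is_derive_cst b x 1))).
  by rewrite /GRing.scale /= mulr1 addr0.
by rewrite [a * dv]mulrC; apply: (is_derive_comp1 (f := v) (g := fun x => a * x + b)).
Qed.

Lemma kderivable_affine k v (a b : R) : kderivable k v -> kderivable k (fun x => v (a * x + b)).
Proof.
have d1 w : (forall x, derivable w x 1) -> forall x, derivable (fun x => w (a * x + b)) x 1.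
  move=> dw x; have H := derivableP (dw (a * x + b)).
  by have [] := is_derive_affine H.
elim: k v => [|k IH] v /= [dv Hv]; split; try exact: d1; [by []|].
rewrite (_ : derive1 _ = fun x => a * v^`()%classic (a * x + b)).
  by apply: kderivableM; [apply: kderivable_cst|apply: (IH v^`()%classic)].
apply/funext => x; rewrite derive1E.
have := is_derive_affine (derivableP (dv (a * x + b))); rewrite derive1E => H.
by apply: derive_val.
Qed.

Lemma smoothD v w : smooth v -> smooth w -> smooth (fun x => v x + w x).
Proof. by move=> /kderivableP Hv /kderivableP Hw; apply/kderivableP => k; apply: kderivableD. Qed.
Lemma smoothM v w : smooth v -> smooth w -> smooth (fun x => v x * w x).
Proof. by move=> /kderivableP Hv /kderivableP Hw; apply/kderivableP => k; apply: kderivableM. Qed.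
Lemma smooth_cst (c : R) : smooth (fun=> c).
Proof. by apply/kderivableP => k; apply: kderivable_cst. Qed.
Lemma smooth_affine v (a b : R) : smooth v -> smooth (fun x => v (a * x + b)).
Proof. by move=> /kderivableP Hv; apply/kderivableP => k; apply: kderivable_affine. Qed.
Lemma smooth_derivable v x : smooth v -> derivable v x 1.
Proof. by move=> sv; apply: (sv 0%N). Qed.
Lemma smooth_continuous v : smooth v -> continuous v.
Proof.
by move=> sv x; apply/differentiable_continuous/derivable1_diffP/smooth_derivable.
Qed.
Lemma smooth_derive1 v : smooth v -> smooth v^`()%classic.
Proof. by move=> sv k x; rewrite -derive1Sn; apply: sv. Qed.

End SmoothFunctions.

Section FlatFunctions.
Variable R : realType.
Implicit Types (p : {poly R}) (x h : R).

(* The family p(1/x) exp(-1/x), extended by 0, is stable under differentiation. *)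
Definition flat p x : R := if 0 < x then p.[x^-1] * expR (- x^-1) else 0.

Lemma pow_expN_bound n (u : R) : 0 <= u -> u ^+ n * expR (- u) <= n`!%:R.
Proof.
move=> u0; rewrite expRN ler_pdivrMr ?expR_gt0 //.
have h : u ^+ n / n`!%:R <= expR u.
  have := expR_sum_le n.+1 u0; rewrite big_nat_recr //=; apply: le_trans.
  by rewrite lerDr sumr_ge0 // => k _; rewrite divr_ge0 ?exprn_ge0.
by move: h; rewrite ler_pdivrMr // mulrC.
Qed.

Lemma poly_expN_bound p n : exists2 C, 0 <= C & forall u, 0 <= u ->
  `|p.[u]| * (u ^+ n * expR (- u)) <= C.
Proof.
exists (\sum_(i < size p) `|p`_i| * (i + n)`!%:R).
  by apply: sumr_ge0 => i _; rewrite mulr_ge0.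
move=> u u0; rewrite horner_coef.
apply: (@le_trans _ _ ((\sum_(i < size p) `|p`_i| * u ^+ i) * (u ^+ n * expR (- u)))).
  rewrite ler_wpM2r //; first by rewrite mulr_ge0 ?exprn_ge0.
  apply: le_trans (ler_norm_sum _ _ _) _; apply: ler_sum => i _.
  by rewrite normrM (ger0_norm (exprn_ge0 _ u0)).
rewrite mulr_suml; apply: ler_sum => i _; rewrite -mulrA ler_wpM2l //.
by rewrite mulrA -exprD pow_expN_bound.
Qed.

(** exp(-1/x) beats every power of 1/x; a bound of order x^2 is what forces the derivative at 0 to
    exist and vanish. *)
Lemma flat_sqr_bound p : exists2 C, 0 <= C & forall x, `|flat p x| <= C * x ^+ 2.
Proof.
have [C C0 HC] := poly_expN_bound p 2; exists C => // x; rewrite /flat.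
case: ltP => x0; last by rewrite normr0 mulr_ge0 ?sqr_ge0.
have := HC x^-1 (ltW _); rewrite invr_gt0 x0 => /(_ isT) H.
rewrite normrM (ger0_norm (expR_ge0 _)) -ler_pdivrMr ?exprn_gt0 //.
by apply: le_trans H; rewrite exprVn mulrCA mulrC mulrA.
Qed.

Lemma is_derive_sqr_bound (v : R -> R) (C : R) : (forall x, `|v x| <= C * x ^+ 2) ->
  is_derive (0 : R) 1 v 0.
Proof.
move=> H; have v0 : v 0 = 0.
  by apply/normr0_eq0/eqP; rewrite eq_le normr_ge0 andbT; have := H 0; rewrite expr0n mulr0.
have C0 : 0 <= C by have := le_trans (normr_ge0 _) (H 1); rewrite expr1n mulr1.
have L : (fun h => h^-1 *: (v (h *: 1 + 0) - v 0)) @ 0^' --> (0 : R).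
  apply/cvgr0Pnorm_le => e e0.
  have C1 : 0 < C + 1 by lra.
  near=> h; have h0 : h != 0 by near: h; apply: nbhs_dnbhs_neq.
  rewrite v0 subr0 addr0 /GRing.scale /= mulr1 normrM normfV.
  rewrite ler_pdivrMl ?normr_gt0 //; apply: le_trans (H h) _.
  rewrite -[h ^+ 2]real_normK ?num_real // expr2 mulrA mulrC ler_wpM2l //.
  have : `|h| < e / (C + 1).
    by near: h; apply: dnbhs0_lt; rewrite divr_gt0.
  rewrite ltr_pdivlMr // => he; have := normr_ge0 h; nra.
split; first by apply/cvg_ex; exists 0; exact: L.
by apply: cvg_lim => //; exact: L.
Unshelve. all: by end_near. Qed.

(** For [x > 0] the chain rule gives x^(-2) (p - p')(1/x) exp(-1/x), which belongs to the same
    family. *)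
Lemma is_derive_flat p x : is_derive x 1 (flat p) (flat ('X^2 * (p - p^`())) x).
Proof.
have [x0|x0|->] := ltgtP x 0.
- rewrite {2}/flat ltNge (ltW x0) /=.
  apply: (@near_eq_is_derive _ _ _ (fun=> 0)).
  near=> y; rewrite /flat ifF //; apply/negbTE; rewrite -leNgt ltW //.
  by near: y; apply: lt_nbhsl.
- have xn : x != 0 by rewrite gt_eqF.
  rewrite {2}/flat x0.
  apply: (@near_eq_is_derive _ _ _ (fun x => p.[x^-1] * expR (- x^-1))).
    near=> y; rewrite /flat ifT //; near: y; exact: lt_nbhsr.
  have Hi : is_derive x 1 (fun x => x^-1) (- x ^- 2).
    by apply: (is_derive_eq (is_deriveV xn (is_derive_id x (1:R)))); rewrite /GRing.scale /= mulr1.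
  have H1 := is_derive1_comp (is_derive_poly p x^-1) Hi.
  have H2 := is_derive_comp1 (g := fun x => - x^-1) (is_derive_expR (- x^-1)) (is_deriveN Hi).
  apply: (is_derive_eq (is_deriveM H1 H2)).
  rewrite /GRing.scale /= !hornerE /= ?exprVn; ring.
- rewrite {2}/flat ltxx.
  have [C C0 H] := flat_sqr_bound p; exact: is_derive_sqr_bound H.
Unshelve. all: by end_near. Qed.

Lemma smooth_flat p : smooth (flat p).
Proof.
apply/kderivableP => k; elim: k p => [|k IH] p; split; try exact: I.
- by move=> x; have [] := is_derive_flat p x.
- by move=> x; have [] := is_derive_flat p x.
rewrite (_ : derive1 _ = flat ('X^2 * (p - p^`()))) //.
by apply/funext => x; rewrite derive1E; have [_ ->] := is_derive_flat p x.
Qed.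

(** The product of two mirrored one-sided functions is even and supported in [[-a, a]]. Evenness
    makes its transform even, hence real on the imaginary axis. *)
Definition bump (a x : R) : R := flat 1 (x + a) * flat 1 (a - x).

Lemma flat1_ge0 x : 0 <= flat 1 x.
Proof. by rewrite /flat; case: ifP => // _; rewrite hornerC mul1r expR_ge0. Qed.
Lemma flat1_le1 x : flat 1 x <= 1.
Proof.
rewrite /flat; case: ifP => // x0; rewrite hornerC mul1r expR_le1 ?oppr_le0 ?invr_ge0 ?ltW //.
Qed.
Lemma flat1_gt0 x : 0 < x -> 0 < flat 1 x.
Proof. by move=> x0; rewrite /flat x0 hornerC mul1r expR_gt0. Qed.
Lemma flat_eq0 p x : x <= 0 -> flat p x = 0.
Proof. by move=> x0; rewrite /flat ltNge x0. Qed.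

Lemma smooth_bump a : smooth (bump a).
Proof.
have F : smooth (flat (1 : {poly R})) by apply: smooth_flat.
apply: smoothM.
  rewrite (_ : (fun x => _) = fun x => flat 1 (1 * x + a)); last by apply/funext=> x; rewrite mul1r.
  exact: (@smooth_affine R (flat 1) 1 a F).
rewrite (_ : (fun x => _) = fun x => flat 1 (-1 * x + a)); last by apply/funext=> x; rewrite mulN1r addrC.
exact: (@smooth_affine R (flat 1) (-1) a F).
Qed.

Lemma bump_ge0 a x : 0 <= bump a x. Proof. by rewrite mulr_ge0 ?flat1_ge0. Qed.
Lemma bump_le1 a x : bump a x <= 1.
Proof. by rewrite -[leRHS]mulr1 ler_pM ?flat1_ge0 ?flat1_le1. Qed.
Lemma bump_even a x : bump a (- x) = bump a x.
Proof. by rewrite /bump mulrC opprK addrC [- x + a]addrC. Qed.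
Lemma bump_eq0 a x : a <= `|x| -> bump a x = 0.
Proof.
rewrite ler_normr => /orP[h|h]; rewrite /bump.
  by rewrite [X in _ * X]flat_eq0 ?mulr0 // subr_le0.
by rewrite flat_eq0 ?mul0r //; lra.
Qed.
Lemma bump_gt0 a x : `|x| < a -> 0 < bump a x.
Proof. by rewrite ltr_norml => /andP[h1 h2]; rewrite mulr_gt0 // flat1_gt0 //; lra. Qed.

End FlatFunctions.

(** * Integration of real and complex functions on the line *)

Section RealIntegral.
Variable R : realType.
Implicit Types (D : set R) (f g : R -> R).

Definition rint D f := mu.-integrable D (EFin \o f).

Lemma rint_measurable D f : rint D f -> measurable_fun D f.
Proof. by move=> H; apply/measurable_EFinP; apply: measurable_int H. Qed.

Lemma rint_le D f g : measurable D -> measurable_fun D f ->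
  (forall x, D x -> `|f x| <= g x) -> rint D g -> rint D f.
Proof.
move=> mD mf fg; apply: le_integrable => //; first exact/measurable_EFinP.
move=> x Dx; rewrite /= lee_fin; apply: le_trans (fg _ Dx) _; exact: ler_norm.
Qed.

Lemma rintD D f g : measurable D -> rint D f -> rint D g -> rint D (fun x => f x + g x).
Proof. by move=> mD Hf Hg; exact: (@integrableD _ _ R mu D mD (EFin \o f) (EFin \o g) Hf Hg). Qed.
Lemma rintZ D f c : measurable D -> rint D f -> rint D (fun x => c * f x).
Proof. by move=> mD Hf; exact: (@integrableZl _ _ R mu D mD c (EFin \o f) Hf). Qed.
Lemma rintN D f : measurable D -> rint D f -> rint D (fun x => - f x).
Proof. by move=> mD Hf; exact: (@integrableN _ _ R mu D (EFin \o f) Hf). Qed.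

Lemma rint_abs D f : measurable D -> rint D f -> rint D (fun x => `|f x|).
Proof.
move=> mD Hf; apply: (rint_le (g := fun x => `|f x|)) => //; last by have := integrable_abse Hf.
  by apply: measurableT_comp => //; exact: rint_measurable Hf.
by move=> x _; rewrite normr_id.
Qed.

Lemma rint_sub D E f : measurable D -> measurable E -> D `<=` E -> rint E f -> rint D f.
Proof. by move=> mD mE DE; apply: integrableS. Qed.

Lemma eq_rint D f g : measurable D -> (forall x, D x -> f x = g x) -> rint D f -> rint D g.
Proof.
move=> mD fg; apply: eq_integrable => // x; rewrite inE => Dx /=.
by rewrite fg.
Qed.

Lemma rint_segment (a b : R) f : continuous f -> rint `[a, b] f.
Proof.
move=> cf; apply: continuous_compact_integrable; first exact: segment_compact.
by apply: continuous_subspaceT.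
Qed.

Lemma rint_restrict D f : measurable D -> rint D f <-> rint setT (f \_ D).
Proof.
move=> mD; rewrite /rint; have := @integrable_restrict _ _ R mu D mD setT measurableT (EFin \o f).
by rewrite setTI restrict_EFin.
Qed.

Lemma rint_supp D f : measurable D -> rint D f -> (forall x, ~ D x -> f x = 0) -> rint setT f.
Proof.
move=> mD /rint_restrict H f0; apply: eq_rint (H mD) => // x _.
by rewrite patchE; case: ifPn => //; rewrite notin_setE => /f0 ->.
Qed.

Lemma Rintegral_supp D f : (forall x, ~ D x -> f x = 0) ->
  \int[mu]_(x in D) f x = \int[mu]_x f x.
Proof.
move=> f0; rewrite Rintegral_mkcond; apply: eq_Rintegral => x _.
by rewrite patchE; case: ifPn => //; rewrite notin_setE => /f0 ->.
Qed.

Lemma Rintegral_dom (D : set R) (u : nat -> R -> R) (f g : R -> R) : measurable D ->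
  (forall n, measurable_fun D (u n)) ->
  (forall x, D x -> u ^~ x @ \oo --> f x) -> rint D g ->
  (forall n x, D x -> `|u n x| <= g x) ->
  rint D f /\ (fun n => \int[mu]_(x in D) u n x) @ \oo --> \int[mu]_(x in D) f x.
Proof.
move=> mD mu_ uf ig ug.
have mf : measurable_fun D f by apply: measurable_fun_cvg uf.
have fg x : D x -> `|f x| <= g x.
  move=> Dx.
  have H : (fun n => `|u n x|) @ \oo --> `|f x| by apply: cvg_norm; exact: uf.
  rewrite leNgt; apply/negP => gf.
  have e0 : 0 < `|f x| - g x by rewrite subr_gt0.
  move/cvgrPdist_lt : H => /(_ _ e0) [N _ HN].
  have := HN N (leqnn N); rewrite /= => /(le_lt_trans (ler_norm _)).
  by have := ug N x Dx; lra.
have iF : rint D f by apply: rint_le ig.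
split => //.
have H := @dominated_cvg _ _ R mu D mD (fun n => EFin \o u n) (EFin \o f) (EFin \o g).
have {}H : (fun n => \int[mu]_(x in D) (u n x)%:E)%E @ \oo --> (\int[mu]_(x in D) (f x)%:E)%E.
  apply: H => //.
  - by move=> n; apply/measurable_EFinP; exact: mu_.
  - by move=> x Dx; apply: cvg_EFin; [exact: nearW|exact: uf].
rewrite /Rintegral; apply: fine_cvg; rewrite fineK; [exact: H|exact: integrable_fin_num].
Unshelve. all: by end_near. Qed.

(* Uniqueness of Lebesgue measure on intervals gives invariance under isometries of the line. *)
Lemma lebesgue_measure_isometry (s t : R) (A : set R) : s = 1 \/ s = -1 -> measurable A ->
  mu ((fun x => s * x + t) @^-1` A) = mu A.
Proof.
move=> s1 mA.
have mphi : measurable_fun [set: R] (fun x : R => s * x + t).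
  apply: measurable_funD; last exact: measurable_cst.
  by apply: measurable_funM; [exact: measurable_cst|exact: measurable_id].
suff E : mu A = pushforward mu (fun x : R => s * x + t) A by rewrite E.
apply: (@lebesgue_measure_unique R (@measure_function_pushforward__canonical__measure_function_Measure _ _ (measurableTypeR R) (measurableTypeR R) R mu (fun x : R => s * x + t) mphi) _ A mA).
move=> X [[a b] /= _ <-]; rewrite /pushforward.
have [ab|ba] := leP a b; last first.
  by rewrite set_itv_ge ?measure0 ?preimage_set0 ?measure0 // -leNgt bnd_simp ltW.
case: s1 => ->.
  rewrite (_ : _ @^-1` _ = `]a - t, b - t]%classic); last first.
    by apply/seteqP; split => x /=; rewrite !in_itv /= => /andP[h1 h2]; apply/andP; split; lra.
  by rewrite !lebesgue_measure_itv /= !lte_fin ltrD2r; case: ifP => // _; rewrite -!EFinD; congr (_%:E); lra.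
rewrite (_ : _ @^-1` _ = `[t - b, t - a[%classic); last first.
  by apply/seteqP; split => x /=; rewrite !in_itv /= => /andP[h1 h2]; apply/andP; split; lra.
rewrite !lebesgue_measure_itv /= !lte_fin (_ : (t - b < t - a) = (a < b)); last by apply/idP/idP; lra.
by case: ifP => // _; rewrite -!EFinD; congr (_%:E); lra.
Qed.

Lemma Rintegral_isometry (s t : R) f : s = 1 \/ s = -1 -> rint setT f ->
  rint setT (fun x => f (s * x + t)) /\ \int[mu]_x f (s * x + t) = \int[mu]_x f x.
Proof.
move=> s1 fi; set phi := fun x : R => s * x + t.
have mphi : measurable_fun [set: R] phi.
  apply: measurable_funD; last exact: measurable_cst.
  by apply: measurable_funM; [exact: measurable_cst|exact: measurable_id].
have mf := rint_measurable fi.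
have mfp : measurable_fun setT (fun x => f (phi x)) by apply: measurableT_comp.
have pe (g : R -> \bar R) : (integral (T := measurableTypeR R) (pushforward mu phi) setT g = \int[mu]_x g x)%E.
  apply: (@eq_measure_integral _ (measurableTypeR R) R setT mu (@measure_function_pushforward__canonical__measure_function_Measure _ _ (measurableTypeR R) (measurableTypeR R) R mu phi mphi)) => A mA _.
  exact: (lebesgue_measure_isometry t s1 mA).
have ifp : rint setT (fun x => f (phi x)).
  apply/integrableP; split; first exact/measurable_EFinP.
  have /integrableP[_ fl] := fi; rewrite -pe in fl.
  rewrite (@ge0_integral_pushforward _ _ (measurableTypeR R) (measurableTypeR R) _ phi mphi mu setT (fun x => `|(f x)%:E|%E)) // in fl.
  by apply/measurableT_comp => //; apply/measurable_EFinP.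
split => //; rewrite /Rintegral -[in RHS]pe integral_pushforward //.
exact/measurable_EFinP.
Qed.

Lemma Rintegral_shift (t : R) f : rint setT f ->
  rint setT (fun x => f (x + t)) /\ \int[mu]_x f (x + t) = \int[mu]_x f x.
Proof.
move=> fi; have := @Rintegral_isometry 1 t f (or_introl erefl) fi.
by rewrite (_ : (fun x => f (1 * x + t)) = (fun x => f (x + t))) //; apply/funext => x; rewrite mul1r.
Qed.

Lemma Rintegral_opp f : rint setT f ->
  rint setT (fun x => f (- x)) /\ \int[mu]_x f (- x) = \int[mu]_x f x.
Proof.
move=> fi; have := @Rintegral_isometry (-1) 0 f (or_intror erefl) fi.
by rewrite (_ : (fun x => f (-1 * x + 0)) = (fun x => f (- x))) //; apply/funext => x; rewrite mulN1r addr0.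
Qed.

Lemma Rintegral_FTC2 (f F : R -> R) (a b : R) : a <= b -> continuous f ->
  (forall x : R, is_derive x 1 F (f x)) -> \int[mu]_(x in `[a, b]) f x = F b - F a.
Proof.
rewrite le_eqVlt => /orP[/eqP <- _ _|ab cf dF].
  by rewrite set_itv1 Rintegral_set1 subrr.
have cF : continuous F.
  by move=> x; apply/differentiable_continuous/derivable1_diffP; have [] := dF x.
rewrite /Rintegral (@continuous_FTC2 _ f F) //.
- by apply: continuous_subspaceT.
- split.
  + by move=> x _; have [] := dF x.
  + by apply: cvg_at_right_filter; apply: cF.
  + by apply: cvg_at_left_filter; apply: cF.
- by move=> x _; rewrite derive1E; have [_ ->] := dF x.
Qed.

Lemma Rintegral_FTC2y (f F : R -> R) : continuous f ->
  (forall x : R, is_derive x 1 F (f x)) -> rint `[0, +oo[ f -> (fun n => F n%:R) @ \oo --> (0 : R) ->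
  \int[mu]_(x in `[0, +oo[) f x = - F 0.
Proof.
move=> cf dF fi F0.
have mI n : measurable (`[0, n%:R] : set R) by exact: measurable_itv.
have mJ : measurable (`[0, +oo[ : set R) by exact: measurable_itv.
have [||||_ H] := @Rintegral_dom `[0, +oo[ (fun n => f \_ `[0, n%:R]) f (fun x => `|f x|) mJ.
- move=> n; apply/(measurable_restrict f (mI n) mJ).
  by apply: measurable_funS (rint_measurable fi) => //; apply: subIsetl.
- move=> x; rewrite /= in_itv /= andbT => x0.
  apply: cvg_near_cst; exists (Num.trunc x).+1 => // n /= xn; rewrite patchE ifT // inE /= in_itv /= x0 /=.
  by apply: ltW; apply: lt_le_trans (truncnS_gt x) _; rewrite ler_nat.
- exact: rint_abs.
- by move=> n x _; rewrite patchE; case: ifP => // _; rewrite normr0.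
have E : (fun n => F n%:R - F 0) @ \oo --> \int[mu]_(x in `[0, +oo[) f x.
  apply: cvg_ext H => n; rewrite -(Rintegral_FTC2 _ cf dF) //.
  rewrite [RHS]Rintegral_mkcond [LHS]Rintegral_mkcond; apply: eq_Rintegral => x _.
  rewrite !patchE; case: ifP; rewrite // => /negbT; rewrite notin_setE /= !in_itv /= andbT => h.
  by case: ifP => //; rewrite inE /= in_itv /= => /andP[].
have E2 : (fun n => F n%:R - F 0) @ \oo --> 0 - F 0 by apply: cvgB => //; exact: cvg_cst.
by rewrite -[RHS]add0r; apply: (cvg_unique _ E E2).
Qed.

Lemma rint_expRN (c : R) : 0 < c -> rint `[0, +oo[ (fun x => expR (- c * x)).
Proof.
move=> c0.
have d (x : R) : is_derive x 1 (fun x : R => - c^-1 * expR (- c * x)) (expR (- c * x)).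
  have H := is_derive_affine (v := expR) (a := - c) (b := 0) (is_derive_expR (- c * x + 0)).
  have H2 := is_deriveZ (- c^-1) H.
  rewrite (_ : (fun x => _) = (- c^-1) *: (fun x => expR (- c * x + 0))); last first.
    by apply/funext => y; change (- c^-1 * expR (- c * y) = - c^-1 * expR (- c * y + 0)); rewrite addr0.
  apply: (is_derive_eq H2); rewrite addr0 /GRing.scale /= mulrA mulrNN mulVf ?mul1r //.
  by rewrite gt_eqF.
have cF : continuous (fun x : R => - c^-1 * expR (- c * x)).
  by move=> x; apply/differentiable_continuous/derivable1_diffP; have [] := d x.
have cf : continuous (fun x => expR (- c * x)).
  move=> x; apply/differentiable_continuous/derivable1_diffP.
  have H := is_derive_affine (v := expR) (a := - c) (b := 0) (is_derive_expR (- c * x + 0)).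
  rewrite (_ : (fun x => _) = fun x => expR (- c * x + 0)); first by case: H.
  by apply/funext => y; rewrite addr0.
apply/integrableP; split.
  by apply/measurable_EFinP; apply: measurable_funTS; apply: continuous_measurable_fun.
rewrite (@eq_integral _ _ R mu _ (fun x => (expR (- c * x))%:E)); last first.
  by move=> x _ /=; rewrite ger0_norm.
rewrite (@ge0_continuous_FTC2y _ _ (fun x => - c^-1 * expR (- c * x)) 0 0) ?ltry //.
- by apply: continuous_subspaceT.
- apply/cvgr0Pnorm_le => e e0; near=> x.
  have x0 : 0 < x by near: x; apply: nbhs_pinfty_gt.
  rewrite normrM normrN !ger0_norm ?expR_ge0 ?invr_ge0 ?(ltW c0) //.
  have h : expR (- c * x) <= (c * x)^-1.
    have := pow_expN_bound 1 (ltW (mulr_gt0 c0 x0)); rewrite expr1 mulNr (_ : 1`!%:R = 1 :> R) //.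
    by rewrite mulrC -ler_pdivlMr ?mulr_gt0 // mul1r.
  apply: le_trans (ler_wpM2l _ h) _; first by rewrite invr_ge0 ltW.
  rewrite invfM mulrA ler_pdivrMr // -ler_pdivrMl //.
- by apply: cvg_at_right_filter; exact: cF.
- by move=> x _; rewrite derive1E; have [_ ->] := d x.
Unshelve. all: by end_near. Qed.

Lemma rint_pow_expRN (c : R) k : 0 < c -> rint `[0, +oo[ (fun x => x ^+ k * expR (- c * x)).
Proof.
move=> c0; have c2 : 0 < c / 2 by rewrite divr_gt0.
apply: (@rint_le _ _ (fun x => (k`!%:R * (2 / c) ^+ k) * expR (- (c / 2) * x))).
- exact: measurable_itv.
- apply: measurable_funTS; apply: measurable_funM; first by apply: measurable_funX; exact: measurable_id.
  by apply: measurableT_comp => //; apply: measurable_funM => //; exact: measurable_cst.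
- move=> x; rewrite /= in_itv /= andbT => x0.
  rewrite ger0_norm ?mulr_ge0 ?exprn_ge0 //.
  have h := pow_expN_bound k (mulr_ge0 (ltW c2) x0).
  have -> : - c * x = - (c / 2 * x) + - (c / 2) * x by field.
  rewrite expRD mulrA ler_wpM2r //.
  rewrite exprMn -mulrA in h.
  have p0 : 0 < (c / 2) ^+ k by rewrite exprn_gt0.
  rewrite -[2 / c]invf_div exprVn ler_pdivlMr //.
  by rewrite mulrC.
- by apply: rintZ; [exact: measurable_itv|exact: rint_expRN].
Qed.

End RealIntegral.

Section ComplexIntegral.
Variable R : realType.
Implicit Types (D : set R) (u v : R -> R[i]) (f g : R -> R).

Definition cmeas D u := measurable_fun D (fun x => Re (u x)) /\ measurable_fun D (fun x => Im (u x)).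

Lemma cmeas_cst D (c : R[i]) : cmeas D (fun=> c).
Proof. by split; exact: measurable_cst. Qed.

Lemma cmeasD D u v : cmeas D u -> cmeas D v -> cmeas D (fun x => u x + v x).
Proof.
move=> [u1 u2] [v1 v2]; split.
  by under eq_fun do rewrite ReD; exact: measurable_funD.
by under eq_fun do rewrite ImD; exact: measurable_funD.
Qed.

Lemma cmeasM D u v : cmeas D u -> cmeas D v -> cmeas D (fun x => u x * v x).
Proof.
move=> [u1 u2] [v1 v2]; split.
  rewrite (_ : (fun x => _) = fun x => Re (u x) * Re (v x) - Im (u x) * Im (v x)); last by apply/funext => x; rewrite ReM.
  by apply: measurable_funB; apply: measurable_funM.
rewrite (_ : (fun x => _) = fun x => Re (u x) * Im (v x) + Im (u x) * Re (v x)); last by apply/funext => x; rewrite ImM.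
by apply: measurable_funD; apply: measurable_funM.
Qed.

Lemma cmeasN D u : cmeas D u -> cmeas D (fun x => - u x).
Proof.
move=> mu_; rewrite (_ : (fun x => _) = fun x => -1 * u x); last by apply/funext => x; rewrite mulN1r.
exact: cmeasM (cmeas_cst _ _) mu_.
Qed.

Lemma cmeas_real D f : measurable_fun D f -> cmeas D (fun x => (f x)%:C).
Proof. by move=> mf; split => //=; exact: measurable_cst. Qed.
Lemma cmeas_sub D E u : measurable E -> D `<=` E -> cmeas E u -> cmeas D u.
Proof. by move=> mE DE [u1 u2]; split; apply: measurable_funS; eassumption. Qed.

Lemma cmeas_sum D (w : nat -> R -> R[i]) N : (forall i, cmeas D (w i)) ->
  cmeas D (fun x => csum (w ^~ x) N).
Proof.
move=> mw; elim: N => [|N IH].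
  rewrite (_ : (fun x => _) = (fun=> 0)); first exact: cmeas_cst.
  by apply/funext => x; rewrite /csum big_geq.
rewrite (_ : (fun x => _) = fun x => csum (w ^~ x) N + w N x); first exact: cmeasD.
by apply/funext => x; rewrite /csum big_nat_recr.
Qed.

Lemma cmeas_cexp D u : cmeas D u -> cmeas D (fun x => cexp (u x)).
Proof.
move=> [u1 u2]; split.
  under eq_fun do rewrite Re_cexp.
  apply: measurable_funM; first exact: measurableT_comp.
  apply: measurableT_comp u2; apply: continuous_measurable_fun; exact: continuous_cos.
under eq_fun do rewrite Im_cexp.
apply: measurable_funM; first exact: measurableT_comp.
apply: measurableT_comp u2; apply: continuous_measurable_fun; exact: continuous_sin.
Qed.

Lemma cmeas_cexpZ D (w : R[i]) : cmeas D (fun t : R => cexp (t%:C * w)).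
Proof. by apply: cmeas_cexp; apply: cmeasM; [by apply: cmeas_real; exact: measurable_id|exact: cmeas_cst]. Qed.

Lemma cmeas_lim D (w : nat -> R -> R[i]) u : measurable D -> (forall i, cmeas D (w i)) ->
  (forall x, D x -> w ^~ x @ \oo --> u x) -> cmeas D u.
Proof.
move=> mD mw wu; split.
  apply: (@measurable_fun_cvg _ _ R D (fun i x => Re (w i x))) => [i|x Dx]; first by case: (mw i).
  by have /cvg_ReIm[] := wu x Dx.
apply: (@measurable_fun_cvg _ _ R D (fun i x => Im (w i x))) => [i|x Dx]; first by case: (mw i).
by have /cvg_ReIm[] := wu x Dx.
Qed.

Lemma cmeas_patch D u : measurable D -> cmeas setT u -> cmeas setT (u \_ D).
Proof.
move=> mD [u1 u2]; split.
  rewrite (_ : (fun x => _) = (fun x => Re (u x)) \_ D).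
    by apply/(measurable_restrict _ mD measurableT); rewrite setTI; apply: measurable_funTS.
  by apply/funext => x; rewrite !patchE; case: ifP.
rewrite (_ : (fun x => _) = (fun x => Im (u x)) \_ D).
  by apply/(measurable_restrict _ mD measurableT); rewrite setTI; apply: measurable_funTS.
by apply/funext => x; rewrite !patchE; case: ifP.
Qed.

Lemma cmeas_normc D u : cmeas D u -> measurable_fun D (fun x => normc (u x)).
Proof.
move=> [u1 u2]; rewrite (_ : (fun x => _) = fun x => Num.sqrt (Re (u x) ^+ 2 + Im (u x) ^+ 2)).
  apply: (measurableT_comp (f := @Num.sqrt R)).
    by apply: continuous_measurable_fun; exact: sqrt_continuous.
  by apply: measurable_funD; apply: measurable_funX.
by apply/funext => x; exact: normcEsqrt.
Qed.

Lemma cmeas_continuous D u : (forall x, {for x, continuous (fun y : R => Re (u y))}) ->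
  (forall x, {for x, continuous (fun y : R => Im (u y))}) -> cmeas D u.
Proof.
by move=> c1 c2; split; apply: measurable_funTS; apply: continuous_measurable_fun.
Qed.

Definition cintb D u := rint D (fun x => Re (u x)) /\ rint D (fun x => Im (u x)).

Lemma cintb_le D u g : measurable D -> cmeas D u -> (forall x, D x -> normc (u x) <= g x) ->
  rint D g -> cintb D u.
Proof.
move=> mD [m1 m2] ug ig; split; apply: (rint_le mD _ _ ig) => // x Dx.
  by apply: le_trans (ler_normc_Re _) (ug x Dx).
by apply: le_trans (ler_normc_Im _) (ug x Dx).
Qed.

Lemma cintb_cmeas D u : cintb D u -> cmeas D u.
Proof. by move=> [h1 h2]; split; exact: rint_measurable. Qed.

Lemma cintb_normc D u : measurable D -> cintb D u -> rint D (fun x => normc (u x)).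
Proof.
move=> mD [h1 h2]; apply: (rint_le (g := fun x => `|Re (u x)| + `|Im (u x)|)) => //.
- by apply: cmeas_normc; apply: cintb_cmeas.
- by move=> x _; rewrite ger0_norm // normc_le_ReIm.
- by apply: rintD => //; exact: rint_abs.
Qed.

Lemma cintbD D u v : measurable D -> cintb D u -> cintb D v -> cintb D (fun x => u x + v x).
Proof.
move=> mD [u1 u2] [v1 v2]; split.
  by under eq_fun do rewrite ReD; exact: rintD.
by under eq_fun do rewrite ImD; exact: rintD.
Qed.

Lemma cintbZ D (c : R[i]) u : measurable D -> cintb D u -> cintb D (fun x => c * u x).
Proof.
move=> mD [u1 u2]; split.
  rewrite (_ : (fun x => _) = fun x => Re c * Re (u x) + - Im c * Im (u x)); last by apply/funext => x; rewrite ReM mulNr.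
  by apply: rintD => //; exact: rintZ.
rewrite (_ : (fun x => _) = fun x => Re c * Im (u x) + Im c * Re (u x)); last by apply/funext => x; rewrite ImM.
by apply: rintD => //; exact: rintZ.
Qed.

Lemma rint0 D : measurable D -> rint D (fun=> 0 : R).
Proof. by move=> mD; apply: (@integrable0 _ _ R mu D). Qed.
Lemma cintb_rC D f : measurable D -> rint D f -> cintb D (fun x => (f x)%:C).
Proof. by move=> mD h; split => //=; exact: rint0. Qed.

Lemma cintbN D u : measurable D -> cintb D u -> cintb D (fun x => - u x).
Proof.
move=> mD mu_; rewrite (_ : (fun x => _) = fun x => -1 * u x); last by apply/funext => x; rewrite mulN1r.
exact: cintbZ.
Qed.

Lemma cintb0 D : measurable D -> cintb D (fun=> 0).
Proof. by move=> mD; split; exact: rint0. Qed.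

Lemma cintb_sum D (w : nat -> R -> R[i]) N : measurable D -> (forall i, cintb D (w i)) ->
  cintb D (fun x => csum (w ^~ x) N).
Proof.
move=> mD mw; elim: N => [|N IH].
  rewrite (_ : (fun x => _) = (fun=> 0)); first exact: cintb0.
  by apply/funext => x; rewrite /csum big_geq.
rewrite (_ : (fun x => _) = fun x => csum (w ^~ x) N + w N x); first exact: cintbD.
by apply/funext => x; rewrite /csum big_nat_recr.
Qed.

Lemma eq_cint D u v : (forall x, D x -> u x = v x) -> cint D u = cint D v.
Proof.
move=> uv; rewrite /cintegral; congr (_ +i* _); apply: eq_Rintegral => x.
  by rewrite inE => /uv ->.
by rewrite inE => /uv ->.
Qed.

Lemma eq_cintb D u v : measurable D -> (forall x, D x -> u x = v x) -> cintb D u -> cintb D v.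
Proof.
move=> mD uv [h1 h2]; split; [apply: eq_rint h1|apply: eq_rint h2] => // x /uv ->.
- by [].
- by [].
Qed.

Lemma cintb_sub D E u : measurable D -> measurable E -> D `<=` E -> cintb E u -> cintb D u.
Proof. by move=> mD mE DE [h1 h2]; split; [apply: rint_sub h1|apply: rint_sub h2]. Qed.

Lemma cintD D u v : measurable D -> cintb D u -> cintb D v ->
  cint D (fun x => u x + v x) = cint D u + cint D v.
Proof.
move=> mD [u1 u2] [v1 v2]; apply: complex_ext; rewrite ?ReD ?ImD /cintegral /=.
  rewrite -(RintD mD u1 v1); apply: eq_Rintegral => x _; exact: ReD.
rewrite -(RintD mD u2 v2); apply: eq_Rintegral => x _; exact: ImD.
Qed.

Lemma cintZ D (c : R[i]) u : measurable D -> cintb D u -> cint D (fun x => c * u x) = c * cint D u.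
Proof.
move=> mD [u1 u2]; apply: complex_ext; rewrite ?ReM ?ImM /cintegral /=.
  rewrite -(RintZl (Re c) mD u1) -(RintZl (Im c) mD u2).
  rewrite -(RintB mD (rintZ (Re c) mD u1) (rintZ (Im c) mD u2)).
  by apply: eq_Rintegral => x _; rewrite ReM.
rewrite -(RintZl (Re c) mD u2) -(RintZl (Im c) mD u1).
rewrite -(RintD mD (rintZ (Re c) mD u2) (rintZ (Im c) mD u1)).
by apply: eq_Rintegral => x _; rewrite ImM.
Qed.

Lemma cintN D u : measurable D -> cintb D u -> cint D (fun x => - u x) = - cint D u.
Proof.
move=> mD h; rewrite -[RHS]mulN1r -cintZ //; apply: eq_cint => x _; by rewrite mulN1r.
Qed.

Lemma cint0 D : cint D (fun=> 0) = 0.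
Proof. by rewrite /cintegral /= /Rintegral integral0. Qed.

Lemma cint_sum D (w : nat -> R -> R[i]) N : measurable D -> (forall i, cintb D (w i)) ->
  cint D (fun x => csum (w ^~ x) N) = csum (fun i => cint D (w i)) N.
Proof.
move=> mD mw; elim: N => [|N IH].
  rewrite (_ : (fun x => _) = (fun=> 0)) ?cint0 /csum ?big_geq //.
  by apply/funext => x; rewrite big_geq.
rewrite (_ : (fun x => _) = fun x => csum (w ^~ x) N + w N x).
  by rewrite cintD // ?IH /csum ?big_nat_recr //; exact: cintb_sum.
by apply/funext => x; rewrite /csum big_nat_recr.
Qed.

(** Multiplication by the conjugate of the integral makes it real, so that the bound follows from
    monotonicity of the real integral. *)
Lemma cint_le D u g : measurable D -> cintb D u -> (forall x, D x -> normc (u x) <= g x) -> rint D g ->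
  normc (cint D u) <= \int[mu]_(x in D) g x.
Proof.
move=> mD hu ug ig; set I := cint D u.
have [->|I0] := eqVneq I 0.
  rewrite normc0_; apply: Rintegral_ge0 => x Dx; exact: le_trans (normc_ge0 _) (ug x Dx).
have n0 : 0 < normc I by rewrite normc_gt0.
rewrite -(ler_pM2l n0) -expr2.
have E : normc I ^+ 2 = Re (conjc I * I).
  by rewrite normc_sqr ReM Re_conjc Im_conjc mulNr opprK !expr2.
rewrite E -cintZ //.
rewrite (_ : Re (cint D _) = \int[mu]_(x in D) Re (conjc I * u x)) //.
rewrite -(RintZl (normc I) mD ig).
apply: le_Rint => //.
- by have [] := cintbZ (conjc I) mD hu.
- exact: rintZ.
move=> x Dx; apply: le_trans (ler_norm _) _; apply: le_trans (ler_normc_Re _) _.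
by rewrite normcM_ normc_conjc ler_wpM2l // ug.
Qed.

Lemma cint_dom D (w : nat -> R -> R[i]) u g : measurable D -> (forall n, cmeas D (w n)) ->
  (forall x, D x -> w ^~ x @ \oo --> u x) -> rint D g -> (forall n x, D x -> normc (w n x) <= g x) ->
  cintb D u /\ (fun n => cint D (w n)) @ \oo --> cint D u.
Proof.
move=> mD mw wu ig wg.
have [||||i1 c1] := @Rintegral_dom R D (fun n x => Re (w n x)) (fun x => Re (u x)) g mD.
- by move=> n; case: (mw n).
- by move=> x Dx; have /cvg_ReIm[] := wu x Dx.
- by [].
- by move=> n x Dx; apply: le_trans (ler_normc_Re _) (wg n x Dx).
have [||||i2 c2] := @Rintegral_dom R D (fun n x => Im (w n x)) (fun x => Im (u x)) g mD.
- by move=> n; case: (mw n).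
- by move=> x Dx; have /cvg_ReIm[] := wu x Dx.
- by [].
- by move=> n x Dx; apply: le_trans (ler_normc_Im _) (wg n x Dx).
by split; [split|apply/cvg_ReIm; split].
Qed.

End ComplexIntegral.

Section IntegralSeries.
Variable R : realType.
Implicit Types (D : set R) (u v : R -> R[i]).

Lemma rint_mono D (w : nat -> R -> R) g (B : R) : measurable D -> (forall n, rint D (w n)) ->
  (forall n x, D x -> 0 <= w n x) -> (forall x, D x -> {homo w ^~ x : n k / (n <= k)%N >-> n <= k}) ->
  (forall n, \int[mu]_(x in D) w n x <= B) -> (forall x, D x -> w ^~ x @ \oo --> g x) ->
  rint D g /\ \int[mu]_(x in D) g x <= B.
Proof.
move=> mD iw w0 wm wB wg.
have mw n := rint_measurable (iw n).
have mg : measurable_fun D g by apply: measurable_fun_cvg wg.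
have g0 x : D x -> 0 <= g x.
  move=> Dx; have H := wg x Dx; rewrite -(cvg_lim (@Rhausdorff R) H).
  by apply: limr_ge; [apply/cvg_ex; exists (g x)|apply: nearW => n; exact: w0].
have lE x : D x -> limn (fun n => (w n x)%:E) = (g x)%:E.
  by move=> Dx; apply/cvg_lim => //; apply: cvg_EFin; [exact: nearW|exact: wg].
have Hc := @cvg_monotone_convergence _ _ R mu D mD (fun n => EFin \o w n).
have {}Hc : (fun n => \int[mu]_(x in D) (w n x)%:E)%E @ \oo --> (\int[mu]_(x in D) (g x)%:E)%E.
  rewrite (_ : (\int[mu]_(x in D) (g x)%:E)%E = (\int[mu]_(x in D) limn (fun n => (w n x)%:E))%E).
    apply: Hc.
    - by move=> n; apply/measurable_EFinP; exact: mw.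
    - by move=> n x Dx; rewrite /= lee_fin w0.
    - by move=> x Dx n k nk; rewrite /= lee_fin; exact: wm.
  by apply: (@eq_integral _ _ R mu) => x; rewrite inE => /lE ->.
have HB : (\int[mu]_(x in D) (g x)%:E <= B%:E)%E.
  rewrite -(cvg_lim _ Hc) //; apply: lime_le; first by apply/cvg_ex; exists (\int[mu]_(x in D) (g x)%:E)%E.
  apply: nearW => n; have := wB n; rewrite /Rintegral -lee_fin fineK //.
  exact: (integrable_fin_num _ (iw n)).
have ig : rint D g.
  apply/integrableP; split; first exact/measurable_EFinP.
  rewrite (@eq_integral _ _ R mu D (EFin \o g)); first by apply: le_lt_trans HB _; exact: ltry.
  by move=> x; rewrite inE => Dx /=; rewrite ger0_norm // g0.
split => //; rewrite /Rintegral -lee_fin fineK //; exact: (integrable_fin_num _ ig).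
Qed.

Lemma rint_sum D (w : nat -> R -> R) N : measurable D -> (forall i, rint D (w i)) ->
  rint D (fun x => \sum_(0 <= i < N) w i x) /\
  \int[mu]_(x in D) (\sum_(0 <= i < N) w i x) = \sum_(0 <= i < N) \int[mu]_(x in D) w i x.
Proof.
move=> mD iw; elim: N => [|N [IH1 IH2]].
  rewrite (_ : (fun x => _) = (fun=> 0)); last by apply/funext => x; rewrite big_geq.
  by split; [exact: rint0|rewrite big_geq // /Rintegral integral0].
rewrite (_ : (fun x => _) = fun x => \sum_(0 <= i < N) w i x + w N x); last first.
  by apply/funext => x; rewrite big_nat_recr.
split; first exact: rintD.
by rewrite (RintD mD IH1 (iw N)) IH2 big_nat_recr.
Qed.

Lemma rint_series D (w : nat -> R -> R) (B : R) : measurable D -> (forall i, rint D (w i)) ->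
  (forall i x, D x -> 0 <= w i x) ->
  (forall N, \sum_(0 <= i < N) \int[mu]_(x in D) w i x <= B) ->
  (forall x, D x -> exists C : R, forall N, \sum_(0 <= i < N) w i x <= C) ->
  exists g : R -> R, [/\ rint D g, \int[mu]_(x in D) g x <= B
    & forall x N, D x -> \sum_(0 <= i < N) w i x <= g x].
Proof.
move=> mD iw w0 wB wC.
pose W N x := \sum_(0 <= i < N) w i x.
have Wm x : D x -> {homo W ^~ x : n k / (n <= k)%N >-> n <= k}.
  move=> Dx n k nk; rewrite /W (big_cat_nat _ nk) //= lerDl; apply: sumr_ge0 => i _; exact: w0.
pose g x := limn (W ^~ x).
have Wg x : D x -> W ^~ x @ \oo --> g x.
  move=> Dx; apply: nondecreasing_is_cvgn; first exact: Wm.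
  by have [C HC] := wC x Dx; exists C => _ [N _ <-]; exact: HC.
have [|||ig gB] := @rint_mono D W g B mD _ _ Wm _ Wg.
- by move=> N; case: (rint_sum N mD iw).
- by move=> N x Dx; apply: sumr_ge0 => i _; exact: w0.
- by move=> N; rewrite /W; case: (rint_sum N mD iw) => _ ->.
exists g; split => // x N Dx; apply: nondecreasing_cvgn_le; first exact: Wm.
by apply/cvg_ex; exists (g x); exact: Wg.
Qed.

(** Monotone convergence applied to the norms produces one integrable majorant of all partial sums;
    dominated convergence then exchanges sum and integral. *)
Lemma cint_series D (w : nat -> R -> R[i]) v (B : R) : measurable D -> (forall i, cintb D (w i)) ->
  (forall N, \sum_(0 <= i < N) \int[mu]_(x in D) normc (w i x) <= B) ->
  (forall x, D x -> exists C : R, forall N, \sum_(0 <= i < N) normc (w i x) <= C) ->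
  (forall x, D x -> csum (w ^~ x) @ \oo --> v x) ->
  cintb D v /\ csum (fun i => cint D (w i)) @ \oo --> cint D v.
Proof.
move=> mD iw wB wC wv.
have [||g [ig _ wg]] := @rint_series D (fun i x => normc (w i x)) B mD _ _ wB wC.
- by move=> i; exact: cintb_normc.
- by move=> i x _; exact: normc_ge0.
have [||||iv cv] := @cint_dom R D (fun N x => csum (w ^~ x) N) v g mD.
- by move=> N; apply: cmeas_sum => i; exact: cintb_cmeas.
- by [].
- by [].
- by move=> N x Dx; apply: le_trans (normc_csum _ _) (wg x N Dx).
by split => //; apply: cvg_ext cv => N; rewrite cint_sum.
Qed.

Lemma cint_shift (t : R) u : cintb setT u ->
  cintb setT (fun x => u (x + t)) /\ cint setT (fun x => u (x + t)) = cint setT u.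
Proof.
move=> [h1 h2]; have [i1 e1] := Rintegral_shift t h1; have [i2 e2] := Rintegral_shift t h2.
by split; [split|rewrite /cintegral e1 e2].
Qed.

Lemma cint_opp u : cintb setT u ->
  cintb setT (fun x => u (- x)) /\ cint setT (fun x => u (- x)) = cint setT u.
Proof.
move=> [h1 h2]; have [i1 e1] := Rintegral_opp h1; have [i2 e2] := Rintegral_opp h2.
by split; [split|rewrite /cintegral e1 e2].
Qed.

Lemma cint_supp D u : (forall x, ~ D x -> u x = 0) -> cint D u = cint setT u.
Proof.
by move=> u0; rewrite /cintegral; congr (_ +i* _); apply: Rintegral_supp => x /u0 ->.
Qed.

Lemma cintb_supp D u : measurable D -> cintb D u -> (forall x, ~ D x -> u x = 0) -> cintb setT u.
Proof. by move=> mD [h1 h2] u0; split; [apply: (rint_supp mD h1)|apply: (rint_supp mD h2)] => x /u0 ->. Qed.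

Lemma cderiv_continuous u (du : R -> R[i]) : (forall t, cderiv u t (du t)) ->
  continuous (fun x => Re (u x)) /\ continuous (fun x => Im (u x)).
Proof.
by move=> h; split=> x; apply/differentiable_continuous/derivable1_diffP; have [[? _] [? _]] := h x.
Qed.

Lemma cint_FTC u du (a b : R) : a <= b -> (forall t, cderiv u t (du t)) ->
  continuous (fun x => Re (du x)) -> continuous (fun x => Im (du x)) ->
  cint `[a, b] du = u b - u a.
Proof.
move=> ab h c1 c2; apply: complex_ext; rewrite ?ReB ?ImB /cintegral /=.
  by rewrite (Rintegral_FTC2 ab c1 (fun x => proj1 (h x))).
by rewrite (Rintegral_FTC2 ab c2 (fun x => proj2 (h x))).
Qed.

Lemma cint_FTCy u du : (forall t, cderiv u t (du t)) ->
  continuous (fun x => Re (du x)) -> continuous (fun x => Im (du x)) -> cintb `[0, +oo[ du ->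
  (fun n => u n%:R) @ \oo --> (0 : R[i]) -> cint `[0, +oo[ du = - u 0.
Proof.
move=> h c1 c2 [i1 i2] /cvg_ReIm[u1 u2]; apply: complex_ext; rewrite ?ReN ?ImN /cintegral /=.
  by rewrite (Rintegral_FTC2y c1 (fun x => proj1 (h x)) i1 u1).
by rewrite (Rintegral_FTC2y c2 (fun x => proj2 (h x)) i2 u2).
Qed.

Lemma cintb_segment u (a b : R) : continuous (fun x => Re (u x)) -> continuous (fun x => Im (u x)) ->
  cintb `[a, b] u.
Proof. by move=> c1 c2; split; exact: rint_segment. Qed.

End IntegralSeries.

(** * Laplace transforms and the extraction of exponentials *)

Section Laplace.
Variable R : realType.
Notation half := (`[0, +oo[%classic : set R).

Definition powexp p k (t : R) : R[i] := (t ^+ k)%:C * cexp (t%:C * - p).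

Lemma mhalf : measurable half. Proof. exact: measurable_itv. Qed.
Lemma inhalf t : half t -> 0 <= t. Proof. by rewrite /= in_itv /= andbT. Qed.

Lemma normc_powexp p k t : 0 <= t -> normc (powexp p k t) = t ^+ k * expR (- Re p * t).
Proof.
move=> t0; rewrite normcM_ normc_rC normc_cexp ger0_norm ?exprn_ge0 //.
by rewrite Re_rC ReN mulrC [t * _]mulrC mulrC.
Qed.

Lemma cmeas_powexp D p k : cmeas D (powexp p k).
Proof.
apply: cmeasM; first by apply: cmeas_real; apply: measurable_funX; exact: measurable_id.
by exact: cmeas_cexpZ.
Qed.

Lemma powexp_cintb p k : 0 < Re p -> cintb half (powexp p k).
Proof.
move=> p0; apply: (cintb_le (g := fun t => t ^+ k * expR (- Re p * t))).
- exact: mhalf.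
- exact: cmeas_powexp.
- by move=> t; rewrite /= in_itv /= andbT => t0; rewrite normc_powexp.
- exact: rint_pow_expRN.
Qed.

Lemma cderiv_powexp p k (t : R) :
  cderiv (powexp p k) t (k%:R * powexp p k.-1 t - p * powexp p k t).
Proof.
apply: cderiv_eq (cderivM (cderiv_real (is_derive_pow k t)) (cderiv_comp_cexp (cderiv_lin (- p) t))) _.
rewrite /powexp rCM (_ : (k%:R)%:C = k%:R :> R[i]); last by rewrite rmorph_nat.
by ring.
Qed.

Lemma powexp_cvg0 p k : 0 < Re p -> (fun n : nat => powexp p k n%:R) @ \oo --> (0 : R[i]).
Proof.
move=> p0; apply/cvg_normc0P.
have c0 : 0 < Re p ^+ k.+1 by rewrite exprn_gt0.
apply: (squeeze_cvgr (f := fun _ : nat => 0 : R) (h := fun n : nat => (k.+1`!%:R / Re p ^+ k.+1) * n%:R^-1)).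
- exists 1%N => // n /= n0; rewrite subr0 normc_ge0 /= normc_powexp ?ler0n //.
  have n1 : (0 : R) < n%:R by rewrite ltr0n.
  have := pow_expN_bound k.+1 (mulr_ge0 (ltW p0) (ltW n1)).
  rewrite exprMn (exprS n%:R) mulNr => h.
  rewrite ler_pdivlMr // mulrC mulrA -(ler_pM2l c0) mulrCA.
  by rewrite [X in _ <= X]mulrC divfK ?gt_eqF // mulrA [n%:R * _ * _]mulrC.
- exact: cvg_cst.
- rewrite -[X in _ --> X](mulr0 (k.+1`!%:R / Re p ^+ k.+1)); apply: cvgM; first exact: cvg_cst.
  by have := @cvg_harmonic R; rewrite -[X in _ -> X]cvg_shiftS.
Qed.

(** Integration by parts: [step] is the fundamental theorem of calculus for [powexp p j], whose
    value at 0 is 1 for [j = 0] and 0 otherwise. *)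
Lemma cint_powexp p k : 0 < Re p -> cint half (powexp p k) = k`!%:R / p ^+ k.+1.
Proof.
move=> p0; have pn0 : p != 0 by apply: contraTneq p0 => ->; rewrite ltxx.
have step j : j%:R * cint half (powexp p j.-1) - p * cint half (powexp p j) = - powexp p j 0.
  have dc := cderiv_continuous (fun t => cderivD (cderivZ j%:R (cderiv_powexp p j.-1 t))
    (cderivN (cderivZ p (cderiv_powexp p j t)))).
  rewrite -!cintZ //; try exact: powexp_cintb.
  rewrite -cintN //; last by apply: cintbZ; [exact: mhalf|exact: powexp_cintb].
  rewrite -cintD //.
  - rewrite -(@cint_FTCy _ (powexp p j) (fun t => j%:R * powexp p j.-1 t - p * powexp p j t)) //.
    + exact: cderiv_powexp.
    + exact: dc.1.
    + exact: dc.2.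
    + apply: cintbD; [exact: mhalf| |].
        by apply: cintbZ; [exact: mhalf|exact: powexp_cintb].
      by apply: cintbN; [exact: mhalf|]; apply: cintbZ; [exact: mhalf|exact: powexp_cintb].
    + exact: powexp_cvg0.
  - by apply: cintbZ; [exact: mhalf|exact: powexp_cintb].
  - by apply: cintbN; [exact: mhalf|]; apply: cintbZ; [exact: mhalf|exact: powexp_cintb].
elim: k => [|k IH].
  have := step 0%N; rewrite mul0r sub0r /powexp expr0 !mul1r mul0r cexp0 => /oppr_inj h.
  by rewrite expr1 -[RHS]mulr1 -h mulKf.
have := step k.+1; rewrite (_ : powexp p k.+1 0 = 0) ?oppr0 => [/subr0_eq /= h|]; last by rewrite /powexp expr0n /= mul0r.
apply: (mulfI pn0); rewrite -h IH factS natrM [p ^+ k.+2]exprS.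
have := expf_neq0 k.+1 pn0; move: (p ^+ k.+1) (k.+1%:R) (k`!%:R) => q a b q0.
by field; rewrite pn0 q0.
Qed.

Lemma Rintegral_pow_expRN (c : R) k : 0 < c ->
  \int[mu]_(t in half) (t ^+ k * expR (- c * t)) = k`!%:R / c ^+ k.+1.
Proof.
move=> c0; have := @cint_powexp c%:C k c0 => /(congr1 (@complex.Re R)).
rewrite -rCX -rCV (_ : (k`!%:R) = (k`!%:R : R)%:C :> R[i]); last by rewrite rmorph_nat.
rewrite -rCM /= => <-; apply: eq_Rintegral => t _.
by rewrite /powexp Re_rC -rCN -rCM cexp_rC /= mulrC [t * _]mulrC mulrC.
Qed.

(** Transforms of high order at [s] see only the pole nearest to [s], so this pole must be unique,
    and its distance must not exceed [Re s] if terms tending to 0 are to be negligible. Local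
    finiteness by itself gives a nearest pole, not a unique one. *)
Lemma nearest_pole (c w : nat -> R[i]) (y : R) (i : nat) : 0 <= y -> (forall j, c j != 0 -> Re (w j) <= y) ->
  (forall j k, c j != 0 -> c k != 0 -> w j = w k -> j = k) ->
  (forall T : R, exists N, forall j, c j != 0 -> `|Im (w j)| <= T -> (j < N)%N) ->
  c i != 0 -> 0 <= Re (w i) ->
  exists (s : R[i]) (i0 : nat), [/\ c i0 != 0, y < Re s, normc (s - w i0) <= Re s
    & forall j, c j != 0 -> j != i0 -> normc (s - w i0) < normc (s - w j)].
Proof.
move=> y0 wy wi lf ci wi0.
(* [sg] is at least twice [y + 1], so that the point halfway to the nearest pole, whose real part
   turns out to be nonnegative, still satisfies [y < Re s]. *)
set sg := 2 * (y + 1); have sg0 : 0 < sg by rewrite /sg; lra.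
pose s0 : R[i] := sg +i* Im (w i).
have di : normc (s0 - w i) <= sg.
  apply: le_trans (normc_le_ReIm _) _; rewrite ReB ImB /s0 /= subrr normr0 addr0.
  by have := wy i ci; rewrite ler_norml => h; apply/andP; split; move: h sg0; rewrite /sg; lra.
have [N HN] := lf (`|Im (w i)| + sg).
have iN : (i < N)%N by apply: HN => //; rewrite lerDl ltW.
case: (@Order.TotalTheory.arg_minP _ R 'I_N (Ordinal iN) (fun j : 'I_N => c j != 0)
  (fun j : 'I_N => normc (s0 - w j))) => // j0 cj0 Hmin.
have near j : c j != 0 -> normc (s0 - w j0) <= normc (s0 - w j).
  move=> cj; have [jN|jN] := ltnP j N; first exact: (Hmin (Ordinal jN)).
  apply: le_trans (Hmin (Ordinal iN) ci) _; apply: le_trans di _.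
  apply: le_trans _ (ler_normc_Im _); rewrite ImB /s0 /=.
  have h : `|Im (w i)| + sg < `|Im (w j)| by rewrite ltNge; apply/negP => /(HN j cj); rewrite ltnNge jN.
  have := lerB_dist (Im (w j)) (Im (w i)); rewrite distrC; move: h; lra.
set d0 := normc (s0 - w j0).
have d0s : d0 <= sg by apply: le_trans di; exact: near.
have rw0 : sg - d0 <= Re (w j0).
  by have := le_trans (ler_norm _) (ler_normc_Re (s0 - w j0)); rewrite ReB /s0 /= -/d0; lra.
(* Moving halfway towards a nearest pole makes it the only one: for a point p, |s - p|^2 equals (|s0
   - p|^2 + |w j0 - p|^2)/2 - d0^2/4, which exceeds d0^2/4 when |s0 - p| >= d0 and p is not
   [w j0]. *)
pose s : R[i] := (2^-1 : R)%:C * (s0 + w j0).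
have sE : s - w j0 = (2^-1 : R)%:C * (s0 - w j0).
  by apply: complex_ext; rewrite !(Re_rC, Im_rC, ReB, ImB, ReD, ImD) ; field.
have dE : normc (s - w j0) = d0 / 2 by rewrite sE normcM_ normc_rC ger0_norm // mulrC.
exists s, j0; split => //.
- by rewrite Re_rC ReD /s0 /=; move: rw0 d0s; rewrite /sg; lra.
- by rewrite dE Re_rC ReD /s0 /=; move: rw0 d0s; rewrite /sg; lra.
move=> j cj jj0; have wj : w j != w j0 by apply: contraNneq jj0 => /(wi _ _ cj cj0) ->.
have h1 : d0 ^+ 2 <= normc (s0 - w j) ^+ 2 by rewrite ler_pXn2r ?nnegrE ?normc_ge0 ?near.
have h2 : 0 < normc (w j - w j0) ^+ 2 by rewrite exprn_gt0 // normc_gt0 subr_eq0.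
rewrite -(@ltr_pXn2r _ 2) ?nnegrE //.
move: h1 h2; rewrite /d0 !normc_sqr /s !(Re_rC, Im_rC, ReB, ImB, ReD, ImD).
move: (Re s0) (Im s0) (Re (w j)) (Im (w j)) (Re (w j0)) (Im (w j0)) => a b p q u v h1 h2.
by nra.
Qed.

(** Multiplied by [t], the sum is at most e^(-st) (e^(dt) - 1), hence at most 1; replacing 1/(k+1)!
    by 1/k! bounds the sum itself by [d]. The factorial of [k + 1] is what gains the factor 1/t. *)
Lemma power_sum_bound (d s t : R) M : 0 < d -> d <= s -> 0 <= t ->
  \sum_(0 <= k < M) d ^+ k.+1 / k.+1`!%:R * (t ^+ k * expR (- s * t)) <= (1 + d) / (1 + t).
Proof.
move=> d0 ds t0; set S := \sum_(_ <= _ < _) _.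
have dt : 0 <= d * t by rewrite mulr_ge0 // ltW.
have e1 : expR (- s * t) * expR (d * t) <= 1.
  by rewrite -expRD -[leRHS]expR0 ler_expR mulNr addrC subr_le0 ler_wpM2r.
have S1 : t * S <= 1.
  apply: le_trans e1; rewrite mulrC; apply: le_trans (ler_wpM2l (expR_ge0 _) (expR_sum_le M.+1 dt)).
  rewrite big_nat_recl // mulrDr expr0 fact0 divr1 mulr1 mulr_suml mulr_sumr.
  apply: le_trans (_ : \sum_(0 <= k < M) expR (- s * t) * ((d * t) ^+ k.+1 / (k.+1)`!%:R) <= _).
    apply: le_of_eq; apply: eq_bigr => k _; rewrite exprMn !exprS.
    by move: (expR _) (_`!%:R^-1) => e f; ring.
  by rewrite lerDr expR_ge0.
have S2 : S <= d.
  have : S <= d * (expR (- s * t) * expR (d * t)).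
    rewrite [leRHS]mulrA [d * _]mulrC -mulrA.
    apply: le_trans (ler_wpM2l (expR_ge0 (- s * t)) (ler_wpM2l (ltW d0) (expR_sum_le M dt))).
    rewrite mulr_sumr mulr_sumr; apply: ler_sum => k _.
    rewrite exprMn exprS.
    have f1 : (k.+1`!%:R : R)^-1 <= k`!%:R^-1.
      by rewrite lef_pV2 ?posrE ?ltr0n ?fact_gt0 // ler_nat factS leq_pmull.
    have : 0 <= expR (- s * t) * (d * (d ^+ k * t ^+ k)).
      by rewrite mulr_ge0 // mulr_ge0 ?(ltW d0) // mulr_ge0 // exprn_ge0 // ltW.
    move/ler_wpM2l => /(_ _ _ f1); move: (expR _) (_^-1) (_^-1) => e f g h.
    rewrite [leLHS](_ : _ = e * (d * (d ^+ k * t ^+ k)) * g); last by ring.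
    by rewrite [leRHS](_ : _ = e * (d * (d ^+ k * t ^+ k)) * f) //; ring.
  by move/le_trans; apply; rewrite ler_piMr // ltW.
rewrite ler_pdivlMr; last by lra.
by rewrite mulrDr mulr1; move: S1 S2; rewrite mulrC; lra.
Qed.

Lemma harmonic_sum_unbounded (C : R) K : exists M, C < \sum_(K <= k < M) (k.+1%:R)^-1.
Proof.
apply: contrapT => h; apply: (@dvg_harmonic R).
apply: nondecreasing_is_cvgn.
  by move=> n k nk; rewrite /series /= (big_cat_nat _ nk) //= lerDl; apply: sumr_ge0.
exists (\sum_(0 <= k < K) (k.+1%:R)^-1 + C) => _ [M _ <-]; rewrite /series /=.
have C0 : 0 <= C by rewrite leNgt; apply/negP => C0; apply: h; exists K; rewrite big_geq.
have [MK|KM] := leqP M K.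
  by apply: le_trans (ler_sum_nat_mono 0 _ MK) _ => //; rewrite lerDl.
rewrite (@big_cat_nat _ _ _ K 0 M) //; last exact: ltnW.
rewrite lerD2l leNgt; apply/negP => h2.
by apply: h; exists M.
Qed.

Lemma geom_cvg0 (q : R) : 0 <= q < 1 -> (fun k => q ^+ k) @ \oo --> (0 : R).
Proof. by move=> /andP[q0 q1]; apply: cvg_expr; rewrite ger0_norm. Qed.

Section Growth.
Variables (c w : nat -> R[i]) (y B B2 : R) (E1 E2 : R -> R[i]).
Hypotheses (y0 : 0 <= y) (wy : forall j, c j != 0 -> Re (w j) <= y)
  (cB : forall N, \sum_(0 <= i < N) normc (c i) <= B)
  (wi : forall j k, c j != 0 -> c k != 0 -> w j = w k -> j = k)
  (lf : forall T : R, exists N, forall j, c j != 0 -> `|Im (w j)| <= T -> (j < N)%N)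
  (cE : forall t : R, 0 <= t -> csum (fun i => c i * cexp (t%:C * w i)) @ \oo --> E1 t + E2 t)
  (mE1 : cmeas half E1) (mE2 : cmeas half E2)
  (iE1 : rint half (fun t => normc (E1 t) / (1 + t)))
  (bE2 : forall t, 0 <= t -> normc (E2 t) <= B2)
  (E20 : forall e : R, 0 < e -> exists T : R, forall t, T <= t -> normc (E2 t) <= e).

Let lap s k E := cint half (fun t => E t * powexp s k t).

Lemma lap_term s k (b v : R[i]) : 0 < Re (s - v) ->
  cintb half (fun t => b * cexp (t%:C * v) * powexp s k t) /\
  cint half (fun t => b * cexp (t%:C * v) * powexp s k t) = b * (k`!%:R / (s - v) ^+ k.+1).
Proof.
move=> sv.
have E : (fun t => b * cexp (t%:C * v) * powexp s k t) = (fun t => b * powexp (s - v) k t).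
  apply/funext => t; rewrite /powexp opprB mulrBr cexpD mulrN.
  by ring.
rewrite E; split; first by apply: cintbZ; [exact: mhalf|exact: powexp_cintb].
by rewrite cintZ ?cint_powexp //; exact: powexp_cintb.
Qed.

(** As [Re s] exceeds [y], one integrable function dominates all the exponentials, and integration
    term by term gives partial fractions of order [k + 1]. *)
Lemma lap_sum s k : y < Re s -> cintb half (fun t => (E1 t + E2 t) * powexp s k t) /\
  csum (fun i => c i * (k`!%:R / (s - w i) ^+ k.+1)) @ \oo --> lap s k (fun t => E1 t + E2 t).
Proof.
move=> ys.
have sw i : c i != 0 -> 0 < Re (s - w i) by move=> /wy; rewrite ReB; move: ys; lra.
pose f i t := c i * cexp (t%:C * w i) * powexp s k t.
have f0 i : c i = 0 -> f i = fun=> 0 by move=> h; apply/funext => t; rewrite /f h !mul0r.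
have fi i : cintb half (f i).
  have [/f0 ->|/sw h] := eqVneq (c i) 0; first exact: (cintb0 mhalf).
  by case: (lap_term k (c i) h).
pose g t := t ^+ k * expR (- (Re s - y) * t).
have fg i t : 0 <= t -> normc (f i t) <= normc (c i) * g t.
  move=> t0; have [/f0 ->|ci] := eqVneq (c i) 0.
    by rewrite normc0_ mulr_ge0 // mulr_ge0 ?expR_ge0 ?exprn_ge0.
  rewrite (_ : normc (f i t) = normc (c i) * normc (cexp (t%:C * w i)) * normc (powexp s k t)); last first.
    by rewrite -2!normcM_.
  rewrite -mulrA ler_wpM2l // normc_powexp // normc_cexp mulrCA.
  rewrite ler_wpM2l ?exprn_ge0 // -expRD ler_expR Re_rC.
  by have := ler_wpM2l t0 (wy ci); lra.
have ig : rint half g by apply: rint_pow_expRN; rewrite subr_gt0.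
have [|||h1 h2] := @cint_series R half f (fun t => (E1 t + E2 t) * powexp s k t)
    (B * \int[mu]_(t in half) g t) mhalf fi.
- move=> N; apply: le_trans (ler_wpM2r _ (cB N)); last first.
    by apply: Rintegral_ge0 => t /inhalf t0; rewrite mulr_ge0 ?expR_ge0 ?exprn_ge0.
  rewrite mulr_suml; apply: ler_sum => i _; rewrite -(RintZl _ mhalf ig).
  apply: (le_Rint mhalf); first by apply: cintb_normc => //; exact: mhalf.
    by apply: rintZ => //; exact: mhalf.
  by move=> t /inhalf t0; exact: fg.
- move=> t /inhalf t0; exists (B * g t) => N.
  apply: le_trans (ler_wpM2r _ (cB N)); last by rewrite mulr_ge0 ?expR_ge0 ?exprn_ge0.
  by rewrite mulr_suml; apply: ler_sum => i _; exact: fg.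
- move=> t /inhalf t0.
  have H : (fun N => csum (fun i => c i * cexp (t%:C * w i)) N * powexp s k t) @ \oo -->
      (E1 t + E2 t) * powexp s k t by apply: cvgM; [exact: cE|exact: cvg_cst].
  by apply: cvg_ext H => N; rewrite /csum mulr_suml.
split => //; apply: cvg_ext h2 => N; apply: eq_bigr => i _.
have [ci|ci] := eqVneq (c i) 0; first by rewrite f0 // cint0 ci mul0r.
by case: (lap_term k (c i) (sw i ci)).
Qed.

Lemma powexp_E1_bound s d k t : 0 < d -> d <= Re s -> 0 <= t ->
  normc (powexp s k t) <= (k.+1`!%:R / d ^+ k.+1 * (1 + d)) / (1 + t).
Proof.
move=> d0 ds t0; rewrite normc_powexp //.
have h := power_sum_bound k.+1 d0 ds t0.
have p0 : 0 < d ^+ k.+1 / k.+1`!%:R by rewrite divr_gt0 ?exprn_gt0 // ltr0n fact_gt0.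
have : d ^+ k.+1 / k.+1`!%:R * (t ^+ k * expR (- Re s * t)) <= (1 + d) / (1 + t).
  apply: le_trans h; rewrite big_nat_recr // lerDr; apply: sumr_ge0 => j _.
  by rewrite !mulr_ge0 ?invr_ge0 ?exprn_ge0 // ltW.
by rewrite mulrC -ler_pdivlMr // invf_div -mulrA [_ / (1 + t) * _]mulrC.
Qed.

(** The weights [d^(k+1) / (k+1)!] are summed inside the integral by [power_sum_bound], which turns
    integrability against 1/(1+t) into a bound that is the same for all [M]. *)
Lemma lap_E1 s d : 0 < d -> d <= Re s -> (forall k, cintb half (fun t => E1 t * powexp s k t)) /\
  exists C, forall M, \sum_(0 <= k < M) d ^+ k.+1 / k.+1`!%:R * normc (lap s k E1) <= C.
Proof.
move=> d0 ds.
have nE k t : normc (E1 t * powexp s k t) = normc (E1 t) * normc (powexp s k t) by rewrite normcM_.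
have ik k : cintb half (fun t => E1 t * powexp s k t).
  apply: (cintb_le (g := fun t => (k.+1`!%:R / d ^+ k.+1 * (1 + d)) * (normc (E1 t) / (1 + t)))).
  - exact: mhalf.
  - by apply: cmeasM => //; exact: cmeas_powexp.
  - move=> t /inhalf t0; rewrite nE [leRHS]mulrCA ler_wpM2l //.
    exact: powexp_E1_bound.
  - by apply: rintZ => //; exact: mhalf.
split => //; exists ((1 + d) * \int[mu]_(t in half) (normc (E1 t) / (1 + t))) => M.
pose W k (t : R) := d ^+ k.+1 / k.+1`!%:R * normc (E1 t * powexp s k t).
have c0 k : 0 <= d ^+ k.+1 / k.+1`!%:R :> R by rewrite divr_ge0 ?exprn_ge0 // ltW.
have iW k : rint half (W k) by apply: rintZ; [exact: mhalf|apply: cintb_normc; [exact: mhalf|exact: ik]].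
have [iS eS] := rint_sum M mhalf iW.
apply: le_trans (_ : \int[mu]_(t in half) (\sum_(0 <= k < M) W k t) <= _).
  rewrite eS; apply: ler_sum => k _; rewrite /W.
  rewrite (RintZl _ mhalf); last by apply: cintb_normc; [exact: mhalf|exact: ik].
  apply: ler_wpM2l => //; apply: cint_le => //; by apply: cintb_normc; [exact: mhalf|exact: ik].
rewrite -(RintZl (1 + d) mhalf iE1).
apply: (le_Rint mhalf iS); first by apply: rintZ => //; exact: mhalf.
move=> t /inhalf t0; rewrite mulrCA.
apply: le_trans (ler_wpM2l (normc_ge0 (E1 t)) (power_sum_bound M d0 ds t0)).
rewrite mulr_sumr; apply: ler_sum => k _; rewrite /W nE normc_powexp //.
by rewrite mulrCA.
Qed.

(** [E2] is at most [e + C exp(-t)]. After normalisation the first part contributes at most [e]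
    because [d <= Re s], and the second a geometric sequence of ratio Re s / (Re s + 1). *)
Lemma lap_E2 s d : 0 < d -> d <= Re s ->
  (forall k, cintb half (fun t => E2 t * powexp s k t)) /\
  forall e, 0 < e -> exists K, forall k, (K <= k)%N -> d ^+ k.+1 / k`!%:R * normc (lap s k E2) <= e.
Proof.
move=> d0 ds; have s0 : 0 < Re s by lra.
have bE (e : R) : 0 < e -> exists2 C, 0 <= C & forall t, 0 <= t -> normc (E2 t) <= e + C * expR (- 1 * t).
  move=> e0; have [T HT] := E20 e0.
  (* On [t < T] the bound [B2] is at most [B2 exp(T - t)]. *)
  exists (B2 * expR T); first by rewrite mulr_ge0 // (le_trans (normc_ge0 (E2 0))) // bE2.
  have B20 : 0 <= B2 by rewrite (le_trans (normc_ge0 (E2 0))) // bE2.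
  move=> t t0; have [/HT h|tT] := leP T t.
    by apply: le_trans h _; rewrite lerDl mulr_ge0 // mulr_ge0.
  apply: le_trans (bE2 t0) _; rewrite -[leLHS]add0r lerD ?(ltW e0) // -mulrA -expRD ler_peMr //.
  by rewrite -[leLHS]expR0 ler_expR; lra.
pose g e C k (t : R) := e * (t ^+ k * expR (- Re s * t)) + C * (t ^+ k * expR (- (Re s + 1) * t)).
have ig e C k : rint half (g e C k).
  by apply: rintD; [exact: mhalf| |]; apply: rintZ; try exact: mhalf; apply: rint_pow_expRN; lra.
have gE e C k : \int[mu]_(t in half) g e C k t = e * (k`!%:R / Re s ^+ k.+1) + C * (k`!%:R / (Re s + 1) ^+ k.+1).
  rewrite (RintD mhalf); first last.
  - by apply: rintZ; [exact: mhalf|apply: rint_pow_expRN; lra].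
  - by apply: rintZ; [exact: mhalf|apply: rint_pow_expRN; lra].
  rewrite (RintZl _ mhalf); last by apply: rint_pow_expRN; lra.
  rewrite (RintZl _ mhalf); last by apply: rint_pow_expRN; lra.
  by rewrite !Rintegral_pow_expRN //; lra.
have le_g e C k t : 0 <= t -> normc (E2 t) <= e + C * expR (- 1 * t) ->
    normc (E2 t * powexp s k t) <= g e C k t.
  move=> t0 h; rewrite (_ : normc _ = normc (E2 t) * normc (powexp s k t)); last by rewrite normcM_.
  rewrite normc_powexp //.
  have p0 : 0 <= t ^+ k * expR (- Re s * t) by rewrite mulr_ge0 ?exprn_ge0.
  apply: le_trans (ler_wpM2r p0 h) _; rewrite /g mulrDl -mulrA lerD2l.
  apply: le_of_eq; congr (_ * _).
  by rewrite mulrCA -expRD; congr (_ * expR _); ring.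
have iE k : cintb half (fun t => E2 t * powexp s k t).
  have [C C0 HC] := bE 1 ltr01.
  apply: (cintb_le (g := g 1 C k)) => //.
    by apply: cmeasM => //; exact: cmeas_powexp.
  by move=> t /inhalf t0; apply: le_g => //; exact: HC.
split => // e e0; have e2 : 0 < e / 2 by lra.
have [C C0 HC] := bE _ e2.
have q1 : 0 <= Re s / (Re s + 1) < 1 by rewrite divr_ge0; [rewrite ltr_pdivrMr; lra|lra|lra].
have /cvgrPdist_lt /(_ (e / 2 / (C + 1))) [|K _ HK] := geom_cvg0 q1; first by rewrite divr_gt0 //; lra.
exists K => k Kk; have {}HK := HK k.+1 (leqW Kk).
have k0 : (0 : R) < k`!%:R by rewrite ltr0n fact_gt0.
have h : normc (lap s k E2) <= \int[mu]_(t in half) g (e / 2) C k t.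
  apply: cint_le => //.
  by move=> t /inhalf t0; apply: le_g => //; exact: HC.
have f0 : 0 <= d ^+ k.+1 / k`!%:R by rewrite divr_ge0 ?exprn_ge0 ?(ltW d0).
apply: le_trans (ler_wpM2l f0 h) _; rewrite gE.
have sk : 0 < Re s ^+ k.+1 by rewrite exprn_gt0.
have sk1 : 0 < (Re s + 1) ^+ k.+1 by rewrite exprn_gt0; lra.
have dk : d ^+ k.+1 <= Re s ^+ k.+1 by rewrite lerXn2r // nnegrE ltW.
apply: le_trans (_ : Re s ^+ k.+1 / k`!%:R * (e / 2 * (k`!%:R / Re s ^+ k.+1) + C * (k`!%:R / (Re s + 1) ^+ k.+1)) <= _).
  apply: ler_wpM2r; last by rewrite ler_wpM2r ?invr_ge0 // ltW.
  by apply: addr_ge0; apply: mulr_ge0; rewrite ?divr_ge0 // ltW.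
have -> : Re s ^+ k.+1 / k`!%:R * (e / 2 * (k`!%:R / Re s ^+ k.+1) + C * (k`!%:R / (Re s + 1) ^+ k.+1))
   = e / 2 + C * (Re s / (Re s + 1)) ^+ k.+1.
  rewrite expr_div_n; move: sk sk1 k0; move: (Re s ^+ k.+1) ((Re s + 1) ^+ k.+1) (k`!%:R : R) => a b f a0 b0 f0'.
  by field; rewrite !gt_eqF.
case/andP: q1 => q0 _; move: HK; rewrite sub0r normrN ger0_norm ?exprn_ge0 //.
move=> /ltW /(ler_wpM2l C0) => HK; have : C * (e / 2 / (C + 1)) <= e / 2.
  by rewrite mulrCA ler_piMr ?(ltW e2) // ler_pdivrMr; lra.
by move: HK; lra.
Qed.

(** At the point given by [nearest_pole] the normalised transform of order [k] has modulus tending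
    to [normc (c i0) > 0]. The share of [E2] becomes negligible, so that of [E1] stays bounded
    below; but [lap_E1] bounds the same quantities summed with weights 1/(k+1), against the
    divergence of the harmonic series. *)
Lemma growth_extraction i : 0 <= Re (w i) -> c i = 0.
Proof.
move=> wi0; apply: contrapT => /eqP ci.
have [s [i0 [ci0 ys ds sep]]] := nearest_pole y0 wy wi lf ci wi0.
set d := normc (s - w i0) in ds sep.
have sw j : c j != 0 -> s - w j != 0.
  by move=> cj; apply: contraTneq (wy cj) => h; rewrite -ltNge; move: ys; rewrite -[s](subrK (w j)) h add0r.
have d0 : 0 < d by rewrite normc_gt0 sw.
have [iE1' [C HC]] := lap_E1 d0 ds.
have [iE2' HE2] := lap_E2 d0 ds.
(* The factor normalises the nearest pole: its term is [c i0] times a number of modulus 1, while the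
   other terms tend to 0. *)
pose T k E : R[i] := (d ^+ k.+1 / k`!%:R)%:C * lap s k E.
pose f k j : R[i] := c j * (d%:C / (s - w j)) ^+ k.+1.
have normf k j : normc (f k j) = normc (c j) * (d / normc (s - w j)) ^+ k.+1.
  by rewrite normcM_ normcX_ normcM_ normcV_ normc_rC (ger0_norm (ltW d0)).
have TQ k : csum (f k) @ \oo --> T k (fun t => E1 t + E2 t).
  have [_ h] := lap_sum k ys.
  have H : (fun N => (d ^+ k.+1 / k`!%:R)%:C * csum (fun i => c i * (k`!%:R / (s - w i) ^+ k.+1)) N)
     @ \oo --> T k (fun t => E1 t + E2 t) by apply: cvgM; [exact: cvg_cst|exact: h].
  apply: cvg_ext H => N; rewrite -csumZ; apply: eq_bigr => j _; rewrite /f expr_div_n.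
  have k0 : (k`!%:R : R[i]) != 0 by rewrite pnatr_eq0 -lt0n fact_gt0.
  rewrite rCM rCV rCX (_ : (k`!%:R)%:C = k`!%:R :> R[i]); last by rewrite rmorph_nat.
  by move: k0; move: (k`!%:R) ((s - w j) ^+ k.+1)^-1 => a b a0; field.
have TD k : T k (fun t => E1 t + E2 t) = T k E1 + T k E2.
  rewrite /T -mulrDr; congr (_ * _); rewrite /lap -cintD //; apply: eq_cint => t _; exact: mulrDl.
pose g k j : R[i] := if j == i0 then 0 else f k j.
have gS k : csum (g k) @ \oo --> T k (fun t => E1 t + E2 t) - f k i0.
  have h : csum (fun j => if j == i0 then f k i0 else 0) @ \oo --> f k i0.
    apply: cvg_near_cst; exists i0.+1 => // N /= iN; by rewrite /csum -big_mkcond big_nat1_eq iN.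
  have H : (fun N => csum (f k) N - csum (fun j => if j == i0 then f k i0 else 0) N) @ \oo -->
     T k (fun t => E1 t + E2 t) - f k i0 by apply: cvgB; [exact: TQ|exact: h].
  apply: cvg_ext H => N; rewrite /csum -sumrB; apply: eq_bigr => j _; rewrite /g.
  by case: eqP => [->|_]; rewrite ?subrr ?subr0.
have normg k j : normc (g k j) <= normc (c j).
  rewrite /g; case: eqP => [_|/eqP ji]; first by rewrite normc0_ normc_ge0.
  rewrite normf; have [->|cj] := eqVneq (c j) 0; first by rewrite normc0_ mul0r.
  rewrite ler_piMr // exprn_ile1 ?divr_ge0 ?normc_ge0 ?(ltW d0) //.
  by rewrite ler_pdivrMr ?normc_gt0 ?sw // mul1r ltW // sep.
have g0 j : (fun k => g k j) @ \oo --> (0 : R[i]).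
  rewrite /g; case: eqP => [_|/eqP ji]; first exact: cvg_cst.
  apply/cvg_normc0P; have [cj|cj] := eqVneq (c j) 0.
    apply: (cvg_ext (u := fun=> 0)); last exact: cvg_cst.
    by move=> k; rewrite subr0 normf cj normc0_ mul0r.
  have q1 : 0 <= d / normc (s - w j) < 1.
    by rewrite divr_ge0 ?normc_ge0 ?(ltW d0) //= ltr_pdivrMr ?normc_gt0 ?sw // mul1r sep.
  have H : (fun k => normc (c j) * (d / normc (s - w j)) ^+ k.+1) @ \oo --> normc (c j) * 0.
    apply: cvgM; first exact: cvg_cst.
    by have := geom_cvg0 q1; rewrite -[X in X -> _]cvg_shiftS.
  rewrite mulr0 in H; apply: cvg_ext H => k; by rewrite subr0 normf.
have S0 : (fun k => T k (fun t => E1 t + E2 t) - f k i0) @ \oo --> (0 : R[i]) by apply: tannery cB normg g0 gS.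
move/cvg_normcP in S0.
(* The nearest pole contributes [4 e] in modulus, the other poles together and [E2] eventually at
   most [e] each, which leaves at least [2 e] for [E1]. *)
set e := normc (c i0) / 4; have e0 : 0 < e by rewrite divr_gt0 ?normc_gt0.
have [K1 _ HK1] := S0 e e0; have [K2 HK2] := HE2 e e0.
have [M HM] := harmonic_sum_unbounded (C / (2 * e)) (maxn K1 K2).
have low k : (maxn K1 K2 <= k)%N -> 2 * e <= d ^+ k.+1 / k`!%:R * normc (lap s k E1).
  rewrite geq_max => /andP[k1 k2]; have /= h1 := HK1 k k1; have h2 := HK2 k k2.
  have dk : 0 <= d ^+ k.+1 / k`!%:R by rewrite divr_ge0 ?exprn_ge0 // ltW.
  have nT E : d ^+ k.+1 / k`!%:R * normc (lap s k E) = normc (T k E).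
    by rewrite normcM_ normc_rC ger0_norm.
  rewrite nT in h2 *; rewrite sub0r -sub0r normc_distC subr0 TD in h1.
  have fe : normc (f k i0) = 4 * e.
    by rewrite normf -/d divff ?gt_eqF // expr1n mulr1 /e; field.
  have := normcB (T k E1 + T k E2) (T k E1 + T k E2 - f k i0); rewrite opprB addrC subrK fe.
  by have := normcD (T k E1) (T k E2); rewrite nT; move: h1 h2; lra.
move: HM; rewrite ltNge => /negP; apply.
have e2 : 0 < 2 * e by rewrite mulr_gt0.
have t0 k : 0 <= d ^+ k.+1 / (k.+1)`!%:R * normc (lap s k E1).
  by rewrite mulr_ge0 // divr_ge0 // exprn_ge0 // ltW.
rewrite ler_pdivlMr // mulr_suml; apply: le_trans (HC M).
have [MK|KM] := leqP M (maxn K1 K2); first by rewrite big_geq //; apply: sumr_ge0.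
rewrite [leRHS](@big_cat_nat _ _ _ (maxn K1 K2)) //; last exact: ltnW.
rewrite -[leLHS]add0r lerD //; first exact: sumr_ge0.
rewrite !big_nat; apply: ler_sum => k /andP[Kk _].
apply: le_trans (ler_wpM2l _ (low k Kk)) _; first by rewrite invr_ge0.
rewrite factS natrM invfM; apply: le_of_eq.
by move: (normc _) (k.+1%:R^-1) (k`!%:R^-1) => a b z; ring.
Qed.

End Growth.

End Laplace.

Arguments mhalf {R}.

(** * Enumeration of the zeros *)

Section Enumeration.
Variable R : realType.
Implicit Types (T : R).

Lemma mass_uniq_seq m T C (s : seq R[i]) : (mass_upto m T <= C%:E)%E -> uniq s ->
  (forall z, z \in s -> `|Re z| <= T) -> \sum_(z <- s) `|m z| <= C.
Proof.
move=> mC us sT; pose s' := [seq z <- s | m z != 0].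
have -> : \sum_(z <- s) `|m z| = \sum_(z <- s') `|m z|.
  rewrite big_filter big_mkcond [RHS]big_mkcond; apply: eq_bigr => z _.
  by case: eqP => //= ->; rewrite normr0.
rewrite -lee_fin; apply: le_trans mC; apply: esum_ge.
pose X : {fset R[i]} := [fset z in s']%fset.
exists [set` X].
  split; first exact: finite_fset.
  by move=> z /=; rewrite !inE mem_filter => /andP[mz zs]; split; [exact: mz|exact: sT].
rewrite fsbig_finite /=; last exact: finite_fset.
rewrite set_fsetK sumEFin lee_fin; apply: le_of_eq.
apply: perm_big; rewrite perm_sym; apply: uniq_perm; first exact: fset_uniq.
  exact: filter_uniq.
by move=> z; rewrite !inE.
Qed.

Lemma mass_enum m T C (zs : nat -> R[i]) N : injective zs -> (mass_upto m T <= C%:E)%E ->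
  \sum_(0 <= j < N | `|Re (zs j)| <= T) `|m (zs j)| <= C.
Proof.
move=> zi mC; rewrite -big_filter -(big_map zs xpredT (fun z => `|m z|)).
apply: (mass_uniq_seq mC).
  by rewrite map_inj_uniq // filter_uniq // iota_uniq.
by move=> z /mapP[j]; rewrite mem_filter => /andP[h _] ->.
Qed.

(** All but finitely many values of [m] on the support are nonzero integers, hence at least 1 in
    absolute value, so the mass bounds the number of points. *)
Lemma supp_finite m T : axiom_A3 m -> finite_set (supp m `&` [set z | `|Re z| <= T]).
Proof.
move=> [_ _ [A A0 [C HC]] fin]; apply: contrapT => inf.
set F := (X in finite_set X) in fin; set S := (X in finite_set X) in inf.
have inf2 : infinite_set (S `\` F) by apply: infinite_setD.
have T0 : 0 <= T.
  rewrite leNgt; apply/negP => T0; apply: inf; rewrite (_ : S = set0); first exact: finite_set0.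
  by apply/seteqP; split=> // z [_ /= h]; have := le_lt_trans h T0; rewrite ltNge normr_ge0.
have {HC}mC := HC T T0; set B := C * _ in mC.
have [X XS nX] := infinite_set_fset (Num.truncn B).+1 inf2.
have h : \sum_(z <- enum_fset X) `|m z| <= B.
  apply: (mass_uniq_seq mC (fset_uniq X)) => z zX.
  by have [[_ h] _] := XS z zX.
have : (\sum_(z <- enum_fset X) (1 : R)) <= B.
  apply: le_trans h; rewrite big_seq [leRHS]big_seq; apply: ler_sum => z zX.
  have [[mz _] nF] := XS z zX; have mint : m z \is a Num.int.
    by apply: contrapT => /negP h; apply: nF; split.
  by apply: norm_intr_ge1.
rewrite big_const_seq count_predT iter_addr_0 -/(1%:R) => h2.
have := lt_le_trans (truncnS_gt B) (le_trans _ h2).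
by rewrite ler_nat => /(_ nX); rewrite ltxx.
Qed.

Lemma locally_finite_countable (S : set R[i]) :
  (forall T, finite_set (S `&` [set z | `|Re z| <= T])) -> countable S.
Proof.
move=> lf; rewrite (_ : S = \bigcup_(n in [set: nat]) (S `&` [set z | `|Re z| <= n%:R])); last first.
  apply/seteqP; split=> [z Sz|z [n _ []] //]; exists (Num.truncn `|Re z|).+1 => //.
  by split=> //=; apply: ltW; exact: truncnS_gt.
by apply: bigcup_countable => // n _; apply: finite_set_countable; exact: lf.
Qed.

Lemma Re_natr n : Re (n%:R : R[i]) = n%:R.
Proof. by rewrite (_ : n%:R = (n%:R : R)%:C) // rmorph_nat. Qed.
Lemma Im_natr n : Im (n%:R : R[i]) = 0.
Proof. by rewrite (_ : n%:R = (n%:R : R)%:C) // rmorph_nat. Qed.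

(* The naturals are added to the support to make the index set infinite. *)
Lemma supp_enumeration m : axiom_A3 m -> exists (y : R) (zs : nat -> R[i]),
  [/\ 0 <= y, injective zs, forall j, `|Im (zs j)| <= y,
    forall z, m z != 0 -> (exists j, zs j = z) /\ (exists j, zs j = conjc z)
  & forall T, exists N, forall j, `|Re (zs j)| <= T -> (j < N)%N].
Proof.
move=> A3; have [_ [y y0 Hy] _ _] := A3.
pose S : set R[i] := supp m `|` [set conjc z | z in supp m] `|` range (fun n : nat => n%:R : R[i]).
have lf T : finite_set (S `&` [set z | `|Re z| <= T]).
  have f1 := supp_finite T A3.
  rewrite !setIUl finite_setU finite_setU; split; [split => //|].
    apply: sub_finite_set (finite_image (@conjc R) f1) => _ [[z mz <-] /= h].
    by exists z => //; split => //=; rewrite Re_conjc in h.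
  apply: sub_finite_set (finite_image (fun n : nat => n%:R : R[i]) (finite_II (Num.truncn T).+1)).
  move=> _ [[n _ <-] /= h]; exists n => //; move: h; rewrite Re_natr normr_nat => h.
  by rewrite ltnS truncn_ge_nat // (le_trans _ h).
have Sy z : S z -> `|Im z| <= y.
  move=> [[/Hy //|[x /Hy h <-]]|[n _ <-]]; first by rewrite Im_conjc normrN.
  by rewrite Im_natr normr0.
have Sinf : infinite_set S.
  apply: (@sub_infinite_set _ (range (fun n : nat => n%:R : R[i]))); first by move=> z h; right.
  move=> fin; apply: infinite_nat; have ninj : injective (fun n : nat => n%:R : R[i]).
    by move=> i j /(congr1 (@complex.Re R)); rewrite !Re_natr => /eqP; rewrite eqr_nat => /eqP.
  rewrite (_ : [set: nat] = (fun n : nat => n%:R : R[i]) @^-1` range (fun n : nat => n%:R : R[i])).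
    by apply: finite_preimage => // i j _ _; exact: ninj.
  by apply/seteqP; split => // n _; exists n.
have := eq_card_nat (locally_finite_countable lf) Sinf; rewrite card_eq_sym.
move=> /card_set_bijP[zs [zS zi zsu]].
have zinj : injective zs by move=> i j h; apply: zi; rewrite ?inE.
have cov z : S z -> exists j, zs j = z by move=> /zsu[j _ <-]; exists j.
exists y, zs; split => //.
- by move=> j; apply: Sy; apply: zS.
- by move=> z mz; split; apply: cov; [left; left|left; right; exists z].
move=> T; have f2 : finite_set (zs @^-1` (S `&` [set z | `|Re z| <= T])).
  by apply: finite_preimage => // i j _ _; exact: zinj.
have [s Hs] := (finite_seqP _).1 f2.
exists (\max_(i <- s) i).+1 => j jT; rewrite ltnS.
have js : j \in s.
  have : (zs @^-1` (S `&` [set z | `|Re z| <= T])) j by split => //; apply: zS.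
  by rewrite Hs.
exact: (@leq_bigmax_seq _ s xpredT id j js isT).
Qed.

Lemma partial_sum_seq (x : R[i] -> R[i]) (s : seq R[i]) : uniq s ->
  partial_sum x [fset z in s]%fset = \sum_(z <- s) x z.
Proof.
move=> us; rewrite /partial_sum -(big_seq_fsetE _ _ xpredT x).
apply: perm_big; apply: uniq_perm => //.
by move=> z; rewrite !inE.
Qed.

(** The nonnegative and the negative terms form two sub-sums, each bounded by [B]. *)
Lemma signed_sum_bound (I : Type) (s : seq I) (F : I -> R) (B : R) :
  (forall P : pred I, `|\sum_(i <- s | P i) F i| <= B) -> \sum_(i <- s) `|F i| <= 2 * B.
Proof.
move=> H; rewrite (bigID (fun i => 0 <= F i)) /= mulr_natl mulr2n lerD //.
  rewrite (eq_bigr F) => [|i]; last by move/ger0_norm.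
  exact: le_trans (ler_norm _) (H _).
rewrite (eq_bigr (fun i => - F i)) => [|i]; last by rewrite -ltNge => /ltr0_norm.
rewrite sumrN; apply: le_trans (ler_norm _) _; rewrite normrN; exact: H.
Qed.

(** Convergence along the net of finite sets is unconditional, which for complex numbers means
    absolute; an enumeration that meets every nonzero term then has the same limit. *)
Lemma net_csum (x : R[i] -> R[i]) (zs : nat -> R[i]) (l : R[i]) : injective zs ->
  (forall z, x z != 0 -> exists j, zs j = z) -> partial_sum x @ totally --> l ->
  csum (fun j => x (zs j)) @ \oo --> l /\
  exists B, forall N, \sum_(0 <= j < N) normc (x (zs j)) <= B.
Proof.
move=> zi zc /cvg_normcP xl0; have xl : forall e : R, 0 < e -> \forall A \near totally, normc (l - partial_sum x A) < e by apply: xl0; apply: totally_filter.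
have zsum N (P : pred nat) (F : R[i] -> R[i]) :
    \sum_(0 <= j < N | P j) F (zs j) = \sum_(z <- [seq zs j | j <- iota 0 N & P j]) F z.
  by rewrite big_map big_filter /index_iota subn0.
have uz N (P : pred nat) : uniq [seq zs j | j <- iota 0 N & P j].
  by rewrite map_inj_uniq // filter_uniq // iota_uniq.
have AX (A : {fset R[i]}) : exists N0, forall z, z \in A -> x z != 0 -> exists2 j, (j < N0)%N & zs j = z.
  have /choice[g Hg] z : exists j, x z != 0 -> zs j = z.
    have [xz|xz] := eqVneq (x z) 0; first by exists 0%N.
    by have [j <-] := zc z xz; exists j.
  exists (\max_(z <- enum_fset A) g z).+1 => z zA xz; exists (g z); last exact: Hg.
  by rewrite ltnS (@leq_bigmax_seq _ (enum_fset A) xpredT g z).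
split.
  apply/cvg_normcP => e e0; have [A _ HA] := xl e e0; have [N0 HN0] := AX A.
  exists N0 => // N /= N0N.
  (* The points [t] of [A] not yet enumerated carry zero terms, so adding them reaches a finite set
     containing [A] without changing the sum. *)
  set s := [seq zs j | j <- iota 0 N & true]; pose t := [seq z <- enum_fset A | z \notin s].
  have ut : uniq (s ++ t).
    rewrite cat_uniq uz filter_uniq ?fset_uniq // andbT; apply/hasPn => z.
    by rewrite mem_filter => /andP[].
  have -> : csum (fun j => x (zs j)) N = partial_sum x [fset z in s ++ t]%fset.
    rewrite partial_sum_seq // big_cat /= /csum (zsum N xpredT x) -/s [X in _ + X]big1_seq ?addr0 //.
    move=> z /=; rewrite mem_filter => /andP[zs' zA]; apply: contraNeq zs' => /(HN0 z zA)[j jN <-].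
    by apply: map_f; rewrite mem_filter /= mem_iota /= add0n (leq_trans jN).
  apply: HA; apply/fsubsetP => z zA; rewrite !inE /t mem_filter.
  by rewrite zA andbT orbN.
have [A _ HA] := xl 1 ltr01.
(* Two finite sets containing [A] have sums within 1 of the limit, so a finite sum off [A], being a
   difference of two such sums, is at most 2. *)
have small (s : seq R[i]) : uniq s -> (forall z, z \in s -> z \notin A) ->
    normc (\sum_(z <- s) x z) <= 2.
  move=> us sA.
  have ut : uniq (enum_fset A ++ s).
    rewrite cat_uniq fset_uniq us andbT /=; apply/hasPn => z; exact: sA.
  have h1 := HA [fset z in enum_fset A ++ s]%fset.
  have h2 := HA A (fsubset_refl A).
  rewrite /= partial_sum_seq // in h1; rewrite /partial_sum -(big_seq_fsetE _ _ xpredT x) in h2.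
  have {}h1 : normc (l - \sum_(z <- enum_fset A ++ s) x z) < 1.
    by apply: h1; apply/fsubsetP => z zA; rewrite !inE zA.
  rewrite big_cat /= in h1.
  move: h1 h2; move: (\sum_(z <- enum_fset A) x z) (\sum_(z <- s) x z) => a b h1 h2.
  have := normcB (l - a) (l - (a + b)).
  by rewrite (_ : l - a - (l - (a + b)) = b); [lra|ring].
exists (\sum_(z <- enum_fset A) normc (x z) + 8) => N.
rewrite (bigID (fun j => zs j \in A)) /= lerD //.
  rewrite -big_filter -(big_map zs xpredT (fun z => normc (x z))).
  set s := map _ _; have us : uniq s by rewrite map_inj_uniq // filter_uniq // iota_uniq.
  have sA z : z \in s -> z \in A by move=> /mapP[j]; rewrite mem_filter => /andP[h _] ->.
  rewrite [leRHS](bigID (fun z => z \in s)) /= -[X in _ <= X + _]big_filter.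
  have -> : \sum_(z <- s) normc (x z) = \sum_(z <- [seq z <- enum_fset A | z \in s]) normc (x z).
    apply: perm_big; apply: uniq_perm => //; first by rewrite filter_uniq ?fset_uniq.
    by move=> z; rewrite mem_filter; case: (boolP (z \in s)) => //= /sA ->.
  by rewrite lerDl; apply: sumr_ge0 => z _; exact: normc_ge0.
(* This is meant for real and imaginary parts: the bound 2 on every sub-sum gives 4 for the absolute
   values of either, hence the 8 in the final bound. *)
have H (F : R[i] -> R) : (forall z, `|F z| <= normc z) -> (forall z w, F (z + w) = F z + F w) -> F 0 = 0 ->
   \sum_(0 <= j < N | zs j \notin A) `|F (x (zs j))| <= 4.
  move=> Fn FD F0; rewrite -big_filter.
  have -> : (4 : R) = 2 * 2 by rewrite -natrM.
  apply: (@signed_sum_bound _ _ (fun j => F (x (zs j)))) => P.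
  rewrite -(big_morph F FD F0); apply: le_trans (Fn _) _.
  rewrite -big_filter -(big_map zs xpredT x); apply: small.
    by rewrite map_inj_uniq // !filter_uniq // iota_uniq.
  by move=> z /mapP[j]; rewrite !mem_filter => /and3P[_ h _] ->.
apply: le_trans (_ : \sum_(0 <= j < N | zs j \notin A) (`|Re (x (zs j))| + `|Im (x (zs j))|) <= _).
  by apply: ler_sum => j _; exact: normc_le_ReIm.
rewrite big_split /= (_ : (8 : R) = 4 + 4); last by rewrite -natrD.
by rewrite lerD //; apply: H => //; [exact: ler_normc_Re|exact: ReD|exact: ler_normc_Im|exact: ImD].
Qed.

End Enumeration.

(** * The archimedean kernel *)

Section Kernel.
Variable R : realType.
Notation half := (`[0, +oo[%classic : set R).
Notation pos := (`]0, +oo[%classic : set R).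
Implicit Types (r v : R -> R).

Lemma mpos : measurable pos. Proof. exact: measurable_itv. Qed.

Lemma rint_inv_sqr : rint half (fun x : R => ((1 + x) ^+ 2)^-1).
Proof.
have d (x : R) : 0 <= x -> is_derive x 1 (fun x : R => - (1 + x)^-1) (((1 + x) ^+ 2)^-1).
  move=> x0; have n0 : 1 + x != 0 by rewrite gt_eqF; lra.
  have H0 : is_derive x 1 (fun x : R => 1 + x) 1.
    by apply: (is_derive_eq (is_deriveD (is_derive_cst (1 : R) x 1) (is_derive_id x (1 : R)))); rewrite add0r.
  have H := is_deriveN (is_deriveV n0 H0).
  apply: (is_derive_eq H); rewrite /GRing.scale /= mulr1 opprK.
  by [].
have cF (x : R) : 0 <= x -> {for x, continuous (fun x : R => (1 + x)^-1)}.
  move=> x0; apply: cvgV; first by rewrite gt_eqF //; lra.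
  by apply: cvgD; [exact: cvg_cst|exact: cvg_id].
have cf : {within half, continuous (fun x : R => ((1 + x) ^+ 2)^-1)}.
  apply: continuous_in_subspaceT => x; rewrite inE /= in_itv /= andbT => x0.
  have -> : (fun x : R => ((1 + x) ^+ 2)^-1) = (fun x => (1 + x)^-1 * (1 + x)^-1).
    by apply/funext => y; rewrite -expr2 exprVn.
  by apply: cvgM; exact: cF.
have f0 (x : R) : 0 <= ((1 + x) ^+ 2)^-1 by rewrite invr_ge0 sqr_ge0.
apply/integrableP; split.
  by apply/measurable_EFinP; apply: subspace_continuous_measurable_fun => //; exact: measurable_itv.
rewrite (@eq_integral _ _ R mu _ (fun x => (((1 + x) ^+ 2)^-1)%:E)); last first.
  by move=> x _ /=; rewrite ger0_norm.
rewrite (@ge0_continuous_FTC2y _ _ (fun x => - (1 + x)^-1) 0 0) ?ltry //.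
- rewrite -[X in _ --> X]oppr0; apply: cvgN; apply/cvgr0Pnorm_le => e e0; near=> x.
  have x0 : 0 < x by near: x; apply: nbhs_pinfty_gt.
  rewrite ger0_norm ?invr_ge0; last by lra.
  rewrite -[e]invrK lef_pV2 ?posrE ?invr_gt0 //; last by lra.
  have : e^-1 < x by near: x; apply: nbhs_pinfty_gt; exact: num_real.
  by move: x0; clear; lra.
- by move=> x x0; have [] := d x (ltW x0).
- by apply: cvgN; apply: cvg_at_right_filter; exact: cF.
- by move=> x; rewrite in_itv /= andbT => x0; rewrite derive1E; have [_ ->] := d x (ltW x0).
Unshelve. all: by end_near. Qed.

(** [pr] and [pi] are the real and imaginary parts of x K(x). The condition [pi 0 = 0] encodes the
    real limit in (A2): it makes Im K bounded near 0, whereas Re K may grow like 1/x. *)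
Definition kernel_parts K (pr pi : R -> R) := [/\ schwartz pr, schwartz pi, pi 0 = 0
  & forall x, 0 < x -> K x = (pr x / x) +i* (pi x / x)].

Lemma schwartz_continuous v : schwartz v -> continuous v.
Proof. by move=> [sv _]; exact: smooth_continuous. Qed.

Lemma kernel_partsP K : axiom_A2 K -> exists pr pi, kernel_parts K pr pi.
Proof.
move=> [[phi [s1 s2] phiK] [l Hl]].
exists (fun x => Re (phi x)), (fun x => Im (phi x)); split => //; last first.
  move=> x x0; have x1 : x != 0 by rewrite gt_eqF.
  by apply: complex_ext; rewrite (phiK x x0) /= ?Re_rC ?Im_rC mulrC mulKf.
have c2 := schwartz_continuous s2.
have H1 : Im (phi x) @[x --> (0 : R)^'+] --> Im (phi 0) by apply: cvg_at_right_filter; exact: c2.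
have /cvg_ReIm[_ H2] := Hl.
have H3 : Im (phi x) @[x --> (0 : R)^'+] --> (0 : R).
  apply: cvg_trans H2; apply: near_eq_cvg.
  by near=> x; rewrite phiK //; near: x; exact: nbhs_right_gt.
exact: (cvg_unique _ H1 H3).
Unshelve. all: by end_near. Qed.

Lemma schwartz_decay v : schwartz v -> exists2 C, 0 <= C & forall x, 0 <= x -> `|v x| * (1 + x) ^+ 4 <= C.
Proof.
move=> [_ H]; have [C0 HC0] := H 0%N 0%N; have [C4 HC4] := H 4%N 0%N.
have p0 : 0 <= C0 by apply: le_trans (HC0 0).
have p4 : 0 <= C4 by apply: le_trans (HC4 0).
exists (8 * (C0 + C4)); first by lra.
move=> x x0; have := HC0 x; have := HC4 x; rewrite expr0 mul1r /= normrM ger0_norm ?exprn_ge0 // => h4 h0.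
have hx : (1 + x) ^+ 4 <= 8 * (1 + x ^+ 4).
  have h1 : (1 + x) ^+ 2 <= 2 * (1 + x ^+ 2) by have := sqr_ge0 (x - 1); rewrite !expr2; lra.
  have : ((1 + x) ^+ 2) ^+ 2 <= (2 * (1 + x ^+ 2)) ^+ 2 by rewrite ler_pXn2r ?nnegrE ?sqr_ge0 //; have := sqr_ge0 x; lra.
  rewrite -exprM => /le_trans; apply; have := sqr_ge0 (x ^+ 2 - 1).
  by rewrite !exprS expr0; lra.
have n0 := normr_ge0 (v x).
by apply: le_trans (ler_wpM2l n0 hx) _; nra.
Qed.

Lemma schwartz_lipschitz v : schwartz v -> exists2 L, 0 <= L & forall x, 0 <= x -> `|v x - v 0| <= L * x.
Proof.
move=> [sv H]; have [L HL] := H 0%N 1%N.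
have L0 : 0 <= L by apply: le_trans (HL 0).
exists L => // x x0.
have := @is_derive_bound R v (v^`()%classic) (fun y => L * y) (fun=> L) 0 x x0.
rewrite mulr0 subr0; apply => [y _|y _|y _].
- by apply: DeriveDef; [exact: smooth_derivable|rewrite derive1E].
- have := @is_derive_id R R y 1; move=> /(is_deriveZ L); rewrite /GRing.scale /= mulr1; exact.
- by have := HL y; rewrite expr0 mul1r.
Qed.

Section Parts.
Variables (K : R -> R[i]) (pr pi : R -> R).
Hypothesis kp : kernel_parts K pr pi.

(** The fourth power leaves two powers for integrability in [x] and two for the decay of the kernel
    term under translation. Near 0 the bound on Im K comes from [pi 0 = 0] and the Lipschitz
    estimate. *)
Lemma kernel_bounds : exists2 C, 0 <= C & forall x, 0 < x ->
  normc (K x) * x * (1 + x) ^+ 4 <= C /\ `|Im (K x)| * (1 + x) ^+ 2 <= C.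
Proof.
have [s1 s2 p0 Kx] := kp.
have [C1 c1 H1] := schwartz_decay s1; have [C2 c2 H2] := schwartz_decay s2.
have [L l0 HL] := schwartz_lipschitz s2.
exists (C1 + C2 + 4 * L); first by lra.
move=> x x0; have x1 := ltW x0; rewrite (Kx x x0); split.
  apply: le_trans (_ : (`|pr x| + `|pi x|) * (1 + x) ^+ 4 <= _); last first.
    by have := H1 x x1; have := H2 x x1; rewrite mulrDl; lra.
  apply: ler_wpM2r; first by rewrite exprn_ge0 //; lra.
  rewrite -ler_pdivlMr // mulrDl; apply: le_trans (normc_le_ReIm _) _ => /=.
  by rewrite !normrM normfV !(ger0_norm x1).
rewrite [Im _]/= normrM normfV (ger0_norm x1); have := HL x x1; rewrite p0 subr0 => h.
have [xl|xg] := leP x 1.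
  have h2 : `|pi x| / x <= L by rewrite ler_pdivrMr.
  have h3 : (1 + x) ^+ 2 <= 4 by nra.
  have : 0 <= `|pi x| / x by rewrite divr_ge0.
  by move: (`|pi x| / x) h2 h3 => a; nra.
have := H2 x x1; have : `|pi x| / x <= `|pi x| by rewrite ler_pdivrMr // ler_peMr // ltW.
have := normr_ge0 (pi x); move: (`|pi x| / x) (`|pi x|) => a b b0 ab h4.
have h5 : (1 + x) ^+ 2 <= (1 + x) ^+ 4 by rewrite ler_eXn2l //; lra.
have h6 : 0 <= (1 + x) ^+ 2 by rewrite exprn_ge0; lra.
have := ler_wpM2r h6 ab; have := ler_wpM2l b0 h5; lra.
Qed.

Lemma cmeas_kernel : cmeas pos K.
Proof.
have [s1 s2 p0 Kx] := kp.
have mv : measurable_fun pos (fun x : R => x^-1).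
  apply: open_continuous_measurable_fun; first exact: interval_open.
  by move=> x; rewrite inE /= in_itv /= andbT => x0; apply: inv_continuous; rewrite gt_eqF.
have m1 : measurable_fun pos (fun x => pr x / x).
  apply: measurable_funM => //; apply: measurable_funTS; apply: continuous_measurable_fun.
  exact: schwartz_continuous.
have m2 : measurable_fun pos (fun x => pi x / x).
  apply: measurable_funM => //; apply: measurable_funTS; apply: continuous_measurable_fun.
  exact: schwartz_continuous.
split.
  by apply: (eq_measurable_fun _ _ m1) => x; rewrite inE /= in_itv /= andbT => x0; rewrite Kx.
by apply: (eq_measurable_fun _ _ m2) => x; rewrite inE /= in_itv /= andbT => x0; rewrite Kx.
Qed.

Lemma kernel_continuous (x : R) : 0 < x -> K y @[y --> x] --> K x.
Proof.
move=> x0; have [s1 s2 p0 Kx] := kp.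
have xn : x != 0 by rewrite gt_eqF.
have nx : \forall y \near x, 0 < y by exact: lt_nbhsr.
apply/cvg_ReIm; rewrite (Kx x x0) /=; split.
  have H : (fun y => pr y / y) @ x --> pr x / x.
    by apply: cvgM; [exact: schwartz_continuous|exact: inv_continuous].
  by apply: cvg_trans H; apply: near_eq_cvg; near=> y; rewrite Kx //; near: y.
have H : (fun y => pi y / y) @ x --> pi x / x.
  by apply: cvgM; [exact: schwartz_continuous|exact: inv_continuous].
by apply: cvg_trans H; apply: near_eq_cvg; near=> y; rewrite Kx //; near: y.
Unshelve. all: by end_near. Qed.

End Parts.

End Kernel.

Arguments mpos {R}.

(** * Test functions and their two-sided Laplace transforms *)

Section TestFunctions.
Variable R : realType.
Implicit Types (r v : R -> R) (w z : R[i]) (a : R).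

Definition testfn r a := smooth r /\ forall x, a <= `|x| -> r x = 0.

Lemma testfn_continuous r a : testfn r a -> continuous r.
Proof. by move=> [sr _]; exact: smooth_continuous. Qed.

Lemma testfn_bounded r a : testfn r a -> exists2 S, 0 <= S & forall x, `|r x| <= S.
Proof.
move=> tr; have cr := testfn_continuous tr; have [_ r0] := tr.
have cn : continuous (fun x => `|r x|) by move=> x; apply: cvg_norm; exact: cr.
have h : - `|a| <= `|a| by rewrite ge0_cp // normr_ge0.
have [c _ Hc] := EVT_max h (continuous_subspaceT cn).
exists `|r c| => // x; have [xa|xa] := lerP `|x| `|a|.
  by apply: Hc; rewrite in_itv /= -ler_norml.
by rewrite r0 ?normr0 // (le_trans (ler_norm a)) // ltW.
Qed.

Lemma is_derive_locally0 r (x e : R) : 0 < e -> (forall y, `|y - x| < e -> r y = 0) -> is_derive x 1 r 0.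
Proof.
move=> e0 h.
apply: (near_eq_is_derive _ (is_derive_cst (0 : R) x (1 : R))).
by exists e => //= y yx; rewrite h // distrC.
Qed.

Lemma testfn_derive r a : testfn r a -> testfn r^`()%classic (a + 1).
Proof.
move=> [sr r0]; split; first exact: smooth_derive1.
move=> x ax; rewrite derive1E.
have H : is_derive x 1 r 0; last by have [_ ->] := H.
apply: (is_derive_locally0 (e := 1)) => // y yx; apply: r0.
by have := lerB_dist x y; rewrite distrC; move: ax yx; lra.
Qed.

Lemma is_derive_smooth r (x : R) : smooth r -> is_derive x 1 r (r^`()%classic x).
Proof. by move=> sr; apply: DeriveDef; [exact: smooth_derivable|rewrite derive1E]. Qed.

Lemma lipschitz_of_bound r (L : R) : smooth r -> (forall x, `|r^`()%classic x| <= L) ->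
  forall x y, `|r x - r y| <= L * `|x - y|.
Proof.
move=> sr HL; have mono x y : y <= x -> `|r x - r y| <= L * `|x - y|.
  move=> yx; have := @is_derive_bound R r (r^`()%classic) (fun y => L * y) (fun=> L) y x yx.
  rewrite (ger0_norm (x := x - y)) ?subr_ge0 // mulrBr; apply => [u _|u _|u _] //.
    exact: is_derive_smooth.
  by have := @is_derive_id R R u 1; move=> /(is_deriveZ L); rewrite /GRing.scale /= mulr1; exact.
move=> x y; have [yx|/ltW xy] := leP y x; first exact: mono.
by rewrite distrC (distrC x); exact: mono.
Qed.

Lemma testfn_lipschitz r a : testfn r a -> exists2 L, 0 <= L & forall x y, `|r x - r y| <= L * `|x - y|.
Proof.
move=> tr; have [L L0 HL] := testfn_bounded (testfn_derive tr).
by exists L => //; apply: lipschitz_of_bound => //; case: tr.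
Qed.

Lemma testfnD r v a : testfn r a -> testfn v a -> testfn (fun x => r x + v x) a.
Proof. by move=> [s1 h1] [s2 h2]; split; [exact: smoothD|move=> x ax; rewrite h1 ?h2 ?addr0]. Qed.

Lemma testfnZ c r a : testfn r a -> testfn (fun x => c * r x) a.
Proof.
move=> [s1 h1]; split; first exact: (smoothM (@smooth_cst R c) s1).
by move=> x ax; rewrite h1 ?mulr0.
Qed.

Lemma testfn_opp r a : testfn r a -> testfn (fun x => r (- x)) a.
Proof.
move=> [s1 h1]; split; last by move=> x ax; rewrite h1 // normrN.
have := @smooth_affine R r (-1) 0 s1; congr smooth; apply/funext => x; by rewrite addr0 mulN1r.
Qed.

Lemma testfn_shift r a t : testfn r a -> testfn (fun x => r (x - t)) (a + `|t|).
Proof.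
move=> [s1 h1]; split.
  have := @smooth_affine R r 1 (- t) s1; congr smooth; apply/funext => x; by rewrite mul1r.
by move=> x ax; apply: h1; have := lerB_dist x t; move: ax; lra.
Qed.

Lemma testfn_scale r a (d : R) : 0 < d -> testfn r a -> testfn (fun x => r (x / d)) (a * d).
Proof.
move=> d0 [s1 h1]; split.
  have := @smooth_affine R r (d^-1) 0 s1; congr smooth; apply/funext => x; by rewrite addr0 mulrC.
move=> x ax; apply: h1; by rewrite normrM normfV (ger0_norm (ltW d0)) ler_pdivlMr.
Qed.

Lemma testfn_bump a : testfn (bump a) a.
Proof. by split; [exact: smooth_bump|exact: bump_eq0]. Qed.

(** The two-sided Laplace transform: the Fourier transform at [z] is its value at [w = i z], with
    [Re w = - Im z] and [Im w = Re z]. *)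
Definition lt r w : R[i] := cint setT (fun x => (r x)%:C * cexp (x%:C * w)).

Lemma fourier_lt r z : fourier (fun x => (r x)%:C) z = lt r ('i * z).
Proof. by rewrite /fourier /lt; apply: eq_cint => x _; congr (_ * cexp _); rewrite mulrCA mulrA. Qed.
Lemma cderiv_cexpx w (t : R) : cderiv (fun t => cexp (t%:C * w)) t (w * cexp (t%:C * w)).
Proof. exact: cderiv_comp_cexp (cderiv_lin _ _). Qed.

Lemma cderiv_test r a w (t : R) : testfn r a -> cderiv (fun x => (r x)%:C * cexp (x%:C * w)) t
  ((r^`()%classic t)%:C * cexp (t%:C * w) + w * ((r t)%:C * cexp (t%:C * w))).
Proof.
move=> [sr _]; apply: cderiv_eq (cderivM (cderiv_real (is_derive_smooth t sr)) (cderiv_cexpx w t)) _.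
by congr (_ + _); rewrite mulrCA.
Qed.

Lemma test_segment r a w (x y : R) : testfn r a ->
  cintb `[x, y] (fun x => (r x)%:C * cexp (x%:C * w)).
Proof.
move=> tr; have [c1 c2] := cderiv_continuous (fun t => cderiv_test w t tr).
exact: cintb_segment.
Qed.

Lemma test_cintb r a w : testfn r a -> cintb setT (fun x => (r x)%:C * cexp (x%:C * w)).
Proof.
move=> tr; apply: (cintb_supp _ (test_segment w (- a) a tr)); first exact: measurable_itv.
move=> x; rewrite /= in_itv /= -ler_norml => /negP; rewrite -ltNge => ax.
by case: tr => _ ->; rewrite ?mul0r // ltW.
Qed.

Lemma lt_shift r a t w : testfn r a -> lt (fun x => r (x - t)) w = cexp (t%:C * w) * lt r w.
Proof.
move=> tr; rewrite {1}/lt; have [_ <-] := cint_shift t (test_cintb w (testfn_shift t tr)).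
rewrite /lt -cintZ //; last exact: test_cintb tr.
by apply: eq_cint => x _; rewrite addrK rCD mulrDl cexpD mulrA mulrC.
Qed.

Lemma ltD r v a w : testfn r a -> testfn v a -> lt (fun x => r x + v x) w = lt r w + lt v w.
Proof.
move=> h1 h2; rewrite /lt -cintD //; [|exact: test_cintb h1|exact: test_cintb h2].
by apply: eq_cint => x _; rewrite rCD mulrDl.
Qed.

Lemma lt_segment r a b w : testfn r a -> a <= b -> lt r w = cint `[- b, b] (fun x => (r x)%:C * cexp (x%:C * w)).
Proof.
move=> [_ r0] ab; rewrite /lt -(@cint_supp _ `[- b, b]) // => x.
rewrite /= in_itv /= -ler_norml => /negP; rewrite -ltNge => bx.
by rewrite r0 ?mul0r // (le_trans ab) // ltW.
Qed.

Lemma lt_derive r a w : 0 <= a -> testfn r a -> lt r^`()%classic w = - (w * lt r w).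
Proof.
move=> a0 tr; have td := testfn_derive tr.
have ab : - (a + 1) <= a + 1 by lra.
have [c1 c2] := cderiv_continuous (fun t => cderivD (cderiv_test w t td) (cderivZ w (cderiv_test w t tr))).
have := cint_FTC ab (fun t => cderiv_test w t tr) c1 c2.
have [_ r0] := tr; rewrite (r0 (a + 1)) ?(r0 (- (a + 1))) ?normrN ?ger0_norm ?lerDl ?addr_ge0 //.
rewrite !mul0r subrr cintD //; [|exact: test_segment td|by apply: cintbZ => //; exact: test_segment tr].
rewrite cintZ //; last exact: test_segment tr.
rewrite -(lt_segment w td (lexx _)) -(lt_segment w tr) ?lerDl // => /eqP.
by rewrite addr_eq0 => /eqP.
Qed.

Lemma lt_bound r a b (t0 S y : R) w : 0 <= b -> testfn r a -> (forall x, b <= `|x - t0| -> r x = 0) ->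
  (forall x, `|r x| <= S) -> `|Re w| <= y -> normc (lt r w) <= 2 * b * S * expR ((`|t0| + b) * y).
Proof.
move=> b0 tr rb rS wy.
have S0 : 0 <= S by apply: le_trans (rS 0).
have -> : lt r w = cint `[t0 - b, t0 + b] (fun x => (r x)%:C * cexp (x%:C * w)).
  rewrite /lt -(@cint_supp _ `[t0 - b, t0 + b]) // => x.
  rewrite /= in_itv /= => /negP h; rewrite rb ?mul0r // leNgt; apply: contra h.
  by rewrite ltr_norml => /andP[h1 h2]; apply/andP; split; lra.
have bd x : `[t0 - b, t0 + b]%classic x -> normc ((r x)%:C * cexp (x%:C * w)) <= S * expR ((`|t0| + b) * y).
  rewrite /= in_itv /= => /andP[x1 x2]; rewrite normcM_ normc_rC normc_cexp ler_pM //.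
  rewrite ler_expR Re_rC; apply: le_trans (ler_norm _) _; rewrite normrM ler_pM //.
  rewrite ler_norml; have := ler_norm t0; have := ler_norm (- t0); rewrite normrN.
  by move=> h1 h2; apply/andP; split; lra.
have ic : rint `[t0 - b, t0 + b] (fun=> S * expR ((`|t0| + b) * y)).
  by apply: rint_segment => x; exact: cvg_cst.
apply: le_trans (cint_le _ (test_segment w _ _ tr) bd ic) _ => //.
have E : fine (mu `[t0 - b, t0 + b]%classic) <= 2 * b.
  by rewrite lebesgue_measure_itv /= lte_fin; case: ifP => _ /=; lra.
have H := Rint_cst (measurable_itv _) (S * expR ((`|t0| + b) * y)).
rewrite H; apply: le_trans (ler_wpM2l _ E) _; first by rewrite mulr_ge0.
by apply: le_of_eq; ring.
Qed.

End TestFunctions.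

(** * The explicit formula for arbitrary real test functions *)

Section ExplicitFormula.
Variable R : realType.
Notation half := (`[0, +oo[%classic : set R).
Notation pos := (`]0, +oo[%classic : set R).
Implicit Types (r : R -> R).

(** The kernel side of (A4) made linear in a real test function: when twice the real part is
    expanded, [K] meets [r x] and its conjugate meets [r (- x)]. *)
Definition kin K r (x : R) : R[i] :=
  (2 * Re (K x) * r 0)%:C - K x * (r x)%:C - conjc (K x) * (r (- x))%:C.

Lemma inpos x : pos x -> 0 < x. Proof. by rewrite /= in_itv /= andbT. Qed.
Lemma Re_kin K r x : Re (kin K r x) = Re (K x) * (2 * r 0 - r x - r (- x)).
Proof. by rewrite /kin !ReB !Re_rCr Re_conjc /=; ring. Qed.
Lemma Im_kin K r x : Im (kin K r x) = Im (K x) * (r (- x) - r x).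
Proof. by rewrite /kin !ImB !Im_rCr Im_conjc /=; ring. Qed.

Lemma rint_inv_sqr_pos : rint pos (fun x : R => ((1 + x) ^+ 2)^-1).
Proof.
apply: (rint_sub (E := half)) => //; last exact: rint_inv_sqr.
by move=> x; rewrite /= !in_itv /= !andbT; exact: ltW.
Qed.

(** Near 0 the large part Re K is multiplied by 2 r(0) - r(x) - r(-x), which the Lipschitz bound
    makes O(x), and Im K is bounded. The constant depends on [r] only through [S] and [L], hence is
    shared by all translates of a bump. *)
Lemma kin_bound K pr pi (S L : R) : kernel_parts K pr pi -> 0 <= S -> 0 <= L ->
  exists2 C, 0 <= C & forall r x, (forall x, `|r x| <= S) -> (forall x y, `|r x - r y| <= L * `|x - y|) -> 0 < x ->
   normc (kin K r x) <= C * ((1 + x) ^+ 2)^-1.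
Proof.
move=> kp S0 L0; have [C C0 HC] := kernel_bounds kp.
exists (2 * C * (L + S)); first by nra.
move=> r x rS rL x0; have [h1 h2] := HC x x0.
apply: le_trans (normc_le_ReIm _) _; rewrite Re_kin Im_kin !normrM.
have x1 : 0 < (1 + x) ^+ 2 by rewrite exprn_gt0; lra.
rewrite ler_pdivlMr // mulrDl.
have hr : `|Re (K x)| * `|2 * r 0 - r x - r (- x)| * (1 + x) ^+ 2 <= 2 * C * L.
  have l1 : `|2 * r 0 - r x - r (- x)| <= 2 * L * x.
    have -> : 2 * r 0 - r x - r (- x) = (r 0 - r x) + (r 0 - r (- x)) by ring.
    apply: le_trans (ler_normD _ _) _; have := rL 0 x; have := rL 0 (- x).
    by rewrite !sub0r opprK normrN (ger0_norm (ltW x0)); lra.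
  have l2 : `|Re (K x)| <= normc (K x) by exact: ler_normc_Re.
  have l3 : (1 + x) ^+ 2 <= (1 + x) ^+ 4 by rewrite ler_eXn2l //; lra.
  apply: le_trans (_ : normc (K x) * (2 * L * x) * (1 + x) ^+ 4 <= _).
    by apply: ler_pM; [rewrite mulr_ge0|exact: ltW|apply: ler_pM|exact: l3].
  rewrite [leLHS](_ : _ = 2 * L * (normc (K x) * x * (1 + x) ^+ 4)); last by ring.
  by rewrite [leRHS](_ : _ = 2 * L * C); [rewrite ler_wpM2l // mulr_ge0|ring].
have hi : `|Im (K x)| * `|r (- x) - r x| * (1 + x) ^+ 2 <= 2 * C * S.
  have l1 : `|r (- x) - r x| <= 2 * S.
    by apply: le_trans (ler_normB _ _) _; have := rS x; have := rS (- x); lra.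
  rewrite mulrAC; apply: le_trans (ler_pM _ _ h2 l1) _ => //; last by lra.
  by rewrite mulr_ge0 // ltW.
by rewrite mulrDr; lra.
Qed.

Lemma cmeas_kin K pr pi r : kernel_parts K pr pi -> continuous r -> cmeas pos (kin K r).
Proof.
move=> kp cr; have mK := cmeas_kernel kp; have [mK1 mK2] := mK.
have mr : measurable_fun pos r by apply: measurable_funTS; exact: continuous_measurable_fun.
have mrN : measurable_fun pos (fun x => r (- x)).
  apply: measurable_funTS; apply: continuous_measurable_fun => x.
  by apply: continuous_comp; [exact: opp_continuous|exact: cr].
split.
  rewrite (_ : (fun x => _) = fun x => Re (K x) * (2 * r 0 - r x - r (- x))); last first.
    by apply/funext => x; exact: Re_kin.
  by apply: measurable_funM => //; do 2!apply: measurable_funB => //; exact: measurable_cst.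
rewrite (_ : (fun x => _) = fun x => Im (K x) * (r (- x) - r x)); last first.
  by apply/funext => x; exact: Im_kin.
by apply: measurable_funM => //; apply: measurable_funB.
Qed.

Lemma kin_cintb K pr pi r a : kernel_parts K pr pi -> testfn r a -> cintb pos (kin K r).
Proof.
move=> kp tr; have [S S0 rS] := testfn_bounded tr; have [L L0 rL] := testfn_lipschitz tr.
have [C C0 HC] := kin_bound kp S0 L0.
apply: (cintb_le (g := fun x => C * ((1 + x) ^+ 2)^-1)).
- exact: mpos.
- exact: cmeas_kin kp (testfn_continuous tr).
- by move=> x /inpos x0; exact: HC.
- by apply: rintZ; [exact: mpos|exact: rint_inv_sqr_pos].
Qed.

Definition prime_sum f r N : R[i] := \sum_(1 <= n < N)
  (f n * (r (ln n%:R))%:C + conjc (f n) * (r (- ln n%:R))%:C).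

Definition datum_value f K r N : R[i] := cint pos (kin K r) - prime_sum f r N.

Lemma lim_sum_eventually (u : nat -> R[i]) N : (forall n, (N <= n)%N -> u n = 0) -> (0 < N)%N ->
  \big[+%R/0]_(1 <= n <oo) u n = \sum_(1 <= n < N) u n.
Proof.
move=> u0 N0; apply/cvg_lim => //; apply: cvg_near_cst; exists N => // M /= NM.
rewrite (big_cat_nat (n := N)) //= [X in _ + X]sum0_nat ?addr0 // => n _ /andP[/u0] //.
Qed.

Lemma imul_real (x y : R) : y%:C * ('i * x%:C) = 0 +i* (y * x) :> R[i].
Proof. by apply: complex_ext => /=; ring. Qed.

Lemma cintb_odd_sin r a x : testfn r a -> (forall y, r (- y) = r y) ->
  \int[mu]_y (r y * sin (y * x)) = 0.
Proof.
move=> tr re.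
have [_ h2] := test_cintb ('i * x%:C) tr.
have E : (fun y => Im ((r y)%:C * cexp (y%:C * ('i * x%:C)))) = (fun y => r y * sin (y * x)).
  apply/funext => y; rewrite imul_real Im_rC Im_cexp /=.
  by rewrite expR0 mul1r.
rewrite E in h2; have [_] := Rintegral_opp h2.
have -> : (fun y => r (- y) * sin (- y * x)) = (fun y => -1 * (r y * sin (y * x))).
  by apply/funext => y; rewrite re mulN1r (mulNr y) sinN mulrN.
rewrite (RintZl (-1) measurableT h2); lra.
Qed.

Lemma cintb_even_cos r a x : testfn r a -> (forall y, r (- y) = - r y) ->
  \int[mu]_y (r y * cos (y * x)) = 0.
Proof.
move=> tr re.
have [h2 _] := test_cintb ('i * x%:C) tr.
have E : (fun y => Re ((r y)%:C * cexp (y%:C * ('i * x%:C)))) = (fun y => r y * cos (y * x)).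
  apply/funext => y; rewrite imul_real Re_rC Re_cexp /=.
  by rewrite expR0 mul1r.
rewrite E in h2; have [_] := Rintegral_opp h2.
have -> : (fun y => r (- y) * cos (- y * x)) = (fun y => -1 * (r y * cos (y * x))).
  by apply/funext => y; rewrite re mulN1r (mulNr y) cosN mulNr.
rewrite (RintZl (-1) measurableT h2); lra.
Qed.

Lemma compact_supp (g : R -> R[i]) a : (forall x, a <= `|x| -> g x = 0) -> compactly_supported g.
Proof.
move=> g0; apply: (subclosed_compact _ (@segment_compact R (- a) a)); first exact: closed_closure.
have -> : `[- a, a]%classic = closure `[- a, a]%classic by apply/closure_id; exact: itv_closed.
apply: closure_subset => x /= gx; rewrite in_itv /= -ler_norml leNgt.
by apply: contra gx => /ltW /g0 ->.
Qed.

Lemma csmooth_imag r : smooth r -> csmooth (fun x => 'i * (r x)%:C).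
Proof.
move=> sr; split.
  by rewrite (_ : (fun x => _) = fun=> 0); [exact: smooth_cst|apply/funext => x /=; ring].
by rewrite (_ : (fun x => _) = r) //; apply/funext => x /=; ring.
Qed.

Lemma fourier_imag r a z : testfn r a -> fourier (fun x => 'i * (r x)%:C) z = 'i * lt r ('i * z).
Proof.
move=> tr; rewrite -fourier_lt /fourier -cintZ //; first by apply: eq_cint => x _; rewrite mulrA.
have := test_cintb ('i * z) tr; congr cintb; apply/funext => x.
by congr (_ * cexp _); rewrite mulrCA mulrA.
Qed.

Lemma rCB (x y : R) : (x - y)%:C = x%:C - y%:C :> R[i].
Proof. by rewrite rCD rCN. Qed.
Lemma Re_ab (x y : R) : Re (x%:C + (- 'i) * y%:C) = x. Proof. by rewrite /=; ring. Qed.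

Lemma Im_ab (x y : R) : Im (x%:C + (- 'i) * y%:C) = - y. Proof. by rewrite /=; ring. Qed.
Lemma imul_cancel (i b c : R[i]) : i * i = -1 -> c * b = - i * (c * (i * b)).
Proof. by move=> ii; rewrite (_ : - i * _ = - (i * i) * (c * b)); [rewrite ii opprK mul1r|ring]. Qed.

(** (A4) requires a transform that is real on the real line. The even part [e] of [r] has this
    property, and so has [i] times its odd part [o]; the combination e - i (i o) recovers [r]. *)
Lemma explicit_formula f K m r a N : L_datum f K m -> testfn r a ->
  (0 < N)%N -> (forall n, (N <= n)%N -> a <= ln (n%:R : R)) ->
  partial_sum (fun z => (m z)%:C * lt r ('i * z)) @ totally --> datum_value f K r N.
Proof.
move=> [_ A2 _ A4] tr N0 Na; have [pr [pi kp]] := kernel_partsP A2.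
pose e x := 2^-1 * (r x + r (- x)); pose o x := 2^-1 * (r x + -1 * r (- x)).
have te : testfn e a by apply: testfnZ; apply: testfnD => //; exact: testfn_opp.
have to : testfn o a by apply: testfnZ; apply: testfnD => //; apply: testfnZ; exact: testfn_opp.
have ee x : e (- x) = e x by rewrite /e opprK addrC.
have oo_ x : o (- x) = - o x by rewrite /o opprK; ring.
have H1 := A4 (fun x => (e x)%:C) (conj te.1 (@smooth_cst R 0)).
have {}H1 := H1 (compact_supp (fun x ax => congr1 (fun y => y%:C) (te.2 x ax))).
have {}H1 := H1 _; move: H1.
have fe0 x : Im (fourier (fun x => (e x)%:C) x%:C) = 0.
  rewrite fourier_lt /lt /cintegral /=; rewrite -[RHS](cintb_odd_sin x te ee).
  apply: eq_Rintegral => y _; by rewrite imul_real Im_rC Im_cexp /= expR0 mul1r.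
move=> /(_ fe0); have H2 := A4 (fun x => 'i * (o x)%:C) (csmooth_imag to.1).
have o0 x : a <= `|x| -> 'i * (o x)%:C = 0 by move=> /to.2 ->; rewrite mulr0.
have fo0 x : Im (fourier (fun x => 'i * (o x)%:C) x%:C) = 0.
  rewrite (fourier_imag _ to) ImM mul0r add0r mul1r /lt /cintegral /= -[RHS](cintb_even_cos x to oo_).
  apply: eq_Rintegral => y _; by rewrite imul_real Re_rC Re_cexp /= expR0 mul1r.
have {}H2 := H2 (compact_supp o0) fo0.
move=> H1.
set D1 : R[i] := (2 * _)%:C in H1; set D2 : R[i] := (2 * _)%:C in H2.
(* [D1] and [D2] are real, so this combination gives real and imaginary part of the value at once:
   [D1] is the former and [- D2] the latter. *)
have H3 : (fun A => partial_sum (fun z => (m z)%:C * fourier (fun x => (e x)%:C) z) A +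
   (- 'i) * partial_sum (fun z => (m z)%:C * fourier (fun x => 'i * (o x)%:C) z) A) @ totally -->
   D1 + (- 'i) * D2.
  by apply: cvgD; [exact: totally_filter|exact: H1|apply: cvgM; [exact: totally_filter|apply: cvg_cst; exact: totally_filter|exact: H2]].
have -> : datum_value f K r N = D1 + (- 'i) * D2.
  have [k1 k2] := kin_cintb kp tr.
  have ln0 n : (N <= n)%N -> a <= `|ln (n%:R : R)| by move=> /Na /le_trans; apply; exact: ler_norm.
  rewrite /D1 /D2 (lim_sum_eventually _ N0); last by move=> n /ln0 h; rewrite (te.2 _ h) mulr0.
  rewrite (lim_sum_eventually _ N0); last by move=> n /ln0 h; rewrite (to.2 _ h) !mulr0.
  have E1 : Re (cint pos (fun x => K x * ((e 0)%:C - (e x)%:C))) = 2^-1 * Re (cint pos (kin K r)).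
    rewrite /cintegral -(RintZl (2^-1) mpos k1); apply: eq_Rintegral => x _.
    by rewrite Re_kin -rCB Re_rCr /e oppr0; field.
  have E2 : Re (cint pos (fun x => K x * ('i * (o 0)%:C - 'i * (o x)%:C))) = - 2^-1 * Im (cint pos (kin K r)).
    rewrite /cintegral -(RintZl (- 2^-1) mpos k2); apply: eq_Rintegral => x _.
    by rewrite Im_kin -mulrBr -rCB (mulrA (K x)) Re_rCr ReM /= /o ?oppr0; field.
  rewrite /datum_value; apply: complex_ext.
    rewrite Re_ab 2!ReB mulrBr; congr (_ - _).
      by rewrite E1 mulrA divff ?mul1r.
    rewrite Re_sum Re_sum mulr_sumr; apply: eq_bigr => n _.
    by rewrite ReD !Re_rCr Re_conjc /e; field.
  rewrite Im_ab ImB ReB mulrBr opprB [RHS]addrC; congr (_ + _).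
    by rewrite E2 mulrA mulrN divff ?mulN1r ?opprK.
  rewrite Im_sum Re_sum mulr_sumr -sumrN; apply: eq_bigr => n _.
  by rewrite ImD !Im_rCr Im_conjc mulrA Re_rCr ReM /= /o; field.
apply: cvg_ext H3 => A; rewrite /partial_sum mulr_sumr -big_split; apply: eq_bigr => z _ /=.
rewrite fourier_lt (fourier_imag _ to) (_ : lt r _ = lt e ('i * val z) + lt o ('i * val z)).
  have i2 : 'i * 'i = -1 :> R[i] by apply: complex_ext => /=; ring.
  by rewrite mulrDr; congr (_ + _); apply/esym; apply: imul_cancel; exact: i2.
rewrite -(ltD _ te to); congr (lt _ _); apply/funext => x; by rewrite /e /o; field.
Qed.

End ExplicitFormula.

Opaque bump.

(** * The explicit formula along translates of a bump *)

Section Applications.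
Variable R : realType.
Notation half := (`[0, +oo[%classic : set R).
Notation pos := (`]0, +oo[%classic : set R).
Implicit Types (f : nat -> R[i]) (K : R -> R[i]) (m : R[i] -> R) (r : R -> R) (a : R).

Lemma datum_csum f K m r a N (zs : nat -> R[i]) : L_datum f K m -> testfn r a ->
  (0 < N)%N -> (forall n, (N <= n)%N -> a <= ln (n%:R : R)) ->
  injective zs -> (forall z, m z != 0 -> exists j, zs j = z) ->
  csum (fun j => (m (zs j))%:C * lt r ('i * zs j)) @ \oo --> datum_value f K r N /\
  exists B, forall M, \sum_(0 <= j < M) normc ((m (zs j))%:C * lt r ('i * zs j)) <= B.
Proof.
move=> F tr N0 Na zi zc; apply: (net_csum (x := fun z => (m z)%:C * lt r ('i * z))) => //.
  by move=> z h; apply: zc; apply: contraNneq h => ->; rewrite mul0r.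
exact: explicit_formula F tr N0 Na.
Qed.

Lemma Rintegral_gt0 (g : R -> R) x0 : continuous g -> rint setT g -> (forall x, 0 <= g x) ->
  0 < g x0 -> 0 < \int[mu]_x g x.
Proof.
move=> cg ig g0 gx.
have h2 : 0 < g x0 / 2 by lra.
have /cvgrPdist_lt /(_ _ h2) [e /= e0 He] := cg x0.
pose I : set R := `[x0, x0 + e / 2]%classic.
have mI : measurable I by exact: measurable_itv.
have HI x : I x -> g x0 / 2 <= g x.
  rewrite /I /= in_itv /= => /andP[x1 x2]; have := He x; rewrite /= distrC ger0_norm ?subr_ge0 //.
  move=> /(_ _); have xe : x - x0 < e by lra.
  by move=> /(_ xe); have := ler_norm (g x0 - g x); lra.
apply: (@lt_le_trans _ _ (\int[mu]_(x in I) (g x0 / 2))).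
  have H := Rint_cst mI (g x0 / 2).
  have E : fine (mu I) = e / 2.
    by rewrite /I lebesgue_measure_itv /= lte_fin ifT /=; [ring|lra].
  by rewrite H E mulr_gt0 // divr_gt0.
rewrite [leLHS]Rintegral_mkcond; apply: le_Rint => //.
  by apply/(rint_restrict _ mI); apply: rint_segment => x; exact: cvg_cst.
by move=> x _; rewrite patchE; case: ifPn => // xI; apply: HI; rewrite inE in xI.
Qed.

(** On the support of the bump |x Im w| is at most 1, hence below pi/2, so the real part of the
    integrand is nonnegative, and it is positive at 0. *)
Lemma lt_bump_gt0 a (w : R[i]) : 0 < a -> a * `|Im w| <= 1 -> 0 < Re (lt (bump a) w).
Proof.
move=> a0 aw; have [h1 _] := test_cintb w (testfn_bump a).
have E : (fun x => Re ((bump a x)%:C * cexp (x%:C * w))) =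
   fun x => bump a x * (expR (x * Re w) * cos (x * Im w)).
  by apply/funext => x; rewrite Re_rC Re_cexp Re_rC Im_rC.
rewrite E in h1; rewrite /lt /cintegral /= (_ : (fun x => Re _) = fun x => bump a x * (expR (x * Re w) * cos (x * Im w))) //.
apply: (Rintegral_gt0 (x0 := 0)) => //.
- rewrite -E; have [c1 _] := cderiv_continuous (fun t => cderiv_test w t (testfn_bump a)); exact: c1.
- move=> x; have [ax|xa] := leP a `|x|; first by rewrite bump_eq0 ?mul0r.
  rewrite mulr_ge0 ?bump_ge0 // mulr_ge0 //.
  have h : `|x * Im w| <= 1.
    by rewrite normrM; apply: le_trans aw; apply: ler_wpM2r => //; exact: ltW.
  have p2 := pi_ge2 R; move: h; rewrite ler_norml => /andP[x1 x2].
  by apply: cos_ge0_pihalf; apply/andP; split; lra.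
- by rewrite !mul0r expR0 cos0 !mulr1 bump_gt0 ?normr0.
Qed.

Lemma lt_bump_neq0 a (w : R[i]) : 0 < a -> a * `|Im w| <= 1 -> lt (bump a) w != 0.
Proof. by move=> a0 aw; apply: contraTneq (lt_bump_gt0 a0 aw) => ->; rewrite ltxx. Qed.

Section Spikes.
Variable a : R.
Hypotheses (a0 : 0 < a) (a1 : a <= 1) (aln : a <= ln 2).
Notation g0 := (bump a).

(** From this index on log n is at least |t| + 1, so a bump of half-width at most 1 centred at log n
    vanishes at [t]: series of translated bumps become finite sums. *)
Definition log_cutoff (t : R) : nat := (Num.truncn (expR (`|t| + 1))).+1.

Lemma log_cutoffP t n : (log_cutoff t <= n)%N -> `|t| + 1 <= ln (n%:R : R).
Proof.
move=> tn; have h : expR (`|t| + 1) < n%:R.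
  by apply: lt_le_trans (truncnS_gt _) _; rewrite ler_nat.
by rewrite -[leLHS]expRK ler_ln ?posrE ?expR_gt0 ?(lt_trans (expR_gt0 _) h) // ltW.
Qed.

Lemma log_cutoff_ge t n : (log_cutoff t <= n)%N -> a + `|t| <= ln (n%:R : R).
Proof. by move=> /log_cutoffP h; apply: le_trans h; rewrite addrC lerD2l. Qed.

Definition spike (b : nat -> R[i]) (t : R) : R[i] :=
  csum (fun n => b n * (g0 (t - ln n%:R))%:C) (log_cutoff t).

Lemma spike_term0 t n : (log_cutoff t <= n)%N -> g0 (t - ln (n%:R : R)) = 0.
Proof.
move=> /log_cutoff_ge h; apply: bump_eq0; have := ler_normB (ln (n%:R : R)) t.
by have := lerB_dist (ln (n%:R : R)) t; rewrite distrC (ger0_norm (ln_nat_ge0 R n)); lra.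
Qed.

Lemma spike_cvg b t : csum (fun n => b n * (g0 (t - ln n%:R))%:C) @ \oo --> spike b t.
Proof.
apply: cvg_near_cst; exists (log_cutoff t) => // M /= NM; rewrite /csum /spike.
rewrite (@big_cat_nat _ _ _ (log_cutoff t) 0 M) //= [X in _ + X]sum0_nat ?addr0 // => n _ /andP[/spike_term0 -> _].
by rewrite mulr0.
Qed.

Lemma bump_cmeas D (c : R) : cmeas D (fun t => (g0 (t - c))%:C).
Proof.
apply: cmeas_real; apply: measurable_funTS; apply: continuous_measurable_fun.
exact: testfn_continuous (testfn_shift c (testfn_bump a)).
Qed.

Lemma spike_cmeas D b : measurable D -> cmeas D (spike b).
Proof.
move=> mD; apply: (cmeas_lim (w := fun N t => csum (fun n => b n * (g0 (t - ln n%:R))%:C) N)) => //.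
  move=> N; apply: cmeas_sum => n; apply: cmeasM; [exact: cmeas_cst|exact: bump_cmeas].
by move=> t _; exact: spike_cvg.
Qed.

Lemma bump_shift_rint (c : R) : rint setT (fun t => g0 (t - c)) /\
  \int[mu]_t g0 (t - c) = \int[mu]_t g0 t.
Proof.
apply: Rintegral_shift; have [h _] := test_cintb 0 (testfn_bump a).
rewrite (_ : g0 = fun x => Re ((g0 x)%:C * cexp (x%:C * 0))) //.
by apply/funext => x; rewrite mulr0 cexp0 mulr1.
Qed.

Lemma bump_half (c : R) : 0 <= c -> \int[mu]_(t in half) g0 (t - c) <= \int[mu]_t g0 t.
Proof.
move=> c0; have [h1 <-] := bump_shift_rint c; rewrite [leLHS]Rintegral_mkcond.
apply: le_Rint => //; first by apply/(rint_restrict _ mhalf); exact: rint_sub h1.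
by move=> x _; rewrite patchE; case: ifP => // _; exact: bump_ge0.
Qed.

(* A spike at [log n] costs at most [1 / log n] against the weight [1 / (1 + t)]. *)
Lemma spike_rint b B : b 0%N = 0 -> b 1%N = 0 ->
  (forall N, \sum_(0 <= n < N) normc (b n) / ln (n%:R : R) <= B) ->
  rint half (fun t => normc (spike b t) / (1 + t)).
Proof.
move=> b0 b1 bB; pose S := \int[mu]_t g0 t.
have S0 : 0 <= S by apply: Rintegral_ge0 => x _; exact: bump_ge0.
have m1 : measurable_fun half (fun t : R => (1 + t)^-1).
  apply: subspace_continuous_measurable_fun; first exact: mhalf.
  apply: continuous_in_subspaceT => t; rewrite inE /= in_itv /= andbT => t0.
  apply: cvgV; first by rewrite gt_eqF //; lra.
  by apply: cvgD; [exact: cvg_cst|exact: cvg_id].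
pose w n t : R[i] := b n * (g0 (t - ln n%:R))%:C * ((1 + t)^-1)%:C.
have inh t : half t -> 0 <= t by rewrite /= in_itv /= andbT.
have ig (c : R) : rint half (fun t => g0 (t - c)).
  by have [h _] := bump_shift_rint c; apply: rint_sub h.
have nw n t : 0 <= t -> normc (w n t) <= normc (b n) / ln (n%:R : R) * g0 (t - ln n%:R).
  move=> t0; case: n => [|[|n]]; rewrite ?b0 ?b1 /w ?b0 ?b1 ?mul0r ?normc0_ ?mul0r //.
  have l0 : 0 < ln (n.+2%:R : R) by exact: ln_nat_gt0.
  rewrite !normcM_ !normc_rC (ger0_norm (bump_ge0 _ _)) -[X in X <= _]mulrA -[X in _ <= X]mulrA ler_wpM2l //.
  rewrite ger0_norm ?invr_ge0; last by lra.
  have [h|h] := leP a `|t - ln (n.+2%:R : R)|; first by rewrite bump_eq0 ?mulr0 ?mul0r.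
  rewrite mulrC ler_wpM2r ?bump_ge0 // lef_pV2 ?posrE //; last by lra.
  by have := ler_norm (- (t - ln (n.+2%:R : R))); have := a1; move: h; rewrite normrN; lra.
have mw n : cmeas half (w n).
  apply: cmeasM; last exact: cmeas_real.
  by apply: cmeasM; [exact: cmeas_cst|exact: bump_cmeas].
have iw n : cintb half (w n).
  apply: (cintb_le (g := fun t => normc (b n) / ln (n%:R : R) * g0 (t - ln n%:R))) => //.
    by move=> t /inh t0; exact: nw.
  exact: rintZ.
have [|||h _] := @cint_series R half w (fun t => spike b t * ((1 + t)^-1)%:C) (B * S) mhalf iw.
- move=> N; apply: le_trans (ler_wpM2r S0 (bB N)); rewrite mulr_suml; apply: ler_sum => n _.
  have q0 : 0 <= normc (b n) / ln (n%:R : R) by rewrite divr_ge0 ?normc_ge0 ?ln_nat_ge0.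
  apply: le_trans (_ : \int[mu]_(t in half) (normc (b n) / ln (n%:R : R) * g0 (t - ln n%:R)) <= _).
    apply: le_Rint => //; [exact: cintb_normc|exact: rintZ|].
    by move=> t /inh t0; exact: nw.
  rewrite (RintZl _ mhalf (ig _)); apply: ler_wpM2l => //.
  by apply: bump_half; exact: ln_nat_ge0.
- move=> t /inh t0; exists (B * 1) => N; rewrite mulr1; apply: le_trans (bB N); apply: ler_sum => n _.
  apply: le_trans (nw n t t0) _; rewrite ler_piMr ?bump_le1 // divr_ge0 ?ln_nat_ge0 //.
- move=> t _.
  have H : (fun N => csum (fun n => b n * (g0 (t - ln n%:R))%:C) N * ((1 + t)^-1)%:C) @ \oo -->
     spike b t * ((1 + t)^-1)%:C by apply: cvgM; [exact: spike_cvg|exact: cvg_cst].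
  by apply: cvg_ext H => N; rewrite /csum mulr_suml.
apply: (eq_rint _ _ (cintb_normc mhalf h)) => // t /inh t0.
by rewrite normcM_ normc_rC ger0_norm // invr_ge0; lra.
Qed.

(** For large [t] the bump stays away from 0, only - K(x) g0(x - t) survives, and [x] is comparable
    to [t]; for small [t] a constant bound suffices. *)
Lemma kin_shift_bound K : axiom_A2 K -> exists2 C, 0 <= C & forall t, 0 <= t ->
  normc (cint pos (kin K (fun x => g0 (x - t)))) <= C * ((1 + t) ^+ 2)^-1.
Proof.
have a0' := a0; have aln' := aln; move=> /kernel_partsP[pr [pi kp]]; have [C1 c1 H1] := kernel_bounds kp.
have [L L0 gL] := testfn_lipschitz (testfn_bump a).
have [C2 c2 H2] := kin_bound kp ler01 L0.
pose I := \int[mu]_(x in pos) ((1 + x) ^+ 2)^-1.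
have I0 : 0 <= I by apply: Rintegral_ge0 => x _; rewrite invr_ge0 sqr_ge0.
have kI t : cintb pos (kin K (fun x => g0 (x - t))).
  exact: kin_cintb kp (testfn_shift t (testfn_bump a)).
have fin t c : (forall x, pos x -> normc (kin K (fun x => g0 (x - t)) x) <= c * ((1 + x) ^+ 2)^-1) ->
    normc (cint pos (kin K (fun x => g0 (x - t)))) <= c * I.
  move=> h; rewrite -(RintZl c mpos (@rint_inv_sqr_pos R)).
  by apply: cint_le h _ => //; apply: rintZ => //; exact: rint_inv_sqr_pos.
have q0 (t : R) : 0 <= t -> 0 < ((1 + t) ^+ 2)^-1 by move=> t0; rewrite invr_gt0 exprn_gt0 //; lra.
exists ((C2 * 9 + C1 / a * 4) * I).
  by rewrite mulr_ge0 // addr_ge0 ?mulr_ge0 // invr_ge0 ltW.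
move=> t t0; have p0 := q0 t t0; rewrite -mulrA [I * _]mulrC mulrA; apply: fin => x /inpos x0.
have px : 0 < ((1 + x) ^+ 2)^-1 by apply: q0; exact: ltW.
have Ca : 0 <= C1 / a by rewrite divr_ge0 // ltW.
(* [9] is (1 + 2)^2, from [t <= 2 a <= 2]. Beyond, the support forces [x >= t / 2] and [x >= a]: the
   first gives (1 + t)^2 <= 4 (1 + x)^2, the second trades the factor [x] of the kernel bound for
   [1 / a]. *)
have [t2|t2] := leP t (2 * a).
  apply: le_trans (H2 (fun x => g0 (x - t)) x _ _ x0) _.
  - by move=> y; rewrite ger0_norm ?bump_ge0 ?bump_le1.
  - by move=> y z; apply: le_trans (gL _ _) _; rewrite opprB addrA subrK.
  apply: ler_wpM2r; first exact: ltW.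
  have h9 : 1 <= 9 * ((1 + t) ^+ 2)^-1.
    have t9 : (1 + t) ^+ 2 <= 9 by have a1' := a1; rewrite expr2; nra.
    by rewrite ler_pdivlMr ?mul1r // exprn_gt0 //; lra.
  by rewrite mulrDl; have := ler_wpM2l c2 h9; have := mulr_ge0 (mulr_ge0 Ca (ler0n R 4)) (ltW p0); lra.
have z0 : g0 (0 - t) = 0 by apply: bump_eq0; rewrite sub0r normrN ger0_norm //; lra.
have z1 : g0 (- x - t) = 0 by apply: bump_eq0; rewrite -opprD normrN ger0_norm //; lra.
rewrite /kin z0 z1 !mulr0 subr0 sub0r -[X in normc X]mulN1r.
have [h|h] := leP a `|x - t|.
  rewrite bump_eq0 // !mulr0 normc0_; have T0 : 0 <= C2 * 9 + C1 / a * 4 by lra.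
  by rewrite mulr_ge0 ?(ltW px) // mulr_ge0 // ltW.
have xt : t / 2 <= x by have := ler_norm (- (x - t)); rewrite normrN; lra.
have xa : a <= x by lra.
rewrite mulN1r normcN normcM_ normc_rC ger0_norm ?bump_ge0 //.
apply: le_trans (_ : normc (K x) * 1 <= _); first by rewrite ler_wpM2l ?normc_ge0 ?bump_le1.
have [h1 _] := H1 x x0; rewrite mulr1.
have n0 := normc_ge0 (K x).
have e1 : normc (K x) * (1 + x) ^+ 4 <= C1 / a.
  rewrite ler_pdivlMr //; apply: le_trans h1; rewrite mulrAC ler_wpM2r ?exprn_ge0 //; first lra.
  by rewrite ler_wpM2l.
have e2 : (1 + t) ^+ 2 <= 4 * (1 + x) ^+ 2 by nra.
rewrite mulrDl mulrDl; apply: le_trans (_ : C1 / a * 4 / (1 + t) ^+ 2 / (1 + x) ^+ 2 <= _); last first.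
  by rewrite lerDr !mulr_ge0 // ltW.
rewrite -mulrA -invfM ler_pdivlMr; last by rewrite mulr_gt0 // exprn_gt0; lra.
apply: le_trans (_ : normc (K x) * (4 * (1 + x) ^+ 2 * (1 + x) ^+ 2) <= _).
  by apply: ler_wpM2l => //; apply: ler_wpM2r => //; rewrite exprn_ge0; lra.
rewrite [leLHS](_ : _ = 4 * (normc (K x) * (1 + x) ^+ 4)); last by ring.
by move: e1; lra.
Qed.

End Spikes.

End Applications.

Section Symmetry.
Variable R : realType.
Notation half := (`[0, +oo[%classic : set R).
Notation pos := (`]0, +oo[%classic : set R).
Implicit Types (a : R).

Lemma cint_conj D (u : R -> R[i]) : measurable D -> cintb D u ->
  cint D (fun x => conjc (u x)) = conjc (cint D u).
Proof.
move=> mD [u1 u2]; apply: complex_ext; rewrite ?Re_conjc ?Im_conjc /cintegral /=.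
  by apply: eq_Rintegral => x _; rewrite Re_conjc.
have := RintZl (-1) mD u2; rewrite mulN1r => <-.
by apply: eq_Rintegral => x _; rewrite Im_conjc mulN1r.
Qed.

Lemma conjcM (x y : R[i]) : conjc (x * y) = conjc x * conjc y. Proof. exact: rmorphM. Qed.
Lemma conjcD (x y : R[i]) : conjc (x + y) = conjc x + conjc y. Proof. exact: rmorphD. Qed.

Lemma conjcN (x : R[i]) : conjc (- x) = - conjc x. Proof. exact: rmorphN. Qed.
Lemma conjc_rC (x : R) : conjc x%:C = x%:C. Proof. by apply: complex_ext => /=; rewrite ?oppr0. Qed.

Lemma conjc_i (z : R[i]) : conjc ('i * z) = - ('i * conjc z).
Proof. by apply: complex_ext; rewrite ?(Re_conjc, Im_conjc, ReN, ImN, ReM, ImM) /=; ring. Qed.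

Lemma cvg_conjc {T : Type} (F : set_system T) (FF : Filter F) (u : T -> R[i]) (l : R[i]) :
  u @ F --> l -> (fun x => conjc (u x)) @ F --> conjc l.
Proof.
move=> /cvg_ReIm[h1 h2]; apply/cvg_ReIm; rewrite Re_conjc Im_conjc; split.
  by apply: cvg_ext h1 => x; rewrite Re_conjc.
apply: (cvg_ext (u := fun x => - Im (u x))); last exact: cvgN h2.
by move=> x; rewrite Im_conjc.
Qed.

Lemma conjc_csum (u : nat -> R[i]) N : conjc (csum u N) = csum (fun i => conjc (u i)) N.
Proof. exact: rmorph_sum. Qed.

Lemma lt_conj r a (w : R[i]) : testfn r a -> conjc (lt r w) = lt r (conjc w).
Proof.
move=> tr; rewrite /lt -cint_conj //; last exact: test_cintb tr.
by apply: eq_cint => x _; rewrite conjcM conjc_rC -cexp_conjc conjcM conjc_rC.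
Qed.

Lemma lt_even r a (w : R[i]) : testfn r a -> (forall x, r (- x) = r x) -> lt r (- w) = lt r w.
Proof.
move=> tr re; have [_ E] := cint_opp (test_cintb w tr); rewrite [RHS]/lt -E.
by apply: eq_cint => x _; rewrite re rCN mulrN mulNr.
Qed.

Lemma datum_value_opp f K r a N : axiom_A2 K -> testfn r a ->
  datum_value f K (fun x => r (- x)) N = conjc (datum_value f K r N).
Proof.
move=> /kernel_partsP[pr [pi kp]] tr; rewrite /datum_value conjcD conjcN; congr (_ - _).
  rewrite -cint_conj //; last exact: kin_cintb kp tr.
  apply: eq_cint => x _; rewrite /kin oppr0 opprK !conjcD !conjcN !conjcM !conjc_rC conjcK.
  by rewrite -!addrA; congr (_ + _); rewrite addrC.
rewrite /prime_sum rmorph_sum; apply: eq_bigr => n _ /=.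
by rewrite opprK conjcD !conjcM !conjc_rC conjcK addrC.
Qed.

(** The bound 1 fits [log_cutoff], the bound [ln 2] separates the spikes at [n >= 2] from the
    origin, and the last one keeps the transform of the bump nonzero at [i x] whenever |Re x| <= |Re
    z|. *)
Definition width (z : R[i]) : R := Num.min (Num.min 1 (ln 2)) (1 + `|Re z|)^-1.

Lemma width_gt0 z : 0 < width z.
Proof. by rewrite /width !lt_min ltr01 ln2_gt0 /= invr_gt0 addrC ltr_wpDl. Qed.
Lemma width_le1 z : width z <= 1. Proof. by rewrite /width !ge_min lexx. Qed.

Lemma width_ln2 z : width z <= ln 2. Proof. by rewrite /width !ge_min lexx orbT. Qed.

Lemma width_neq0 z (x : R[i]) : `|Re x| <= `|Re z| -> lt (bump (width z)) ('i * x) != 0.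
Proof.
move=> xz; apply: lt_bump_neq0; first exact: width_gt0.
rewrite ImM /= mul0r add0r mul1r; apply: le_trans (_ : (1 + `|Re z|)^-1 * `|Re z| <= _).
  apply: ler_pM => //; [exact: ltW (width_gt0 z)|by rewrite /width ge_min lexx orbT].
by rewrite mulrC ler_pdivrMr ?mul1r ?lerDr // ltr_wpDr.
Qed.

Section Shifts.
Variables (f : nat -> R[i]) (K : R -> R[i]) (m : R[i] -> R) (a : R) (y : R) (zs : nat -> R[i]).
Hypotheses (F : L_datum f K m) (a0 : 0 < a) (a1 : a <= 1) (aln : a <= ln 2).
Notation g0 := (bump a).

Definition shifted_value t : R[i] := datum_value f K (fun x => g0 (x - t)) (log_cutoff t).

(** The bump is even, and reflecting a real test function exchanges the roles of [K] and [f] with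
    their conjugates. *)
Lemma shifted_value_opp t : shifted_value (- t) = conjc (shifted_value t).
Proof.
have [_ A2 _ _] := F; rewrite /shifted_value /log_cutoff normrN -(datum_value_opp f _ A2 (testfn_shift t (testfn_bump a))).
by rewrite (_ : (fun x => g0 (x - - t)) = (fun x => g0 (- x - t))) //; apply/funext => x; rewrite opprK -bump_even opprD.
Qed.

Lemma shifted_csum t : injective zs -> (forall z, m z != 0 -> exists j, zs j = z) ->
  csum (fun j => (m (zs j))%:C * lt g0 ('i * zs j) * cexp (t%:C * ('i * zs j))) @ \oo --> shifted_value t /\
  exists B, forall N, \sum_(0 <= j < N) normc ((m (zs j))%:C * lt g0 ('i * zs j)) <= B.
Proof.
move=> zi zc; have la n : (log_cutoff (0 : R) <= n)%N -> a <= ln (n%:R : R).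
  by move=> h; have := log_cutoff_ge a1 h; rewrite normr0 addr0.
have [_ hB] := datum_csum F (testfn_bump a) (ltn0Sn _) la zi zc; split => //.
have [h _] := datum_csum F (testfn_shift t (testfn_bump a)) (ltn0Sn _) (fun n h => log_cutoff_ge a1 h) zi zc.
apply: cvg_ext h => N; apply: eq_bigr => j _.
by rewrite (lt_shift t _ (testfn_bump a)) -mulrA; congr (_ * _); rewrite mulrC.
Qed.

Lemma shifted_value_cmeas D : measurable D -> injective zs -> (forall z, m z != 0 -> exists j, zs j = z) ->
  cmeas D shifted_value.
Proof.
move=> mD zi zc; apply: (cmeas_lim mD _ (fun t _ => (shifted_csum t zi zc).1)) => N.
apply: cmeas_sum => j; apply: cmeasM; first exact: cmeas_cst.
by exact: cmeas_cexpZ.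
Qed.

Definition prime_coef n : R[i] := if (n <= 1)%N then 0 else - f n.

Definition smooth_value t : R[i] := cint pos (kin K (fun x => g0 (x - t))) - (2 * Re (f 1%N) * g0 t)%:C.

(** At [n = 1] the two conjugate terms add up to [2 Re (f 1) g0(t)] and join the smooth part. For
    [n >= 2] and [t >= 0] the reflected term at - log n vanishes because [a <= ln 2]. *)
Lemma shifted_value_split t : 0 <= t -> shifted_value t = spike a prime_coef t + smooth_value t.
Proof.
move=> t0; rewrite /shifted_value /datum_value /smooth_value addrCA; congr (_ + _).
have N2 : (1 < log_cutoff t)%N.
  rewrite /log_cutoff ltnS truncn_gt0 -[leLHS]expR0 ler_expR; have := normr_ge0 t; lra.
rewrite /prime_sum /spike /csum big_ltn //.
rewrite [in RHS]big_ltn // {1}/prime_coef /= mul0r add0r [in RHS]big_ltn // {1}/prime_coef /= mul0r add0r.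
rewrite ln1 oppr0 !sub0r bump_even.
rewrite opprD addrC; congr (_ + _); last first.
  rewrite -sumrN; apply: eq_big_nat => n /andP[n2 _]; rewrite /prime_coef leqNgt n2 /=.
  have -> : g0 (- ln n%:R - t) = 0.
    apply: bump_eq0; rewrite -opprD normrN ger0_norm ?addr_ge0 ?ln_nat_ge0 //.
    apply: le_trans aln _; apply: ler_wpDr => //; rewrite ler_ln ?posrE ?ltr0n // ?ler_nat //.
    exact: ltn_trans n2.
  by rewrite mulr0 addr0 mulNr -[in RHS]bump_even opprB.
congr (- _); rewrite -mulrDl; apply: complex_ext; rewrite ?Re_rCr ?Im_rCr ?ReD ?ImD ?Re_conjc ?Im_conjc /=; ring.
Qed.

Lemma smooth_value_bound : exists2 C, 0 <= C & forall t, 0 <= t -> normc (smooth_value t) <= C * ((1 + t) ^+ 2)^-1.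
Proof.
have [_ A2 _ _] := F; have [C C0 HC] := kin_shift_bound a0 a1 aln A2.
exists (C + 8 * `|Re (f 1%N)|); first by rewrite addr_ge0 // mulr_ge0.
move=> t t0; apply: le_trans (normcB _ _) _; rewrite [leRHS]mulrDl; apply: lerD; first exact: HC.
rewrite normc_rC 2!normrM.
have p0 : 0 < (1 + t) ^+ 2 by rewrite exprn_gt0 //; lra.
rewrite (ger0_norm (bump_ge0 _ _)) ger0_norm // ler_pdivlMr //.
have [ta|ta] := leP a t; first by rewrite bump_eq0 ?mulr0 ?mul0r ?mulr_ge0 // ger0_norm.
have h4 : (1 + t) ^+ 2 <= 4 by have := a1; rewrite expr2; nra.
have g1 := bump_le1 a t; have gg := bump_ge0 a t; have n0 := normr_ge0 (Re (f 1%N)).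
have : g0 t * (1 + t) ^+ 2 <= 1 * 4 by apply: ler_pM => //; exact: ltW.
by rewrite -mulrA => h; have := ler_wpM2l n0 h; lra.
Qed.

End Shifts.

End Symmetry.

(** * Symmetry of the zeros under conjugation *)

Section Vanishing.
Variable R : realType.
Notation half := (`[0, +oo[%classic : set R).
Notation pos := (`]0, +oo[%classic : set R).
Implicit Types (m : R[i] -> R).

Lemma Re_iM (z : R[i]) : Re ('i * z) = - Im z.
Proof. by rewrite ReM /= mul0r mul1r sub0r. Qed.
Lemma Im_iM (z : R[i]) : Im ('i * z) = Re z.
Proof. by rewrite ImM /= mul0r mul1r add0r. Qed.

Lemma im_inj (z x : R[i]) : 'i * z = 'i * x -> z = x.
Proof.
move=> h; apply: complex_ext; first by rewrite -!Im_iM h.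
by apply: oppr_inj; rewrite -!Re_iM h.
Qed.

Lemma inv_sqr_decay (C e : R) : 0 <= C -> 0 < e -> exists2 T : R, 0 <= T &
  forall t, T <= t -> C * ((1 + t) ^+ 2)^-1 <= e.
Proof.
move=> C0 e0; exists (C / e); first by rewrite divr_ge0 // ltW.
move=> t; rewrite ler_pdivrMr // => h; have t0 : 0 <= t.
  by move: C0 h e0; nra.
rewrite ler_pdivrMr; last by rewrite exprn_gt0 //; lra.
by rewrite expr2; nra.
Qed.

(** [growth_extraction] reaches only zeros with [Re (i z) >= 0]; this symmetry brings in the others.
    The values at [t] and [- t] are conjugate, so the exponential sum with coefficients proportional
    to m(z) - m(conj z) is identically 0, and the extraction applies with [E1 = E2 = 0]. *)
Lemma m_conj f K m : L_datum f K m -> forall z, m (conjc z) = m z.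
Proof.
move=> F; suff H z : Im z <= 0 -> m (conjc z) = m z.
  move=> z; have [/H //|iz] := leP (Im z) 0.
  by have := H (conjc z); rewrite conjcK Im_conjc => -> //; lra.
move=> iz; have [_ _ A3 _] := F.
have [y [zs [y0 zi zy zcov zlf]]] := supp_enumeration A3.
have zc x : m x != 0 -> exists j, zs j = x by move=> /zcov[].
pose zs' j := conjc (zs j).
have zi' : injective zs' by move=> j k /(congr1 (@conjc R)); rewrite /zs' !conjcK; exact: zi.
have zc' x : m x != 0 -> exists j, zs' j = x.
  by move=> /zcov[_ [j jx]]; exists j; rewrite /zs' jx conjcK.
pose a := width z; have a0 : 0 < a := width_gt0 z.
have a1 : a <= 1 := width_le1 z; have aln : a <= ln 2 := width_ln2 z.
pose c j := ((m (zs j))%:C - (m (zs' j))%:C) * lt (bump a) ('i * zs j).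
have [_ [B cB]] := shifted_csum F a1 0 zi zc.
have [_ [B' cB']] := shifted_csum F a1 0 zi' zc'.
have ltE j : lt (bump a) ('i * zs j) = conjc (lt (bump a) ('i * zs' j)).
  rewrite (lt_conj _ (testfn_bump a)) conjc_i /zs' conjcK.
  by rewrite (lt_even _ (testfn_bump a)) //; exact: bump_even.
have cB2 N : \sum_(0 <= j < N) normc (c j) <= B + B'.
  apply: le_trans (lerD (cB N) (cB' N)); rewrite -big_split; apply: ler_sum => j _.
  rewrite /c mulrBl; apply: le_trans (normcB _ _) _; rewrite lerD2l {1}ltE.
  by rewrite !normcM_ normc_conjc.
have cE t : csum (fun j => c j * cexp (t%:C * ('i * zs j))) @ \oo --> (0 : R[i]).
  have [h1 _] := shifted_csum F a1 t zi zc; have [h2 _] := shifted_csum F a1 (- t) zi' zc'.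
  pose u2 := csum (fun j => (m (zs' j))%:C * lt (bump a) ('i * zs' j) * cexp ((- t)%:C * ('i * zs' j))).
  have h3 : (fun N => conjc (u2 N)) @ \oo --> shifted_value f K a t.
    by rewrite -[shifted_value _ _ _ _]conjcK -(shifted_value_opp a F); apply: cvg_conjc; exact: h2.
  rewrite -[X in _ --> X](subrr (shifted_value f K a t)).
  have h4 : (fun N => csum (fun j => (m (zs j))%:C * lt (bump a) ('i * zs j) * cexp (t%:C * ('i * zs j))) N
    - conjc (u2 N)) @ \oo --> shifted_value f K a t - shifted_value f K a t.
    by apply: cvgB; [exact: h1|exact: h3].
  apply: cvg_ext h4 => N; rewrite /= /u2 conjc_csum.
  rewrite /csum -sumrB; apply: eq_bigr => j _; rewrite /c 2!conjcM conjc_rC -ltE -cexp_conjc.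
  rewrite (_ : conjc ((- t)%:C * ('i * zs' j)) = t%:C * ('i * zs j)); first by rewrite !mulrBl.
  by rewrite conjcM conjc_rC conjc_i /zs' conjcK rCN mulrN mulNr opprK.
apply: contrapT => mz; have mz' : (m z != 0) || (m (conjc z) != 0).
  by apply: contrapT => /negP; rewrite negb_or !negbK => /andP[/eqP h1 /eqP h2]; apply: mz; rewrite h1 h2.
have [j jz] : exists j, zs j = z.
  case/orP: mz' => [/zc //|/zc'[j jx]]; exists j.
  by rewrite -[LHS]conjcK -/(zs' j) jx conjcK.
have : c j = 0.
  apply: (@growth_extraction R c (fun j => 'i * zs j) y (B + B') 0 (fun=> 0) (fun=> 0)).
  - exact: y0.
  - by move=> k _; rewrite Re_iM; have := zy k; rewrite ler_norml => /andP[h _]; lra.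
  - exact: cB2.
  - by move=> k l ck cl /im_inj /zi.
  - by move=> T; have [N HN] := zlf T; exists N => k _; rewrite Im_iM; exact: HN.
  - by move=> t t0; rewrite addr0; exact: cE.
  - exact: cmeas_cst.
  - exact: cmeas_cst.
  - rewrite (_ : (fun t => _) = fun=> 0); first exact: (rint0 mhalf).
    by apply/funext => t; rewrite normc0_ mul0r.
  - by move=> t _; rewrite normc0_.
  - by move=> e e0; exists 0 => t _; rewrite normc0_ ltW.
  - by rewrite Re_iM jz; lra.
rewrite /c /zs' jz => /eqP; rewrite mulf_eq0 (negbTE (width_neq0 (lexx _))) orbF subr_eq0.
by move=> /eqP /(congr1 (@complex.Re R)) /= h; apply: mz.
Qed.

End Vanishing.

(** * Convolution with Dirichlet coefficients on the half-line *)

Section Truncation.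
Variable R : realType.
Notation half := (`[0, +oo[%classic : set R).
Implicit Types (s w : R[i]) (t u : R).

Lemma Rintegral_cut (D E : set R) (v u : R -> R) : E `<=` D -> (forall x, D x -> ~ E x -> v x = 0) ->
  (forall x, E x -> v x = u x) -> \int[mu]_(x in D) v x = \int[mu]_(x in E) u x.
Proof.
move=> ED v0 vu; rewrite Rintegral_mkcond [RHS]Rintegral_mkcond; congr Rintegral; apply/funext => x.
rewrite /patch; have [xE|xE] := boolP (x \in E).
  have Ex : E x by move: xE; rewrite inE.
  by rewrite mem_set ?vu //; exact: ED.
case: ifP => // /set_mem Dx; apply: v0 => // Ex; move/negP: xE; apply; exact: mem_set.
Qed.

Lemma cint_cut (D E : set R) (v u : R -> R[i]) : E `<=` D -> (forall x, D x -> ~ E x -> v x = 0) ->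
  (forall x, E x -> v x = u x) -> cint D v = cint E u.
Proof.
move=> ED v0 vu; rewrite /cintegral; congr (_ +i* _); apply: Rintegral_cut => //.
- by move=> x Dx Ex; rewrite v0.
- by move=> x Ex; rewrite vu.
- by move=> x Dx Ex; rewrite v0.
- by move=> x Ex; rewrite vu.
Qed.

Transparent cpow.
Lemma cpowE k s : cpow k s = cexp (s * (ln (k%:R : R))%:C). Proof. by []. Qed.
Opaque cpow.

Definition cut G u : R[i] := if 0 <= u then G u else 0.

Lemma cutE G : cut G = G \_ half.
Proof.
by apply/funext => u; rewrite /cut /patch mem_setE in_itv /= andbT.
Qed.

Section Series.
Variables (A : nat -> R[i]) (BA : R).
Hypotheses (AB : forall N, \sum_(0 <= k < N) normc (A k) <= BA).

(** For [A n = a_F(n) / sqrt n] this is L_F(1/2 + w), so that the critical line becomes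
    [Re w = 0]. *)
Definition lser w : R[i] := xget 0 [set l | csum (fun k => A k * cpow k (- w)) @ \oo --> l].

Lemma BA_ge0 : 0 <= BA.
Proof. by apply: le_trans (AB 0); rewrite big_geq. Qed.

Lemma normc_cpowN_le1 k w : 0 <= Re w -> normc (cpow k (- w)) <= 1.
Proof.
move=> w0; rewrite normc_cpow -[leRHS]expR0 ler_expR ReN mulNr oppr_le0 mulr_ge0 //.
exact: ln_nat_ge0.
Qed.

Lemma lserP w : 0 <= Re w -> csum (fun k => A k * cpow k (- w)) @ \oo --> lser w.
Proof.
move=> w0; have [l Hl] : exists l : R[i], csum (fun k => A k * cpow k (- w)) @ \oo --> l.
  apply: (@abs_csum_cvg R _ BA) => N; apply: le_trans (AB N); apply: ler_sum => k _.
  by rewrite normcM_ ler_piMr // normc_cpowN_le1.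
exact: (@xgetPex _ 0 [set l | csum (fun k => A k * cpow k (- w)) @ \oo --> l] (ex_intro _ l Hl)).
Qed.

Lemma lserE w l : 0 <= Re w -> csum (fun k => A k * cpow k (- w)) @ \oo --> l -> lser w = l.
Proof. by move=> w0 h; apply: (cvgc_unique (lserP w0) h). Qed.

Lemma lser_bound s : 0 <= Re s -> normc (lser s) <= BA.
Proof.
move=> s0.
have H n : normc (csum (fun k => A k * cpow k (- s)) n) <= BA.
  apply: le_trans (normc_csum _ _) _; apply: le_trans (AB n); apply: ler_sum => k _.
  by rewrite normcM_ ler_piMr // normc_cpowN_le1.
exact: normc_lim_le H (lserP s0).
Qed.

(** Convolution with the measure of mass [A k] at log k, [G] being extended by 0 to negative
    arguments. *)
Definition tconv G t : R[i] := csum (fun k => A k * cut G (t - ln k%:R)) (log_cutoff t).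

Lemma cut_term0 G t k : (log_cutoff t <= k)%N -> cut G (t - ln k%:R) = 0.
Proof.
move=> /log_cutoffP h; rewrite /cut ifF //; apply/negP => h2; have := ler_norm t; lra.
Qed.

Lemma tconv_cvg G t : csum (fun k => A k * cut G (t - ln k%:R)) @ \oo --> tconv G t.
Proof.
apply: cvg_near_cst; exists (log_cutoff t) => // N /= tN.
rewrite /tconv /csum [LHS](big_cat_nat _ tN) // [X in _ + X = _]big_nat [X in _ + X = _]big1 ?addr0 //.
by move=> k /andP[kt _]; rewrite cut_term0 // mulr0.
Qed.

Lemma tconv_bound G t S : 0 <= S -> (forall u, 0 <= u -> normc (G u) <= S) -> normc (tconv G t) <= BA * S.
Proof.
move=> S0 GS; apply: le_trans (normc_csum _ _) _; apply: le_trans (ler_wpM2r S0 (AB (log_cutoff t))).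
rewrite mulr_suml; apply: ler_sum => k _; rewrite normcM_ ler_wpM2l // /cut.
by case: ifP => [/GS //|_]; rewrite normc0_.
Qed.

Lemma tconvD G G' t : (forall u, 0 <= u -> u <= t -> True) ->
  tconv (fun u => G u + G' u) t = tconv G t + tconv G' t.
Proof.
move=> _; rewrite /tconv -csumD; apply: eq_bigr => k _; rewrite -mulrDr /cut.
by case: ifP; rewrite ?addr0.
Qed.

Lemma tconvZ (c : R[i]) G t : tconv (fun u => c * G u) t = c * tconv G t.
Proof.
rewrite /tconv -csumZ; apply: eq_bigr => k _; rewrite mulrCA /cut.
by case: ifP; rewrite ?mulr0.
Qed.

Lemma eq_tconv G G' t : (forall u, 0 <= u -> G u = G' u) -> tconv G t = tconv G' t.
Proof.
by move=> GG; apply: eq_bigr => k _; rewrite /cut; case: ifP => // /GG ->.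
Qed.

Lemma tconv_csum (g : nat -> R -> R[i]) G t : (forall u, 0 <= u -> csum (g ^~ u) @ \oo --> G u) ->
  csum (fun i => tconv (g i) t) @ \oo --> tconv G t.
Proof.
move=> gG.
have E N : csum (fun i => tconv (g i) t) N = tconv (fun u => csum (g ^~ u) N) t.
  rewrite /tconv /csum exchange_big; apply: eq_bigr => k _; rewrite -mulr_sumr /cut.
  by case: ifP => // _; rewrite big1.
have H M : (fun N => csum (fun k => A k * cut (fun u => csum (g ^~ u) N) (t - ln k%:R)) M) @ \oo -->
    csum (fun k => A k * cut G (t - ln k%:R)) M.
  elim: M => [|M IH].
    by rewrite /csum big_geq //; apply: cvg_ext (cvg_cst _) => N; rewrite big_geq.
  have H2 : (fun N => A M * cut (fun u => csum (g ^~ u) N) (t - ln M%:R)) @ \oo -->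
      A M * cut G (t - ln M%:R).
    apply: cvgM; first exact: cvg_cst.
    by rewrite /cut; case: ifP => [/gG //|_]; exact: cvg_cst.
  have -> : csum (fun k => A k * cut G (t - ln k%:R)) M.+1 =
      csum (fun k => A k * cut G (t - ln k%:R)) M + A M * cut G (t - ln M%:R).
    by rewrite /csum big_nat_recr.
  by apply: cvg_ext (cvgD IH H2) => N; rewrite [RHS]/csum big_nat_recr.
by apply: cvg_ext (H (log_cutoff t)) => N; rewrite E.
Qed.

Lemma A_tail e : 0 < e -> exists M, forall N, \sum_(0 <= k < N | (M <= k)%N) normc (A k) <= e.
Proof. move=> e0; apply: (@nneg_sum_tail R (fun k => normc (A k)) 0 BA) => //. Qed.

(** For [k] beyond some [M] the tail of the sum of |A k| is small; for the finitely many others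
    [t - log k] is eventually large. *)
Lemma tconv_cvg0 G S : 0 <= S -> (forall u, 0 <= u -> normc (G u) <= S) ->
  (forall e : R, 0 < e -> exists T : R, forall u, T <= u -> normc (G u) <= e) ->
  forall e : R, 0 < e -> exists T : R, forall t, T <= t -> normc (tconv G t) <= e.
Proof.
move=> S0 GS G0 e e0.
have S1 : 0 < S + 1 by lra.
have B1 : 0 < BA + 1 by have := BA_ge0; lra.
have e1 : 0 < e / 2 / (S + 1) by rewrite !divr_gt0.
have e2 : 0 < e / 2 / (BA + 1) by rewrite !divr_gt0.
have [M HM] := A_tail e1; have [T HT] := G0 _ e2.
exists (T + ln M.+1%:R) => t tT; apply: le_trans (normc_csum _ _) _.
rewrite (bigID (fun k => (M <= k)%N)) [leRHS](splitr e); apply: lerD.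
  apply: le_trans (_ : e / 2 / (S + 1) * (S + 1) <= _); last by rewrite divfK ?lt0r_neq0.
  apply: le_trans (ler_wpM2r (ltW S1) (HM (log_cutoff t))); rewrite mulr_suml.
  apply: ler_sum => k _; rewrite normcM_ ler_wpM2l // /cut.
  by case: ifP => [/GS h|_]; [apply: le_trans h _; lra|rewrite normc0_ ltW].
apply: le_trans (_ : (BA + 1) * (e / 2 / (BA + 1)) <= _); last by rewrite mulrC divfK ?lt0r_neq0.
have h : BA * (e / 2 / (BA + 1)) <= (BA + 1) * (e / 2 / (BA + 1)) by rewrite ler_wpM2r; lra.
apply: le_trans h; apply: le_trans (ler_wpM2r (ltW e2) (AB (log_cutoff t))); rewrite mulr_suml.
rewrite big_mkcond; apply: ler_sum => k _; case: ifP => [Mk|_]; last by rewrite mulr_ge0 ?normc_ge0 ?ltW.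
rewrite normcM_ ler_wpM2l // /cut; case: ifP => [_|_]; last by rewrite normc0_ ltW.
apply: HT; rewrite lerBrDr; apply: le_trans tT; rewrite lerD2l.
move: Mk; rewrite -ltnNge => kM; case: k kM => [|k] kM.
  by rewrite (_ : ln 0%:R = 0) ?ln_nat_ge0 // ln0.
by rewrite ler_ln ?posrE ?ltr0n // ler_nat; move: kM => /andP[_ /ltnW /leqW].
Qed.

Definition expw w u : R[i] := cexp (u%:C * w).

Lemma cexp_sub_ln t k w : cexp ((t - ln (k%:R : R))%:C * w) = cexp (t%:C * w) * cpow k (- w).
Proof.
by rewrite cpowE -cexpD; congr cexp; rewrite rCB; ring.
Qed.

(** For [Re w >= 0] this is the sum over log k > t of A k e^((t - log k) w): bounded, and small for
    large [t]. Convolution thus multiplies e^(tw) by L(w) up to an error tending to 0. *)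
Definition rem w t : R[i] := lser w * expw w t - tconv (expw w) t.

Lemma rem_cvg w t : 0 <= Re w ->
  csum (fun k => if 0 <= t - ln k%:R then 0 else A k * expw w (t - ln k%:R)) @ \oo --> rem w t.
Proof.
move=> w0.
have H1 : (fun N => csum (fun k => A k * cpow k (- w)) N * expw w t -
     csum (fun k => A k * cut (expw w) (t - ln k%:R)) N) @ \oo --> rem w t.
  apply: cvgB; last exact: tconv_cvg.
  by apply: cvgM; [exact: lserP|exact: cvg_cst].
apply: cvg_ext H1 => N; rewrite /csum mulr_suml -sumrB; apply: eq_bigr => k _.
rewrite /cut /expw cexp_sub_ln; case: ifP => _; ring.
Qed.

Lemma rem_term_le w t k : 0 <= Re w ->
  normc (if 0 <= t - ln k%:R then 0 else A k * expw w (t - ln k%:R)) <= normc (A k).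
Proof.
move=> w0; case: ifP => [_|/negbT]; first by rewrite normc0_ normc_ge0.
rewrite -ltNge => h; rewrite normcM_ ler_piMr // normc_cexp -[leRHS]expR0 ler_expR Re_rC.
by rewrite mulr_le0_ge0 // ltW.
Qed.

Lemma rem_bound w t : 0 <= Re w -> normc (rem w t) <= BA.
Proof.
move=> w0; have H N : normc (csum (fun k => if 0 <= t - ln k%:R then 0 else A k * expw w (t - ln k%:R)) N) <= BA.
  apply: le_trans (normc_csum _ _) _.
  by apply: le_trans (AB N); apply: ler_sum => k _; exact: rem_term_le.
refine (@normc_lim_le R nat \oo _ _ _ _ H (rem_cvg (t := t) w0)).
Qed.

Lemma rem_cvg0 w : 0 <= Re w -> forall e : R, 0 < e -> exists T : R, forall t, T <= t -> normc (rem w t) <= e.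
Proof.
move=> w0 e e0; have [M HM] := A_tail e0; exists (ln M.+1%:R) => t tT.
have H N : normc (csum (fun k => if 0 <= t - ln k%:R then 0 else A k * expw w (t - ln k%:R)) N) <= e;
  last refine (@normc_lim_le R nat \oo _ _ _ _ H (rem_cvg (t := t) w0)).
apply: le_trans (normc_csum _ _) _; apply: le_trans (HM N); rewrite [leRHS]big_mkcond; apply: ler_sum => k _; case: leqP => [_|kM].
  exact: rem_term_le.
rewrite ifT ?normc0_ // subr_ge0; apply: le_trans tT; case: k kM => [|k] kM.
  by rewrite (_ : ln 0%:R = 0) ?ln_nat_ge0 // ln0.
by rewrite ler_ln ?posrE ?ltr0n // ler_nat; exact: leqW (ltnW kM).
Qed.

Definition lap s G : R[i] := cint half (fun t => G t * expw (- s) t).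

(** The convolution theorem: translation by log k multiplies the transform by k^(-s). *)
Lemma laplace_tconv s G : 0 < Re s -> cintb half (fun t => G t * expw (- s) t) ->
  cintb half (fun t => tconv G t * expw (- s) t) /\ lap s (tconv G) = lser s * lap s G.
Proof.
move=> s0 iG.
pose u0 := cut (fun t => G t * expw (- s) t).
have iu0 : cintb setT u0.
  rewrite /u0 cutE; have [i1 i2] := iG; split.
    have := proj1 (rint_restrict _ mhalf) i1; apply: eq_rint => // x _.
    by rewrite /patch; case: ifP.
  have := proj1 (rint_restrict _ mhalf) i2; apply: eq_rint => // x _.
  by rewrite /patch; case: ifP.
have eu0 : cint setT u0 = lap s G.
  apply: cint_cut => // x; rewrite /u0 /cut /= in_itv /= andbT; last by move=> ->.
  by move=> _ /negP /negbTE ->.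
pose w k t := A k * cut G (t - ln k%:R) * expw (- s) t.
have wE k : w k = fun t => A k * cpow k (- s) * u0 (t + (- ln k%:R)).
  apply/funext => t; rewrite /w /u0 /cut; case: ifP => _; last by rewrite !mulr0 mul0r.
  rewrite /expw cexp_sub_ln opprK.
  have : cpow k (- s) * cpow k s = 1 by rewrite -cpowD addNr cpow0.
  move: (cpow k s) (cpow k (- s)) (cexp _) (G _) => p q e g pq.
  have -> : A k * q * (g * (e * p)) = A k * g * e * (q * p) by ring.
  by rewrite pq mulr1.
have iwT k : cintb setT (w k) by rewrite wE; apply: cintbZ => //; case: (cint_shift (- ln k%:R) iu0).
have iw k : cintb half (w k) by apply: cintb_sub (iwT k) => //; exact: mhalf.
have wh k t : ~ half t -> w k t = 0.
  rewrite /= in_itv /= andbT => /negP; rewrite -ltNge => t0; rewrite /w /cut ifF ?mulr0 ?mul0r //.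
  by apply/negP => h; have := ln_nat_ge0 R k; lra.
have ew k : cint half (w k) = A k * cpow k (- s) * lap s G.
  rewrite (cint_supp (wh k)) wE; have [i1 e1] := cint_shift (- ln k%:R) iu0.
  by rewrite cintZ // e1 eu0.
have nu0 := cintb_normc measurableT iu0.
pose I0 := \int[mu]_t normc (u0 t).
have I00 : 0 <= I0 by apply: Rintegral_ge0.
have nw k : \int[mu]_(t in half) normc (w k t) <= normc (A k) * I0.
  rewrite Rintegral_supp; last by move=> t /wh ->; rewrite normc0_.
  have [i1 e1] := Rintegral_shift (- ln k%:R) nu0.
  apply: le_trans (_ : \int[mu]_t (normc (A k) * normc (u0 (t + - ln k%:R))) <= _).
    apply: (le_Rint measurableT); first exact: (cintb_normc measurableT (iwT k)).
      by apply: rintZ => //; exact: i1.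
    move=> t _; rewrite wE normcM_ ler_wpM2r // normcM_ ler_piMr //.
    by apply: normc_cpowN_le1; exact: ltW.
  by rewrite (RintZl _ measurableT i1) e1.
have [|||h1 h2] := @cint_series R half w (fun t => tconv G t * expw (- s) t) (BA * I0) mhalf iw.
- move=> N; apply: le_trans (ler_wpM2r I00 (AB N)); rewrite mulr_suml.
  by apply: ler_sum => k _; exact: nw.
- move=> t _; exists (\sum_(0 <= k < log_cutoff t) normc (w k t)) => N.
  have [tN|tN] := leqP (log_cutoff t) N.
    rewrite (big_cat_nat _ tN) // gerDl big_nat big1 // => k /andP[kt _].
    by rewrite /w cut_term0 // mulr0 mul0r normc0_.
  by apply: ler_sum_nat_mono (ltnW tN).
- move=> t _.
  have H : (fun N => csum (fun k => A k * cut G (t - ln k%:R)) N * expw (- s) t) @ \oo -->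
      tconv G t * expw (- s) t by apply: cvgM; [exact: tconv_cvg|exact: cvg_cst].
  by apply: cvg_ext H => N; rewrite /csum mulr_suml.
split => //; apply: (cvgc_unique h2).
have H : (fun N => csum (fun k => A k * cpow k (- s)) N * lap s G) @ \oo --> lser s * lap s G.
  by apply: cvgM; [apply: lserP; exact: ltW|exact: cvg_cst].
by apply: cvg_ext H => N; rewrite /csum mulr_suml; apply: eq_bigr => k _; rewrite ew.
Qed.

Lemma expw_powexp s : expw (- s) = powexp s 0.
Proof. by apply/funext => t; rewrite /expw /powexp expr0 mul1r. Qed.

Lemma laplace_expw s w : 0 < Re (s - w) -> cintb half (fun t => expw w t * expw (- s) t) /\
  lap s (expw w) = (s - w)^-1.
Proof.
move=> sw; have [h1 h2] := lap_term 0 1 sw.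
have E : (fun t => 1 * cexp (t%:C * w) * powexp s 0 t) = (fun t => expw w t * expw (- s) t).
  by apply/funext => t; rewrite mul1r expw_powexp.
by rewrite /lap -E; split => //; rewrite h2 mul1r expr1 fact0 div1r.
Qed.

(** Here [Re s] may be smaller than [Re w], so that e^(tw) need not have a transform at [s]. As L
    vanishes at [w], the convolved exponential is minus the bounded remainder and does have one,
    with the value that the convolution theorem suggests. *)
Lemma laplace_rem s w : 0 < Re s -> 0 <= Re w -> lser w = 0 -> s != w ->
  cintb half (fun t => tconv (expw w) t * expw (- s) t) /\ lap s (tconv (expw w)) = lser s / (s - w).
Proof.
move=> s0 w0 lw sw.
have remE t : tconv (expw w) t = - rem w t by rewrite /rem lw mul0r sub0r opprK.
have ws : w - s != 0 by rewrite subr_eq0 eq_sym.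
(* With [b = log k] this is the exponential restricted to [t < b], where the [k]-th term of the
   remainder lives. *)
pose v (b t : R) : R[i] := if b <= t then 0 else expw (w - s) t.
have vb b t : 0 <= t -> normc (cexp (- b%:C * w) * v b t) <= expR (- Re s * t).
  move=> t0; rewrite /v; case: ifPn => [_|]; first by rewrite mulr0 normc0_ expR_ge0.
  rewrite -ltNge => h.
  rewrite normcM_ normc_cexp normc_cexp -expRD ler_expR !Re_rC -rCN Re_rC ReB.
  have : (b - t) * Re w >= 0 by rewrite mulr_ge0 // subr_ge0 ltW.
  lra.
have ig : rint half (fun t => expR (- Re s * t)) by exact: rint_expRN.
have FTC b : 0 <= b -> cintb `[0, b] (expw (w - s)) /\
    cint `[0, b] (expw (w - s)) = (cexp (b%:C * (w - s)) - 1) / (w - s).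
  move=> b0; pose F t := (w - s)^-1 * cexp (t%:C * (w - s)).
  have dF t : cderiv F t (expw (w - s) t).
    apply: (cderiv_eq (cderivZ (w - s)^-1 (cderiv_cexpx (w - s) t))).
    by rewrite mulrA mulVf // mul1r.
  have [c1 c2] := cderiv_continuous (fun t => cderiv_cexpx (w - s) t).
  split; first exact: cintb_segment.
  by rewrite (cint_FTC b0 dF c1 c2) /F mul0r cexp0; ring.
have mv b : cmeas half (v b).
  have -> : v b = (fun t => expw (w - s) t * (1 - cut (fun=> 1) (t - b))).
    apply/funext => t; rewrite /v /cut subr_ge0; case: ifP => _; ring.
  apply: cmeasM; first by exact: cmeas_cexpZ.
  apply: cmeasD; [exact: cmeas_cst|apply: cmeasN].
  apply: (cmeas_sub (E := setT)) => //.
  have -> : (fun t => cut (fun=> 1 : R[i]) (t - b)) = (fun=> 1 : R[i]) \_ `[b, +oo[.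
    by apply/funext => t; rewrite /cut /patch mem_setE in_itv /= andbT subr_ge0.
  by apply: cmeas_patch; [exact: measurable_itv|exact: cmeas_cst].
have iv b : cintb half (fun t => cexp (- b%:C * w) * v b t).
  apply: (cintb_le (g := fun t => expR (- Re s * t)) mhalf _ _ ig).
    by apply: cmeasM; [exact: cmeas_cst|exact: mv].
  by move=> t /inhalf; exact: vb.
have iv' b : cintb half (v b).
  have := cintbZ (cexp (b%:C * w)) mhalf (iv b); apply: eq_cintb; first exact: mhalf.
  by move=> t _; rewrite mulrA -cexpD mulNr addrN cexp0 mul1r.
have ev b : 0 <= b -> cint half (v b) = (cexp (b%:C * (w - s)) - 1) / (w - s).
  move=> b0; have [f1 f2] := FTC b b0; rewrite -f2.
  have f1' : cintb `[0, b[ (expw (w - s)).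
    by apply: cintb_sub f1 => // t; rewrite /= !in_itv /= => /andP[-> /ltW ->].
  rewrite (@cint_cut half `[0, b[ _ (expw (w - s))); first last.
  - by move=> t; rewrite /= in_itv /= => /andP[_ tb]; rewrite /v leNgt tb.
  - by move=> t /inhalf t0; rewrite /= in_itv /= t0 /= /v => /negP; rewrite -leNgt => ->.
  - by move=> t; rewrite /= !in_itv /= andbT => /andP[].
  by rewrite /cintegral; congr (_ +i* _); apply: Rintegral_itv_bndo_bndc; case: f1'.
pose x k t := - (if 0 <= t - ln k%:R then 0 else A k * expw w (t - ln k%:R)) * expw (- s) t.
have xE k : x k = fun t => - A k * (cexp (- (ln (k%:R : R))%:C * w) * v (ln k%:R) t).
  apply/funext => t; rewrite /x /v subr_ge0; case: ifP => _; first by rewrite oppr0 !mulr0 mul0r.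
  rewrite /expw mulNr mulNr -mulrA -!cexpD; congr (- (_ * cexp _)); rewrite rCB; ring.
have ix k : cintb half (x k) by rewrite xE; apply: cintbZ; [exact: mhalf|exact: iv].
have nx k t : half t -> normc (x k t) <= normc (A k) * expR (- Re s * t).
  move=> /inhalf t0; rewrite xE normcM_ normcN; apply: ler_wpM2l.
    exact: normc_ge0.
  exact: vb.
pose I0 := \int[mu]_(t in half) expR (- Re s * t).
have I00 : 0 <= I0 by apply: Rintegral_ge0.
have [|||h1 h2] := @cint_series R half x (fun t => tconv (expw w) t * expw (- s) t) (BA * I0) mhalf ix.
- move=> N; apply: le_trans (ler_wpM2r I00 (AB N)); rewrite mulr_suml; apply: ler_sum => k _.
  rewrite -(RintZl _ mhalf ig).
  apply: (le_Rint mhalf); last exact: nx.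
    by apply: cintb_normc; [exact: mhalf|exact: ix].
  by apply: rintZ => //; exact: mhalf.
- move=> t ht; exists (BA * expR (- Re s * t)) => N.
  apply: le_trans (ler_wpM2r (expR_ge0 _) (AB N)); rewrite mulr_suml; apply: ler_sum => k _.
  exact: nx.
- move=> t _; rewrite remE.
  have H : (fun N => - csum (fun k => if 0 <= t - ln k%:R then 0 else A k * expw w (t - ln k%:R)) N
      * expw (- s) t) @ \oo --> - rem w t * expw (- s) t.
    by apply: cvgM; [apply: cvgN; exact: rem_cvg|exact: cvg_cst].
  by apply: cvg_ext H => N; rewrite /csum -sumrN mulr_suml.
split => //; apply: (cvgc_unique h2).
(* Integrated term by term, the remainder gives A k (k^(-s) - k^(-w)) / (s - w), and the second
   series sums to L(w) = 0. *)
have H : (fun N => (csum (fun k => A k * cpow k (- s)) N - csum (fun k => A k * cpow k (- w)) N) / (s - w)) @ \oo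
    --> (lser s - lser w) / (s - w).
  apply: cvgM; last exact: cvg_cst.
  by apply: cvgB; apply: lserP => //; exact: ltW.
rewrite lw subr0 in H; apply: cvg_ext H => N; rewrite /csum -sumrB mulr_suml; apply: eq_bigr => k _.
rewrite xE cintZ; [|exact: mhalf|exact: iv].
rewrite cintZ; [|exact: mhalf|exact: iv'].
rewrite ev; last exact: ln_nat_ge0.
have -> : cexp ((ln (k%:R : R))%:C * (w - s)) = cpow k (- s) * cpow k w.
  by rewrite -cpowD addrC cpowE mulrC.
have -> : cexp (- (ln (k%:R : R))%:C * w) = cpow k (- w) by rewrite cpowE mulNr mulNr mulrC.
have <- : - (s - w) = w - s by rewrite opprB.
rewrite invrN; have := mulVf (cpow_neq0 k w); rewrite (cpowN k w).
move: (s - w)^-1 (cpow k w) (cpow k w)^-1 (cpow k (- s)) (A k) => e p p' q b pp.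
have -> : - b * (p' * ((q * p - 1) * - e)) = b * e * (q * (p' * p) - p') by ring.
by rewrite pp; ring.
Qed.

(** Exponents with negative real part fall under the convolution theorem, the others under
    [laplace_rem]. The common bound [BA] is what later dominates the sum over the zeros. *)
Lemma laplace_tconv_expw s w : 0 < Re s -> (0 <= Re w -> lser w = 0) -> s != w ->
  [/\ cintb half (fun t => tconv (expw w) t * expw (- s) t), lap s (tconv (expw w)) = lser s / (s - w)
  & forall t, 0 <= t -> normc (tconv (expw w) t) <= BA].
Proof.
move=> s0 lw sw; have [w0|w0] := leP 0 (Re w).
  have [h1 h2] := laplace_rem s0 w0 (lw w0) sw; split => // t t0.
  have := rem_bound t w0; rewrite /rem lw // mul0r sub0r.
  by rewrite normcN.
have sw0 : 0 < Re (s - w) by rewrite ReB; lra.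
have [i1 e1] := laplace_expw sw0; have [i2 e2] := laplace_tconv s0 i1.
split => //; first by rewrite e2 e1.
move=> t t0; rewrite -[leRHS]mulr1; apply: tconv_bound => // u u0.
by rewrite normc_cexp -[leRHS]expR0 ler_expR Re_rC mulr_ge0_le0 // ltW.
Qed.

End Series.
End Truncation.

Lemma dconv_sum_weighted (V : comPzRingType) (x y c : nat -> V) M :
  \sum_(1 <= n < M) dconv x y n * c n =
  \sum_(1 <= d < M) \sum_(1 <= e < M | (d * e < M)%N) x d * y e * c (d * e)%N.
Proof.
transitivity (\sum_(1 <= n < M) \sum_(1 <= d < M) \sum_(1 <= e < M | (d * e == n)%N) x d * y e * c (d * e)%N).
  apply: eq_big_nat => n hn; rewrite (dconv_widen _ _ hn) mulr_suml.
  by apply: eq_bigr => d _; rewrite mulr_suml; apply: eq_bigr => e /eqP ->.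
rewrite exchange_big /=; apply: eq_big_nat => d /andP[d1 dn].
rewrite (exchange_big_dep xpredT) //= [RHS]big_mkcond; apply: eq_big_nat => e /andP[e1 en].
case: ifP => deN.
  rewrite (eq_bigl (fun n => (d * e == n)%N && true)); last by move=> i; rewrite andbT.
  by rewrite big_nat_eq // muln_gt0 d1 e1.
rewrite sum0_nat // => n /eqP den /andP[_].
by rewrite -den deN.
Qed.

(** * Vanishing of L at the zeros, and its partial fractions *)

Section FunctionalRelation.
Variable R : realType.
Notation half := (`[0, +oo[%classic : set R).

Lemma ln_expN_bound (n : nat) (e : R) : 0 < e -> ln (n%:R : R) * expR (- e * ln n%:R) <= e^-1.
Proof.
move=> e0; rewrite -[leRHS]mul1r ler_pdivlMr // mulrAC mulNr expRN -ler_pdivlMr ?invr_gt0 ?expR_gt0 //.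
rewrite invrK mul1r mulrC; apply: le_trans (expR_ge1Dx _); lra.
Qed.

Variables (f : nat -> R[i]) (K : R -> R[i]) (m : R[i] -> R) (a y : R) (zs : nat -> R[i]).
Hypotheses (F : L_datum f K m) (a0 : 0 < a) (a1 : a <= 1) (aln : a <= ln 2).
Hypotheses (y0 : 0 <= y) (zi : injective zs) (zy : forall j, `|Im (zs j)| <= y)
  (zcov : forall z, m z != 0 -> exists j, zs j = z)
  (zlf : forall T, exists N, forall j, `|Re (zs j)| <= T -> (j < N)%N).
Variables (A : nat -> R[i]) (BA : R).
Hypotheses (A0 : A 0%N = 0) (AB : forall N, \sum_(0 <= k < N) normc (A k) <= BA).
Notation g0 := (bump a).
Let c j := (m (zs j))%:C * lt g0 ('i * zs j).
Let w j : R[i] := 'i * zs j.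
Let G := shifted_value f K a.
Let S := smooth_value f K a.

Let pE := dconv A (prime_coef f).

Lemma spike_upto b t N : (log_cutoff t <= N)%N ->
  csum (fun n => b n * (g0 (t - ln n%:R))%:C) N = spike a b t.
Proof.
move=> tN; rewrite /spike /csum (big_cat_nat _ tN) //= [X in _ + X = _]big_nat.
rewrite [X in _ + X = _]big1 ?addr0 // => n /andP[nt _].
by rewrite (spike_term0 a1 nt) mulr0.
Qed.

(** Translation by log k moves the spike at log n to log (k n). The cut at 0 is harmless: the
    coefficients vanish for [n <= 1], and [a <= ln 2] keeps the other spikes in positive
    arguments. *)
Lemma tconv_spike t : 0 <= t -> tconv A (spike a (prime_coef f)) t = spike a pE t.
Proof.
move=> t0; pose M := log_cutoff t; pose p := prime_coef f.
have M0 : (0 < M)%N by [].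
have E1 k : (0 < k)%N -> cut (spike a p) (t - ln k%:R) =
    \sum_(1 <= n < M | (k * n < M)%N) p n * (g0 (t - ln (k * n)%:R))%:C.
  move=> k0; have kl := ln_nat_ge0 R k.
  have lnM n : (0 < n)%N -> t - ln k%:R - ln n%:R = t - ln (k * n)%:R.
    by move=> n0; rewrite natrM lnM ?posrE ?ltr0n // opprD addrA.
  have E2 : \sum_(1 <= n < M) p n * (g0 (t - ln (k * n)%:R))%:C =
     \sum_(1 <= n < M | (k * n < M)%N) p n * (g0 (t - ln (k * n)%:R))%:C.
    rewrite [RHS]big_mkcond; apply: eq_bigr => n _; case: ifPn => //; rewrite -leqNgt => h.
    by rewrite (spike_term0 a1 h) mulr0.
  rewrite -E2 /cut; case: ifPn => [tk|].
    rewrite -(@spike_upto p _ M).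
      rewrite /csum big_ltn // {1}/p /prime_coef /= mul0r add0r; apply: eq_big_nat => n /andP[n0 _].
      by rewrite lnM.
    by rewrite /M /log_cutoff ltnS; apply: le_truncn; rewrite ler_expR lerD2r !ger0_norm //; lra.
  rewrite -ltNge => tk; rewrite big_seq big1 // => n; rewrite mem_index_iota => /andP[n0 _].
  rewrite /p /prime_coef; case: ifPn => [_|]; first by rewrite mul0r.
  rewrite -ltnNge => n2; rewrite bump_eq0 ?mulr0 //.
  have l2 : ln 2 <= ln (n%:R : R) by rewrite ler_ln ?posrE ?ltr0n // ?ler_nat //.
  by rewrite -lnM // ler0_norm; have := aln; have := a0; lra.
have -> : tconv A (spike a p) t = \sum_(1 <= k < M) A k * cut (spike a p) (t - ln k%:R).
  by rewrite /tconv /csum big_ltn // A0 mul0r add0r.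
transitivity (\sum_(1 <= n < M) dconv A p n * (g0 (t - ln n%:R))%:C).
  rewrite dconv_sum_weighted; apply: eq_big_nat => k /andP[k0 _].
  by rewrite E1 // mulr_sumr; apply: eq_bigr => n _; rewrite mulrA.
have p0 : pE 0%N = 0 by rewrite /pE /dconv big_geq.
by rewrite /spike /csum [RHS]big_ltn // p0 mul0r add0r.
Qed.

Lemma tconv_shifted t : 0 <= t -> tconv A G t = spike a pE t + tconv A S t.
Proof.
move=> t0; rewrite -tconv_spike // -tconvD //; apply: eq_tconv => u u0.
by rewrite /G shifted_value_split.
Qed.

Lemma c_bound : exists2 Bc, 0 <= Bc & forall N, \sum_(0 <= j < N) normc (c j) <= Bc.
Proof.
have [_ [B cB]] := shifted_csum F a1 0 zi zcov.
by exists B => //; apply: le_trans (cB 0%N); rewrite big_geq.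
Qed.

Lemma tconv_poles t : csum (fun j => c j * tconv A (expw (w j)) t) @ \oo --> tconv A G t.
Proof.
have H : csum (fun j => tconv A (fun u => c j * expw (w j) u) t) @ \oo --> tconv A G t.
  by apply: tconv_csum => u u0; have [h _] := shifted_csum F a1 u zi zcov; exact: h.
by apply: cvg_ext H => N; apply: eq_bigr => j _; rewrite tconvZ.
Qed.

Let BA0 : 0 <= BA := BA_ge0 AB.

Lemma tconv_expw_bound v t : Re v < 0 -> normc (tconv A (expw v) t) <= BA.
Proof.
move=> v0; rewrite -[leRHS]mulr1; apply: (tconv_bound AB) => // u u0.
by rewrite normc_cexp -[leRHS]expR0 ler_expR Re_rC mulr_ge0_le0 // ltW.
Qed.

Lemma expR_linN_decay (b : R) : b < 0 -> forall e : R, 0 < e -> exists T : R, forall u, T <= u -> expR (u * b) <= e.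
Proof.
move=> b0 e e0; exists (ln e / b) => u; rewrite ler_ndivrMr // => h.
by rewrite -[leRHS](lnK e0) ler_expR.
Qed.

(** After convolution the exponential of [w j] carries [c j] times L at [w j] when [Re (w j) >= 0],
    with an error vanishing at infinity; the exponentials with [Re (w j) < 0] decay altogether.
    [growth_extraction] applies to what remains. *)
Lemma lser_pole BE j : (forall N, \sum_(0 <= n < N) normc (pE n) / ln (n%:R : R) <= BE) ->
  0 <= Re (w j) -> c j * lser A (w j) = 0.
Proof.
move=> pB wj; have [Bc Bc0 cB] := c_bound.
(* [phi i] is what the convolved exponential leaves after its main term. Each is bounded by [BA] and
   tends to 0, so by domination their sum against the [c i] tends to 0 as well and can be absorbed
   in [E2]. *)
pose phi i t := if 0 <= Re (w i) then - rem A (w i) t else tconv A (expw (w i)) t.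
have phiB i t : normc (phi i t) <= BA.
  rewrite /phi; case: ifPn => [w0|]; last by rewrite -ltNge; exact: tconv_expw_bound.
  by rewrite normcN; exact: (rem_bound AB).
have cphiB N t : \sum_(0 <= i < N) normc (c i * phi i t) <= Bc * BA.
  apply: le_trans (ler_wpM2r BA0 (cB N)); rewrite mulr_suml; apply: ler_sum => i _.
  by rewrite normcM_ ler_wpM2l //.
have /choice[Phi HPhi] t : exists l : R[i], csum (fun i => c i * phi i t) @ \oo --> l.
  by apply: (@abs_csum_cvg R _ (Bc * BA)) => N; exact: cphiB.
pose c' i := if 0 <= Re (w i) then c i * lser A (w i) else 0.
suff : c' j = 0 by rewrite /c' wj.
have cE t : csum (fun i => c' i * cexp (t%:C * w i)) @ \oo --> tconv A G t - Phi t.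
  have H : (fun N => csum (fun i => c i * tconv A (expw (w i)) t) N - csum (fun i => c i * phi i t) N) @ \oo
     --> tconv A G t - Phi t by apply: cvgB; [exact: tconv_poles|exact: HPhi].
  apply: cvg_ext H => N; rewrite /csum -sumrB; apply: eq_bigr => i _.
  rewrite /c' /phi; case: ifP => _; last by rewrite subrr mul0r.
  by rewrite /rem /expw; ring.
pose E1 := spike a pE; pose E2 t := tconv A G t - Phi t - E1 t.
have E12 t : E1 t + E2 t = tconv A G t - Phi t by rewrite /E2 [LHS]addrC subrK.
have E2E t : 0 <= t -> E2 t = tconv A S t - Phi t.
  by move=> t0; rewrite /E2 tconv_shifted //; rewrite /E1; ring.
have [C C0 HC] := smooth_value_bound F a0 a1 aln.
have SB t : 0 <= t -> normc (S t) <= C.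
  move=> t0; apply: le_trans (HC t t0) _; rewrite ler_piMr // invf_le1 ?exprn_gt0 //; last by lra.
  by rewrite exprn_ege1 //; lra.
have S0 (e : R) : 0 < e -> exists T : R, forall t, T <= t -> normc (S t) <= e.
  move=> e0; have [T T0 HT] := inv_sqr_decay C0 e0.
  by exists T => t Tt; apply: le_trans (HC t (le_trans T0 Tt)) (HT t Tt).
have Phi0 : Phi @ +oo --> (0 : R[i]).
  apply: (@tannery R R +oo _ (fun t i => c i * phi i t) Phi (fun i => normc (c i) * BA) (Bc * BA)) => //.
  - by move=> N; rewrite -mulr_suml ler_wpM2r.
  - by move=> t i; rewrite normcM_ ler_wpM2l //.
  - move=> i; rewrite -[X in _ --> X](mulr0 (c i)).
    have H : (fun t => phi i t) @ +oo --> (0 : R[i]).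
      apply/cvg_normcP => e e0; have e2 : 0 < e / 2 by rewrite divr_gt0.
      have [T HT] : exists T : R, forall t, T <= t -> normc (phi i t) <= e / 2.
        have [w0|w0] := leP 0 (Re (w i)).
          have [T HT] := rem_cvg0 AB w0 e2; exists T => t Tt.
          by rewrite /phi w0 normcN HT.
        have [T HT] : exists T : R, forall t, T <= t -> normc (tconv A (expw (w i)) t) <= e / 2; last first.
          by exists T => t /HT; rewrite /phi ifF //; apply/negbTE; rewrite -ltNge.
        apply: (tconv_cvg0 AB (S := 1)) => //.
          by move=> u u0; rewrite normc_cexp -[leRHS]expR0 ler_expR Re_rC mulr_ge0_le0 // ltW.
        move=> d /(expR_linN_decay w0)[T HT]; exists T => u /HT.
        by rewrite normc_cexp Re_rC.
      near=> t; rewrite sub0r normcN.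
      apply: le_lt_trans (HT t _) _; last by lra.
      by near: t; apply: nbhs_pinfty_ge; exact: num_real.
    have H2 : (fun=> c i) @ (+oo : set_system R) --> c i by exact: cvg_cst.
    exact: (cvgM H2 H).
have mE1 : cmeas half E1 by exact: (spike_cmeas a1 _ mhalf).
have mE2 : cmeas half E2.
  apply: cmeasD; last exact: cmeasN.
  apply: (@cmeas_lim R half (fun N t => csum (fun i => c' i * cexp (t%:C * w i)) N)); first exact: mhalf.
    move=> N; apply: (@cmeas_sum R half (fun i t => c' i * cexp (t%:C * w i))) => i.
    apply: cmeasM; first exact: cmeas_cst.
    by exact: cmeas_cexpZ.
  by move=> t _; exact: cE.
have iE1 : rint half (fun t => normc (E1 t) / (1 + t)).
  apply: (@spike_rint R a a1 pE BE) => //; first by rewrite /pE /dconv big_geq.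
  by rewrite /pE /dconv big_nat1 big1_seq // => e /andP[/eqP + _]; rewrite mul1n => ->; rewrite mulr0.
have PhiB t : normc (Phi t) <= Bc * BA.
  have H N : normc (csum (fun i => c i * phi i t) N) <= Bc * BA by apply: le_trans (normc_csum _ _) (cphiB N t).
  exact: normc_lim_le H (HPhi t).
apply: (@growth_extraction R c' w y (Bc * BA) (BA * C + Bc * BA) E1 E2).
- exact: y0.
- by move=> k _; rewrite Re_iM; have := zy k; rewrite ler_norml => /andP[h _]; lra.
- move=> N; apply: le_trans (ler_wpM2r BA0 (cB N)); rewrite mulr_suml; apply: ler_sum => i _.
  rewrite /c'; case: ifPn => w0; last by rewrite normc0_ mulr_ge0 //.
  rewrite normcM_ ler_wpM2l //.
  exact: (lser_bound AB).
- by move=> k l _ _ /im_inj /zi.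
- by move=> T; have [N HN] := zlf T; exists N => k _; rewrite Im_iM; exact: HN.
- by move=> t _; rewrite E12; exact: cE.
- exact: mE1.
- exact: mE2.
- exact: iE1.
- move=> t t0; rewrite E2E //; apply: le_trans (normcB _ _) _; apply: lerD (PhiB t).
  by apply: (tconv_bound AB).
- move=> e e0; have e2 : 0 < e / 2 by rewrite divr_gt0.
  have [T1 HT1] := tconv_cvg0 AB C0 SB S0 e2.
  move/cvg_normcP : Phi0 => /(_ _ e2) [T2 [_ HT2]].
  exists (Num.max 0 (Num.max T1 (T2 + 1))) => t; rewrite !ge_max => /andP[t0 /andP[t1 t2]].
  rewrite E2E // [leRHS](splitr e); apply: le_trans (normcB _ _) _; apply: lerD (HT1 t t1) _.
  have : normc (0 - Phi t) < e / 2 by apply: HT2; lra.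
  by rewrite normc_distC subr0 => /ltW.
- exact: wj.
Unshelve. all: by end_near. Qed.

Definition log_coef (B : nat -> R[i]) n : R[i] := - ((ln (n%:R : R))%:C * B n).
Let bE := log_coef A.
Hypothesis Aconv : forall n, (0 < n)%N ->
  (ln (n%:R : R))%:C * A n = dconv (fun k => if k == 1%N then 0 else f k) A n.

(** This is where convolution pays: the spike weights, built from [f], become log n A n up to sign,
    as in L' = (L'/L) L. *)
Lemma pE_log : pE = bE.
Proof.
apply/funext => -[|n]; first by rewrite /pE /dconv big_geq // /bE /log_coef A0 mulr0 oppr0.
rewrite /bE /log_coef Aconv // [in RHS]dconvC -mulN1r -dconvZr.
apply: eq_dconv => // d /andP[d0 _]; rewrite /prime_coef.
by case: d d0 => [|[|d]] //= _; rewrite ?mulr0 ?mulN1r.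
Qed.

(** Divided by log n, the new spike weights are at most |A n| in modulus, which is summable; this is
    the hypothesis of [lser_pole]. *)
Lemma lser_zero j : 0 <= Re (w j) -> c j * lser A (w j) = 0.
Proof.
apply: (@lser_pole BA) => N; apply: le_trans (AB N); apply: ler_sum => n _.
rewrite pE_log /bE /log_coef normcN normcM_ normc_rC ger0_norm ?ln_nat_ge0 //.
have [->|n0] := eqVneq (ln (n%:R : R)) 0; first by rewrite !mul0r normc_ge0.
by rewrite mulrAC divff // mul1r.
Qed.

(** log n times n^(- Re s) is at most 1 / Re s, so the series of L' converges absolutely for
    [Re s > 0] although only the sum of |A n| is controlled. *)
Lemma lap_spike s : 0 < Re s -> [/\ csum (fun k => bE k * cpow k (- s)) @ \oo --> lser bE s,
  cintb half (fun t => spike a bE t * expw (- s) t) & lap s (spike a bE) = lt g0 s * lser bE s].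
Proof.
move=> s0.
have bB N : \sum_(0 <= k < N) normc (bE k * cpow k (- s)) <= BA / Re s.
  apply: le_trans (ler_wpM2r _ (AB N)); last by rewrite invr_ge0 ltW.
  rewrite mulr_suml; apply: ler_sum => k _; rewrite normcM_ normc_cpow /bE /log_coef.
  rewrite normcN normcM_ normc_rC ger0_norm ?ln_nat_ge0 //.
  by rewrite mulrAC mulrC ler_wpM2l // ReN; exact: ln_expN_bound.
have H : csum (fun k => bE k * cpow k (- s)) @ \oo --> lser bE s.
  have [l Hl] := abs_csum_cvg bB.
  exact: (@xgetPex _ 0 [set l | csum (fun k => bE k * cpow k (- s)) @ \oo --> l] (ex_intro _ l Hl)).
pose v x := (g0 x)%:C * cexp (x%:C * - s).
have iv : cintb setT v by exact: (test_cintb _ (testfn_bump a)).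
pose x k t := bE k * (g0 (t - ln k%:R))%:C * expw (- s) t.
have xE k : x k = fun t => bE k * cpow k (- s) * v (t + - ln k%:R).
  apply/funext => t; rewrite /x /v /expw cexp_sub_ln opprK.
  have : cpow k (- s) * cpow k s = 1 by rewrite -cpowD addNr cpow0.
  move: (cpow k s) (cpow k (- s)) (cexp _) (g0 _)%:C (bE k) => p q e g b pq.
  have -> : b * q * (g * (e * p)) = b * g * e * (q * p) by ring.
  by rewrite pq mulr1.
have ixT k : cintb setT (x k) by rewrite xE; apply: cintbZ => //; case: (cint_shift (- ln k%:R) iv).
have ix k : cintb half (x k) by apply: cintb_sub (ixT k) => //; exact: mhalf.
have xh k t : ~ half t -> x k t = 0.
  rewrite /= in_itv /= andbT => /negP; rewrite -ltNge => t0; rewrite /x.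
  have bE0 : bE 0%N = 0 by rewrite /bE /log_coef A0 mulr0 oppr0.
  have bE1 : bE 1%N = 0 by rewrite /bE /log_coef ln1 mul0r oppr0.
  case: k => [|[|k]]; rewrite ?bE0 ?bE1 ?mul0r //.
  rewrite bump_eq0 ?mulr0 ?mul0r //.
  have l2 : ln 2 <= ln (k.+2%:R : R) by rewrite ler_ln ?posrE ?ltr0n // ?ler_nat //.
  by rewrite ler0_norm; have := aln; have := a0; lra.
have ex k : cint half (x k) = bE k * cpow k (- s) * lt g0 s.
  rewrite (cint_supp (xh k)) xE; have [i1 e1] := cint_shift (- ln k%:R) iv.
  by rewrite cintZ // e1 -(lt_even s (testfn_bump a) (bump_even a)).
have nv := cintb_normc measurableT iv.
pose I0 := \int[mu]_t normc (v t).
have I00 : 0 <= I0 by apply: Rintegral_ge0.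
have nx k : \int[mu]_(t in half) normc (x k t) <= normc (bE k * cpow k (- s)) * I0.
  rewrite Rintegral_supp; last by move=> t /xh ->; rewrite normc0_.
  have [i1 e1] := Rintegral_shift (- ln k%:R) nv.
  rewrite /I0 -e1 -(RintZl _ measurableT i1).
  apply: (le_Rint measurableT); first exact: (cintb_normc measurableT (ixT k)).
    by apply: rintZ => //; exact: i1.
  by move=> t _; rewrite xE normcM_.
have [|||h1 h2] := @cint_series R half x (fun t => spike a bE t * expw (- s) t) (BA / Re s * I0) mhalf ix.
- move=> N; apply: le_trans (ler_wpM2r I00 (bB N)); rewrite mulr_suml.
  by apply: ler_sum => k _; exact: nx.
- move=> t _; exists (\sum_(0 <= k < log_cutoff t) normc (x k t)) => N.
  have [tN|tN] := leqP (log_cutoff t) N.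
    rewrite (big_cat_nat _ tN) //= gerDl big_nat big1 // => k /andP[kt _].
    by rewrite /x (spike_term0 a1 kt) mulr0 mul0r normc0_.
  by apply: ler_sum_nat_mono (ltnW tN).
- move=> t _.
  have H2 : (fun N => csum (fun k => bE k * (g0 (t - ln k%:R))%:C) N * expw (- s) t) @ \oo -->
      spike a bE t * expw (- s) t by apply: cvgM; [exact: spike_cvg|exact: cvg_cst].
  by apply: cvg_ext H2 => N; rewrite /csum mulr_suml.
split => //; apply: (cvgc_unique h2).
have H2 : (fun N => lt g0 s * csum (fun k => bE k * cpow k (- s)) N) @ \oo --> lt g0 s * lser bE s.
  by apply: cvgM; [exact: cvg_cst|exact: H].
by apply: cvg_ext H2 => N; rewrite /csum mulr_sumr; apply: eq_bigr => k _; rewrite ex mulrC.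
Qed.

Lemma smooth_value_cmeas : cmeas half S.
Proof.
have m1 := shifted_value_cmeas F a1 mhalf zi zcov.
have m2 : cmeas half (spike a (prime_coef f)) by exact: (spike_cmeas a1 _ mhalf).
have E t : half t -> G t - spike a (prime_coef f) t = S t.
  by move=> /inhalf t0; rewrite /G shifted_value_split // addrC addKr.
apply: (@cmeas_lim R half (fun _ t => G t - spike a (prime_coef f) t)); first exact: mhalf.
  by move=> _; apply: cmeasD => //; exact: cmeasN.
by move=> t ht; rewrite E //; exact: cvg_cst.
Qed.

Lemma smooth_value_cintb s : 0 <= Re s -> cintb half (fun t => S t * expw (- s) t).
Proof.
move=> s0; have [C C0 HC] := smooth_value_bound F a0 a1 aln.
apply: (cintb_le (g := fun t => C * ((1 + t) ^+ 2)^-1) mhalf).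
- apply: cmeasM; first exact: smooth_value_cmeas.
  by exact: cmeas_cexpZ.
- move=> t /inhalf t0; rewrite normcM_; apply: le_trans (HC t t0).
  by rewrite ler_piMr // normc_cexp -[leRHS]expR0 ler_expR Re_rC ReN mulrN oppr_le0 mulr_ge0.
- by apply: rintZ; [exact: mhalf|exact: rint_inv_sqr].
Qed.

(** The Laplace transform of the convolved explicit formula: a partial fraction expansion of L'/L,
    multiplied by L and by the transform of the bump. In this form it holds at every [s] off the
    zeros with [Re s > 0], with no continuation of L. *)
Lemma functional_relation s : 0 < Re s -> (forall j, c j != 0 -> s != w j) ->
  csum (fun j => c j / (s - w j) * lser A s) @ \oo --> lt g0 s * lser bE s + lser A s * lap s S.
Proof.
move=> s0 sw; have [Bc Bc0 cB] := c_bound.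
have [_ i1 e1] := lap_spike s0.
have [i2 e2] := laplace_tconv AB s0 (smooth_value_cintb (ltW s0)).
have eG : lap s (tconv A G) = lt g0 s * lser bE s + lser A s * lap s S.
  rewrite -e1 -e2 /lap -(cintD mhalf i1 i2).
  by apply: eq_cint => t /inhalf t0; rewrite tconv_shifted // pE_log mulrDl.
have LT j : c j != 0 -> [/\ cintb half (fun t => tconv A (expw (w j)) t * expw (- s) t),
    lap s (tconv A (expw (w j))) = lser A s / (s - w j)
    & forall t, 0 <= t -> normc (tconv A (expw (w j)) t) <= BA].
  move=> cj; apply: (laplace_tconv_expw AB s0) => [wj|]; last exact: sw.
  by have /eqP := lser_zero wj; rewrite mulf_eq0 (negbTE cj) => /eqP.
pose x j t := c j * (tconv A (expw (w j)) t * expw (- s) t).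
have x0 j : c j = 0 -> x j = fun=> 0 by move=> h; apply/funext => t; rewrite /x h mul0r.
have ix j : cintb half (x j).
  have [/x0 ->|/LT[h _ _]] := eqVneq (c j) 0; first exact: (cintb0 mhalf).
  by apply: cintbZ => //; exact: mhalf.
have ig : rint half (fun t => expR (- Re s * t)) by exact: rint_expRN.
pose I0 := \int[mu]_(t in half) expR (- Re s * t).
have I00 : 0 <= I0 by apply: Rintegral_ge0.
have nx j t : half t -> normc (x j t) <= normc (c j) * (BA * expR (- Re s * t)).
  move=> /inhalf t0; have [cj|/LT[_ _ h]] := eqVneq (c j) 0.
    by rewrite x0 // normc0_ !mulr_ge0.
  rewrite 2!normcM_ ler_wpM2l // ler_pM ?h //.
  by rewrite normc_cexp ler_expR Re_rC ReN mulrC.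
have [|||h1 h2] := @cint_series R half x (fun t => tconv A G t * expw (- s) t) (Bc * (BA * I0)) mhalf ix.
- move=> N; apply: le_trans (ler_wpM2r (mulr_ge0 BA0 I00) (cB N)); rewrite mulr_suml; apply: ler_sum => j _.
  rewrite -(RintZl _ mhalf ig) -(RintZl _ mhalf); last first.
    by apply: rintZ => //; exact: mhalf.
  apply: (le_Rint mhalf); last exact: nx.
    by apply: cintb_normc; [exact: mhalf|exact: ix].
  by do 2!(apply: rintZ; first exact: mhalf).
- move=> t ht; exists (Bc * (BA * expR (- Re s * t))) => N.
  apply: le_trans (ler_wpM2r (mulr_ge0 BA0 (expR_ge0 _)) (cB N)); rewrite mulr_suml; apply: ler_sum => j _.
  exact: nx.
- move=> t _.
  have H : (fun N => csum (fun j => c j * tconv A (expw (w j)) t) N * expw (- s) t) @ \oo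
      --> tconv A G t * expw (- s) t by apply: cvgM; [exact: tconv_poles|exact: cvg_cst].
  by apply: cvg_ext H => N; rewrite /csum mulr_suml; apply: eq_bigr => j _; rewrite /x mulrA.
rewrite -eG; apply: cvg_ext h2 => N; apply: eq_bigr => j _.
have [cj|cj] := eqVneq (c j) 0; first by rewrite x0 // cint0 cj !mul0r.
have [i e _] := LT j cj; rewrite cintZ; [|exact: mhalf|exact: i].
by move: e; rewrite /lap => ->; rewrite mulrA mulrAC.
Qed.

End FunctionalRelation.

(** With [A] the unit of convolution nothing is convolved and L is replaced by 1, so [lser_pole]
    gives the vanishing of the coefficient itself. Conjugation symmetry reduces to zeros with
    [Im z <= 0]. *)
Lemma summable_vanish (R : realType) (f : nat -> R[i]) (K : R -> R[i]) (m : R[i] -> R) B0 : L_datum f K m ->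
  (forall N, \sum_(2 <= n < N) normc (f n) / ln (n%:R : R) <= B0) -> forall z, m z = 0.
Proof.
move=> F fB z; wlog iz : z / Im z <= 0.
  move=> H; have [/H //|iz] := leP (Im z) 0.
  by rewrite -(m_conj F); apply: H; rewrite Im_conjc; lra.
apply/eqP/negPn/negP => mz; have [_ _ A3 _] := F.
have [y [zs [y0 zi zy zcov zlf]]] := supp_enumeration A3.
have [j jz] := (zcov z mz).1; pose A k : R[i] := (k == 1%N)%:R.
have AB N : \sum_(0 <= k < N) normc (A k) <= 1.
  case: N => [|[|N]]; [by rewrite big_geq|by rewrite big_nat1 normc0_|].
  rewrite big_ltn // big_ltn // normc0_ normc1_ add0r sum0_nat ?addr0 // => k _ /andP[k2 _].
  by rewrite /A gtn_eqF // normc0_.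
have pB N : \sum_(0 <= n < N) normc (dconv A (prime_coef f) n) / ln (n%:R : R) <= B0.
  have p0 n : (n <= 1)%N -> normc (dconv A (prime_coef f) n) / ln (n%:R : R) = 0.
    by case: n => [|[|n]] // _; rewrite ?ln1 ?invr0 ?mulr0 // /dconv big_geq // normc0_ mul0r.
  have [N2|N2] := leqP 2 N.
    apply: le_trans (fB N); rewrite big_ltn ?(ltn_trans _ N2) // big_ltn // !p0 // !add0r.
    rewrite big_nat [leRHS]big_nat; apply: ler_sum => n /andP[n2 _].
    by rewrite dconv1n ?(ltnW n2) // /prime_coef leqNgt n2 /= normcN.
  by apply: le_trans (fB 0%N); rewrite [leRHS]big_geq // big1_seq // => n; rewrite mem_index_iota => /andP[_ nN]; rewrite p0 //; lia.
have wj : 0 <= Re ('i * zs j) by rewrite Re_iM jz; lra.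
have := lser_pole F (width_gt0 z) (width_le1 z) (width_ln2 z) y0 zi zy (fun x h => (zcov x h).1) zlf
  (erefl : A 0%N = 0) AB pB wj.
have -> : lser A ('i * zs j) = 1.
  apply: (lserE AB wj); apply: cvg_near_cst; exists 2%N => // N /= N2.
  rewrite /csum big_ltn ?(ltn_trans _ N2) // big_ltn // mul0r add0r mul1r cpow1n sum0_nat ?addr0 // => k _ /andP[k2 _].
  by rewrite /A gtn_eqF // mul0r.
rewrite mulr1 jz => /eqP; rewrite mulf_eq0 (negPf (width_neq0 (lexx _))) orbF.
by move=> /eqP /(congr1 (@complex.Re R)) /= h; move: mz; rewrite h eqxx.
Qed.

Section RealDerivatives.
Variable R : realType.
Implicit Types (f g : R -> R) (t h x : R).

Lemma rderivD f g t df dg : is_derive t 1 f df -> is_derive t 1 g dg ->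
  is_derive t 1 (fun x => f x + g x) (df + dg).
Proof. by move=> h1 h2; exact: is_deriveD. Qed.
Lemma rderivZ c f t df : is_derive t 1 f df -> is_derive t 1 (fun x => c * f x) (c * df).
Proof. by move=> h1; exact: (is_deriveZ c h1). Qed.
Lemma rderiv_cst c t : is_derive t 1 (fun=> c : R) 0.
Proof. exact: is_derive_cst. Qed.
Lemma rderiv_id t : is_derive t 1 (fun x : R => x) 1.
Proof. exact: is_derive_id. Qed.
Lemma rderiv_eq f t d d' : is_derive t 1 f d -> d = d' -> is_derive t 1 f d'.
Proof. by move=> h <-. Qed.

Lemma rderiv_cos x t : is_derive t 1 (fun t => cos (x * t)) (- x * sin (x * t)).
Proof.
have := @is_derive_affine R cos x 0 _ t (is_derive_cos _).
rewrite (_ : (fun s => _) = (fun t => cos (x * t))); last by apply/funext => s; rewrite addr0.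
by move=> h; apply: rderiv_eq h _; rewrite addr0 mulrN mulNr.
Qed.

Lemma rderiv_sin x t : is_derive t 1 (fun t => sin (x * t)) (x * cos (x * t)).
Proof.
have := @is_derive_affine R sin x 0 _ t (is_derive_sin _).
rewrite (_ : (fun s => _) = (fun t => sin (x * t))); last by apply/funext => s; rewrite addr0.
by move=> h; apply: rderiv_eq h _; rewrite addr0.
Qed.

Lemma derive_lipschitz f df B s t : (forall t, is_derive t 1 f (df t)) -> (forall t, `|df t| <= B) ->
  `|f t - f s| <= B * `|t - s|.
Proof.
move=> fd dB; wlog st : s t / s <= t.
  move=> H; have [|/ltW] := leP s t; first exact: H.
  by move=> ts; rewrite distrC [X in _ <= _ * X]distrC; exact: H.
have := @is_derive_bound R f df (fun x => B * x) (fun=> B * 1) s t st (fun x _ => fd x)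
   (fun x _ => rderivZ B (rderiv_id x)).
by rewrite -mulrBr mulr1 [X in B * X]ger0_norm ?subr_ge0 //; apply.
Qed.

Lemma taylor2 f df ddf B t h : (forall t, is_derive t 1 f (df t)) -> (forall t, is_derive t 1 df (ddf t)) ->
  (forall t, `|ddf t| <= B) -> `|f (t + h) - f t - h * df t| <= h ^+ 2 * B.
Proof.
move=> fd dfd dB.
have B0 : 0 <= B := le_trans (normr_ge0 _) (dB 0).
pose g x := f x + - df t * x; pose dg x := df x + - df t * 1.
have gd x : is_derive x 1 g (dg x) by apply: rderivD => //; apply: rderivZ; exact: rderiv_id.
have bd x : `|x - t| <= `|h| -> `|dg x| <= B * `|h|.
  move=> xh; rewrite /dg mulr1; apply: le_trans (derive_lipschitz t x dfd dB) _.
  by rewrite ler_wpM2l.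
have E : f (t + h) - f t - h * df t = g (t + h) - g t by rewrite /g; ring.
rewrite E -[h ^+ 2]real_normK ?num_real //.
have L x : is_derive x 1 (fun x => (B * `|h|) * x) ((B * `|h|) * 1) by apply: rderivZ; exact: rderiv_id.
have [h0|/ltW h0] := leP 0 h.
  have th : t <= t + h by rewrite lerDl.
  have := @is_derive_bound R g dg _ _ t (t + h) th (fun x _ => gd x) (fun x _ => L x).
  have -> : `|h| = h by rewrite ger0_norm.
  move=> H; apply: le_trans (H _) _; last by apply: le_of_eq; ring.
  move=> x /andP[x1 x2]; rewrite mulr1; have := bd x; rewrite (ger0_norm h0); apply.
  rewrite ger0_norm; lra.
have th : t + h <= t by rewrite gerDl.
have := @is_derive_bound R g dg _ _ (t + h) t th (fun x _ => gd x) (fun x _ => L x).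
have -> : `|h| = - h by rewrite ler0_norm.
rewrite distrC => H; apply: le_trans (H _) _; last by apply: le_of_eq; ring.
move=> x /andP[x1 x2]; rewrite mulr1; have := bd x; rewrite (ler0_norm h0); apply.
rewrite ler0_norm; lra.
Qed.

Lemma is_derive_quadratic f t d C : (forall h, `|f (t + h) - f t - h * d| <= h ^+ 2 * C) ->
  is_derive t 1 f d.
Proof.
move=> H; pose v x := f (t + x) - f t - x * d.
have v0 : is_derive (1 * t + - t) 1 v 0.
  by rewrite mul1r subrr; apply: (@is_derive_sqr_bound R v C) => x; rewrite mulrC; exact: H.
have := rderivD (is_derive_affine v0) (rderivD (rderivZ d (rderiv_id t)) (rderiv_cst (f t - t * d) t)).
rewrite (_ : (fun x => _) = f); last first.
  apply/funext => x; rewrite /v (_ : t + (1 * x - t) = x); last by ring.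
  ring.
by move=> h; apply: rderiv_eq h _; ring.
Qed.

End RealDerivatives.

(** * The phase function Theta and its growth *)

Section Phase.
Variable R : realType.
Notation half := (`[0, +oo[%classic : set R).
Notation pos := (`]0, +oo[%classic : set R).
Implicit Types (t h x : R) (v : R -> R).

Lemma Rintegral_abs_le (D : set R) (u g : R -> R) : measurable D -> rint D u -> rint D g ->
  (forall x, D x -> `|u x| <= g x) -> `|\int[mu]_(x in D) u x| <= \int[mu]_(x in D) g x.
Proof.
move=> mD iu ig ug; have h : normc (cint D (fun x => (u x)%:C)) <= \int[mu]_(x in D) g x.
  by apply: cint_le => //; [exact: cintb_rC|move=> x Dx; rewrite normc_rC; exact: ug].
by apply: le_trans h; apply: le_trans (ler_normc_Re _); rewrite /cintegral.
Qed.

(** A second-order Taylor bound with an integrable majorant takes the place of a domination of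
    difference quotients. *)
Lemma param_derive (u du : R -> R -> R) (g : R -> R) t : (forall t, rint pos (u t)) -> (forall t, rint pos (du t)) ->
  rint pos g -> (forall h x, 0 < x -> `|u (t + h) x - u t x - h * du t x| <= h ^+ 2 * g x) ->
  is_derive t 1 (fun t => \int[mu]_(x in pos) u t x) (\int[mu]_(x in pos) du t x).
Proof.
move=> iu idu ig H; apply: (@is_derive_quadratic R _ t _ (\int[mu]_(x in pos) g x)) => h.
rewrite -(RintZl _ mpos ig) -(RintZl _ mpos (idu t)).
have i1 := rintN mpos (iu t); have i2 := rintD mpos (iu (t + h)) i1.
have i3 := rintZ h mpos (idu t).
rewrite -(RintB mpos (iu (t + h)) (iu t)).
rewrite -(RintB mpos i2 i3).
apply: Rintegral_abs_le; first exact: mpos.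
- exact: (rintD mpos i2 (rintN mpos i3)).
- by apply: rintZ => //; exact: mpos.
- by move=> x /inpos x0; exact: H.
Qed.

Section Kernel.
Variables (K : R -> R[i]) (pr pi : R -> R).
Hypothesis kp : kernel_parts K pr pi.
Let p x := Re (K x).
Let q x := Im (K x).

Let mp : measurable_fun pos p. Proof. by case: (cmeas_kernel kp). Qed.
Let mq : measurable_fun pos q. Proof. by case: (cmeas_kernel kp). Qed.

Lemma kernel_moments : exists2 C, 0 <= C & forall x, 0 < x ->
  (`|p x| + `|q x|) * x <= C * ((1 + x) ^+ 2)^-1 /\ (`|p x| + `|q x|) * x ^+ 2 <= C * ((1 + x) ^+ 2)^-1.
Proof.
have [C C0 HC] := kernel_bounds kp; exists (2 * C) => [|x x0]; first by rewrite mulr_ge0.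
have [h _] := HC x x0.
have x2 : 0 < (1 + x) ^+ 2 by rewrite exprn_gt0; lra.
have n2 : `|p x| + `|q x| <= 2 * normc (K x).
  have := ler_normc_Re (K x); have := ler_normc_Im (K x); rewrite /p /q; lra.
have N0 : 0 <= normc (K x) * x by rewrite mulr_ge0 // ltW.
have e1 : normc (K x) * x * (1 + x) ^+ 2 <= C.
  apply: le_trans h; rewrite ler_wpM2l // ler_eXn2l //; lra.
have e2 : normc (K x) * x ^+ 2 * (1 + x) ^+ 2 <= C.
  apply: le_trans h.
  rewrite (_ : _ * _ = normc (K x) * x * (x * (1 + x) ^+ 2)); last by move: (normc _) => N; ring.
  rewrite ler_wpM2l //.
  rewrite (_ : 4%N = (2 + 2)%N) // exprD ler_wpM2r ?ltW //; rewrite expr2; nra.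
split; rewrite ler_pdivlMr //.
  have := ler_wpM2r (ltW (mulr_gt0 x0 x2)) n2; lra.
have := ler_wpM2r (ltW (mulr_gt0 (exprn_gt0 2 x0) x2)) n2; lra.
Qed.

Let mx (g : R -> R) : continuous g -> measurable_fun pos g.
Proof. by move=> cg; apply: measurable_funTS; exact: continuous_measurable_fun. Qed.

Let mcos t : measurable_fun pos (fun x => cos (x * t)).
Proof.
apply: mx => x; apply: continuous_comp; last exact: continuous_cos.
by apply: (@continuousM R R); [exact: cvg_id|exact: cvg_cst].
Qed.

Let msin t : measurable_fun pos (fun x => sin (x * t)).
Proof.
apply: mx => x; apply: continuous_comp; last exact: continuous_sin.
by apply: (@continuousM R R); [exact: cvg_id|exact: cvg_cst].
Qed.

Let mid : measurable_fun pos (fun x : R => x).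
Proof. exact: measurable_id. Qed.

Let mV : measurable_fun pos (fun x : R => x^-1).
Proof.
apply: open_continuous_measurable_fun; first exact: interval_open.
by move=> x; rewrite inE /= in_itv /= andbT => x0; apply: inv_continuous; rewrite gt_eqF.
Qed.

(** This is Re (K(x) (1 - e^(-ixt))). The two definitions after it are its derivative in [t] and its
    primitive in [t] vanishing at 0. *)
Definition theta_integrand t x := Re (K x) * (1 - cos (x * t)) - Im (K x) * sin (x * t).
Definition dtheta_integrand t x := Re (K x) * x * sin (x * t) - Im (K x) * x * cos (x * t).
Definition Theta_integrand t x := Re (K x) * (t - sin (x * t) / x) - Im (K x) * ((1 - cos (x * t)) / x).

Lemma theta_integrand_derive x t : is_derive t 1 (theta_integrand ^~ x) (dtheta_integrand t x).
Proof.
have h := rderivD (rderivZ (p x) (rderivD (rderiv_cst 1 t) (rderivZ (-1) (rderiv_cos x t))))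
    (rderivZ (- q x) (rderiv_sin x t)).
have E : (fun s => p x * (1 + -1 * cos (x * s)) + - q x * sin (x * s)) = theta_integrand ^~ x.
  by apply/funext => s; rewrite /theta_integrand /p /q; ring.
by rewrite E in h; apply: rderiv_eq h _; rewrite /dtheta_integrand /p /q; ring.
Qed.

Lemma dtheta_integrand_derive x t : is_derive t 1 (dtheta_integrand ^~ x)
  (Re (K x) * x ^+ 2 * cos (x * t) + Im (K x) * x ^+ 2 * sin (x * t)).
Proof.
have h := rderivD (rderivZ (p x * x) (rderiv_sin x t)) (rderivZ (- q x * x) (rderiv_cos x t)).
have E : (fun s => p x * x * sin (x * s) + - q x * x * cos (x * s)) = dtheta_integrand ^~ x.
  by apply/funext => s; rewrite /dtheta_integrand /p /q; ring.
by rewrite E in h; apply: rderiv_eq h _; rewrite /p /q; ring.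
Qed.

Lemma Theta_integrand_derive x t : 0 < x -> is_derive t 1 (Theta_integrand ^~ x) (theta_integrand t x).
Proof.
move=> x0.
have h := rderivD (rderivZ (p x) (rderivD (rderiv_id t) (rderivZ (- x^-1) (rderiv_sin x t))))
    (rderivZ (- q x * x^-1) (rderivD (rderiv_cst 1 t) (rderivZ (-1) (rderiv_cos x t)))).
have E : (fun s => p x * (s + - x^-1 * sin (x * s)) + - q x * x^-1 * (1 + -1 * cos (x * s))) = Theta_integrand ^~ x.
  by apply/funext => s; rewrite /Theta_integrand /p /q; ring.
rewrite E in h; apply: rderiv_eq h _; rewrite /theta_integrand /p /q.
have xx : x^-1 * x = 1 by rewrite mulVf // gt_eqF.
have -> : - Im (K x) * x^-1 * (0 + -1 * (- x * sin (x * t))) = - Im (K x) * sin (x * t) * (x^-1 * x) by ring.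
have -> : - x^-1 * (x * cos (x * t)) = - (x^-1 * x) * cos (x * t) by ring.
by rewrite xx; ring.
Qed.

Let trig_bound (b c s s' : R) : `|s| <= 1 -> `|s'| <= 1 -> `|b * s + c * s'| <= `|b| + `|c|.
Proof.
move=> h1 h2; apply: le_trans (ler_normD _ _) _; rewrite !normrM.
by apply: lerD; rewrite ler_piMr.
Qed.

Lemma dtheta_integrand_bound x t : 0 < x -> `|dtheta_integrand t x| <= (`|p x| + `|q x|) * x.
Proof.
move=> x0; rewrite /dtheta_integrand -mulNr; apply: le_trans (trig_bound _ _ (sin_max _) (cos_max _)) _.
by rewrite normrN !normrM (gtr0_norm x0) -/(p x) -/(q x) mulrDl.
Qed.

Lemma ddtheta_bound x t : 0 < x ->
  `|Re (K x) * x ^+ 2 * cos (x * t) + Im (K x) * x ^+ 2 * sin (x * t)| <= (`|p x| + `|q x|) * x ^+ 2.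
Proof.
move=> x0; apply: le_trans (trig_bound _ _ (cos_max _) (sin_max _)) _.
by rewrite (normrM (Re _)) (normrM (Im _)) (ger0_norm (sqr_ge0 x)) mulrDl.
Qed.

Let w1 x := (`|p x| + `|q x|) * x.
Let w2 x := (`|p x| + `|q x|) * x ^+ 2.

Let mabs : measurable_fun pos (fun x => `|p x| + `|q x|).
Proof. by apply: measurable_funD; apply: measurableT_comp. Qed.

Lemma rint_w : rint pos w1 /\ rint pos w2.
Proof.
have [C C0 HC] := kernel_moments.
have ig : rint pos (fun x => C * ((1 + x) ^+ 2)^-1) by apply: rintZ; [exact: mpos|exact: rint_inv_sqr_pos].
split; apply: rint_le ig; try exact: mpos.
- exact: measurable_funM.
- move=> x /inpos x0; rewrite ger0_norm; first by case: (HC x x0).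
  by rewrite mulr_ge0 // ltW.
- by apply: measurable_funM => //; apply: measurable_funX.
- move=> x /inpos x0; rewrite ger0_norm; first by case: (HC x x0).
  by rewrite mulr_ge0 // exprn_ge0 // ltW.
Qed.

Lemma rint_theta t : rint pos (theta_integrand t).
Proof.
have [i1 _] := rint_w; apply: rint_le (rintZ `|t| mpos i1); first exact: mpos.
  apply: measurable_funB; apply: measurable_funM => //.
  by apply: measurable_funB => //; exact: measurable_cst.
move=> x /inpos x0; have := derive_lipschitz 0 t (theta_integrand_derive x) (fun t => dtheta_integrand_bound t x0).
rewrite {2}/theta_integrand mulr0 cos0 sin0 subrr !mulr0 subrr !subr0.
by rewrite mulrC.
Qed.

Lemma rint_dtheta t : rint pos (dtheta_integrand t).
Proof.
have [i1 _] := rint_w; apply: rint_le i1; first exact: mpos.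
  by apply: measurable_funB; apply: measurable_funM => //; apply: measurable_funM.
by move=> x /inpos x0; exact: dtheta_integrand_bound.
Qed.

Lemma rint_Theta t : rint pos (Theta_integrand t).
Proof.
have [i1 _] := rint_w; apply: rint_le (rintZ (t ^+ 2) mpos i1); first exact: mpos.
  apply: measurable_funB; apply: measurable_funM => //.
    by apply: measurable_funB; [exact: measurable_cst|exact: measurable_funM].
  by apply: measurable_funM => //; apply: measurable_funB => //; exact: measurable_cst.
move=> x /inpos x0; have := @taylor2 R _ _ _ (w1 x) 0 t (fun t => Theta_integrand_derive t x0)
   (theta_integrand_derive x) (fun t => dtheta_integrand_bound t x0).
rewrite {2}/Theta_integrand {1}/theta_integrand mulr0 cos0 sin0 subrr !mul0r !mulr0 !subr0 !mulr0 !subr0 add0r.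
by [].
Qed.

Variable f1 : R.

(** It turns out to be minus the rate of change of the phase of L on the critical line, up to the
    sign changes at zeros; its primitive [Theta] compensates that phase. *)
Definition theta t := \int[mu]_(x in pos) theta_integrand t x - f1.
Definition dtheta t := \int[mu]_(x in pos) dtheta_integrand t x.
Definition Theta t := \int[mu]_(x in pos) Theta_integrand t x - f1 * t.

Lemma Theta_derive t : is_derive t 1 Theta (theta t).
Proof.
have [i1 _] := rint_w.
have h : is_derive t 1 (fun t => \int[mu]_(x in pos) Theta_integrand t x) (\int[mu]_(x in pos) theta_integrand t x).
  apply: (@param_derive Theta_integrand theta_integrand w1 t rint_Theta rint_theta i1) => h x x0.
  exact: (@taylor2 R _ _ _ (w1 x) t h (fun t => Theta_integrand_derive t x0)
   (theta_integrand_derive x) (fun t => dtheta_integrand_bound t x0)).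
have H := rderivD h (rderivZ (- f1) (rderiv_id t)).
rewrite (_ : Theta = fun x => \int[mu]_(y in pos) Theta_integrand x y + - f1 * x).
  by apply: rderiv_eq H _; rewrite /theta mulr1.
by apply/funext => x; rewrite /Theta mulNr.
Qed.

Lemma theta_derive t : is_derive t 1 theta (dtheta t).
Proof.
have [_ i2] := rint_w.
have h : is_derive t 1 (fun t => \int[mu]_(x in pos) theta_integrand t x) (\int[mu]_(x in pos) dtheta_integrand t x).
  apply: (@param_derive theta_integrand dtheta_integrand w2 t rint_theta rint_dtheta i2) => h x x0.
  exact: (@taylor2 R _ _ _ (w2 x) t h (theta_integrand_derive x)
   (dtheta_integrand_derive x) (fun t => ddtheta_bound t x0)).
by apply: rderiv_eq (rderivD h (rderiv_cst (- f1) t)) _; rewrite addr0.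
Qed.

End Kernel.

Let w_ t : R[i] := 'i * t%:C.

Definition osc v t : R[i] := cint half (fun x => (v x)%:C * cexp (x%:C * ('i * t%:C))).

Lemma Re_imul_rC t : Re ('i * t%:C : R[i]) = 0.
Proof. by rewrite Re_iM /= oppr0. Qed.
Lemma osc_norm t x : normc (cexp (x%:C * ('i * t%:C)) : R[i]) = 1.
Proof. by rewrite normc_cexp Re_rC Re_imul_rC mulr0 expR0. Qed.

Lemma schwartz_derive v : schwartz v -> schwartz v^`()%classic.
Proof.
move=> [sv bv]; split; first exact: smooth_derive1.
by move=> j k; have [C HC] := bv j k.+1; exists C => x; rewrite -derive1Sn.
Qed.

Lemma schwartz_rint v : schwartz v -> rint half v.
Proof.
move=> sv; have [C C0 HC] := schwartz_decay sv.
apply: rint_le (rintZ C mhalf (@rint_inv_sqr R)); first exact: mhalf.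
  by apply: measurable_funTS; apply: continuous_measurable_fun; exact: schwartz_continuous.
move=> x; rewrite /= in_itv /= andbT => x0; rewrite ler_pdivlMr ?exprn_gt0 //; last by lra.
apply: le_trans (HC x x0); rewrite ler_wpM2l // ler_weXn2l //; lra.
Qed.

Lemma cderiv_osc v t x : schwartz v -> cderiv (fun x => (v x)%:C * cexp (x%:C * ('i * t%:C))) x
  ((v^`()%classic x)%:C * cexp (x%:C * ('i * t%:C)) + 'i * t%:C * ((v x)%:C * cexp (x%:C * ('i * t%:C)))).
Proof.
move=> [sv _]; apply: cderiv_eq (cderivM (cderiv_real (is_derive_smooth x sv)) (cderiv_cexpx _ x)) _.
by congr (_ + _); rewrite mulrCA.
Qed.

Lemma osc_cintb v t : schwartz v -> cintb half (fun x => (v x)%:C * cexp (x%:C * ('i * t%:C))).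
Proof.
move=> sv; apply: (cintb_le (g := fun x => `|v x|) mhalf).
- have [c1 c2] := cderiv_continuous (fun x => cderiv_osc t x sv).
  by apply: cmeas_continuous => x; [exact: c1|exact: c2].
- by move=> x _; rewrite normcM_ osc_norm mulr1 normc_rC.
- by apply: rint_abs; [exact: mhalf|exact: schwartz_rint].
Qed.

(** Integration by parts; the boundary term at infinity vanishes by Schwartz decay. *)
Lemma osc_parts v t : schwartz v -> t%:C * osc v t = 'i * ((v 0)%:C + osc v^`()%classic t).
Proof.
move=> sv; have sd := schwartz_derive sv.
have [c1 c2] := cderiv_continuous (fun x => cderivD (cderiv_osc t x sd) (cderivZ ('i * t%:C) (cderiv_osc t x sv))).
have i1 := osc_cintb t sd; have i2 := osc_cintb t sv; have i3 := cintbZ ('i * t%:C) mhalf i2.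
have i4 := cintbD mhalf i1 i3.
have := cint_FTCy (fun x => cderiv_osc t x sv) c1 c2 i4.
rewrite (cintD mhalf i1 i3) (cintZ _ mhalf i2) -/(osc v t) -/(osc _ t) mul0r cexp0 mulr1.
move=> H; have {H} : osc v^`()%classic t + 'i * t%:C * osc v t = - (v 0)%:C.
  apply: H; have [C C0 HC] := schwartz_decay sv.
  apply/cvg_normcP => e e0; have e2 : 0 < e / 2 by rewrite divr_gt0.
  have [T T0 HT] := inv_sqr_decay C0 e2; exists (Num.truncn T).+1 => // n /= nT.
  have Tn : T <= n%:R.
    by apply: le_trans (ltW (truncnS_gt T)) _; rewrite ler_nat.
  rewrite normc_distC subr0 normcM_ osc_norm mulr1 normc_rC.
  apply: le_lt_trans (_ : e / 2 < e); last by lra.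
  have n1 : 1 <= 1 + n%:R :> R by rewrite lerDl.
  apply: le_trans (HT _ Tn); rewrite ler_pdivlMr //.
  by apply: le_trans (HC _ (ler0n R n)); rewrite ler_wpM2l // ler_weXn2l.
move=> h; have ii : 'i * 'i = -1 :> R[i] by rewrite -expr2 sqr_i.
have -> : (v 0)%:C = - (osc v^`()%classic t + 'i * t%:C * osc v t) by rewrite h opprK.
have -> : 'i * (- (osc v^`()%classic t + 'i * t%:C * osc v t) + osc v^`()%classic t) = - ('i * 'i) * (t%:C * osc v t) by ring.
by rewrite ii opprK mul1r.
Qed.

Lemma osc_bound v t : schwartz v -> normc (osc v t) <= \int[mu]_(x in half) `|v x|.
Proof.
move=> sv; apply: cint_le; first exact: mhalf.
- exact: osc_cintb.
- by move=> x _; rewrite normcM_ osc_norm mulr1 normc_rC.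
- by apply: rint_abs; [exact: mhalf|exact: schwartz_rint].
Qed.

Lemma osc_decay v : schwartz v -> exists2 C, 0 <= C & forall t, 0 < t -> normc (osc v t) <= C / t.
Proof.
move=> sv; have sd := schwartz_derive sv.
have h0 : 0 <= \int[mu]_(x in half) `|v^`()%classic x| by apply: Rintegral_ge0 => x _; exact: normr_ge0.
exists (`|v 0| + \int[mu]_(x in half) `|v^`()%classic x|) => [|t t0]; first by rewrite addr_ge0.
have E : t * normc (osc v t) = normc (t%:C * osc v t) by rewrite normcM_ normc_rC gtr0_norm.
rewrite ler_pdivlMr // mulrC E osc_parts // normcM_.
have -> : normc ('i : R[i]) = 1.
  by have := osc_norm 0 0; rewrite normcEsqrt /= expr0n expr1n add0r sqrtr1.
rewrite mul1r; apply: le_trans (normcD _ _) _; rewrite normc_rC lerD2l; exact: osc_bound.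
Qed.

Section Asymptotics.
Variables (K : R -> R[i]) (pr pi : R -> R) (f1 : R).
Hypothesis kp : kernel_parts K pr pi.

Lemma dtheta_osc t : dtheta K t = Im (osc pr t) - Re (osc pi t).
Proof.
have [s1 s2 p0 Kx] := kp.
have [_ i1] := osc_cintb t s1; have [i2 _] := osc_cintb t s2.
have E x : Im ((pr x)%:C * cexp (x%:C * ('i * t%:C))) - Re ((pi x)%:C * cexp (x%:C * ('i * t%:C))) =
    pr x * sin (x * t) - pi x * cos (x * t).
  by rewrite Im_rC Re_rC Im_cexp Re_cexp Re_rC Im_rC Re_imul_rC mulr0 expR0 !mul1r Im_iM.
have iE := rintD mhalf i1 (rintN mhalf i2).
rewrite /osc /cintegral -(RintB mhalf i1 i2).
rewrite -Rintegral_itv_obnd_cbnd; last first.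
  by apply: (rint_sub mpos mhalf _ iE) => x; rewrite /= !in_itv /= !andbT => /ltW.
apply: eq_Rintegral => x; rewrite inE => /inpos x0; rewrite E /dtheta_integrand Kx //=.
by rewrite !divfK // gt_eqF.
Qed.

Lemma sub_cancel_le (c X Y b b' : R) : `|X| <= b -> `|Y| <= b' -> `|c + X - - Y - c| <= b + b'.
Proof.
by move=> h1 h2; rewrite (_ : _ - c = X + Y); [apply: le_trans (ler_normD _ _) (lerD h1 h2)|ring].
Qed.

(** As x K(x) is Schwartz, [dtheta] is a combination of oscillatory integrals. One integration by
    parts brings out the boundary value [pr 0], a second one bounds the error. *)
Lemma dtheta_asymptotic : exists2 C, 0 <= C & forall t, 0 < t -> `|t * dtheta K t - pr 0| <= C / t.
Proof.
have [s1 s2 p0 Kx] := kp.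
have [C1 C10 H1] := osc_decay (schwartz_derive s1); have [C2 C20 H2] := osc_decay (schwartz_derive s2).
exists (C1 + C2) => [|t t0]; first exact: addr_ge0.
have e1 : t * Im (osc pr t) = pr 0 + Re (osc pr^`()%classic t).
  by rewrite -Im_rC osc_parts // Im_iM ReD.
have e2 : t * Re (osc pi t) = - Im (osc pi^`()%classic t).
  by rewrite -Re_rC osc_parts // Re_iM ImD /= add0r.
rewrite dtheta_osc mulrBr e1 e2 mulrDl; have := H1 t t0; have := H2 t t0.
move=> h1 h2.
have h3 := le_trans (ler_normc_Re _) h2; have h4 := le_trans (ler_normc_Im _) h1.
exact: sub_cancel_le h3 h4.
Qed.

Lemma dtheta_bound : exists2 C, 0 <= C & forall t, 1 <= t -> `|dtheta K t| <= C / t.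
Proof.
have [C C0 H] := dtheta_asymptotic; exists (C + `|pr 0|) => [|t t1]; first exact: addr_ge0.
have t0 : 0 < t by lra.
rewrite ler_pdivlMr // mulrC -{1}(gtr0_norm t0) -normrM -[_ * _](subrK (pr 0)).
apply: le_trans (ler_normD _ _) _; rewrite lerD2r; apply: le_trans (H t t0) _.
by rewrite ler_pdivrMr // ler_peMr.
Qed.

(** [theta] differs from [pr 0 * ln t] by a bounded function, since the derivative of the difference
    is O(1/t^2). The sign of [pr 0] decides between the alternatives. *)
Lemma theta_dichotomy : (exists B, forall t, 1 <= t -> theta K f1 t <= B) \/
  (forall B, exists2 T, 1 <= T & forall t, T <= t -> B <= theta K f1 t).
Proof.
have [C C0 H] := dtheta_asymptotic; pose c := pr 0.
have key t : 1 <= t -> `|theta K f1 t - c * ln t - theta K f1 1| <= C.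
  move=> t1.
  have h1 (x : R) : 1 <= x <= t -> is_derive x 1 (fun s => theta K f1 s + - c * ln s) (dtheta K x + - c * x^-1).
    move=> /andP[x1 _]; apply: rderivD; first exact: (theta_derive kp).
    by apply: rderivZ; apply: is_derive1_ln; lra.
  have h2 (x : R) : 1 <= x <= t -> is_derive x 1 (fun s => - C * s^-1) (- C * (- x ^- 2 * 1)).
    move=> /andP[x1 _]; apply: rderivZ.
    have xn : x != 0 by rewrite gt_eqF; lra.
    exact: (@is_deriveV R (fun s => s) x 1 1 xn (rderiv_id x)).
  have := is_derive_bound t1 h1 h2; rewrite ln1 mulr0 addr0 invr1 => h.
  have -> : theta K f1 t - c * ln t - theta K f1 1 = theta K f1 t + - c * ln t - theta K f1 1 by ring.
  apply: le_trans (h _) _.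
    move=> x /andP[x1 _]; have x0 : 0 < x by lra.
    have -> : dtheta K x + - c * x^-1 = (x * dtheta K x - c) / x by field; rewrite gt_eqF.
    rewrite normrM normfV (gtr0_norm x0) ler_pdivrMr //.
    have -> : - C * (- x ^- 2 * 1) * x = C / x by field; rewrite gt_eqF.
    exact: H.
  have t0 : 0 < t^-1 by rewrite invr_gt0; lra.
  have := mulr_ge0 C0 (ltW t0); lra.
have [c0|c0] := leP c 0.
  left; exists (theta K f1 1 + C) => t t1; have := key t t1; rewrite ler_norml => /andP[_].
  have := mulr_le0_ge0 c0 (ln_ge0 t1); lra.
right => B; pose X := (B + C - theta K f1 1) / c.
exists (Num.max 1 (expR X)) => [|t]; first by rewrite le_max lexx.
rewrite ge_max => /andP[t1 tX]; have := key t t1; rewrite ler_norml => /andP[h _].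
have : X <= ln t by rewrite -(expRK X) ler_ln ?posrE ?expR_gt0 //; lra.
rewrite ler_pdivrMr // mulrC; lra.
Qed.

End Asymptotics.
End Phase.

(** * The kernel transform on the critical line *)

Section Boundary.
Variable R : realType.
Notation half := (`[0, +oo[%classic : set R).
Notation pos := (`]0, +oo[%classic : set R).
Implicit Types (t x : R).

Lemma Rintegral_swap (P : R -> R -> R) (g : R -> R) :
  measurable_fun setT (fun z : R * R => P z.1 z.2) -> (forall x, rint setT (P x)) ->
  (forall t, rint setT (P ^~ t)) -> (forall x, \int[mu]_t `|P x t| <= g x) -> rint setT g ->
  \int[mu]_x (\int[mu]_t P x t) = \int[mu]_t (\int[mu]_x P x t).
Proof.
move=> mP iP iP' Pg ig; pose Q (z : R * R) := (P z.1 z.2)%:E.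
have mQ : measurable_fun setT Q by apply/measurable_EFinP.
have fin (u : R -> R) : rint setT u -> (\int[mu]_t (u t)%:E = (\int[mu]_t u t)%:E)%E.
  by move=> iu; rewrite /Rintegral fineK //; exact: (integrable_fin_num measurableT iu).
have nE x : (\int[mu]_t `|Q (x, t)| = (\int[mu]_t `|P x t|)%:E)%E.
  by rewrite -fin //; apply: rint_abs => //; exact: iP.
have iQ : (mu \x mu)%E.-integrable setT Q.
  apply/integrable12ltyP => //.
  apply: le_lt_trans (integrable_lty measurableT ig).
  apply: ge0_le_integral => //.
  - by move=> x _; apply: integral_ge0.
  - have mA : measurable_fun setT (fun z => `|Q z|%E) by exact: measurableT_comp.
    exact: (@measurable_fun_fubini_tonelli_F _ _ _ _ _ mu (fun z => `|Q z|%E) mA).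
  - by apply/measurable_EFinP; exact: rint_measurable ig.
  - by move=> x _; rewrite nE lee_fin.
have := Fubini iQ; rewrite /Q /= => H; rewrite /Rintegral; congr fine.
transitivity (\int[mu]_x \int[mu]_y (P x y)%:E)%E.
  by apply: eq_integral => x _; rewrite -fin //.
by rewrite H; apply: eq_integral => x _; rewrite fin.
Qed.

Lemma Rintegral_even (F : R -> R) : rint setT F -> (forall t, F (- t) = F t) ->
  \int[mu]_(t in half) F t = 2^-1 * \int[mu]_t F t.
Proof.
move=> iF eF.
have ih : rint half F by apply: rint_sub iF => //; exact: mhalf.
have ip : rint pos F by apply: rint_sub iF => //; exact: mpos.
have i1 : rint setT (F \_ half) by exact: (proj1 (rint_restrict F mhalf) ih).
have i2 : rint setT (F \_ pos) by exact: (proj1 (rint_restrict F mpos) ip).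
have [i3 e3] := Rintegral_opp i2.
have E t : F t = (F \_ half) t + (F \_ pos) (- t).
  rewrite /patch !mem_setE !in_itv /= !andbT oppr_gt0; case: (leP 0 t) => _; rewrite ?addr0 ?add0r //.
have -> : \int[mu]_t F t = \int[mu]_(t in half) F t + \int[mu]_(t in pos) F t.
  rewrite [in RHS]Rintegral_mkcond [X in _ = _ + X]Rintegral_mkcond -e3.
  rewrite -(RintD measurableT i1 i3).
  by apply: eq_Rintegral => t _; exact: E.
rewrite (@Rintegral_itv_obnd_cbnd R 0 +oo%O F ip); lra.
Qed.

Lemma box_rint (a c : R) : 0 <= a -> rint setT (fun t => if `|t - c| <= a then 1 else 0) /\
  \int[mu]_t (if `|t - c| <= a then 1 else 0) = 2 * a.
Proof.
move=> a0; pose I := `[c - a, c + a]%classic.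
have inI t : (I t : Prop) <-> `|t - c| <= a.
  by rewrite /I /= in_itv /= ler_norml; split => /andP[h1 h2]; apply/andP; split; lra.
have mI : measurable I by exact: measurable_itv.
have i1 : rint I (fun=> 1 : R) by apply: rint_segment => x; exact: cvg_cst.
pose one : R -> R := fun=> 1.
have E : (fun t => if `|t - c| <= a then 1 else 0 : R) = one \_ I.
  apply/funext => t; rewrite /patch; case: ifPn => h; first by rewrite mem_set //; exact/inI.
  by rewrite memNset // => /inI; apply/negP.
rewrite E -Rintegral_mkcond; split; first exact: (proj1 (rint_restrict one mI) i1).
have e : fine (mu I) = 2 * a.
  by rewrite /I lebesgue_measure_itv /= lte_fin; case: ifP => /= h; lra.
have H := Rint_cst mI 1.
by rewrite H e mul1r.
Qed.

Section Datum.
Variables (f : nat -> R[i]) (K : R -> R[i]) (m : R[i] -> R) (a : R) (zs : nat -> R[i]).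
Variables (pr pi : R -> R).
Hypotheses (F : L_datum f K m) (a0 : 0 < a) (a1 : a <= 1) (aln : a <= ln 2) (kp : kernel_parts K pr pi).
Hypotheses (zi : injective zs) (zcov : forall z, m z != 0 -> exists j, zs j = z).
Variable tau : R.
Notation g0 := (bump a).
Let w : R[i] := 'i * tau%:C.
Let e t : R[i] := cexp (t%:C * w).
Let h := Re (lt g0 w).

Let wc : conjc w = - w.
Proof. by rewrite /w conjc_i conjc_rC. Qed.

Lemma lt_bump_real : lt g0 w = h%:C.
Proof.
have E : conjc (lt g0 w) = lt g0 w by rewrite (lt_conj w (testfn_bump a)) wc (lt_even _ (testfn_bump a) (bump_even a)).
apply: complex_ext => //; move/(congr1 (@complex.Im R)): E; rewrite Im_conjc /=; lra.
Qed.

Let Re_w : Re w = 0. Proof. by rewrite /w Re_iM /= oppr0. Qed.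
Let Im_w : Im w = tau. Proof. by rewrite /w Im_iM. Qed.

Let Re_e t : Re (e t) = cos (t * tau).
Proof. by rewrite /e Re_cexp Re_rC Im_rC Re_w Im_w mulr0 expR0 mul1r. Qed.

Let Im_e t : Im (e t) = sin (t * tau).
Proof. by rewrite /e Im_cexp Re_rC Im_rC Re_w Im_w mulr0 expR0 mul1r. Qed.

Let lt_Re r : Re (lt r w) = \int[mu]_t (r t * Re (e t)).
Proof. by rewrite /lt /cintegral /=; apply: eq_Rintegral => t _; rewrite Re_rC. Qed.

Let lt_Im r : Im (lt r w) = \int[mu]_t (r t * Im (e t)).
Proof. by rewrite /lt /cintegral /=; apply: eq_Rintegral => t _; rewrite Im_rC. Qed.

Let rint_Re r b : testfn r b -> rint setT (fun t => r t * Re (e t)).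
Proof. by move=> tr; have [i _] := test_cintb w tr; apply: eq_rint i => // t _; rewrite Re_rC. Qed.

Let rint_Im r b : testfn r b -> rint setT (fun t => r t * Im (e t)).
Proof. by move=> tr; have [_ i] := test_cintb w tr; apply: eq_rint i => // t _; rewrite Im_rC. Qed.

Let p x := Re (K x).
Let q x := Im (K x).

Let A x t := (2 * g0 t - g0 (t - x) - g0 (t - - x)) * Re (e t).
Let B x t := (g0 (t - - x) - g0 (t - x)) * Im (e t).

Let tshift x : testfn (fun t => g0 (t - x)) (a + `|x|) := testfn_shift x (testfn_bump a).

Lemma bump_rotation x : Re (lt (fun t => g0 (t - x)) w) = h * cos (x * tau) /\
  Im (lt (fun t => g0 (t - x)) w) = h * sin (x * tau).
Proof.
by rewrite (lt_shift x w (testfn_bump a)) lt_bump_real Re_rCr Im_rCr -/(e x) Re_e Im_e ![_ * h]mulrC.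
Qed.

(** For fixed [x] the kernel integrand is a combination of translates of the bump in [t], so
    integration over all [t] against the oscillation brings out the factor [h] and leaves the
    integrand of [theta]. *)
Lemma line_transform x : rint setT (fun t => p x * A x t + q x * B x t) /\
  \int[mu]_t (p x * A x t + q x * B x t) = 2 * h * theta_integrand K tau x.
Proof.
have [c1 s1] := bump_rotation x; have [c2 s2] := bump_rotation (- x).
have c0 : \int[mu]_t (g0 t * Re (e t)) = h by rewrite /h lt_Re.
rewrite lt_Re in c1; rewrite lt_Re in c2; rewrite lt_Im in s1; rewrite lt_Im in s2.
have i0 := rint_Re (testfn_bump a); have i1 := rint_Re (tshift x); have i2 := rint_Re (tshift (- x)).
have j1 := rint_Im (tshift x); have j2 := rint_Im (tshift (- x)).
have k1 := rintZ (2 * p x) measurableT i0; have k2 := rintZ (- p x) measurableT i1.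
have k3 := rintZ (- p x) measurableT i2; have k4 := rintZ (q x) measurableT j2.
have k5 := rintZ (- q x) measurableT j1.
have l1 := rintD measurableT k1 k2; have l2 := rintD measurableT l1 k3.
have l3 := rintD measurableT l2 k4; have l4 := rintD measurableT l3 k5.
have E t : p x * A x t + q x * B x t = 2 * p x * (g0 t * Re (e t)) + - p x * (g0 (t - x) * Re (e t)) +
   - p x * (g0 (t - - x) * Re (e t)) + q x * (g0 (t - - x) * Im (e t)) + - q x * (g0 (t - x) * Im (e t)).
  by rewrite /A /B; ring.
split; first by apply: eq_rint l4 => // t _; rewrite E.
transitivity (\int[mu]_t (2 * p x * (g0 t * Re (e t)) + - p x * (g0 (t - x) * Re (e t)) +
   - p x * (g0 (t - - x) * Re (e t)) + q x * (g0 (t - - x) * Im (e t)) + - q x * (g0 (t - x) * Im (e t)))).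
  by apply: eq_Rintegral => t _; rewrite E.
rewrite (RintD measurableT l3 k5) (RintD measurableT l2 k4).
rewrite (RintD measurableT l1 k3) (RintD measurableT k1 k2).
rewrite (RintZl _ measurableT i0) (RintZl _ measurableT i1).
rewrite (RintZl _ measurableT i2) (RintZl _ measurableT j2).
rewrite (RintZl _ measurableT j1).
rewrite c0 c1 c2 s1 s2.
rewrite [- x * tau]mulNr cosN sinN /theta_integrand -/(p x) -/(q x); ring.
Qed.

Let AB_even x t : p x * A x (- t) + q x * B x (- t) = p x * A x t + q x * B x t.
Proof.
rewrite /A /B !Re_e !Im_e mulNr cosN sinN bump_even.
have -> : - t - x = - (t - - x) by ring.
have -> : - t - - x = - (t - x) by ring.
rewrite !bump_even; ring.
Qed.

Let kinE x t : p x * A x t + q x * B x t =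
  Re (kin K (fun y => g0 (y - t)) x) * Re (e t) + Im (kin K (fun y => g0 (y - t)) x) * Im (e t).
Proof.
rewrite Re_kin Im_kin /A /B -/(p x) -/(q x) sub0r bump_even.
have -> : x - t = - (t - x) by ring.
have -> : - x - t = - (t - - x) by ring.
rewrite !bump_even; ring.
Qed.

(** The majorant for Fubini: for fixed [x] the integrand lives where [t] is within [a] of 0 or of
    [x], so its integral over [t] is O((1 + x)^(-2)). *)
Lemma kin_line_bound : exists2 C, 0 <= C & forall x t, 0 < x -> 0 <= t ->
  `|p x * A x t + q x * B x t| <= C * ((1 + x) ^+ 2)^-1 *
     ((if `|t - 0| <= a then 1 else 0) + (if `|t - x| <= a then 1 else 0)).
Proof.
have [L L0 gL] := testfn_lipschitz (testfn_bump a).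
have [C C0 HC] := kin_bound kp ler01 L0; exists (2 * C) => [|x t x0 t0]; first by rewrite mulr_ge0.
have N : `|p x * A x t + q x * B x t| <= 2 * C * ((1 + x) ^+ 2)^-1.
  rewrite kinE; apply: le_trans (_ : 2 * normc (kin K (fun y => g0 (y - t)) x) <= _).
    apply: le_trans (ler_normD _ _) _; rewrite !normrM !Re_e !Im_e.
    rewrite mulrDl mul1r; apply: lerD.
      by apply: le_trans (ler_piMr _ (cos_max _)) (ler_normc_Re _).
    by apply: le_trans (ler_piMr _ (sin_max _)) (ler_normc_Im _).
  rewrite -mulrA ler_wpM2l //; apply: HC => //.
  - by move=> y; rewrite ger0_norm ?bump_ge0 ?bump_le1.
  - by move=> y z; apply: le_trans (gL _ _) _; rewrite opprB addrA subrK.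
have N0 := le_trans (normr_ge0 _) N.
rewrite subr0; case: ifPn => h1; case: ifPn => h2; rewrite ?addr0 ?add0r ?mulr1 //.
  by apply: le_trans N _; lra.
rewrite mulr0; move: h1 h2; rewrite -!ltNge => h1 h2.
have z0 : g0 t = 0 by apply: bump_eq0; exact: ltW.
have z1 : g0 (t - x) = 0 by apply: bump_eq0; exact: ltW.
have z2 : g0 (t - - x) = 0.
  by apply: bump_eq0; move: h1; rewrite !ger0_norm //; lra.
by rewrite /A /B z0 z1 z2 !mulr0 !subr0 !mul0r !mulr0 addr0 normr0.
Qed.

Let mg0 : measurable_fun setT g0.
Proof. by apply: continuous_measurable_fun; exact: (testfn_continuous (testfn_bump a)). Qed.

Let mcos : measurable_fun setT (fun t => Re (e t)).
Proof.
rewrite (_ : (fun t => _) = (fun t => cos (t * tau))); last by apply/funext => t; rewrite Re_e.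
apply: (measurableT_comp (f := @cos R)); first by apply: continuous_measurable_fun; exact: continuous_cos.
by apply: measurable_funM => //; exact: measurable_cst.
Qed.

Let msin : measurable_fun setT (fun t => Im (e t)).
Proof.
rewrite (_ : (fun t => _) = (fun t => sin (t * tau))); last by apply/funext => t; rewrite Im_e.
apply: (measurableT_comp (f := @sin R)); first by apply: continuous_measurable_fun; exact: continuous_sin.
by apply: measurable_funM => //; exact: measurable_cst.
Qed.

(** The real part is the integral over [t >= 0] of a function even in [t], hence half of an integral
    over the line; exchanging the order of integration reduces it to [line_transform]. *)
Lemma boundary_transform : Re (lap w (smooth_value f K a)) = h * theta K (Re (f 1%N)) tau.
Proof.
have [C C0 HC] := kin_line_bound.
have int0 : \int[mu]_t (0 : R) = 0 by have H := Rint_cst measurableT 0; rewrite H mul0r.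
pose p0 := p \_ pos; pose q0 := q \_ pos; pose one : R -> R := fun=> 1; pose h0 := one \_ half.
have [mp mq] := cmeas_kernel kp.
have mp0 : measurable_fun setT p0 by exact: (proj1 (measurable_restrictT p mpos) mp).
have mq0 : measurable_fun setT q0 by exact: (proj1 (measurable_restrictT q mpos) mq).
have mh0 : measurable_fun setT h0.
  exact: (proj1 (measurable_restrictT one mhalf) (measurable_cst _)).
have p0E x : p0 x = if 0 < x then p x else 0 by rewrite /p0 /patch mem_setE in_itv andbT.
have q0E x : q0 x = if 0 < x then q x else 0 by rewrite /q0 /patch mem_setE in_itv andbT.
have h0E t : h0 t = if 0 <= t then 1 else 0 by rewrite /h0 /patch mem_setE in_itv andbT.
(* The indicators of the half-lines are built into [P], so that Fubini applies on the whole
   plane. *)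
pose P x t := (p0 x * A x t + q0 x * B x t) * h0 t.
have PE x t : P x t = if (0 < x) && (0 <= t) then p x * A x t + q x * B x t else 0.
  rewrite /P p0E q0E h0E; case: (0 < x); case: (0 <= t) => /=; rewrite ?mulr1 ?mulr0 //.
  by rewrite !mul0r addr0.
have mf : measurable_fun [set: R * R] (@fst R R) by exact: measurable_fst.
have ms : measurable_fun [set: R * R] (@snd R R) by exact: measurable_snd.
have mP : measurable_fun setT (fun z : R * R => P z.1 z.2).
  have m1 : measurable_fun [set: R * R] (fun z : R * R => g0 z.2) by exact: (measurableT_comp mg0 ms).
  have m2 : measurable_fun [set: R * R] (fun z : R * R => g0 (z.2 - z.1)).
    by apply: (measurableT_comp mg0); exact: measurable_funB.
  have m3 : measurable_fun [set: R * R] (fun z : R * R => g0 (z.2 - - z.1)).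
    apply: (measurableT_comp mg0); apply: measurable_funB => //.
    by apply: measurableT_comp.
  have m4 : measurable_fun [set: R * R] (fun z : R * R => Re (e z.2)) by exact: (measurableT_comp mcos ms).
  have m5 : measurable_fun [set: R * R] (fun z : R * R => Im (e z.2)) by exact: (measurableT_comp msin ms).
  apply: measurable_funM; last exact: (measurableT_comp mh0 ms).
  apply: measurable_funD; apply: measurable_funM; [exact: (measurableT_comp mp0 mf)| |
    exact: (measurableT_comp mq0 mf)|]; apply: measurable_funM => //.
    by apply: measurable_funB => //; apply: measurable_funB => //; apply: measurable_funM => //; exact: measurable_cst.
  exact: measurable_funB.
have mPx x : measurable_fun setT (P x).
  have mpair : measurable_fun [set: R] (fun t : R => (x, t)).
    by apply: measurable_fun_pair; [exact: measurable_cst|exact: measurable_id].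
  exact: (measurableT_comp mP mpair).
have mPt t : measurable_fun setT (P ^~ t).
  have mpair : measurable_fun [set: R] (fun x : R => (x, t)).
    by apply: measurable_fun_pair; [exact: measurable_id|exact: measurable_cst].
  exact: (measurableT_comp mP mpair).
pose bx x t : R := (if `|t - 0| <= a then 1 else 0) + (if `|t - x| <= a then 1 else 0).
have bxi x : rint setT (bx x) /\ \int[mu]_t bx x t = 4 * a.
  have [i1 e1] := box_rint 0 (ltW a0); have [i2 e2] := box_rint x (ltW a0).
  split; first exact: rintD.
  by rewrite /bx (RintD measurableT i1 i2) e1 e2; lra.
pose c x := if 0 < x then C * ((1 + x) ^+ 2)^-1 else 0.
have c0 x : 0 <= c x.
  by rewrite /c; case: ifP => // x0; rewrite mulr_ge0 // invr_ge0 sqr_ge0.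
have Pb x t : `|P x t| <= c x * bx x t.
  rewrite PE /c; case: ifPn => [/andP[x0 t0]|]; first by rewrite x0; exact: HC.
  move=> _; rewrite normr0 mulr_ge0 //; first exact: c0.
  by rewrite /bx; do 2!case: ifP => _ //; rewrite ?addr0 ?add0r // addr_ge0.
have bx2 x t : bx x t <= 2 by rewrite /bx; do 2!case: ifP => _; lra.
have ic : rint setT c.
  have ig : rint pos (fun x => C * ((1 + x) ^+ 2)^-1) by apply: rintZ; [exact: mpos|exact: rint_inv_sqr_pos].
  have := proj1 (rint_restrict _ mpos) ig; apply: eq_rint => // x _.
  by rewrite /c /patch mem_setE in_itv /= andbT.
have iPx x : rint setT (P x).
  by have [i1 _] := bxi x; apply: rint_le (rintZ (c x) measurableT i1).
have iPt t : rint setT (P ^~ t).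
  apply: rint_le (rintZ 2 measurableT ic) => // x _; apply: le_trans (Pb x t) _.
  by rewrite mulrC ler_wpM2r.
have nP x : \int[mu]_t `|P x t| <= 4 * a * c x.
  have [i1 e1] := bxi x; rewrite [leRHS]mulrC -e1 -(RintZl _ measurableT i1).
  apply: (le_Rint measurableT) => //.
  - by apply: rint_abs => //; exact: iPx.
  - exact: rintZ.
have := Rintegral_swap mP iPx iPt nP (rintZ (4 * a) measurableT ic).
have lhs x : \int[mu]_t P x t = h * (theta_integrand K tau \_ pos) x.
  rewrite /patch mem_setE in_itv /= andbT; case: ifPn => x0; last first.
    have -> : P x = fun=> 0 by apply/funext => t; rewrite PE (negbTE x0).
    by rewrite mulr0.
  have [i1 e1] := line_transform x.
  rewrite (@Rintegral_cut R setT half _ (fun t => p x * A x t + q x * B x t)) //.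
  - by rewrite (Rintegral_even i1) ?e1 //; lra.
  - by move=> t _; rewrite /= in_itv /= andbT PE => /negP /negbTE ->; rewrite andbF.
  - by move=> t /inhalf t0; rewrite PE x0 t0.
have it := rint_theta kp tau.
have it' := proj1 (rint_restrict _ mpos) it.
rewrite (_ : (fun x => \int[mu]_t P x t) = (fun x => h * (theta_integrand K tau \_ pos) x)); last first.
  by apply/funext => x; exact: lhs.
rewrite (RintZl _ measurableT it') -Rintegral_mkcond => swap.
have rhs t : \int[mu]_x P x t = if 0 <= t then \int[mu]_(x in pos) (p x * A x t + q x * B x t) else 0.
  case: ifPn => t0.
    apply: (@Rintegral_cut R setT pos _ (fun x => p x * A x t + q x * B x t)) => // x.
      by move=> _; rewrite /= in_itv /= andbT PE => /negP /negbTE ->.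
    by move=> /inpos x0; rewrite PE x0 t0.
  have -> : P ^~ t = fun=> 0 by apply/funext => x; rewrite PE (negbTE t0) andbF.
  exact: int0.
have Sint := smooth_value_cintb F a0 a1 aln zi zcov (s := w); rewrite Re_w in Sint.
have [iS _] := Sint (lexx _).
have eN t : expw (- w) t = conjc (e t).
  by rewrite /expw /e -cexp_conjc conjcM conjc_rC wc.
pose G1 t := g0 t * Re (e t).
have iG1 : rint setT G1 by exact: (rint_Re (testfn_bump a)).
have iG1h : rint half G1 by apply: rint_sub iG1 => //; exact: mhalf.
(* The term with [f 1] is added back so that only the kernel is left on the right; its own integral
   accounts for the [- f1] in [theta]. *)
have SE t : half t -> Re (smooth_value f K a t * expw (- w) t) + 2 * Re (f 1%N) * G1 t =
    \int[mu]_x P x t.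
  move=> /inhalf t0; rewrite rhs t0 eN ReM Re_conjc Im_conjc.
  have -> : Re (smooth_value f K a t) = Re (cint pos (kin K (fun x => g0 (x - t)))) - 2 * Re (f 1%N) * g0 t.
    by rewrite /smooth_value ReB.
  have -> : Im (smooth_value f K a t) = Im (cint pos (kin K (fun x => g0 (x - t)))).
    by rewrite /smooth_value ImB; exact: subr0.
  have ik := kin_cintb kp (testfn_shift t (testfn_bump a)); have [ik1 ik2] := ik.
  have -> : \int[mu]_(x in pos) (p x * A x t + q x * B x t) =
     Re (cint pos (kin K (fun x => g0 (x - t)))) * Re (e t) + Im (cint pos (kin K (fun x => g0 (x - t)))) * Im (e t).
    have j1 := rintZ (Re (e t)) mpos ik1; have j2 := rintZ (Im (e t)) mpos ik2.
    rewrite /cintegral /= ![_ * Re (e t)]mulrC ![_ * Im (e t)]mulrC.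
    rewrite -(RintZl _ mpos ik1) -(RintZl _ mpos ik2).
    rewrite -(RintD mpos j1 j2); apply: eq_Rintegral => x _.
    by rewrite kinE ![_ * Re (e t)]mulrC ![_ * Im (e t)]mulrC.
  by rewrite /G1; ring.
have -> : Re (lap w (smooth_value f K a)) = \int[mu]_(t in half) Re (smooth_value f K a t * expw (- w) t) by [].
have H1 : \int[mu]_(t in half) G1 t = 2^-1 * h.
  rewrite (Rintegral_even iG1) /G1 ?/h ?lt_Re // => t.
  by rewrite bump_even !Re_e mulNr cosN.
have H2 : \int[mu]_(t in half) (Re (smooth_value f K a t * expw (- w) t) + 2 * Re (f 1%N) * G1 t) =
   \int[mu]_t (\int[mu]_x P x t).
  symmetry; apply: Rintegral_cut => // t; last by move=> /SE.
  by move=> _; rewrite /= in_itv /= andbT rhs => /negP /negbTE ->.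
have iG2 := rintZ (2 * Re (f 1%N)) mhalf iG1h.
move: H2; rewrite (RintD mhalf iS iG2).
rewrite (RintZl _ mhalf iG1h) H1 -swap /theta => E.
by rewrite mulrBr -E; lra.
Qed.

End Datum.
End Boundary.

(** * Drift of a phase, and functions on vertical lines *)

Section PhaseDrift.
Variable R : realType.
Implicit Types (t : R).

Lemma rderivM (f g : R -> R) t df dg : is_derive t 1 f df -> is_derive t 1 g dg ->
  is_derive t 1 (fun x => f x * g x) (df * g t + f t * dg).
Proof.
move=> h1 h2; have h := @is_deriveM R _ f g t 1 df dg h1 h2.
by apply: rderiv_eq h _; rewrite addrC /GRing.scale /= [g t * df]mulrC.
Qed.

(* For D' = (kappa + i eps) D with |kappa| <= B, the weight e^(-2Bt) makes |D|^2 decrease and lets Im(D)^2 grow only through eps. *)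
Lemma phase_drift (D lam : R -> R[i]) (g dg : R -> R) (t1 t2 B : R) : t1 <= t2 ->
  (forall t, t1 <= t <= t2 -> cderiv D t (lam t * D t)) ->
  (forall t, t1 <= t <= t2 -> `|Re (lam t)| <= B) ->
  (forall t, t1 <= t <= t2 -> `|Im (lam t)| <= dg t) ->
  (forall t, t1 <= t <= t2 -> is_derive t 1 g (dg t)) -> Im (D t1) = 0 ->
  Im (D t2) ^+ 2 <= normc (D t1) ^+ 2 * (g t2 - g t1) * expR (2 * B * (t2 - t1)).
Proof.
move=> t12 dD kB eB dg_ Y1.
pose X t := Re (D t); pose Y t := Im (D t); pose k t := Re (lam t); pose e t := Im (lam t).
have dX t : t1 <= t <= t2 -> is_derive t 1 X (k t * X t - e t * Y t).
  by move=> h; have [d _] := dD t h; apply: rderiv_eq d _; rewrite ReM.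
have dY t : t1 <= t <= t2 -> is_derive t 1 Y (k t * Y t + e t * X t).
  by move=> h; have [_ d] := dD t h; apply: rderiv_eq d _; rewrite ImM.
pose W t := expR (- (2 * B) * t + 2 * B * t1).
have dW t : is_derive t 1 W (- (2 * B) * W t).
  by apply: (@is_derive_affine R expR); exact: is_derive_expR.
have W1 : W t1 = 1 by rewrite /W -expR0; congr expR; ring.
have W2 : W t2 * expR (2 * B * (t2 - t1)) = 1.
  by rewrite /W -expRD -expR0; congr expR; ring.
have W0 t : 0 < W t by exact: expR_gt0.
pose n1 := X t1 ^+ 2; have n10 : 0 <= n1 := sqr_ge0 _.
have N t : t1 <= t <= t2 -> (X t * X t + Y t * Y t) * W t <= n1.
  move=> /andP[ht1 ht2].
  pose F t := (-1) * ((X t * X t + Y t * Y t) * W t).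
  pose dF t := (-1) * ((((k t * X t - e t * Y t) * X t + X t * (k t * X t - e t * Y t)) +
     ((k t * Y t + e t * X t) * Y t + Y t * (k t * Y t + e t * X t))) * W t +
     (X t * X t + Y t * Y t) * (- (2 * B) * W t)).
  have h : F t1 <= F t.
    apply: (@is_derive_nondecr R F dF) => // x /andP[x1 x2].
      have hx : t1 <= x <= t2 by rewrite x1 (le_trans x2).
      have dXX := rderivM (dX x hx) (dX x hx); have dYY := rderivM (dY x hx) (dY x hx).
      exact: (rderivZ (-1) (rderivM (rderivD dXX dYY) (dW x))).
    have hx : t1 <= x <= t2 by rewrite x1 (le_trans x2).
    have -> : dF x = 2 * ((B - k x) * ((X x ^+ 2 + Y x ^+ 2) * W x)) by rewrite /dF; ring.
    rewrite mulr_ge0 // mulr_ge0 //; last by rewrite mulr_ge0 ?addr_ge0 ?sqr_ge0 // ltW.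
    by rewrite subr_ge0; apply: le_trans (ler_norm _) (kB x hx).
  move: h; rewrite /F W1 (_ : Y t1 = 0) // /n1 expr2; lra.
pose Z t := Y t * Y t * W t.
pose F t := n1 * g t + (-1) * Z t.
pose dF t := n1 * dg t + (-1) * (((k t * Y t + e t * X t) * Y t + Y t * (k t * Y t + e t * X t)) * W t +
     Y t * Y t * (- (2 * B) * W t)).
have h : F t1 <= F t2.
  apply: (@is_derive_nondecr R F dF) => // x hx.
    exact: (rderivD (rderivZ n1 (dg_ x hx)) (rderivZ (-1) (rderivM (rderivM (dY x hx) (dY x hx)) (dW x)))).
  have e1 : 2 * (B - k x) * (Y x ^+ 2 * W x) >= 0.
    apply: mulr_ge0; last by apply: mulr_ge0; [exact: sqr_ge0|exact: ltW].
    by apply: mulr_ge0 => //; rewrite subr_ge0; apply: le_trans (ler_norm _) (kB x hx).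
  have e2 : `|2 * e x * (X x * Y x * W x)| <= n1 * dg x.
    apply: le_trans (_ : `|e x| * ((X x * X x + Y x * Y x) * W x) <= _).
      rewrite -mulrA normrM (ger0_norm (ler0n R 2)) normrM mulrCA ler_wpM2l //.
      rewrite normrM (gtr0_norm (W0 x)) mulrA ler_wpM2r ?(ltW (W0 x)) // normrM.
      have := sqr_ge0 (`|X x| - `|Y x|); rewrite sqrrB !real_normK ?num_real // !expr2; lra.
    rewrite mulrC; apply: ler_pM => //; last exact: eB.
      by rewrite mulr_ge0 ?addr_ge0 ?sqr_ge0 // -?expr2 ?sqr_ge0 // ltW.
    exact: N.
  have -> : dF x = n1 * dg x - 2 * e x * (X x * Y x * W x) + 2 * (B - k x) * (Y x ^+ 2 * W x).
    by rewrite /dF; ring.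
  by rewrite addr_ge0 // subr_ge0; apply: le_trans (ler_norm _) e2.
have Z2 : Z t2 <= n1 * (g t2 - g t1).
  move: h; rewrite /F {1}/Z (_ : Y t1 = 0) //; lra.
have -> : normc (D t1) ^+ 2 = n1 by rewrite normc_sqr Y1 expr0n addr0.
have E0 := expR_ge0 (2 * B * (t2 - t1)).
by apply: le_trans (ler_wpM2r E0 Z2); rewrite /Z -[Y t2 * Y t2 * W t2 * _]mulrA W2 mulr1 expr2.
Qed.

End PhaseDrift.

Section LineTools.
Variable R : realType.
Notation half := (`[0, +oo[%classic : set R).
Implicit Types (t x sg : R).

Definition vline (sg t : R) : R[i] := sg%:C + 'i * t%:C.

Lemma Re_vline sg t : Re (vline sg t) = sg.
Proof. by rewrite /vline ReD Re_iM /= oppr0 addr0. Qed.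
Lemma Im_vline sg t : Im (vline sg t) = t.
Proof. by rewrite /vline ImD Im_iM /= add0r. Qed.

Lemma cos_sub1_bound x : `|cos x - 1| <= x ^+ 2 /\ `|sin x - x| <= x ^+ 2.
Proof.
have dc (y : R) : is_derive y 1 (fun y => cos y) (- sin y) by exact: is_derive_cos.
have ds (y : R) : is_derive y 1 (fun y => sin y) (cos y) by exact: is_derive_sin.
have dsN (y : R) : is_derive y 1 (fun y => - sin y) (- cos y).
  by have := rderivZ (-1) (ds y); rewrite mulN1r; (move=> h; rewrite (_ : (fun y => - sin y) = fun y => -1 * sin y) //; apply/funext => z; rewrite mulN1r).
have bc (y : R) : `|- cos y| <= 1 by rewrite normrN; exact: cos_max.
have bs (y : R) : `|- sin y| <= 1 by rewrite normrN; exact: sin_max.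
have h1 := taylor2 0 x dc dsN bc; have h2 := taylor2 0 x ds dc bs.
have e1 : cos (0 + x) - cos 0 - x * - sin 0 = cos x - 1 by rewrite add0r cos0 sin0; ring.
have e2 : sin (0 + x) - sin 0 - x * cos 0 = sin x - x by rewrite add0r cos0 sin0; ring.
by rewrite -e1 -e2 -(mulr1 (x ^+ 2)); split.
Qed.

Lemma ln_sqr_expN_bound (n : nat) (e : R) : 0 < e -> ln (n%:R : R) ^+ 2 * expR (- e * ln n%:R) <= (2 / e) ^+ 2.
Proof.
move=> e0; have e2 : 0 < e / 2 by rewrite divr_gt0.
have h := ln_expN_bound n e2; have L := ln_nat_ge0 R n.
have -> : expR (- e * ln (n%:R : R)) = expR (- (e / 2) * ln n%:R) ^+ 2.
  by rewrite expr2 -expRD; congr expR; lra.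
rewrite -exprMn -[2 / e]invf_div; apply: lerXn2r => //; rewrite nnegrE.
  by rewrite mulr_ge0.
by rewrite invr_ge0 ltW.
Qed.

Section Series.
Variables (A : nat -> R[i]) (BA : R).
Hypotheses (A0 : A 0%N = 0) (AB : forall N, \sum_(0 <= k < N) normc (A k) <= BA).

(** Each k^(-it) is expanded to second order; the remainders carry log^2 k times k^(-sg), which is
    bounded for [sg > 0], so together they are O(h^2). *)
Lemma lser_derive sg t : 0 < sg ->
  csum (fun k => log_coef A k * cpow k (- vline sg t)) @ \oo --> lser (log_coef A) (vline sg t) ->
  cderiv (fun t => lser A (vline sg t)) t ('i * lser (log_coef A) (vline sg t)).
Proof.
move=> sg0 H; set d := 'i * _.
pose C := 2 * ((2 / sg) ^+ 2 * BA).
have key h : normc (lser A (vline sg (t + h)) - lser A (vline sg t) - h%:C * d) <= h ^+ 2 * C.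
  have Hlim : (fun N => csum (fun k => A k * cpow k (- vline sg (t + h))) N -
      csum (fun k => A k * cpow k (- vline sg t)) N -
      h%:C * ('i * csum (fun k => log_coef A k * cpow k (- vline sg t)) N)) @ \oo -->
      lser A (vline sg (t + h)) - lser A (vline sg t) - h%:C * d.
    apply: cvgB; last by apply: cvgM; [exact: cvg_cst|apply: cvgM; [exact: cvg_cst|exact: H]].
    by apply: cvgB; apply: (lserP AB); rewrite Re_vline ltW.
  have Hb N : normc (csum (fun k => A k * cpow k (- vline sg (t + h))) N -
      csum (fun k => A k * cpow k (- vline sg t)) N -
      h%:C * ('i * csum (fun k => log_coef A k * cpow k (- vline sg t)) N)) <= h ^+ 2 * C.
    have -> : csum (fun k => A k * cpow k (- vline sg (t + h))) N - csum (fun k => A k * cpow k (- vline sg t)) N -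
      h%:C * ('i * csum (fun k => log_coef A k * cpow k (- vline sg t)) N) =
      csum (fun k => A k * cpow k (- vline sg t) * (cexp ('i * (- h * ln k%:R)%:C) - 1 - 'i * (- h * ln k%:R)%:C)) N.
      rewrite /csum !mulr_sumr -!sumrB; apply: eq_bigr => k _.
      have -> : cpow k (- vline sg (t + h)) = cpow k (- vline sg t) * cexp ('i * (- h * ln k%:R)%:C).
        by rewrite !cpowE -cexpD; congr cexp; rewrite /vline rCD !rCM rCN; ring.
      rewrite /log_coef !rCM rCN; ring.
    apply: le_trans (normc_csum _ _) _.
    apply: le_trans (_ : \sum_(0 <= k < N) normc (A k) * (h ^+ 2 * (2 * (2 / sg) ^+ 2)) <= _); last first.
      rewrite -mulr_suml; apply: le_trans (ler_wpM2r _ (AB N)) _.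
        by apply: mulr_ge0; [exact: sqr_ge0|apply: mulr_ge0; [by []|exact: sqr_ge0]].
      by rewrite le_eqVlt /C; apply/orP; left; apply/eqP; ring.
    apply: ler_sum => k _; rewrite 2!normcM_ -mulrA ler_wpM2l //.
    rewrite normc_cpow ReN Re_vline.
    set L := ln k%:R; pose v := - h * L; rewrite -/v.
    have [c1 s1] := cos_sub1_bound v.
    have N2 : normc (cexp ('i * v%:C) - 1 - 'i * v%:C) <= 2 * v ^+ 2.
      apply: le_trans (normc_le_ReIm _) _; rewrite !ReB !ImB Re_cexp Im_cexp Re_iM Im_iM /= oppr0 expR0 !mul1r !subr0 addr0.
      by move: c1 s1; rewrite -/v; lra.
    apply: le_trans (ler_wpM2l (expR_ge0 _) N2) _.
    have := ln_sqr_expN_bound k sg0; rewrite -/L => h3.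
    apply: le_trans (_ : h ^+ 2 * (2 * (L ^+ 2 * expR (- sg * L))) <= _).
      by rewrite le_eqVlt /v; apply/orP; left; apply/eqP; ring.
    by rewrite ler_wpM2l ?sqr_ge0 // ler_wpM2l.
  exact: normc_lim_le Hb Hlim.
split; apply: (@is_derive_quadratic R _ t _ C) => h; apply: le_trans (key h).
  by apply: le_trans (ler_normc_Re _); rewrite !ReB Re_rC.
by apply: le_trans (ler_normc_Im _); rewrite !ImB Im_rC.
Qed.

Lemma lser_boundary (sg : nat -> R) t : (forall n, 0 <= sg n) -> sg @ \oo --> (0 : R) ->
  (fun n => lser A (vline (sg n) t)) @ \oo --> lser A (vline 0 t).
Proof.
move=> s0 sc; have BA0 : 0 <= BA := BA_ge0 AB.
pose wt n k : R[i] := A k * (cpow k (- vline (sg n) t) - cpow k (- vline 0 t)).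
have T : (fun n => lser A (vline (sg n) t) - lser A (vline 0 t)) @ \oo --> (0 : R[i]).
  apply: (@tannery R nat \oo _ wt _ (fun k => normc (A k) * 2) (BA * 2)).
  - by move=> N; rewrite -mulr_suml ler_wpM2r.
  - move=> n k; rewrite normcM_ ler_wpM2l //; apply: le_trans (normcB _ _) _.
    by rewrite (_ : 2 = 1 + 1) //; apply: lerD; apply: normc_cpowN_le1; rewrite Re_vline.
  - move=> k; have E n : wt n k = A k * cpow k (- vline 0 t) * (expR (- ln k%:R * sg n) - 1)%:C.
      rewrite /wt; have -> : cpow k (- vline (sg n) t) = cpow k (- vline 0 t) * (expR (- ln k%:R * sg n))%:C.
        by rewrite -cexp_rC !cpowE -cexpD; congr cexp; rewrite /vline rCM rCN; ring.
      rewrite rCB; ring.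
    have H : (fun n => expR (- ln (k%:R : R) * sg n) - 1) @ \oo --> (0 : R).
      have H1 : (fun n => - ln (k%:R : R) * sg n) @ \oo --> (0 : R).
        by rewrite -[X in _ --> X](mulr0 (- ln (k%:R : R))); apply: cvgM; [exact: cvg_cst|exact: sc].
      have H2 : (fun n => expR (- ln (k%:R : R) * sg n)) @ \oo --> expR (0 : R).
        by apply: (cvg_comp _ _ H1); exact: continuous_expR.
      have H3 : (fun n => expR (- ln (k%:R : R) * sg n) - 1) @ \oo --> expR 0 - 1.
        by apply: cvgB; [exact: H2|exact: cvg_cst].
      by rewrite expR0 subrr in H3.
    have HC : (fun n => (expR (- ln (k%:R : R) * sg n) - 1)%:C) @ \oo --> (0 : R[i]).
      apply/cvg_normcP => e e0; move/cvgrPdist_lt : H => /(_ _ e0); apply: filterS => n.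
      by rewrite normc_distC subr0 normc_rC sub0r normrN.
    have H3 : (fun n => A k * cpow k (- vline 0 t) * (expR (- ln k%:R * sg n) - 1)%:C) @ \oo --> A k * cpow k (- vline 0 t) * 0.
      by apply: cvgM; [exact: cvg_cst|exact: HC].
    by rewrite mulr0 in H3; apply: cvg_ext H3 => n; rewrite E.
  - move=> n.
    have H : (fun N => csum (fun k => A k * cpow k (- vline (sg n) t)) N - csum (fun k => A k * cpow k (- vline 0 t)) N)
       @ \oo --> lser A (vline (sg n) t) - lser A (vline 0 t).
      by apply: cvgB; apply: (lserP AB); rewrite Re_vline.
    by apply: cvg_ext H => N; rewrite /csum -sumrB; apply: eq_bigr => k _; rewrite /wt mulrBr.
have T2 : (fun n => lser A (vline (sg n) t) - lser A (vline 0 t) + lser A (vline 0 t)) @ \oo --> 0 + lser A (vline 0 t).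
  by apply: cvgD; [exact: T|exact: cvg_cst].
by rewrite add0r in T2; apply: cvg_ext T2 => n; rewrite subrK.
Qed.

End Series.

Section Bump.
Variables (a T : R).
Hypotheses (a0 : 0 < a) (a1 : a <= 1) (aT : a * T <= 2^-1) (T0 : 0 <= T).
Notation g0 := (bump a).
Let I0 := \int[mu]_t g0 t.

Lemma bump_mass_gt0 : 0 < I0.
Proof.
have h : 0 < Re (lt g0 0) by apply: lt_bump_gt0 => //; rewrite normr0 mulr0.
suff -> : I0 = Re (lt g0 0) by [].
by rewrite /lt /cintegral /=; apply: eq_Rintegral => t _; rewrite Re_rC mulr0 cexp0 mulr1.
Qed.

Let ig0 : rint setT g0.
Proof. by have [h _] := bump_shift_rint a 0; apply: eq_rint h => // t _; rewrite subr0. Qed.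

(** On the support, |t Im s| <= 1/2 keeps the cosine above 1/4 and |t Re s| <= 1 keeps the
    exponential above 1/e. The bound is uniform on a rectangle, which later permits division by the
    transform. *)
Lemma lt_bump_lower s : `|Re s| <= 1 -> `|Im s| <= T -> 4^-1 * expR (-1) * I0 <= Re (lt g0 s).
Proof.
move=> s1 sT; have [i1 _] := test_cintb s (testfn_bump a).
rewrite -(RintZl _ measurableT ig0) /lt /cintegral /=.
apply: (le_Rint measurableT) => //; first exact: rintZ.
have a1' := a1; move=> t _; rewrite Re_rC mulrC.
have [ta|ta] := leP a `|t|; first by rewrite bump_eq0 // !mul0r.
rewrite ler_wpM2l ?bump_ge0 // Re_cexp Re_rC Im_rC.
have u1 : `|t * Im s| <= 2^-1.
  rewrite normrM; apply: le_trans aT; apply: ler_pM => //; exact: ltW.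
have u2 : `|t * Re s| <= 1.
  by rewrite normrM; apply: le_trans (_ : 1 * 1 <= 1); [apply: ler_pM => //; lra|rewrite mulr1].
have [c _] := cos_sub1_bound (t * Im s).
have c4 : 4^-1 <= cos (t * Im s).
  have q : (t * Im s) ^+ 2 <= 2^-1 * 2^-1.
    by rewrite -[(t * Im s) ^+ 2]real_normK ?num_real // expr2 ler_pM.
  by move: c; rewrite ler_norml => /andP[h _]; lra.
have e1 : expR (-1) <= expR (t * Re s).
  by rewrite ler_expR; move: u2; rewrite ler_norml => /andP[h _].
by rewrite mulrC; apply: ler_pM => //; exact: expR_ge0.
Qed.

Lemma lt_bump_lipschitz (d : R) s s' : `|Re s| <= 1 -> normc (s' - s) <= d ->
  normc (lt g0 s' - lt g0 s) <= 4 * expR (1 + d) * I0 * normc (s' - s).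
Proof.
move=> s1 sd.
have i1 := test_cintb s (testfn_bump a); have i2 := test_cintb s' (testfn_bump a).
have i3 := cintbN measurableT i1.
have -> : lt g0 s' - lt g0 s = cint setT (fun t => (g0 t)%:C * cexp (t%:C * s') + - ((g0 t)%:C * cexp (t%:C * s))).
  by rewrite (cintD measurableT i2 i3) (cintN measurableT i1).
have ig := rintZ (4 * expR (1 + d) * normc (s' - s)) measurableT ig0.
have h := @cint_le R setT _ _ measurableT (cintbD measurableT i2 i3) _ ig.
apply: le_trans (h _) _; last first.
  rewrite (RintZl _ measurableT ig0) -/I0.
  by apply: le_of_eq; ring.
move=> t _; rewrite -mulrBr normcM_ normc_rC ger0_norm ?bump_ge0 // [leRHS]mulrC.
have [ta|ta] := leP a `|t|; first by rewrite bump_eq0 // !mul0r.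
rewrite ler_wpM2l ?bump_ge0 //.
have -> : cexp (t%:C * s') - cexp (t%:C * s) = cexp (t%:C * s) * (cexp (t%:C * (s' - s)) - 1).
  by rewrite mulrBr mulr1 -cexpD; congr (cexp _ - _); ring.
rewrite normcM_ normc_cexp Re_rC.
have t1 : `|t| <= 1 by have := a1; lra.
have e1 : expR (t * Re s) <= expR 1.
  rewrite ler_expR; apply: le_trans (ler_norm _) _; rewrite normrM.
  by apply: le_trans (_ : 1 * 1 <= 1); [apply: ler_pM|rewrite mulr1].
have X : normc (t%:C * (s' - s)) <= normc (s' - s).
  by rewrite normcM_ normc_rC ler_piMl.
have := @cexp_taylor_bound R (t%:C * (s' - s)) 1 1.
rewrite lexx ler01 => /(_ isT); rewrite big_ord_recl big_ord0 addr0 !expr0 mul1r expr1n.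
have -> : (0`!%:R)^-1 * 1 = 1 :> R[i] by rewrite mulr1 invr1.
have -> : 1 / 1`!%:R = 1 :> R by rewrite div1r invr1.
rewrite mulr1 expr1 => h2.
rewrite expRD [leRHS](_ : _ = expR 1 * (4 * expR d * normc (s' - s))); last by ring.
apply: ler_pM => //; rewrite //; apply: le_trans h2 _.
rewrite (_ : _ * _ = 4 * (expR (normc (t%:C * (s' - s))) * normc (t%:C * (s' - s)))); last first.
  by move: (normc _) => Q; ring.
rewrite -mulrA ler_wpM2l // ler_pM // ler_expR; lra.
Qed.

End Bump.

(** For an integer [x] this is [u^(-x)], [Num.truncn] supplying the natural exponent: as a factor it
    divides out a zero of multiplicity [x]. *)
Definition ipow (x : R) (u : R[i]) : R[i] :=
  if 0 <= x then u^-1 ^+ (Num.truncn x) else u ^+ (Num.truncn (- x)).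

Lemma truncn_int (x : R) : x \is a Num.int -> 0 <= x -> (Num.truncn x)%:R = x.
Proof. by move=> xi x0; apply: truncnK; rewrite natrEint xi. Qed.

Lemma ipow_derive (x : R) (u : R -> R[i]) t (du : R[i]) : x \is a Num.int -> u t != 0 -> cderiv u t du ->
  cderiv (fun t => ipow x (u t)) t (- (x%:C * du / u t) * ipow x (u t)).
Proof.
move=> xi u0 hu; rewrite /ipow; case: ifPn => [x0|].
  have := cderivX (Num.truncn x) (cderivV u0 hu) => h; apply: cderiv_eq h _.
  move: (truncn_int xi x0); move: (Num.truncn x) => n <-.
  rewrite (_ : n%:R%:C = n%:R); last exact: rmorph_nat.
  case: n => [|n] /=; first by rewrite !mul0r oppr0 mul0r.
  rewrite [(u t)^-1 ^+ n.+1]exprS exprVn; field.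
  by rewrite u0 ?expf_neq0.
rewrite -ltNge => x0.
have := cderivX (Num.truncn (- x)) hu => h; apply: cderiv_eq h _.
have xi' : - x \is a Num.int by rewrite rpredN.
have : - (Num.truncn (- x))%:R = x by rewrite truncn_int ?opprK // oppr_ge0 ltW.
move: (Num.truncn (- x)) => n <-; rewrite rCN.
rewrite (_ : n%:R%:C = n%:R); last exact: rmorph_nat.
case: n => [|n] /=; first by rewrite !(mul0r, oppr0).
by rewrite [u t ^+ n.+1]exprS; field.
Qed.

Lemma conjcX (z : R[i]) n : conjc (z ^+ n) = conjc z ^+ n.
Proof. by elim: n => [|n IH]; rewrite ?exprS ?conjcM ?IH //; exact: conjc_rC. Qed.

Lemma conjcV (z : R[i]) : conjc z^-1 = (conjc z)^-1.
Proof.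
have [->|z0] := eqVneq z 0; first by rewrite invr0 (conjc_rC 0) invr0.
have cz0 : conjc z != 0 by rewrite -normc_gt0 normc_conjc normc_gt0.
by apply: (mulfI cz0); rewrite -conjcM mulfV // mulfV // (conjc_rC 1).
Qed.

(** The same integral power of two points of the imaginary axis has the same phase up to sign, so a
    zero on the critical line changes the phase by at most a sign. *)
Lemma ipow_imag (x y z : R) : y != 0 -> z != 0 -> exists2 k : R, k != 0 &
  ipow x ('i * y%:C) * conjc (ipow x ('i * z%:C)) = k%:C.
Proof.
move=> y0 z0; have yz0 : y * z != 0 by rewrite mulf_neq0.
have E : ('i * y%:C) * conjc ('i * z%:C) = (y * z)%:C :> R[i].
  rewrite conjc_i conjc_rC rCM mulrN -mulrN -!mulrA; have : 'i * 'i = -1 :> R[i] by rewrite -expr2 sqr_i.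
  move=> ii; rewrite (_ : 'i * (y%:C * - ('i * z%:C)) = - ('i * 'i) * (y%:C * z%:C)); last by ring.
  by rewrite ii opprK mul1r.
rewrite /ipow; case: ifP => _.
  exists ((y * z)^-1 ^+ Num.truncn x); first by rewrite expf_neq0 // invr_eq0.
  have -> : conjc (('i * z%:C)^-1 ^+ Num.truncn x) = (conjc ('i * z%:C))^-1 ^+ Num.truncn x :> R[i].
    by rewrite conjcX conjcV.
  by rewrite -exprMn -invfM E rCX rCV.
exists ((y * z) ^+ Num.truncn (- x)); first by rewrite expf_neq0.
have -> : conjc (('i * z%:C) ^+ Num.truncn (- x)) = conjc ('i * z%:C) ^+ Num.truncn (- x) :> R[i].
  by rewrite conjcX.
by rewrite -exprMn E rCX.
Qed.

Lemma ipow_cvg (x : R) (u : nat -> R[i]) (l : R[i]) : l != 0 -> u @ \oo --> l ->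
  (fun n => ipow x (u n)) @ \oo --> ipow x l.
Proof.
move=> l0 ul; have X k (v : nat -> R[i]) (l' : R[i]) : v @ \oo --> l' -> (fun n => v n ^+ k) @ \oo --> l' ^+ k.
  move=> h; elim: k => [|k IH]; first by rewrite expr0; apply: cvg_ext (cvg_cst _) => n; rewrite expr0.
  have H := cvgM h IH.
  by rewrite exprS; apply: (cvg_ext _ (H _)) => n; rewrite exprS.
have H : (fun n => (u n)^-1) @ \oo --> l^-1 by exact: (@cvgV R[i] nat \oo _ u l l0 ul).
by rewrite /ipow; case: ifP => _; [exact: (X _ (fun n => (u n)^-1) l^-1 H)|exact: (X _ u l ul)].
Qed.

End LineTools.

(** * Constancy of the phase across zeros on the critical line *)

Section Crossing.
Variable R : realType.
Notation half := (`[0, +oo[%classic : set R).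
Notation pos := (`]0, +oo[%classic : set R).
Implicit Types (t x sg tau : R).

Lemma mul_conjc (u : R[i]) : conjc u * u = (normc u ^+ 2)%:C.
Proof. by apply: complex_ext; rewrite ?ReM ?ImM ?Re_conjc ?Im_conjc ?normc_sqr /=; ring. Qed.
Lemma vline0 t : vline 0 t = 'i * t%:C.
Proof. by rewrite /vline add0r. Qed.
Lemma vline_sub sg t sg' t' : vline sg t - vline sg' t' = vline (sg - sg') (t - t').
Proof. by rewrite /vline !rCB; ring. Qed.
Lemma normc_vline_Re sg t : `|sg| <= normc (vline sg t).
Proof. by rewrite -{1}(Re_vline sg t); exact: ler_normc_Re. Qed.
Lemma normc_vline_Im sg t : `|t| <= normc (vline sg t).
Proof. by rewrite -{1}(Im_vline sg t); exact: ler_normc_Im. Qed.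
Lemma normc_vline_real sg : normc (vline sg 0) = `|sg|.
Proof. by rewrite /vline mulr0 addr0 normc_rC. Qed.

Lemma finite_min (P : nat -> R -> Prop) N : (forall j, exists2 e : R, 0 < e & P j e) ->
  (forall j e e', 0 < e' -> e' <= e -> P j e -> P j e') ->
  exists2 e : R, 0 < e <= 1 & forall j, (j < N)%N -> P j e.
Proof.
move=> H mono; elim: N => [|N [e /andP[e0 e1] He]]; first by exists 1; rewrite ?ltr01 ?lexx.
have [e' e'0 He'] := H N; have m0 : 0 < Num.min e e' by rewrite lt_min e0.
exists (Num.min e e'); first by rewrite m0 ge_min e1.
move=> j; rewrite ltnS leq_eqVlt => /orP[/eqP ->|/He Pj].
  by apply: mono He' => //; rewrite ge_min lexx orbT.
by apply: mono Pj => //; rewrite ge_min lexx.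
Qed.

Variables (f : nat -> R[i]) (K : R -> R[i]) (m : R[i] -> R) (y : R) (zs : nat -> R[i]).
Variables (pr pi : R -> R) (A : nat -> R[i]) (BA : R).
Hypotheses (F : L_datum f K m) (kp : kernel_parts K pr pi) (y0 : 0 <= y) (zi : injective zs)
  (zy : forall j, `|Im (zs j)| <= y)
  (zcov : forall z, m z != 0 -> (exists j, zs j = z) /\ (exists j, zs j = conjc z))
  (zlf : forall T, exists N, forall j, `|Re (zs j)| <= T -> (j < N)%N).
Hypotheses (A0 : A 0%N = 0) (AB : forall N, \sum_(0 <= k < N) normc (A k) <= BA).
Hypothesis Aconv : forall n, (0 < n)%N ->
  (ln (n%:R : R))%:C * A n = dconv (fun k => if k == 1%N then 0 else f k) A n.
Variables (t1 t2 : R).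
Hypotheses (t1_ge0 : 0 <= t1) (t12 : t1 <= t2)
  (m_int : forall j, Im (zs j) = 0 -> t1 <= Re (zs j) -> m (zs j) \is a Num.int)
  (np1 : forall j, m (zs j) != 0 -> zs j != t1%:C) (np2 : forall j, m (zs j) != 0 -> zs j != t2%:C).

Let t2_ge0 : 0 <= t2 := le_trans t1_ge0 t12.
(** The last bound gives [a * t2 <= 1/2], under which the transform of the bump has a positive lower
    bound up to height [t2]. *)
Definition strip_width : R := Num.min (Num.min 1 (ln 2)) (2 * (1 + t2))^-1.
Notation a := strip_width.
Let t21 : 0 < 2 * (1 + t2). Proof. by have := t2_ge0; lra. Qed.
Let a0 : 0 < a. Proof. by rewrite !lt_min ltr01 ln2_gt0 invr_gt0. Qed.
Let a1 : a <= 1. Proof. by rewrite !ge_min lexx. Qed.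
Let aln : a <= ln 2. Proof. by rewrite !ge_min lexx orbT. Qed.
Let aT : a * t2 <= 2^-1.
Proof.
have h : a <= (2 * (1 + t2))^-1 by rewrite ge_min lexx orbT.
apply: le_trans (ler_wpM2r t2_ge0 h) _; rewrite mulrC ler_pdivrMr //; have := t2_ge0; lra.
Qed.
Notation g0 := (bump a).
Let w j : R[i] := 'i * zs j.
Let w' j : R[i] := 'i * conjc (zs j).
Let H s := lt g0 s.
Let c j := (m (zs j))%:C * H (w j).
Let c' j := (m (zs j))%:C * H (w' j).
(** Each zero is averaged with its conjugate: [w' j] is the mirror image of [w j] in the imaginary
    axis, and on that axis the two halves add up to a purely imaginary number. *)
Let term j s := 2^-1 * (c j / (s - w j) + c' j / (s - w' j)).
Let S := smooth_value f K a.
Let Gk s := lap s S.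
Let l s := lser A s.
Let zc1 z : m z != 0 -> exists j, zs j = z. Proof. by case/zcov. Qed.
Let zc2 z : m z != 0 -> exists j, conjc (zs j) = z.
Proof. by case/zcov => _ [j jz]; exists j; rewrite jz; apply: complex_ext; rewrite !(Re_conjc, Im_conjc) ?opprK. Qed.
Let zi' : injective (fun j => conjc (zs j)).
Proof. by move=> j k /(can_inj (@conjcK R)) /zi. Qed.
Let mc j : m (conjc (zs j)) = m (zs j) := m_conj F (zs j).

Let w'E j : w' j = - conjc (w j).
Proof. by rewrite /w' /w conjc_i opprK. Qed.

Let c'E j : c' j = conjc (c j).
Proof.
by rewrite /c' /c conjcM conjc_rC /H w'E (lt_even _ (testfn_bump a) (bump_even a)) (lt_conj _ (testfn_bump a)).
Qed.

Let vl j : w j = vline (- Im (zs j)) (Re (zs j)).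
Proof. by apply: complex_ext; rewrite ?Re_vline ?Im_vline ?Re_iM ?Im_iM. Qed.

Let vl' j : w' j = vline (Im (zs j)) (Re (zs j)).
Proof. by apply: complex_ext; rewrite ?Re_vline ?Im_vline ?Re_iM ?Im_iM ?Im_conjc ?Re_conjc ?opprK. Qed.

(** The zeros on the critical line between the two heights: the only ones that the vertical segments
    approach as their abscissa tends to 0. *)
Definition near_pole N j := [&& (j < N)%N, m (zs j) != 0, Im (zs j) == 0, t1 <= Re (zs j) & Re (zs j) <= t2].

Section Fixed.
Variables (N0 : nat) (d0 Bm C : R).
Hypotheses (N0P : forall j, `|Re (zs j)| <= t2 + 1 -> (j < N0)%N).
Notation J := (near_pole N0).

Let sep d j := forall sg tau, 0 <= sg <= d -> t1 <= tau <= t2 -> m (zs j) != 0 -> ~~ J j ->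
  d <= normc (vline sg tau - w j) /\ d <= normc (vline sg tau - w' j).

(** A zero off the line stays at distance |Im z| / 2 from a strip of that width, one on the line but
    outside [[t1, t2]] at its distance to the interval, and one of index at least [N0] at distance
    at least 1; so a minimum over finitely many zeros suffices. *)
Lemma separation : exists2 d, 0 < d <= 1 & forall j, sep d j.
Proof.
have [||d /andP[d00 d1] Hd] := @finite_min (fun j d => (j < N0)%N -> sep d j) N0.
- move=> j; have [jN|jN] := ltnP j N0; last by exists 1.
  have [I0|I0] := eqVneq (Im (zs j)) 0; last first.
    exists (`|Im (zs j)| / 2); first by rewrite divr_gt0 // normr_gt0.
    move=> _ sg tau /andP[s0 sd] _ _ _; rewrite vl vl' !vline_sub.
    split; apply: le_trans (normc_vline_Re _ _).
      have := ler_normB (sg - - Im (zs j)) sg.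
      rewrite opprK addrAC subrr add0r (ger0_norm s0); lra.
    have := ler_normB (sg - Im (zs j)) sg; rewrite addrAC subrr add0r normrN (ger0_norm s0); lra.
  have [[r1 r2]|nr] := pselect (t1 <= Re (zs j) /\ Re (zs j) <= t2).
    exists 1 => // _ sg tau _ _ mz; rewrite /near_pole jN mz I0 eqxx r1 r2 //.
  have [r1|r1] := leP t1 (Re (zs j)).
    have r2 : t2 < Re (zs j) by rewrite ltNge; apply/negP => h; apply: nr.
    exists (Re (zs j) - t2); first by rewrite subr_gt0.
    move=> _ sg tau _ /andP[h1 h2] _ _; rewrite vl vl' !vline_sub.
    by split; apply: le_trans (normc_vline_Im _ _); rewrite distrC; apply: le_trans (ler_norm _); lra.
  exists (t1 - Re (zs j)); first by rewrite subr_gt0.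
  move=> _ sg tau _ /andP[h1 h2] _ _; rewrite vl vl' !vline_sub.
  by split; apply: le_trans (normc_vline_Im _ _); apply: le_trans (ler_norm _); lra.
- move=> j e e' e'0 e'e h jN sg tau /andP[s0 se] ht mz nJ.
  have hs : 0 <= sg <= e by rewrite s0 (le_trans se).
  have [h1 h2] := h jN sg tau hs ht mz nJ.
  by split; apply: le_trans e'e _.
exists d; first by rewrite d00.
move=> j; have [jN|jN] := ltnP j N0; first exact: Hd.
move=> sg tau _ /andP[h1 h2] _ _; rewrite vl vl' !vline_sub.
have b : t2 + 1 < `|Re (zs j)| by rewrite ltNge; apply/negP => /N0P; rewrite ltnNge jN.
have b2 : d <= `|tau - Re (zs j)|.
  have := ler_normB tau (tau - Re (zs j)); rewrite opprB addrCA subrr addr0.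
  have tau0 : 0 <= tau := le_trans t1_ge0 h1; rewrite (ger0_norm tau0); lra.
by split; apply: le_trans b2 (normc_vline_Im _ _).
Qed.

Hypotheses (d0P : 0 < d0 <= 1) (sepP : forall j, sep d0 j).
Hypotheses (Bm0 : 0 <= Bm) (cB : forall N, \sum_(0 <= j < N) (normc (c j) + normc (c' j)) <= Bm).
Hypotheses (C0 : 0 <= C) (SB : forall t, 0 <= t -> normc (S t) <= C * ((1 + t) ^+ 2)^-1).

Let d00 : 0 < d0. Proof. by case/andP: d0P. Qed.
Let d01 : d0 <= 1. Proof. by case/andP: d0P. Qed.
Let rect sg tau := (0 <= sg <= d0) && (t1 <= tau <= t2).

Let reg j s := if J j then 0 else term j s.

Lemma c0 j : m (zs j) = 0 -> c j = 0 /\ c' j = 0.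
Proof. by move=> mz; rewrite /c /c' mz !mul0r. Qed.
Lemma term0 j s : m (zs j) = 0 -> term j s = 0.
Proof. by move=> /c0[e e']; rewrite /term e e' !mul0r addr0 mulr0. Qed.

Lemma reg_le sg tau j : rect sg tau -> normc (reg j (vline sg tau)) <= (normc (c j) + normc (c' j)) / d0.
Proof.
move=> /andP[hs ht]; have b0 : 0 <= (normc (c j) + normc (c' j)) / d0.
  by rewrite divr_ge0 ?addr_ge0 // ltW.
rewrite /reg; case: ifPn => nJ; first by rewrite normc0_.
have [mz|mz] := eqVneq (m (zs j)) 0; first by rewrite term0 // normc0_.
have [h1 h2] := sepP hs ht mz nJ.
have bd (u v : R[i]) : d0 <= normc v -> normc (u / v) <= normc u / d0.
  move=> h; rewrite normcM_ normcV_ ler_wpM2l // lef_pV2 ?posrE //; exact: lt_le_trans h.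
rewrite /term normcM_ normcV_ normc_nat.
have := normcD (c j / (vline sg tau - w j)) (c' j / (vline sg tau - w' j)).
have := bd (c j) _ h1; have := bd (c' j) _ h2; have := normc_ge0 (c j / (vline sg tau - w j) + c' j / (vline sg tau - w' j)).
rewrite mulrDl; lra.
Qed.

Lemma regB sg tau N : rect sg tau -> \sum_(0 <= j < N) normc (reg j (vline sg tau)) <= Bm / d0.
Proof.
move=> hr; apply: le_trans (ler_wpM2r _ (cB N)); last by rewrite invr_ge0 ltW.
by rewrite mulr_suml; apply: ler_sum => j _; exact: reg_le.
Qed.

Let Nreg s : R[i] := xget 0 [set v | csum (reg ^~ s) @ \oo --> v].

Lemma NregP sg tau : rect sg tau -> csum (reg ^~ (vline sg tau)) @ \oo --> Nreg (vline sg tau).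
Proof.
move=> hr; have [v Hv] := abs_csum_cvg (fun N => regB N hr).
exact: (@xgetPex _ 0 [set v | csum (reg ^~ (vline sg tau)) @ \oo --> v] (ex_intro _ v Hv)).
Qed.

Lemma Nreg_bound sg tau : rect sg tau -> normc (Nreg (vline sg tau)) <= Bm / d0.
Proof.
move=> hr; have h N : normc (csum (reg ^~ (vline sg tau)) N) <= Bm / d0.
  exact: le_trans (normc_csum _ _) (regB N hr).
exact: normc_lim_le h (NregP hr).
Qed.

Lemma rect0 sg tau : rect sg tau -> rect 0 tau.
Proof. by move=> /andP[_ ht]; rewrite /rect lexx ltW. Qed.

Lemma Nreg_lipschitz sg tau : rect sg tau ->
  normc (Nreg (vline sg tau) - Nreg (vline 0 tau)) <= sg * (Bm / d0 ^+ 2).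
Proof.
move=> hr; have hr0 := rect0 hr; have /andP[hs ht] := hr; have /andP[hs0 _] := hr0; have /andP[s0 _] := hs.
have bd (u v v' : R[i]) : v - v' = sg%:C -> d0 <= normc v -> d0 <= normc v' ->
    normc (u / v - u / v') <= sg * (normc u / d0 ^+ 2).
  move=> vv h1 h2; have n1 := lt_le_trans d00 h1; have n2 := lt_le_trans d00 h2.
  have v0 : v != 0 by rewrite -normc_gt0. have v0' : v' != 0 by rewrite -normc_gt0.
  have -> : u / v - u / v' = - (u * sg%:C) / (v * v') by rewrite -vv; field; rewrite v0 v0'.
  rewrite normcM_ normcV_ normcN 2!normcM_ normc_rC (ger0_norm s0).
  rewrite [leRHS](_ : _ = normc u * sg / d0 ^+ 2); last by ring.
  rewrite ler_wpM2l ?mulr_ge0 // lef_pV2 ?posrE ?exprn_gt0 ?mulr_gt0 //.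
  by rewrite expr2 ler_pM // ltW.
have Hl : (fun N => csum (reg ^~ (vline sg tau)) N - csum (reg ^~ (vline 0 tau)) N) @ \oo -->
   Nreg (vline sg tau) - Nreg (vline 0 tau) by apply: cvgB; exact: NregP.
have Hb N : normc (csum (reg ^~ (vline sg tau)) N - csum (reg ^~ (vline 0 tau)) N) <= sg * (Bm / d0 ^+ 2).
  rewrite /csum -sumrB; apply: le_trans (normc_sum _ _ _) _.
  apply: le_trans (_ : \sum_(0 <= j < N) (normc (c j) + normc (c' j)) * (sg / d0 ^+ 2) <= _); last first.
    rewrite -mulr_suml [leRHS]mulrCA; apply: ler_wpM2r (cB N).
    by rewrite divr_ge0 // exprn_ge0 // ltW.
  apply: ler_sum => j _; have b0 : 0 <= (normc (c j) + normc (c' j)) * (sg / d0 ^+ 2).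
    by rewrite mulr_ge0 ?addr_ge0 // divr_ge0 // exprn_ge0 // ltW.
  rewrite /reg; case: ifPn => nJ; first by rewrite subr0 normc0_.
  have [mz|mz] := eqVneq (m (zs j)) 0; first by rewrite !term0 // subr0 normc0_.
  have [h1 h2] := sepP hs ht mz nJ; have [h3 h4] := sepP hs0 ht mz nJ.
  have e v : vline sg tau - v - (vline 0 tau - v) = sg%:C by rewrite /vline; ring.
  have b1 := bd (c j) _ _ (e (w j)) h1 h3; have b2 := bd (c' j) _ _ (e (w' j)) h2 h4.
  rewrite /term -mulrBr opprD addrACA normcM_ normcV_ normc_nat.
  have := normcD (c j / (vline sg tau - w j) - c j / (vline 0 tau - w j))
     (c' j / (vline sg tau - w' j) - c' j / (vline 0 tau - w' j)).
  move: b1 b2 b0; rewrite mulrDl; set X := normc _; set Y := normc (_ - _ + _).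
  have : 0 <= Y by exact: normc_ge0.
  move=> Y0 b1 b2 b0 b3.
  have : Y <= normc (c j) * (sg / d0 ^+ 2) + normc (c' j) * (sg / d0 ^+ 2).
    apply: le_trans b3 _; rewrite [X in _ <= X + _]mulrCA [X in _ <= _ + X]mulrCA; exact: lerD.
  lra.
exact: normc_lim_le Hb Hl.
Qed.

(** On the axis [s - w' j] is minus the conjugate of [s - w j], so each term is half the difference
    of a number and its conjugate. *)
Lemma Nreg_imag tau : rect 0 tau -> Re (Nreg (vline 0 tau)) = 0.
Proof.
move=> hr; have [Hr _] := proj1 (cvg_ReIm _ _ _) (NregP hr).
have E N : Re (csum (reg ^~ (vline 0 tau)) N) = 0.
  rewrite /csum Re_sum big1 // => j _; rewrite /reg; case: ifP => // _.
  rewrite /term c'E w'E.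
  have -> : vline 0 tau - - conjc (w j) = - conjc (vline 0 tau - w j).
    apply: complex_ext; rewrite ?(ReB, ImB, ReN, ImN, Re_conjc, Im_conjc, Re_vline, Im_vline); ring.
  rewrite invrN mulrN -conjcV -conjcM; set X := _ / _.
  have -> : 2^-1 = (2^-1)%:C :> R[i] by rewrite rCV; congr (_^-1); apply: complex_ext; rewrite /= ?addr0.
  by rewrite Re_rC ReB Re_conjc subrr mulr0.
have Hz : (fun N => Re (csum (reg ^~ (vline 0 tau)) N)) @ \oo --> (0 : R).
  by apply: cvg_ext (cvg_cst _) => N; rewrite E.
exact: (@cvg_unique _ (@Rhausdorff R) _ _ _ _ Hr Hz).
Qed.

Lemma ig : rint half (fun t => C * ((1 + t) ^+ 2)^-1).
Proof. by apply: rintZ; [exact: mhalf|exact: rint_inv_sqr]. Qed.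
Let BG := \int[mu]_(t in half) (C * ((1 + t) ^+ 2)^-1).

Lemma iS s : 0 <= Re s -> cintb half (fun t => S t * expw (- s) t).
Proof. exact: (smooth_value_cintb F a0 a1 aln zi zc1). Qed.

Lemma Gk_bound s : 0 <= Re s -> normc (Gk s) <= BG.
Proof.
move=> s0; apply: (cint_le mhalf (iS s0) _ ig).
move=> t /inhalf t0; rewrite normcM_; apply: le_trans (SB t0).
by rewrite ler_piMr // normc_cexp -[leRHS]expR0 ler_expR Re_rC ReN mulrN oppr_le0 mulr_ge0.
Qed.

(** A modulus of continuity, in the distance to the axis, for the transform of the kernel part;
    dominated convergence makes it tend to 0. *)
Let om sg := \int[mu]_(t in half) (C * ((1 + t) ^+ 2)^-1 * (1 - expR (- sg * t))).

Lemma om_meas sg : measurable_fun half (fun t => C * ((1 + t) ^+ 2)^-1 * (1 - expR (- sg * t))).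
Proof.
apply: measurable_funM; first exact: rint_measurable ig.
apply: measurable_funB; first exact: measurable_cst.
apply: measurableT_comp; first exact: measurable_expR.
by apply: measurable_funM => //; exact: measurable_cst.
Qed.

Lemma om_le sg t : 0 <= sg -> half t -> `|C * ((1 + t) ^+ 2)^-1 * (1 - expR (- sg * t))| <= C * ((1 + t) ^+ 2)^-1.
Proof.
move=> s0 /inhalf t0; have e1 : expR (- sg * t) <= 1 by rewrite -[leRHS]expR0 ler_expR mulNr oppr_le0 mulr_ge0.
have e0 := expR_ge0 (- sg * t); have k0 : 0 <= C * ((1 + t) ^+ 2)^-1 by rewrite mulr_ge0 // invr_ge0 sqr_ge0.
rewrite ger0_norm; last by rewrite mulr_ge0 // subr_ge0.
by rewrite ler_piMr //; lra.
Qed.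

Lemma om_cvg (sg : nat -> R) : (forall n, 0 <= sg n) -> sg @ \oo --> (0 : R) -> (fun n => om (sg n)) @ \oo --> (0 : R).
Proof.
move=> s0 sc.
have [||||_ h] := @Rintegral_dom R half (fun n t => C * ((1 + t) ^+ 2)^-1 * (1 - expR (- sg n * t))) (fun=> 0)
    (fun t => C * ((1 + t) ^+ 2)^-1) mhalf.
- by move=> n; exact: om_meas.
- move=> t _.
  have H1 : (fun n => - sg n * t) @ \oo --> (0 : R).
    have H0 : (fun n => - sg n * t) @ \oo --> - 0 * t by apply: cvgM; [apply: cvgN|exact: cvg_cst].
    by rewrite oppr0 mul0r in H0.
  have H2 : (fun n => expR (- sg n * t)) @ \oo --> expR (0 : R).
    by apply: (cvg_comp _ _ H1); exact: continuous_expR.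
  have H3 : (fun n => C * ((1 + t) ^+ 2)^-1 * (1 - expR (- sg n * t))) @ \oo --> C * ((1 + t) ^+ 2)^-1 * (1 - expR 0).
    by apply: cvgM; [exact: cvg_cst|apply: cvgB; [exact: cvg_cst|exact: H2]].
  by rewrite expR0 subrr mulr0 in H3.
- exact: ig.
- by move=> n t ht; exact: om_le.
have E0 : \int[mu]_(t in half) (0 : R) = 0.
  by have E := Rint_cst mhalf 0; rewrite E mul0r.
by rewrite E0 in h.
Qed.

Lemma Gk_om sg tau : 0 <= sg -> normc (Gk (vline sg tau) - Gk (vline 0 tau)) <= om sg.
Proof.
move=> s0.
have i1 : cintb half (fun t => S t * expw (- vline sg tau) t) by apply: iS; rewrite Re_vline.
have i2 : cintb half (fun t => S t * expw (- vline 0 tau) t) by apply: iS; rewrite Re_vline.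
have i3 := cintbN mhalf i2.
rewrite /Gk /lap -(cintN mhalf i2) -(cintD mhalf i1 i3).
apply: (cint_le mhalf (cintbD mhalf i1 i3)); last first.
  by apply: rint_le ig; [exact: mhalf|exact: om_meas|move=> t; exact: om_le].
move=> t ht; have t0 := inhalf ht.
have -> : expw (- vline sg tau) t = expw (- vline 0 tau) t * (expR (- sg * t))%:C.
  by rewrite /expw -cexp_rC -cexpD; congr cexp; rewrite /vline rCM rCN; ring.
have -> : S t * (expw (- vline 0 tau) t * (expR (- sg * t))%:C) - S t * expw (- vline 0 tau) t =
   S t * (expw (- vline 0 tau) t * ((expR (- sg * t) - 1)%:C)) by rewrite rCB; ring.
rewrite 2!normcM_ normc_rC.
have -> : normc (expw (- vline 0 tau) t) = 1 by rewrite normc_cexp Re_rC ReN Re_vline oppr0 mulr0 expR0.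
have e1 : expR (- sg * t) <= 1 by rewrite -[leRHS]expR0 ler_expR mulNr oppr_le0 mulr_ge0.
rewrite mul1r distrC ger0_norm ?subr_ge0 // ler_wpM2r ?subr_ge0 //; exact: SB.
Qed.

Let I0 := \int[mu]_t g0 t.
Let eta := 4^-1 * expR (-1) * I0.
Let CH := 4 * expR (1 + (1 + t2)) * I0.
Lemma I00 : 0 < I0. Proof. exact: bump_mass_gt0. Qed.
Lemma eta0 : 0 < eta. Proof. by apply: mulr_gt0; [apply: mulr_gt0; [rewrite invr_gt0 ltr0n|exact: expR_gt0]|exact: I00]. Qed.
Lemma CH0 : 0 <= CH. Proof. by apply: mulr_ge0; [apply: mulr_ge0; [exact: ler0n|exact: expR_ge0]|exact: ltW I00]. Qed.
Lemma rectRe sg tau : rect sg tau -> `|Re (vline sg tau)| <= 1.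
Proof. by move=> /andP[/andP[s0 sd] _]; rewrite Re_vline ger0_norm // (le_trans sd). Qed.

Lemma H_lower sg tau : rect sg tau -> eta <= Re (H (vline sg tau)).
Proof.
move=> hr; apply: (lt_bump_lower a1 aT); first exact: rectRe.
by have /andP[_ /andP[h1 h2]] := hr; rewrite Im_vline ger0_norm // (le_trans t1_ge0).
Qed.

Lemma H_normc sg tau : rect sg tau -> eta <= normc (H (vline sg tau)).
Proof. by move=> /H_lower h; apply: le_trans h (le_trans (ler_norm _) (ler_normc_Re _)). Qed.
Lemma H_neq0 sg tau : rect sg tau -> H (vline sg tau) != 0.
Proof. by move=> /H_normc h; rewrite -normc_gt0; exact: lt_le_trans eta0 h. Qed.

Lemma H_lip sg tau sg' tau' : rect sg tau -> rect sg' tau' ->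
  normc (H (vline sg' tau') - H (vline sg tau)) <= CH * normc (vline sg' tau' - vline sg tau).
Proof.
move=> hr hr'; apply: (lt_bump_lipschitz a1); first exact: rectRe.
rewrite vline_sub; apply: le_trans (normc_le_ReIm _) _; rewrite Re_vline Im_vline.
have /andP[/andP[p1 p2] /andP[p3 p4]] := hr; have /andP[/andP[q1 q2] /andP[q3 q4]] := hr'.
have d1 := d01; have t1p := t1_ge0.
by apply: lerD; rewrite ler_norml; apply/andP; split; lra.
Qed.

Let x_ j := Re (zs j).
Lemma JP j : J j -> [/\ m (zs j) != 0, w j = vline 0 (x_ j), rect 0 (x_ j) & m (zs j) \is a Num.int].
Proof.
move=> /and4P[_ mz /eqP I0' /andP[h1 h2]]; split => //; first by rewrite vl I0' oppr0.
  by rewrite /rect lexx (ltW d00) h1 h2.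
exact: m_int.
Qed.

Lemma H_real j : J j -> Im (H (w j)) = 0.
Proof. by move=> /JP[_ -> _ _]; rewrite vline0 /H (lt_bump_real a (x_ j)). Qed.

Lemma H_imag sg tau : rect sg tau -> `|Im (H (vline sg tau))| <= CH * sg.
Proof.
move=> hr; have /andP[/andP[s0 _] _] := hr; have h := H_lip (rect0 hr) hr.
have I0' : Im (H (vline 0 tau)) = 0 by rewrite vline0 /H (lt_bump_real a tau).
move: h; rewrite vline_sub subrr subr0 normc_vline_real (ger0_norm s0) => h.
by apply: le_trans h; apply: le_trans (ler_normc_Im _); rewrite ImB I0' subr0.
Qed.

Let NS s : R[i] := \sum_(0 <= j < N0) (if J j then c j / (s - w j) else 0).
Let NM s : R[i] := \sum_(0 <= j < N0) (if J j then (m (zs j))%:C / (s - w j) else 0).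

Lemma not_pole sg tau j : rect sg tau -> 0 < sg -> m (zs j) != 0 ->
  vline sg tau != w j /\ vline sg tau != w' j.
Proof.
move=> hr s0 mz; have /andP[hs ht] := hr; have [Jj|nJ] := boolP (J j).
  have I0' : Im (zs j) = 0 by have /and4P[_ _ /eqP] := Jj.
  split; apply/negP => /eqP /(congr1 (@complex.Re R)); rewrite Re_vline ?vl ?vl' Re_vline I0' ?oppr0 => e;
   by move: s0; rewrite e ltxx.
have [h1 h2] := sepP hs ht mz nJ.
by split; rewrite -subr_eq0 -normc_gt0; exact: lt_le_trans d00 _.
Qed.

(** The average of the functional relations for the zeros and for their conjugates. For a near zero
    [w' j = w j] and [c j] is real, so the two halves coincide. *)
Lemma relation_on_line sg tau : rect sg tau -> 0 < sg ->
  (NS (vline sg tau) + Nreg (vline sg tau) - Gk (vline sg tau)) * l (vline sg tau) =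
  H (vline sg tau) * lser (log_coef A) (vline sg tau).
Proof.
move=> hr s0; set s := vline sg tau; have Rs : 0 < Re s by rewrite Re_vline.
have zy' j : `|Im (conjc (zs j))| <= y by rewrite Im_conjc normrN.
have zlf' T : exists N, forall j, `|Re (conjc (zs j))| <= T -> (j < N)%N.
  by have [N HN] := zlf T; exists N => j; rewrite Re_conjc; exact: HN.
have np j : c j != 0 -> s != w j.
  move=> cj; have [mz|mz] := eqVneq (m (zs j)) 0; last by case: (not_pole hr s0 mz).
  by move: cj; rewrite (c0 mz).1 eqxx.
have np' j : (m (conjc (zs j)))%:C * lt g0 ('i * conjc (zs j)) != 0 -> s != 'i * conjc (zs j).
  move=> cj; have [mz|mz] := eqVneq (m (zs j)) 0; last by case: (not_pole hr s0 mz).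
  by move: cj; rewrite mc mz mul0r eqxx.
have R1 := functional_relation F a0 a1 aln y0 zi zy zc1 zlf A0 AB Aconv Rs np.
have R2 := functional_relation F a0 a1 aln y0 zi' zy' zc2 zlf' A0 AB Aconv Rs np'.
set RHS := lt g0 s * lser (log_coef A) s + lser A s * lap s S.
have R3 : csum (fun j => term j s * l s) @ \oo --> RHS.
  have h : (fun N => 2^-1 * (csum (fun j => c j / (s - w j) * l s) N +
      csum (fun j => (m (conjc (zs j)))%:C * lt g0 ('i * conjc (zs j)) / (s - 'i * conjc (zs j)) * lser A s) N)) @ \oo
      --> 2^-1 * (RHS + RHS).
    by apply: cvgM; [exact: cvg_cst|apply: cvgD; [exact: R1|exact: R2]].
  have e2 : 2^-1 * (RHS + RHS) = RHS by field.
  rewrite e2 in h; apply: cvg_ext h => N; rewrite -csumD -csumZ; apply: eq_bigr => j _.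
  by rewrite mc /term /c' /c /l /w' /w /H; ring.
have R4 : csum (fun j => term j s * l s) @ \oo --> (NS s + Nreg s) * l s.
  have h : (fun N => (NS s + csum (reg ^~ s) N) * l s) @ \oo --> (NS s + Nreg s) * l s.
    by apply: cvgM; [apply: cvgD; [exact: cvg_cst|exact: NregP]|exact: cvg_cst].
  apply: cvg_trans h; apply: near_eq_cvg; exists N0 => // N /= N0N.
  rewrite /csum -mulr_suml; congr (_ * _); rewrite /NS.
  have -> : \sum_(0 <= j < N0) (if J j then c j / (s - w j) else 0) = \sum_(0 <= j < N) (if J j then c j / (s - w j) else 0).
    rewrite [X in _ = X](big_cat_nat _ N0N) // [X in _ = _ + X]big_nat [X in _ = _ + X]big1 ?addr0 // => j /andP[Nj _].
    by rewrite /near_pole ltnNge Nj.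
  rewrite -big_split /=; apply: eq_bigr => j _; rewrite /reg; case: ifPn => Jj; last by rewrite add0r.
  have I0' : Im (zs j) = 0 by have /and4P[_ _ /eqP] := Jj.
  have e : w' j = w j by rewrite vl vl' I0' oppr0.
  by rewrite addr0 /term c'E e; have -> : conjc (c j) = c j; [rewrite -c'E /c' /c e|field; rewrite subr_eq0; case: (not_pole hr s0 (let: And4 h _ _ _ := JP Jj in h))].
have e := cvgc_unique R3 R4.
by rewrite mulrBl -e /RHS /H /Gk /l; ring.
Qed.

Let Th := Theta K (Re (f 1%N)).
Let th := theta K (Re (f 1%N)).
(** [V] divides out the near zeros; the exponents are integers because these zeros have height at
    least [t1]. *)
Let V s : R[i] := \prod_(0 <= j < N0) (if J j then ipow (m (zs j)) (s - w j) else 1).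
Let E tau : R[i] := cexp ('i * (Th tau)%:C).
Let Q sg tau : R[i] := l (vline sg tau) * V (vline sg tau) * E tau.
Let Z s : R[i] := Nreg s - Gk s.
(** The logarithmic derivative of [Q] along the vertical line. In the first bracket the poles at the
    near zeros cancel; in the second the real part cancels as the line approaches the axis. *)
Let lam sg tau : R[i] := 'i * ((NS (vline sg tau) / H (vline sg tau) - NM (vline sg tau)) +
  (Z (vline sg tau) / H (vline sg tau) + (th tau)%:C)).

Lemma cderiv_vline sg tau : cderiv (vline sg) tau 'i.
Proof.
have h := cderivD (cderiv_cst sg%:C tau) (cderivZ 'i (cderiv_real (rderiv_id tau))).
by apply: cderiv_eq h _; rewrite add0r mulr1.
Qed.

Lemma V_derive sg tau : rect sg tau -> 0 < sg ->
  cderiv (fun tau => V (vline sg tau)) tau (- ('i * NM (vline sg tau)) * V (vline sg tau)).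
Proof.
move=> hr s0; pose v j x : R[i] := if J j then ipow (m (zs j)) (vline sg x - w j) else 1.
pose d j : R[i] := if J j then (m (zs j))%:C / (vline sg tau - w j) else 0.
have gen N : cderiv (fun x => \prod_(0 <= j < N) v j x) tau
    (- ('i * \sum_(0 <= j < N) d j) * \prod_(0 <= j < N) v j tau).
  elim: N => [|N IH].
    have -> : (fun x => \prod_(0 <= j < 0) v j x) = fun=> 1 by apply/funext => t; rewrite big_geq.
    by apply: cderiv_eq (cderiv_cst 1 tau) _; rewrite !big_geq // mulr0 oppr0 mul0r.
  have hj : cderiv (v N) tau (- ('i * d N) * v N tau).
    rewrite /v /d; case: ifPn => Jj; last by apply: cderiv_eq (cderiv_cst 1 tau) _; rewrite mulr0 oppr0 mul0r.
    have [mz _ _ mi] := JP Jj; have [np _] := not_pole hr s0 mz.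
    have u0 : vline sg tau - w N != 0 by rewrite subr_eq0.
    have hu := cderivD (cderiv_vline sg tau) (cderiv_cst (- w N) tau).
    have hu' := cderiv_eq hu (addr0 'i).
    apply: cderiv_eq (ipow_derive mi u0 hu') _; by congr (- _ * _); rewrite mulrAC [LHS]mulrC.
  have -> : (fun x => \prod_(0 <= j < N.+1) v j x) = (fun x => (\prod_(0 <= j < N) v j x) * v N x).
    by apply/funext => t; rewrite big_nat_recr.
  apply: cderiv_eq (cderivM IH hj) _; rewrite (big_nat_recr N 0 (v ^~ tau)) // (big_nat_recr N 0 d) //=; ring.
exact: gen N0.
Qed.

Lemma Q_derive sg tau : rect sg tau -> 0 < sg -> cderiv (Q sg) tau (lam sg tau * Q sg tau).
Proof.
move=> hr s0; have rel := relation_on_line hr s0; have Hn := H_neq0 hr.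
have [HA _ _] := lap_spike a0 a1 aln A0 AB (s := vline sg tau) (eq_ind_r (fun x => is_true (0 < x)) s0 (Re_vline sg tau)).
have dl := lser_derive AB s0 HA.
have dE : cderiv E tau ('i * (th tau)%:C * E tau).
  apply: cderiv_comp_cexp; apply: cderivZ; apply: cderiv_real; exact: (Theta_derive kp).
apply: cderiv_eq (cderivM (cderivM dl (V_derive hr s0)) dE) _.
have -> : lser (log_coef A) (vline sg tau) =
    (NS (vline sg tau) + Nreg (vline sg tau) - Gk (vline sg tau)) * l (vline sg tau) / H (vline sg tau).
  by rewrite rel mulrC mulrA mulVf // mul1r.
by rewrite /lam /Q /Z /l; field.
Qed.

Let HM := \sum_(0 <= j < N0) normc (H (w j)).
Let MJ := \sum_(0 <= j < N0) `|m (zs j)|.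
Let C3 := CH / eta + HM * (CH / eta ^+ 2).
Let CZ := (Bm / d0 + BG) / eta.
Let Ce sg := (sg * (Bm / d0 ^+ 2) + om sg) / eta + (Bm / d0 + BG) * (CH * sg) / eta ^+ 2.

Lemma HM_ge j : (j < N0)%N -> normc (H (w j)) <= HM.
Proof.
move=> jN; rewrite /HM (bigD1_seq j _ (iota_uniq _ _)); last by rewrite mem_index_iota.
by rewrite lerDl; apply: sumr_ge0 => i _; exact: normc_ge0.
Qed.

Lemma C30 : 0 <= C3.
Proof.
have ch := CH0; have e0 := ltW eta0; apply: addr_ge0; first exact: divr_ge0.
apply: mulr_ge0; last by apply: divr_ge0 => //; exact: exprn_ge0.
by apply: sumr_ge0.
Qed.

Lemma quot_le (u : R[i]) sg tau : rect sg tau -> normc (u / H (vline sg tau)) <= normc u / eta.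
Proof.
move=> hr; rewrite normcM_ normcV_ ler_wpM2l // lef_pV2 ?posrE; [exact: H_normc|exact: lt_le_trans eta0 (H_normc hr)|exact: eta0].
Qed.

(** H(w j) / H(s) - 1 vanishes to first order at [w j], so the quotient is bounded. Its real part is
    smaller: H is real on the axis, so the numerator has imaginary part O(sg), and [s - w j] has
    real part [sg]. *)
Lemma near_term sg tau j : rect sg tau -> 0 < sg -> J j ->
  normc ((H (w j) / H (vline sg tau) - 1) / (vline sg tau - w j)) <= C3 /\
  `|Re ((H (w j) / H (vline sg tau) - 1) / (vline sg tau - w j))| <= C3 * (sg / normc (vline sg tau - w j)).
Proof.
move=> hr s0 Jj; set u := vline sg tau - w j; set q := _ / u; have [mz wE rj mi] := JP Jj; have [np _] := not_pole hr s0 mz.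
have Hn := H_neq0 hr; have hL := H_lip rj hr; have hI := H_imag hr; have Hr := H_real Jj.
have u0 : u != 0 by rewrite subr_eq0.
have nu : 0 < normc u by rewrite normc_gt0.
have jN : (j < N0)%N by have /and4P[] := Jj.
have HMj := HM_ge jN; have e0 := eta0; have ch0 := CH0.
set Y := H (w j) / H (vline sg tau) - 1.
have YE : Y = (H (w j) - H (vline sg tau)) / H (vline sg tau) by rewrite /Y mulrBl divff.
have nY : normc Y <= CH * normc u / eta.
  rewrite YE; apply: le_trans (quot_le _ hr) _; rewrite ler_pM2r ?invr_gt0 //.
  by rewrite normc_distC /u wE.
have iY : `|Im Y| <= HM * (CH * sg / eta ^+ 2).
  have -> : Y = H (w j) * conjc (H (vline sg tau)) * (((normc (H (vline sg tau))) ^+ 2)^-1)%:C - 1.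
    rewrite /Y; congr (_ - 1); rewrite -mulrA; congr (_ * _).
    have hh : H (vline sg tau) * conjc (H (vline sg tau)) = ((normc (H (vline sg tau))) ^+ 2)%:C.
      by apply: complex_ext; rewrite ?ReM ?ImM ?Re_conjc ?Im_conjc ?normc_sqr /=; ring.
    have n0 : ((normc (H (vline sg tau))) ^+ 2)%:C != 0 :> R[i].
      by rewrite -hh mulf_neq0 // -normc_gt0 normc_conjc normc_gt0.
    by rewrite rCV -hh invfM mulrCA mulfV ?mulr1 // -normc_gt0 normc_conjc normc_gt0.
  rewrite ImB (_ : Im (1 : R[i]) = 0) // subr0 Im_rCr ImM Im_conjc Hr mul0r addr0 mulrN mulNr normrN normrM normrM.
  have Hn2 : eta ^+ 2 <= normc (H (vline sg tau)) ^+ 2.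
    by rewrite ler_pXn2r // ?nnegrE ?normc_ge0 ?(ltW e0) //; exact: H_normc.
  rewrite -mulrA; apply: ler_pM; [exact: normr_ge0|by apply: mulr_ge0; exact: normr_ge0| |].
    by apply: le_trans (ler_normc_Re _) HMj.
  apply: ler_pM; [exact: normr_ge0|exact: normr_ge0|exact: H_imag|].
  rewrite ger0_norm; last by rewrite invr_ge0 sqr_ge0.
  by rewrite lef_pV2 // posrE exprn_gt0 //; exact: lt_le_trans eta0 (H_normc hr).
have HM0 : 0 <= HM by apply: le_trans HMj; exact: normc_ge0.
split.
  rewrite /q -/Y normcM_ normcV_ ler_pdivrMr //; apply: le_trans nY _.
  rewrite mulrAC; apply: ler_wpM2r; first exact: ltW.
  rewrite /C3 lerDl; apply: mulr_ge0 => //; apply: divr_ge0 => //; apply: exprn_ge0; exact: ltW.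
have -> : q = Y * conjc u * ((normc u ^+ 2)^-1)%:C.
  rewrite /q -/Y -mulrA; congr (_ * _).
  have hh : u * conjc u = (normc u ^+ 2)%:C by apply: complex_ext; rewrite ?ReM ?ImM ?Re_conjc ?Im_conjc ?normc_sqr /=; ring.
  have n0 : conjc u != 0 by rewrite -normc_gt0 normc_conjc.
  by rewrite rCV -hh invfM mulrCA mulfV // mulr1.
rewrite Re_rCr ReM Re_conjc Im_conjc mulrN opprK.
have Ru : Re u = sg by rewrite /u wE vline_sub Re_vline subr0.
rewrite Ru normrM normfV (ger0_norm (sqr_ge0 (normc u))) ler_pdivrMr ?exprn_gt0 //.
apply: le_trans (ler_normD _ _) _; rewrite !normrM (gtr0_norm s0).
have nR := le_trans (ler_normc_Re Y) nY; have nI := ler_normc_Im u.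
have b1 : `|Re Y| * sg <= CH * normc u / eta * sg by rewrite ler_wpM2r // ltW.
have b2 : `|Im Y| * `|Im u| <= HM * (CH * sg / eta ^+ 2) * normc u by apply: ler_pM.
apply: le_trans (lerD b1 b2) _; apply: le_of_eq.
rewrite /C3; have un := lt0r_neq0 nu; have en := lt0r_neq0 e0; move: (normc u) un => n un; field.
by rewrite un en.
Qed.

(** On the axis the regular zeros contribute an imaginary number and H is real, so only the kernel
    transform remains, evaluated by [boundary_transform]. *)
Lemma boundary_term tau : rect 0 tau -> Re (Z (vline 0 tau) / H (vline 0 tau)) = - th tau.
Proof.
move=> hr; have h := boundary_transform F a0 a1 aln kp zi zc1 tau.
have N0' := Nreg_imag hr; have hl := H_lower hr.
have Hr : H (vline 0 tau) = (Re (H (vline 0 tau)))%:C by rewrite vline0 /H {1}(lt_bump_real a tau).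
rewrite Hr -rCV Re_rCr /Z ReB N0' sub0r /Gk vline0 h -/(H _) -vline0 mulNr mulrAC divff ?mul1r //.
by rewrite gt_eqF //; exact: lt_le_trans eta0 hl.
Qed.

Lemma Z_bound sg tau : rect sg tau -> normc (Z (vline sg tau)) <= Bm / d0 + BG.
Proof.
move=> hr; apply: le_trans (normcB _ _) _; apply: lerD; first exact: Nreg_bound.
by apply: Gk_bound; have /andP[/andP[s0 _] _] := hr; rewrite Re_vline.
Qed.

Lemma ZH_bound sg tau : rect sg tau -> normc (Z (vline sg tau) / H (vline sg tau)) <= CZ.
Proof.
move=> hr; apply: le_trans (quot_le _ hr) _; rewrite /CZ; apply: ler_wpM2r (Z_bound hr); rewrite invr_ge0; exact: ltW eta0.
Qed.

(** The quantity is 0 on the axis by [boundary_term]. Its growth with [sg] is controlled by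
    Lipschitz bounds for H and for the sum over regular zeros, and by [om] for the kernel. *)
Lemma far_term sg tau : rect sg tau -> `|Re (Z (vline sg tau) / H (vline sg tau)) + th tau| <= Ce sg.
Proof.
move=> hr; have hr0 := rect0 hr; have /andP[/andP[s0 _] _] := hr; have e0 := eta0.
rewrite -[th tau]opprK -(boundary_term hr0) -ReB; apply: le_trans (ler_normc_Re _) _.
have Hn := H_neq0 hr; have Hn0 := H_neq0 hr0.
have -> : Z (vline sg tau) / H (vline sg tau) - Z (vline 0 tau) / H (vline 0 tau) =
   (Z (vline sg tau) - Z (vline 0 tau)) / H (vline sg tau) +
   (Z (vline 0 tau) * (H (vline 0 tau) - H (vline sg tau))) / H (vline sg tau) / H (vline 0 tau).
  by field; rewrite Hn Hn0.
apply: le_trans (normcD _ _) _; apply: lerD.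
  apply: le_trans (quot_le _ hr) _; rewrite ler_pM2r ?invr_gt0 //.
  have -> : Z (vline sg tau) - Z (vline 0 tau) = (Nreg (vline sg tau) - Nreg (vline 0 tau)) -
     (Gk (vline sg tau) - Gk (vline 0 tau)) by rewrite /Z; ring.
  by apply: le_trans (normcB _ _) _; apply: lerD; [exact: Nreg_lipschitz|exact: Gk_om].
have dd (x e : R) : x / e ^+ 2 = x / e / e by rewrite expr2 invfM mulrA.
rewrite (dd _ eta).
apply: le_trans (quot_le _ hr0) _; rewrite ler_pM2r ?invr_gt0 //.
apply: le_trans (quot_le _ hr) _; rewrite ler_pM2r ?invr_gt0 // normcM_.
apply: ler_pM; rewrite //; first exact: Z_bound.
have := H_lip hr hr0; by rewrite vline_sub subrr sub0r normc_vline_real normrN (ger0_norm s0).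
Qed.

Lemma NS_NM sg tau : rect sg tau -> 0 < sg -> NS (vline sg tau) / H (vline sg tau) - NM (vline sg tau) =
  \sum_(0 <= j < N0) (if J j then (m (zs j))%:C * ((H (w j) / H (vline sg tau) - 1) / (vline sg tau - w j)) else 0).
Proof.
move=> hr s0; rewrite /NS /NM mulr_suml -sumrB; apply: eq_bigr => j _; case: ifPn => Jj; last by rewrite mul0r subrr.
have [mz _ _ _] := JP Jj; have [np _] := not_pole hr s0 mz.
by rewrite /c; field; rewrite H_neq0 // subr_eq0 np.
Qed.

Lemma lam_bound sg tau : rect sg tau -> 0 < sg -> `|Re (lam sg tau)| <= MJ * C3 + CZ.
Proof.
move=> hr s0; rewrite /lam Re_iM ImD normrN; apply: le_trans (ler_normD _ _) _; apply: lerD; last first.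
  by rewrite ImD /= addr0; apply: le_trans (ler_normc_Im _) _; exact: ZH_bound.
apply: le_trans (ler_normc_Im _) _; rewrite NS_NM //; apply: le_trans (normc_sum _ _ _) _.
rewrite /MJ mulr_suml; apply: ler_sum => j _; case: ifPn => Jj.
  by rewrite normcM_ normc_rC ler_wpM2l //; case: (near_term hr s0 Jj).
rewrite normc0_; apply: mulr_ge0; [exact: normr_ge0|exact: C30].
Qed.

(** At abscissa [sg = r^2] the bound sg / |s - w j| is replaced by half of r + r^3 / |s - w j|^2,
    which has an elementary primitive: [r] times an arctangent, apart from the linear part. *)
Let dg r tau := \sum_(0 <= j < N0) (if J j then `|m (zs j)| * C3 * (2^-1 * (r + r * ((r ^+ 2)^-1 *
   (1 + ((r ^+ 2)^-1 * tau + - ((r ^+ 2)^-1 * x_ j)) ^+ 2)^-1))) else 0) + Ce (r ^+ 2).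
Let g r tau := \sum_(0 <= j < N0) (if J j then `|m (zs j)| * C3 * (2^-1 * (r * tau + r * atan ((r ^+ 2)^-1 * tau + - ((r ^+ 2)^-1 * x_ j)))) else 0)
  + Ce (r ^+ 2) * tau.

Lemma rderiv_sum (u du : nat -> R -> R) N t : (forall j, is_derive t 1 (u j) (du j t)) ->
  is_derive t 1 (fun x => \sum_(0 <= j < N) u j x) (\sum_(0 <= j < N) du j t).
Proof.
move=> h; elim: N => [|N IH].
  rewrite (_ : (fun x => _) = fun=> 0); last by apply/funext => x; rewrite big_geq.
  by rewrite big_geq //; exact: rderiv_cst.
rewrite (_ : (fun x => _) = fun x => \sum_(0 <= j < N) u j x + u N x); last by apply/funext => x; rewrite big_nat_recr.
by rewrite big_nat_recr //=; exact: rderivD.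
Qed.

Lemma g_derive r tau : is_derive tau 1 (g r) (dg r tau).
Proof.
have hC := rderivZ (Ce (r ^+ 2)) (rderiv_id tau); rewrite mulr1 in hC.
apply: rderivD hC.
apply: (@rderiv_sum (fun j tau => if J j then `|m (zs j)| * C3 * (2^-1 * (r * tau + r * atan ((r ^+ 2)^-1 * tau + - ((r ^+ 2)^-1 * x_ j)))) else 0)
  (fun j tau => if J j then `|m (zs j)| * C3 * (2^-1 * (r + r * ((r ^+ 2)^-1 *
   (1 + ((r ^+ 2)^-1 * tau + - ((r ^+ 2)^-1 * x_ j)) ^+ 2)^-1))) else 0)) => j.
case: ifP => _; last exact: rderiv_cst.
apply: rderivZ; apply: rderivZ; apply: rderivD.
  by have := rderivZ r (rderiv_id tau); rewrite mulr1.
by apply: rderivZ; apply: is_derive_affine; exact: is_derive1_atan.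
Qed.

Lemma lam_small r tau : 0 < r -> rect (r ^+ 2) tau -> `|Im (lam (r ^+ 2) tau)| <= dg r tau.
Proof.
move=> r0 hr; have s0 : 0 < r ^+ 2 by rewrite exprn_gt0.
rewrite /lam Im_iM ReD; apply: le_trans (ler_normD _ _) _; apply: lerD; last first.
  by rewrite ReD; exact: far_term.
rewrite NS_NM // Re_sum; apply: le_trans (ler_norm_sum _ _ _) _; apply: ler_sum => j _.
case: ifPn => Jj; last by rewrite normr0.
rewrite Re_rC normrM -mulrA ler_wpM2l //; have [_ h] := near_term hr s0 Jj.
apply: le_trans h _; apply: ler_wpM2l; first exact: C30.
have [mz wE _ _] := JP Jj; rewrite wE vline_sub subr0.
set d := tau - x_ j; have e : (r ^+ 2)^-1 * tau + - ((r ^+ 2)^-1 * x_ j) = d / r ^+ 2 by rewrite /d; ring.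
rewrite e; set n := normc _.
have n2 : n ^+ 2 = (r ^+ 2) ^+ 2 + d ^+ 2 by rewrite /n normc_sqr Re_vline Im_vline.
have n0 : 0 < n.
  by rewrite /n normc_gt0 -normc_gt0; apply: lt_le_trans (normc_vline_Re _ _); rewrite gtr0_norm.
set x := r ^+ 2 / n.
have -> : (1 + (d / r ^+ 2) ^+ 2)^-1 = x ^+ 2.
  have n2' : n ^+ 2 != 0 by rewrite expf_neq0 // gt_eqF.
  have nz : (r ^+ 2) ^+ 2 + d ^+ 2 != 0 by rewrite -n2.
  rewrite /x [RHS]expr_div_n n2; by field; rewrite (lt0r_neq0 r0) /= ?nz.
have rn := lt0r_neq0 r0.
have -> : r * ((r ^+ 2)^-1 * x ^+ 2) = x ^+ 2 / r by field.
(* The inequality of arithmetic and geometric means for [r] and [x^2 / r]. *)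
have h2 : x * 2 <= r + x ^+ 2 / r.
  rewrite -(ler_pM2r r0) mulrDl divfK //; have := sqr_ge0 (r - x); rewrite sqrrB expr2; lra.
by move: h2; lra.
Qed.

(** The arctangent varies by at most pi whatever [r] is, so every contribution is O(r) or O(om
    (r^2)). *)
Lemma g_increment : exists2 C6, 0 <= C6 & forall r, 0 < r -> r <= d0 -> g r t2 - g r t1 <= C6 * (r + om (r ^+ 2)).
Proof.
have BG0 : 0 <= BG by apply: le_trans (normc_ge0 _) (Gk_bound (s := 0) (lexx _)).
have e0 := eta0; have L0 : 0 <= t2 - t1 by rewrite subr_ge0.
have MJ0 : 0 <= MJ by apply: sumr_ge0.
have b0 : 0 <= Bm / d0 by rewrite divr_ge0 // ltW.
have b1 : 0 <= Bm / d0 ^+ 2 by rewrite divr_ge0 // exprn_ge0 // ltW.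
pose a5 := Bm / d0 ^+ 2 / eta + (Bm / d0 + BG) * CH / eta ^+ 2.
have a50 : 0 <= a5.
  rewrite addr_ge0 //; first by rewrite divr_ge0 // ltW.
  apply: divr_ge0; last by apply: exprn_ge0; exact: ltW.
  by apply: mulr_ge0; [exact: addr_ge0|exact: CH0].
exists (MJ * C3 * (t2 - t1 + trigo.pi) + (a5 + eta^-1) * (t2 - t1)) => [|r r0 rd].
  have pi0 := @pi_ge0 R; have c30 := C30.
  apply: addr_ge0; first by apply: mulr_ge0; [exact: mulr_ge0|exact: addr_ge0].
  by apply: mulr_ge0 => //; apply: addr_ge0 => //; rewrite invr_ge0; exact: ltW.
have r1 : r <= 1 := le_trans rd d01.
have o0 : 0 <= om (r ^+ 2) := le_trans (normc_ge0 _) (Gk_om 0 (sqr_ge0 r)).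
have s1 : r ^+ 2 <= r by rewrite expr2; have := ler_wpM2l (ltW r0) r1; rewrite mulr1.
have gen (b b2 e ch x o : R) : (x * b + o) / e + b2 * (ch * x) / e ^+ 2 = (b / e + b2 * ch / e ^+ 2) * x + e^-1 * o by ring.
have cE : Ce (r ^+ 2) <= (a5 + eta^-1) * (r + om (r ^+ 2)).
  have -> : Ce (r ^+ 2) = a5 * r ^+ 2 + eta^-1 * om (r ^+ 2) by apply: gen.
  have ie : 0 <= eta^-1 by rewrite invr_ge0 ltW.
  have := ler_wpM2l a50 s1; have := mulr_ge0 a50 o0; have := mulr_ge0 ie (ltW r0); lra.
have gE : g r t2 - g r t1 <= MJ * C3 * (t2 - t1 + trigo.pi) * r + Ce (r ^+ 2) * (t2 - t1).
  rewrite /g opprD addrACA -sumrB -mulrBr lerD2r /MJ -mulrA -mulrA mulr_suml; apply: ler_sum => j _.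
  have pi0 := @pi_ge0 R; have c30 := C30.
  case: ifPn => _; last first.
    rewrite subr0; apply: mulr_ge0; first exact: normr_ge0.
    apply: mulr_ge0 => //; apply: mulr_ge0; last exact: ltW.
    exact: addr_ge0.
  rewrite -mulrBr -mulrA ler_wpM2l // ler_wpM2l // -mulrBr.
  set u := atan _; set v := atan _.
  have hu := atan_ltpi2 ((r ^+ 2)^-1 * t2 + - ((r ^+ 2)^-1 * x_ j)).
  have hv := atan_gtNpi2 ((r ^+ 2)^-1 * t1 + - ((r ^+ 2)^-1 * x_ j)).
  have huv : u - v <= trigo.pi by rewrite /u /v; lra.
  have := ler_wpM2l (ltW r0) huv; have := mulr_ge0 (ltW r0) L0; have := mulr_ge0 (ltW r0) pi0; lra.
apply: le_trans gE _; rewrite [leRHS]mulrDl; apply: lerD.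
  apply: ler_wpM2l; last by rewrite lerDl.
  by apply: mulr_ge0; [apply: mulr_ge0 => //; exact: C30|apply: addr_ge0 => //; exact: pi_ge0].
by rewrite mulrAC ler_wpM2r.
Qed.

Lemma phase_estimate : exists2 C6, 0 <= C6 & forall r, 0 < r -> r <= d0 ->
  Im (Q (r ^+ 2) t2 * conjc (Q (r ^+ 2) t1)) ^+ 2 <= (normc (Q (r ^+ 2) t1) ^+ 2) ^+ 2 * (C6 * (r + om (r ^+ 2))).
Proof.
have [C6 C60 HC6] := g_increment; set B := MJ * C3 + CZ.
exists (C6 * expR (2 * B * (t2 - t1))) => [|r r0 rd]; first by rewrite mulr_ge0.
have s0 : 0 < r ^+ 2 by rewrite exprn_gt0.
have sd : r ^+ 2 <= d0.
  by rewrite expr2; apply: (le_trans _ rd); rewrite ler_piMr ?(ltW r0) //; exact: le_trans rd d01.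
have hr tau : t1 <= tau <= t2 -> rect (r ^+ 2) tau by move=> h; rewrite /rect h (ltW s0) sd.
(* The constant factor makes [D t1] real, as [phase_drift] requires, without changing the
   logarithmic derivative. *)
pose D tau := conjc (Q (r ^+ 2) t1) * Q (r ^+ 2) tau.
have dD tau : t1 <= tau <= t2 -> cderiv D tau (lam (r ^+ 2) tau * D tau).
  move=> h; apply: cderiv_eq (cderivZ _ (Q_derive (hr tau h) s0)) _; rewrite /D; ring.
have D1 : D t1 = (normc (Q (r ^+ 2) t1) ^+ 2)%:C.
  exact: mul_conjc.
have I1 : Im (D t1) = 0 by rewrite D1.
have := phase_drift t12 dD (fun tau h => lam_bound (hr tau h) s0) (fun tau h => lam_small r0 (hr tau h))
   (fun tau h => g_derive r tau) I1.
rewrite D1 normc_rC ger0_norm ?sqr_ge0 // /D mulrC => h; apply: le_trans h _.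
have := HC6 r r0 rd => h; rewrite -mulrA ler_wpM2l ?sqr_ge0 //.
rewrite -[C6 * _ * _]mulrAC ler_wpM2r //.
Qed.

Lemma Im_conj_cvg (u v : nat -> R[i]) (lu lv : R[i]) : u @ \oo --> lu -> v @ \oo --> lv ->
  (fun n => Im (u n * conjc (v n))) @ \oo --> Im (lu * conjc lv).
Proof. by move=> hu hv; apply: (proj1 (cvg_ReIm _ _ _) (cvgM hu (cvg_conjc _ hv))).2. Qed.

Lemma V_boundary (sg : nat -> R) t : sg @ \oo --> (0 : R) ->
  (forall j, J j -> t != x_ j) -> (fun n => V (vline (sg n) t)) @ \oo --> V (vline 0 t).
Proof.
move=> sc np.
pose v j s : R[i] := if J j then ipow (m (zs j)) (s - w j) else 1.
have gen N : (fun n => \prod_(0 <= j < N) v j (vline (sg n) t)) @ \oo --> \prod_(0 <= j < N) v j (vline 0 t).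
  elim: N => [|N IH]; first by rewrite big_geq //; apply: cvg_ext (cvg_cst _) => n; rewrite big_geq.
  have hv : (fun n => v N (vline (sg n) t)) @ \oo --> v N (vline 0 t).
    rewrite /v; case: ifPn => Jj; last exact: cvg_cst.
    have [_ wE _ _] := JP Jj; apply: ipow_cvg.
      by rewrite wE vline_sub subrr -normc_gt0; apply: lt_le_trans (normc_vline_Im _ _); rewrite normr_gt0 subr_eq0 np.
    apply: cvgB; last exact: cvg_cst.
    by apply: cvgD; [apply/(cvg_ReIm _ _ _); split; [exact: sc|exact: cvg_cst]|exact: cvg_cst].
  have rec s : \prod_(0 <= j < N.+1) v j s = (\prod_(0 <= j < N) v j s) * v N s by rewrite big_nat_recr.
  rewrite rec; have h : (fun n => (\prod_(0 <= j < N) v j (vline (sg n) t)) * v N (vline (sg n) t)) @ \oo -->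
      (\prod_(0 <= j < N) v j (vline 0 t)) * v N (vline 0 t) by apply: cvgM; [exact: IH|exact: hv].
  by apply: cvg_ext h => n; rewrite rec.
exact: gen N0.
Qed.

Lemma V_real t t' : (forall j, J j -> t != x_ j) -> (forall j, J j -> t' != x_ j) ->
  exists2 k : R, k != 0 & V (vline 0 t) * conjc (V (vline 0 t')) = k%:C.
Proof.
move=> np np'; pose v j s : R[i] := if J j then ipow (m (zs j)) (s - w j) else 1.
suff gen N : exists2 k : R, k != 0 &
    (\prod_(0 <= j < N) v j (vline 0 t)) * conjc (\prod_(0 <= j < N) v j (vline 0 t')) = k%:C by exact: gen N0.
elim: N => [|N [k k0 IH]].
  by exists 1; rewrite ?oner_neq0 // !big_geq // mul1r (conjc_rC 1).
have [k' k'0 h] : exists2 k : R, k != 0 & v N (vline 0 t) * conjc (v N (vline 0 t')) = k%:C.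
  rewrite /v; case: ifPn => Jj; last by exists 1; rewrite ?oner_neq0 // mul1r (conjc_rC 1).
  have [_ wE _ _] := JP Jj; rewrite wE !vline_sub subrr !vline0.
  by apply: ipow_imag; rewrite subr_eq0; [exact: np|exact: np'].
exists (k * k'); first by rewrite mulf_neq0.
by rewrite !big_nat_recr //= conjcM mulrACA IH h rCM.
Qed.

(** As the abscissa tends to 0 so does the drift bound, and [Q] has the same phase up to sign at
    both heights on the axis itself. By [V_real] the factors [V] also agree in phase up to sign
    there, and drop out. *)
Lemma crossing_fixed : Im (l (vline 0 t2) * E t2 * conjc (l (vline 0 t1) * E t1)) = 0.
Proof.
have [C6 C60 HC6] := phase_estimate.
(* A null sequence staying below [d0]; the abscissas are its squares. *)
pose rn n : R := d0 / n.+1%:R; have n0 n : 0 < n.+1%:R :> R by rewrite ltr0n.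
have rn0 n : 0 < rn n by rewrite /rn divr_gt0.
have rnd n : rn n <= d0 by rewrite /rn ler_pdivrMr // ler_peMr ?(ltW d00) // ler1n.
have rc : rn @ \oo --> (0 : R).
  have h : (fun n => d0 * n.+1%:R^-1) @ \oo --> d0 * (0 : R) by apply: cvgM; [exact: cvg_cst|exact: cvg_harmonic].
  by rewrite mulr0 in h.
pose sn n := rn n ^+ 2; have sn0 n : 0 <= sn n by exact: sqr_ge0.
have sc : sn @ \oo --> (0 : R).
  have h : (fun n => rn n * rn n) @ \oo --> (0 : R) * 0 by apply: cvgM.
  by rewrite mulr0 in h; apply: cvg_ext h => n; rewrite /sn expr2.
have npj t : (forall j, m (zs j) != 0 -> zs j != t%:C) -> forall j, J j -> t != x_ j.
  move=> h j Jj; have [mz _ _ _] := JP Jj; have I0' : Im (zs j) = 0 by have /and4P[_ _ /eqP] := Jj.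
  by apply: contra (h j mz) => /eqP ->; apply/eqP; apply: complex_ext; rewrite ?I0'.
have p1 := npj t1 np1; have p2 := npj t2 np2.
have QL t : (forall j, J j -> t != x_ j) -> (fun n => Q (sn n) t) @ \oo --> Q 0 t.
  move=> np; apply: cvgM; last exact: cvg_cst.
  by apply: cvgM; [exact: (lser_boundary AB)|exact: V_boundary].
have L1 := Im_conj_cvg (QL t2 p2) (QL t1 p1).
have L2 := (proj1 (cvg_ReIm _ _ _) (cvgM (cvg_conjc _ (QL t1 p1)) (QL t1 p1))).1.
have oc := om_cvg sn0 sc.
have L3 : (fun n => Re (conjc (Q (sn n) t1) * Q (sn n) t1) * Re (conjc (Q (sn n) t1) * Q (sn n) t1) * (C6 * (rn n + om (sn n)))) @ \oo -->
   Re (conjc (Q 0 t1) * Q 0 t1) * Re (conjc (Q 0 t1) * Q 0 t1) * (C6 * (0 + 0)).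
  apply: cvgM; first by apply: cvgM; exact: L2.
  by apply: cvgM; [exact: cvg_cst|apply: cvgD; [exact: rc|exact: oc]].
have L4 : (fun n => Im (Q (sn n) t2 * conjc (Q (sn n) t1)) * Im (Q (sn n) t2 * conjc (Q (sn n) t1))) @ \oo -->
   Im (Q 0 t2 * conjc (Q 0 t1)) * Im (Q 0 t2 * conjc (Q 0 t1)) by apply: cvgM.
have L5 := ler_cvg_to L4 L3 (nearW _ (fun n => _)).
have I0' : Im (Q 0 t2 * conjc (Q 0 t1)) = 0.
  have /L5 h : forall n, Im (Q (sn n) t2 * conjc (Q (sn n) t1)) * Im (Q (sn n) t2 * conjc (Q (sn n) t1)) <=
      Re (conjc (Q (sn n) t1) * Q (sn n) t1) * Re (conjc (Q (sn n) t1) * Q (sn n) t1) * (C6 * (rn n + om (sn n))).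
    move=> n; have := HC6 (rn n) (rn0 n) (rnd n).
    have eR (x : R) : Re (x%:C : R[i]) = x by [].
    by rewrite -/(sn n) mul_conjc eR -!expr2.
  move: h; rewrite addr0 !mulr0 => h; apply/eqP; rewrite -sqrf_eq0 expr2; apply/eqP/le_anti.
  by rewrite h -expr2 sqr_ge0.
have [k k0 hk] := V_real p2 p1.
have e : Q 0 t2 * conjc (Q 0 t1) = l (vline 0 t2) * E t2 * conjc (l (vline 0 t1) * E t1) * k%:C.
  by rewrite -hk /Q !conjcM; ring.
by move: I0'; rewrite e Im_rCr => /eqP; rewrite mulf_eq0 (negPf k0) orbF => /eqP.
Qed.

End Fixed.

Lemma crossing : Im (lser A ('i * t2%:C) * cexp ('i * (Theta K (Re (f 1%N)) t2)%:C) *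
  conjc (lser A ('i * t1%:C) * cexp ('i * (Theta K (Re (f 1%N)) t1)%:C))) = 0.
Proof.
have [N0 N0P] := zlf (t2 + 1); have [d0 d0P sepP] := separation N0P.
have [B1 B10 cB1] := c_bound F a1 zi zc1; have [B2 B20 cB2] := c_bound F a1 zi' zc2.
have [C C0 SB] := smooth_value_bound F a0 a1 aln.
have cB N : \sum_(0 <= j < N) (normc (c j) + normc (c' j)) <= B1 + B2.
  rewrite big_split; apply: lerD; first exact: cB1.
  by apply: le_trans (cB2 N); apply: ler_sum => j _; rewrite mc.
rewrite -(vline0 t2) -(vline0 t1); apply: (@crossing_fixed N0 d0 (B1 + B2) C);
  do ?[exact: N0P|exact: d0P|exact: sepP|exact: cB|exact: SB|exact: addr_ge0|exact: C0].
Qed.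

End Crossing.

(** * Mean values of oscillating functions *)

Section Averages.
Variable R : realType.
Implicit Types (t x : R).

Let indom (a b t : R) : (`[a, b]%classic : set R) t -> a <= t <= b. Proof. by rewrite /= in_itv. Qed.

Lemma rC_eq0 (x : R) : (x%:C == 0 :> R[i]) = (x == 0).
Proof. by apply/eqP/eqP => [/(congr1 (@complex.Re R))|->]. Qed.
Lemma rint_segment_cst (a b B : R) : rint `[a, b] (fun=> B).
Proof. by apply: rint_segment => x; exact: cvg_cst. Qed.
Lemma is_derive_cts (f : R -> R) t (d : R) : is_derive t 1 f d -> {for t, continuous f}.
Proof. by move=> h; apply/differentiable_continuous/derivable1_diffP; have [] := h. Qed.

Lemma Rintegral_FTC2_in (f F : R -> R) (a b : R) : a < b -> (forall x, a <= x <= b -> {for x, continuous f}) ->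
  (forall x, a <= x <= b -> is_derive x 1 F (f x)) ->
  rint `[a, b] f /\ \int[mu]_(x in `[a, b]) f x = F b - F a.
Proof.
move=> ab cf dF.
have w : {within `[a, b], continuous f}.
  by apply: continuous_in_subspaceT => x; rewrite inE => /indom h; exact: cf.
split; first by apply: continuous_compact_integrable => //; exact: segment_compact.
have sub x : x \in `]a, b[ -> a <= x <= b by rewrite in_itv => /andP[h1 h2]; rewrite !ltW.
rewrite /Rintegral (@continuous_FTC2 _ f F) //.
- split.
  + by move=> x /sub h; have [] := dF x h.
  + by apply: cvg_at_right_filter; apply: (is_derive_cts (dF a _)); rewrite lexx ltW.
  + by apply: cvg_at_left_filter; apply: (is_derive_cts (dF b _)); rewrite lexx ltW.
- by move=> x /sub h; rewrite derive1E; have [_ ->] := dF x h.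
Qed.

Lemma segment_length (a b : R) : a <= b -> fine (mu `[a, b]) = b - a.
Proof.
rewrite le_eqVlt => /orP[/eqP ->|ab]; last by rewrite lebesgue_measure_itv /= lte_fin ab -EFinB.
by rewrite lebesgue_measure_itv /= ltxx subrr.
Qed.

(* Integration by parts against [1 / psi']. *)
Lemma cexp_i_cts (phi : R -> R) : continuous phi ->
  continuous (fun x => Re (cexp ('i * (phi x)%:C) : R[i])) /\ continuous (fun x => Im (cexp ('i * (phi x)%:C) : R[i])).
Proof.
move=> cp; split => x.
  rewrite (_ : (fun x => _) = fun x => cos (phi x)); last first.
    by apply/funext => t; rewrite Re_cexp Re_iM Im_iM /= oppr0 expR0 mul1r.
  by apply: continuous_comp; [exact: cp|exact: continuous_cos].
rewrite (_ : (fun x => _) = fun x => sin (phi x)); last first.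
  by apply/funext => t; rewrite Im_cexp Re_iM Im_iM /= oppr0 expR0 mul1r.
by apply: continuous_comp; [exact: cp|exact: continuous_sin].
Qed.

(** The primitive e^(i psi) / (i psi') gives two boundary terms of modulus at most 1/c; the error in
    its derivative carries psi'' / psi'^2, which accounts for the second summand. *)
Lemma oscillation_bound (psi dpsi ddpsi : R -> R) (a b c C : R) : a < b -> 0 < c ->
  (forall t, is_derive t 1 psi (dpsi t)) -> (forall t, is_derive t 1 dpsi (ddpsi t)) -> continuous ddpsi ->
  (forall t, a <= t <= b -> c <= `|dpsi t|) -> (forall t, a <= t <= b -> `|ddpsi t| <= C) ->
  normc (cint `[a, b] (fun t => cexp ('i * (psi t)%:C))) <= 2 / c + C / c ^+ 2 * (b - a).
Proof.
move=> ab c0 dp ddp cdd lo hi.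
have mD : measurable (`[a, b]%classic : set R) by exact: measurable_itv.
pose E t : R[i] := cexp ('i * (psi t)%:C).
have nE t : normc (E t) = 1 by rewrite /E normc_cexp Re_iM oppr0 expR0.
have nI : normc ('i : R[i]) = 1 by rewrite /normc expr0n add0r expr1n sqrtr1.
have i1 : 'i != 0 :> R[i] by rewrite -normc_gt0 nI.
have n0 t : a <= t <= b -> dpsi t != 0 by move=> /lo h; rewrite -normr_gt0; exact: lt_le_trans c0 h.
pose q t := ddpsi t / dpsi t ^+ 2.
pose u t : R[i] := E t * (('i * (dpsi t)%:C)^-1); pose r t : R[i] := E t * ('i * (q t)%:C).
have du t : a <= t <= b -> cderiv u t (E t + r t).
  move=> h; have d1 : cderiv E t ('i * (dpsi t)%:C * E t).
    by apply: cderiv_comp_cexp; apply: cderivZ; exact: cderiv_real.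
  have d2 := cderivZ 'i (cderiv_real (ddp t)).
  have i0 : 'i * (dpsi t)%:C != 0 :> R[i] by rewrite mulf_eq0 negb_or i1 rC_eq0 n0.
  apply: cderiv_eq (cderivM d1 (cderivV i0 d2)) _.
  have ii : 'i ^+ 2 = -1 :> R[i] := sqr_i R.
  rewrite /r /q rCM rCV (_ : (dpsi t ^+ 2)%:C = (dpsi t)%:C ^+ 2); last by rewrite expr2 rCM -expr2.
  rewrite exprMn ii [X in X + _ = _]mulrAC divff // mul1r; congr (_ + _ * _).
  by rewrite mulN1r invrN mulrN mulNr opprK -mulrA.
have cq t : a <= t <= b -> {for t, continuous q}.
  move=> h; apply: continuousM; first exact: cdd.
  apply: continuousV; first by rewrite expf_neq0 // n0.
  by rewrite (_ : (fun x => _) = fun x => dpsi x * dpsi x); [apply: continuousM; exact: is_derive_cts (ddp t)|apply/funext => x; rewrite expr2].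
have [cc cs] := @cexp_i_cts psi (fun t => is_derive_cts (dp t)).
have Rr : (fun x => Re (r x)) = fun x => - Im (E x) * q x.
  by apply/funext => x; rewrite /r ReM Re_iM Im_iM /=; ring.
have Ir : (fun x => Im (r x)) = fun x => Re (E x) * q x.
  by apply/funext => x; rewrite /r ImM Re_iM Im_iM /=; ring.
have cRr t : a <= t <= b -> {for t, continuous (fun x => Re (r x))}.
  by move=> h; rewrite Rr; apply: continuousM; [apply: continuousN; exact: cs|exact: cq].
have cIr t : a <= t <= b -> {for t, continuous (fun x => Im (r x))}.
  by move=> h; rewrite Ir; apply: continuousM; [exact: cc|exact: cq].
have [j1 e1] := @Rintegral_FTC2_in (fun x => Re (E x + r x)) (fun x => Re (u x)) a b ab
  (fun t h => (eq_ind_r (fun g : R -> R => {for t, continuous g})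
     (continuousD (cc t) (cRr t h))
     (funext (fun x => ReD (E x) (r x))))) (fun t h => proj1 (du t h)).
have [j2 e2] := @Rintegral_FTC2_in (fun x => Im (E x + r x)) (fun x => Im (u x)) a b ab
  (fun t h => (eq_ind_r (fun g : R -> R => {for t, continuous g})
     (continuousD (cs t) (cIr t h))
     (funext (fun x => ImD (E x) (r x))))) (fun t h => proj2 (du t h)).
have iE : cintb `[a, b] E by exact: cintb_segment.
have iEr : cintb `[a, b] (fun x => E x + r x) by split.
have ir : cintb `[a, b] r.
  have := cintbD mD iEr (cintbN mD iE); congr cintb; apply/funext => x; ring.
have e : cint `[a, b] E = u b - u a - cint `[a, b] r.
  rewrite -[LHS](addrK (cint `[a, b] r)) -(cintD mD iE ir); congr (_ - _).
  by apply: complex_ext; rewrite ?ReB ?ImB; [exact: e1|exact: e2].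
have nu t : a <= t <= b -> normc (u t) <= c^-1.
  move=> h; rewrite /u normcM_ nE mul1r normcV_ normcM_ nI mul1r normc_rC.
  by rewrite lef_pV2 ?posrE ?lo //; exact: lt_le_trans c0 (lo t h).
have nr : normc (cint `[a, b] r) <= C / c ^+ 2 * (b - a).
  have B t : (`[a, b]%classic : set R) t -> normc (r t) <= C / c ^+ 2.
    move=> /indom h; rewrite /r normcM_ nE mul1r normcM_ nI mul1r normc_rC /q normrM normfV normrX.
    apply: ler_pM => //; [exact: hi|].
    rewrite lef_pV2 ?posrE ?exprn_gt0 //; last exact: lt_le_trans c0 (lo t h).
    by rewrite ler_pXn2r ?nnegrE ?(ltW c0) ?lo.
  have := cint_le mD ir B (rint_segment_cst _ _ _).
  by rewrite Rintegral_cst // segment_length // ltW.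
rewrite [cint _ _]e; apply: le_trans (normcB _ _) _; apply: lerD nr.
apply: le_trans (normcB _ _) _; rewrite mulr2n mulrDl !mul1r.
by apply: lerD; apply: nu; rewrite lexx ltW.
Qed.

(** Windows moving to infinity with length equal to their left end: a bound of order 1/t becomes
    uniform on them, and behaviour before a fixed time does not affect the limit of the means. *)
Definition seg N : set R := `[N.+1%:R, 2 * N.+1%:R]%classic.
Definition avg (v : R -> R[i]) N : R[i] := (N.+1%:R^-1)%:C * cint (seg N) v.

Lemma seg_lt N : N.+1%:R < 2 * N.+1%:R :> R.
Proof. by rewrite mulr_natl mulr2n ltrDl ltr0n. Qed.
Lemma seg_length N : fine (mu (seg N)) = N.+1%:R.
Proof. by rewrite segment_length ?ltW ?seg_lt // mulr_natl mulr2n addrK. Qed.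
Lemma seg_meas N : measurable (seg N). Proof. exact: measurable_itv. Qed.

Lemma avg_le (v : R -> R[i]) N B : cintb (seg N) v -> (forall t, normc (v t) <= B) -> normc (avg v N) <= B.
Proof.
move=> iv vB; have n0 : 0 < N.+1%:R :> R by rewrite ltr0n.
rewrite /avg normcM_ normc_rC ger0_norm // ler_pdivrMl // mulrC.
have := cint_le (seg_meas N) iv (fun t _ => vB t) (rint_segment_cst _ _ _).
by rewrite Rintegral_cst ?seg_length //; exact: seg_meas.
Qed.

Lemma normc_cexp_i x : normc (cexp ('i * x%:C) : R[i]) = 1.
Proof. by rewrite normc_cexp Re_iM /= oppr0 expR0. Qed.

(** On the window the second derivative of the phase is at most C/(N+1), so over a length N+1 the
    oscillating integral stays bounded and its mean is O(1/N). *)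
Lemma avg_osc (psi dpsi ddpsi : R -> R) (c C T1 : R) : 0 < c -> 0 <= C ->
  (forall t, is_derive t 1 psi (dpsi t)) -> (forall t, is_derive t 1 dpsi (ddpsi t)) -> continuous ddpsi ->
  (forall t, T1 <= t -> c <= `|dpsi t|) -> (forall t, 1 <= t -> `|ddpsi t| <= C / t) ->
  avg (fun t => cexp ('i * (psi t)%:C)) @ \oo --> (0 : R[i]).
Proof.
move=> c0 C0 dp ddp cdd lo hi; pose B := 2 / c + C / c ^+ 2.
have B0 : 0 <= B by rewrite addr_ge0 ?divr_ge0 ?exprn_ge0 // ltW.
have bd N : T1 <= N.+1%:R -> normc (avg (fun t => cexp ('i * (psi t)%:C)) N) <= B / N.+1%:R.
  move=> TN; have n0 : 0 < N.+1%:R :> R by rewrite ltr0n.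
  rewrite /avg normcM_ normc_rC ger0_norm // mulrC ler_wpM2r ?invr_ge0 ?(ltW n0) //.
  have := @oscillation_bound psi dpsi ddpsi N.+1%:R (2 * N.+1%:R) c (C / N.+1%:R) (seg_lt N) c0 dp ddp cdd.
  move=> h; apply: le_trans (h _ _) _.
  - by move=> t /andP[t1 _]; apply: lo; exact: le_trans TN t1.
  - move=> t /andP[t1 _]; have t0 : 1 <= t by apply: le_trans t1; rewrite ler1n.
    apply: le_trans (hi t t0) _; rewrite ler_wpM2l // lef_pV2 ?posrE //; exact: lt_le_trans n0 t1.
  rewrite /B lerD2l (_ : 2 * N.+1%:R - N.+1%:R = N.+1%:R); last by ring.
  by rewrite mulrAC divfK ?lt0r_neq0.
apply/cvg_normcP => e e0; exists (Num.truncn (`|T1| + B / e)).+1 => // N NT.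
have {}NT : ((Num.truncn (`|T1| + B / e)).+1 <= N)%N := NT.
have h : `|T1| + B / e < N.+1%:R.
  apply: lt_trans (truncnS_gt _) _; by rewrite ltr_nat ltnS.
have b0 : 0 <= B / e by rewrite divr_ge0 // ltW.
have h1 : T1 <= N.+1%:R by have := ler_norm T1; lra.
have E0 (X : R[i]) : normc (0 - X) = normc X by rewrite normc_distC subr0.
apply: (eq_ind_r (fun z => is_true (z < e)) _ (E0 _)); apply: le_lt_trans (bd N h1) _.
rewrite ltr_pdivrMr // mulrC -ltr_pdivrMr //; have := normr_ge0 T1; lra.
Qed.

(** The mean is taken term by term; every mean has modulus at most 1, so the sum of |A k| dominates
    and the limit passes inside. *)
Lemma avg_series (A L : nat -> R[i]) BA (phi : nat -> R -> R) (S : R[i]) (v : R -> R[i]) :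
  (forall N, \sum_(0 <= k < N) normc (A k) <= BA) -> (forall k, continuous (phi k)) ->
  (forall t, 0 <= t -> csum (fun k => A k * cexp ('i * (phi k t)%:C)) @ \oo --> v t) ->
  (forall k, normc (L k) <= 1) ->
  (forall k, A k != 0 -> avg (fun t => cexp ('i * (phi k t)%:C)) @ \oo --> L k) ->
  csum (fun k => A k * L k) @ \oo --> S -> avg v @ \oo --> S.
Proof.
move=> AB cp vS L1 AL LS; pose E k t : R[i] := cexp ('i * (phi k t)%:C).
have iE k N : cintb (seg N) (E k) by have [c1 c2] := cexp_i_cts (cp k); exact: cintb_segment.
have key N : csum (fun k => A k * avg (E k) N) @ \oo --> avg v N.
  have n0 : 0 <= N.+1%:R :> R by exact: ler0n.
  have [||||| _ h] := @cint_series R (seg N) (fun k t => A k * E k t) v (BA * N.+1%:R).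
  - exact: seg_meas.
  - by move=> k; apply: cintbZ; [exact: seg_meas|exact: iE].
  - move=> M; apply: le_trans (ler_wpM2r n0 (AB M)); rewrite mulr_suml; apply: ler_sum => k _.
    rewrite (_ : (fun x => _) = fun=> normc (A k)); last first.
      by apply/funext => t; rewrite normcM_ normc_cexp_i mulr1.
    by rewrite Rintegral_cst ?seg_length //; exact: seg_meas.
  - move=> t _; exists BA => M; apply: le_trans (AB M); apply: ler_sum => k _.
    by rewrite normcM_ normc_cexp_i mulr1.
  - move=> t /indom /andP[t1 _]; apply: vS; exact: le_trans t1.
  have h2 : (fun M => (N.+1%:R^-1)%:C * csum (fun k => cint (seg N) (fun t => A k * E k t)) M) @ \oo --> avg v N.
    by apply: cvgM; [exact: cvg_cst|exact: h].
  apply: cvg_ext h2 => M; rewrite -csumZ; apply: eq_bigr => k _.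
  by rewrite (cintZ _ (seg_meas N) (iE k N)) /avg mulrCA.
have T : (fun N => avg v N - S) @ \oo --> (0 : R[i]).
  apply: (@tannery R nat \oo _ (fun N k => A k * (avg (E k) N - L k)) _ (fun k => normc (A k) * 2) (BA * 2)).
  - by move=> N; rewrite -mulr_suml ler_wpM2r.
  - move=> N k; rewrite normcM_ ler_wpM2l //; apply: le_trans (normcB _ _) _.
    rewrite (_ : 2 = 1 + 1) //; apply: lerD => //; apply: avg_le => // t.
    by rewrite normc_cexp_i.
  - move=> k; have [->|Ak] := eqVneq (A k) 0.
      by apply: cvg_ext (cvg_cst _) => N; rewrite mul0r.
    have h : (fun N => A k * (avg (E k) N - L k)) @ \oo --> A k * (L k - L k).
      by apply: cvgM; [exact: cvg_cst|apply: cvgB; [exact: AL|exact: cvg_cst]].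
    by rewrite subrr mulr0 in h.
  move=> N; have h : (fun M => csum (fun k => A k * avg (E k) N) M - csum (fun k => A k * L k) M) @ \oo --> avg v N - S.
    by apply: cvgB; [exact: key|exact: LS].
  by apply: cvg_ext h => M; rewrite /csum -sumrB; apply: eq_bigr => k _; rewrite mulrBr.
have h : (fun N => avg v N - S + S) @ \oo --> 0 + S by apply: cvgD; [exact: T|exact: cvg_cst].
by rewrite add0r in h; apply: cvg_ext h => N; rewrite subrK.
Qed.

End Averages.

(** * The reflection formula and Bohr means *)

Section Reflection.
Variable R : realType.
Notation pos := (`]0, +oo[%classic : set R).
Variables (f : nat -> R[i]) (K : R -> R[i]) (m : R[i] -> R) (pr pi : R -> R) (A : nat -> R[i]) (BA : R).
Hypotheses (F : L_datum f K m) (kp : kernel_parts K pr pi).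
Hypotheses (A0 : A 0%N = 0) (AB : forall N, \sum_(0 <= k < N) normc (A k) <= BA).
Hypothesis Aconv : forall n, (0 < n)%N ->
  (ln (n%:R : R))%:C * A n = dconv (fun k => if k == 1%N then 0 else f k) A n.
Let Th := Theta K (Re (f 1%N)).
Let th := theta K (Re (f 1%N)).
Let L t := lser A ('i * t%:C).

Lemma dtheta_continuous : continuous (dtheta K).
Proof.
have [_ i2] := rint_w kp; have id := rint_dtheta kp; have mp := @mpos R.
pose B := \int[mu]_(x in pos) ((`|Re (K x)| + `|Im (K x)|) * x ^+ 2).
have lip t h : `|dtheta K (t + h) - dtheta K t| <= `|h| * B.
  rewrite /dtheta -(RintB mp (id (t + h)) (id t)) /B.
  rewrite -(RintZl _ mp i2); apply: Rintegral_abs_le; first exact: mp.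
  - exact: (rintD mp (id (t + h)) (rintN mp (id t))).
  - exact: rintZ.
  move=> x; rewrite /= in_itv /= andbT => x0.
  have := derive_lipschitz t (t + h) (dtheta_integrand_derive K x) (fun t => ddtheta_bound K t x0).
  by rewrite [t + h - t]addrAC subrr add0r [_ * `|h|]mulrC.
have B0 : 0 <= B by have := lip 0 1; rewrite normr1 mul1r => /(le_trans (normr_ge0 _)).
move=> t; apply/cvgrPdist_lt => e e0; apply/nbhs_ballP; exists (e / (B + 1)).
  by rewrite /= divr_gt0 //; lra.
move=> x tx; have {}tx : `|t - x| < e / (B + 1) := tx.
have := lip t (x - t); rewrite (_ : t + (x - t) = x); last by ring.
rewrite distrC => h; apply: le_lt_trans h _; rewrite distrC; have b1 : 0 < B + 1 by lra.
move: tx; rewrite ltr_pdivlMr // => tx; apply: le_lt_trans tx; rewrite ler_wpM2l //; lra.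
Qed.

Lemma nonint_bound : exists T0 : R, 0 <= T0 /\ forall z, T0 <= Re z -> m z \is a Num.int.
Proof.
have [_ _ [_ _ _ /finite_seqP[s sE]] _] := F.
exists (1 + \sum_(z <- s) `|Re z|); split; first by rewrite addr_ge0 // sumr_ge0.
move=> z hz; apply/negPn/negP => nz.
have zs : z \in s.
  have : [set` s] z by rewrite -sE; split => //=; apply: contraNneq nz => ->; exact: rpred0.
  by [].
have h : `|Re z| <= \sum_(z <- s) `|Re z|.
  elim: s zs {sE hz} => // a s IH; rewrite inE big_cons => /orP[/eqP ->|/IH h].
    by rewrite lerDl sumr_ge0.
  by apply: le_trans h _; rewrite lerDr.
have := ler_norm (Re z); lra.
Qed.

(** A bump narrow enough for the height [t] has nonzero transform there, so [lser_zero] leaves L as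
    the vanishing factor. *)
Lemma L_pole t : 0 <= t -> m t%:C != 0 -> L t = 0.
Proof.
move=> t0 mt; have [_ _ A3 _] := F; have [y [zs [y0 zi zy zcov zlf]]] := supp_enumeration A3.
have [j zj] := (zcov _ mt).1.
pose a := Num.min (Num.min 1 (ln 2)) (1 + t)^-1.
have p1 : 0 < 1 + t by lra.
have a0 : 0 < a by rewrite !lt_min ltr01 ln2_gt0 invr_gt0.
have a1 : a <= 1 by rewrite !ge_min lexx.
have aln : a <= ln 2 by rewrite !ge_min lexx orbT.
have at1 : a * `|Im ('i * t%:C : R[i])| <= 1.
  rewrite Im_iM (ger0_norm t0); have h : a <= (1 + t)^-1 by rewrite ge_min lexx orbT.
  apply: le_trans (ler_wpM2r t0 h) _; rewrite mulrC ler_pdivrMr //; lra.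
have := lser_zero F a0 a1 aln y0 zi zy (fun z h => (zcov z h).1) zlf A0 AB Aconv (j := j).
rewrite zj Re_iM oppr0 => /(_ (lexx _)) /eqP; rewrite !mulf_eq0 rC_eq0 (negPf mt) (negPf (lt_bump_neq0 a0 at1)) /=.
by move/eqP.
Qed.

(** If one of the heights carries a zero, L vanishes there and so does the product; otherwise
    [crossing] applies, the values of [m] being integers beyond [T0]. *)
Lemma crossing_all : exists T0 : R, 0 <= T0 /\ forall t1 t2, T0 <= t1 -> t1 <= t2 ->
  Im (L t2 * cexp ('i * (Th t2)%:C) * conjc (L t1 * cexp ('i * (Th t1)%:C))) = 0.
Proof.
have [T0 [T00 HT]] := nonint_bound; exists T0; split => // t1 t2 h1 h2.
have t1_0 := le_trans T00 h1; have t2_0 := le_trans t1_0 h2.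
have [m1|m1] := eqVneq (m t1%:C) 0; last by rewrite (L_pole t1_0 m1) mul0r conjc_rC mulr0.
have [m2|m2] := eqVneq (m t2%:C) 0; last by rewrite (L_pole t2_0 m2) !mul0r.
have [_ _ A3 _] := F; have [y [zs [y0 zi zy zcov zlf]]] := supp_enumeration A3.
apply: (crossing F kp y0 zi zy zcov zlf A0 AB Aconv t1_0 h2).
- by move=> j _ h; apply: HT; exact: le_trans h.
- by move=> j; apply: contra => /eqP ->; rewrite m1.
- by move=> j; apply: contra => /eqP ->; rewrite m2.
Qed.

(** Beyond [T0] the product of L and e^(i Theta) stays on one real line through 0; reflection in
    that line is the relation. *)
Lemma reflection : exists (T0 : R) (u : R[i]), [/\ 0 <= T0, normc u = 1 & forall t, T0 <= t ->
  L t = u * cexp ('i * (- 2 * Th t)%:C) * conjc (L t)].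
Proof.
have [T0 [T00 HT]] := crossing_all.
pose e t : R[i] := cexp ('i * (Th t)%:C).
(* If L vanishes identically beyond [T0] the relation holds with [u = 1]; otherwise the line is
   spanned by the value at a point where L does not vanish. *)
have [[s [s0 Ls]]|no] := pselect (exists s, T0 <= s /\ L s != 0); last first.
  exists T0, 1; split => //; first by rewrite normc1_.
  by move=> t t0; have -> : L t = 0; [apply/eqP/negPn/negP => h; apply: no; exists t|rewrite (conjc_rC 0) mulr0].
pose om := L s * e s; have om0 : om != 0 by rewrite mulf_neq0 // cexp_neq0.
have Ie t : T0 <= t -> Im (L t * e t * conjc om) = 0.
  move=> t0; have [st|/ltW ts] := leP s t; first exact: HT.
  have h := HT t s t0 ts; rewrite -/(e t) -/(e s) in h.
  have -> : L t * e t * conjc om = conjc (om * conjc (L t * e t)) by rewrite conjcM conjcK mulrC.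
  by rewrite Im_conjc h oppr0.
have co0 : conjc om != 0 by rewrite -normc_gt0 normc_conjc normc_gt0.
exists T0, (om / conjc om); split => //.
  by rewrite normcM_ normcV_ normc_conjc divff // normc_eq0.
move=> t t0; have h := Ie t t0.
have {}h : L t * e t * conjc om = conjc (L t * e t * conjc om).
  by apply: complex_ext; rewrite ?Re_conjc ?Im_conjc // h oppr0.
have ee : conjc (e t) = (e t)^-1.
  by rewrite /e -cexp_conjc -cexpN conjc_i conjc_rC.
have e0 : e t != 0 by exact: cexp_neq0.
have e2 : cexp ('i * (- 2 * Th t)%:C) = (e t)^-1 * (e t)^-1.
  by rewrite /e -!cexpN -cexpD; congr cexp; rewrite rCM; ring.
have hh : conjc (L t * e t * conjc om) = conjc (L t) * (e t)^-1 * om by rewrite (conjcM (L t * e t)) conjcK (conjcM (L t)) ee.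
rewrite e2; rewrite hh in h.
rewrite [LHS](_ : L t = L t * e t * conjc om / e t / conjc om); last by field; rewrite e0 co0.
by rewrite h; field; rewrite e0 co0.
Qed.

(** The mean of L(t) n^(it) is [A n]. By the reflection formula it is also a mean of terms with
    phase (log n + log k) t - 2 Theta(t), which tend to 0 when the derivative of the phase stays
    away from 0. *)
Lemma Bohr_mean : exists N : nat, forall n, (N < n)%N -> A n = 0.
Proof.
have [T0 [u [T00 u1 refl]]] := reflection.
have [C C0 HC] := dtheta_bound kp.
have cTh : continuous Th by move=> t; exact: is_derive_cts (Theta_derive kp _ t).
have Lser t : 0 <= t -> csum (fun k => A k * cpow k (- ('i * t%:C))) @ \oo --> L t.
  by move=> t0; apply: (lserP AB); rewrite Re_iM /= oppr0.
(* The phase derivative may be separated from 0 only from a time depending on [k]: [avg_series]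
   treats the terms one at a time. *)
suff main n : (0 < n)%N -> (forall k, (0 < k)%N -> exists T1, forall t, T1 <= t -> 1 <= `|ln (n%:R : R) + ln k%:R - 2 * th t|) -> A n = 0.
  (* If [theta] is bounded above by [B], then log n >= 2 B + 1 keeps log n + log k above 2 theta +
     1; if [theta] tends to infinity, 2 theta eventually exceeds log n + log k + 1 for each fixed
     [k]. *)
  have [[B HB]|hi] := theta_dichotomy (Re (f 1%N)) kp.
    exists (Num.truncn (expR (2 * B + 1))) => n nN; apply: main; first exact: leq_ltn_trans nN.
    move=> k k0; exists 1 => t t1; have h := HB t t1.
    have l1 : 2 * B + 1 <= ln (n%:R : R).
      rewrite -ler_expR lnK ?posrE ?ltr0n ?(leq_ltn_trans _ nN) // ltW //.
      by apply: lt_le_trans (truncnS_gt _) _; rewrite ler_nat.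
    have l2 : 0 <= ln (k%:R : R) by rewrite ln_ge0 // ler1n.
    apply: le_trans (ler_norm _); rewrite /th; lra.
  exists 0%N => n n0; apply: main => // k k0.
  have [T T1 HT] := hi ((ln (n%:R : R) + ln k%:R + 1) / 2); exists T => t /HT h.
  rewrite distrC; apply: le_trans (ler_norm _); rewrite /th; lra.
move=> n0 sep; pose v t : R[i] := L t * cpow n ('i * t%:C).
have A0n k : A k != 0 -> (0 < k)%N by case: k => //; rewrite A0 eqxx.
have M1 : avg v @ \oo --> A n.
  apply: (@avg_series R A (fun k => (k == n)%:R) BA (fun k t => (ln n%:R - ln k%:R) * t) (A n) v AB).
  - by move=> k t; apply: cvgM; [exact: cvg_cst|exact: cvg_id].
  - move=> t t0; have h : (fun N => csum (fun k => A k * cpow k (- ('i * t%:C))) N * cpow n ('i * t%:C)) @ \oo --> v t.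
      by apply: cvgM; [exact: Lser|exact: cvg_cst].
    apply: cvg_ext h => N; rewrite /csum mulr_suml; apply: eq_bigr => k _; rewrite -mulrA; congr (_ * _).
    by rewrite !cpowE -cexpD; congr cexp; rewrite rCM rCB; ring.
  - by move=> k; case: eqP => _; rewrite ?normc1_ ?normc0_.
  - move=> k Ak; have k0 := A0n k Ak; have [->|kn] := eqVneq k n.
      apply: cvg_ext (cvg_cst _) => N; rewrite /avg.
      have -> : (fun t : R => cexp ('i * ((ln n%:R - ln n%:R) * t)%:C)) = fun=> 1 :> R[i].
        by apply/funext => t; rewrite subrr mul0r mulr0 cexp0.
      have E1 := @Rintegral_cst _ _ R mu (seg N) (seg_meas N) 1.
      have E0 := @Rintegral_cst _ _ R mu (seg N) (seg_meas N) 0.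
      have -> : @cintegral R (seg N) (fun=> 1) = (N.+1%:R)%:C.
        apply: complex_ext; last exact: (etrans E0 (mul0r _)).
        by apply: (etrans E1); rewrite seg_length mul1r.
      by rewrite -rCM mulVf.
    have b0 : 0 < `|ln (n%:R : R) - ln k%:R|.
      rewrite normr_gt0 subr_eq0; apply/negP => /eqP e; have : (n%:R : R) = k%:R.
        by apply: ln_inj; rewrite ?posrE ?ltr0n.
      by move/eqP; rewrite eqr_nat eq_sym (negPf kn).
    apply: (@avg_osc R _ (fun=> ln n%:R - ln k%:R) (fun=> 0) _ 0 0 b0 (lexx _)).
    + by move=> t; have h := rderivZ (ln n%:R - ln k%:R) (rderiv_id t); rewrite mulr1 in h.
    + by move=> t; exact: cvg_cst.
    + by [].
    + by move=> t _; rewrite normr0 mul0r.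
  have h : (fun=> A n) @ \oo --> A n by exact: cvg_cst.
  apply: cvg_trans h; apply: near_eq_cvg; exists n.+1 => // N /= nN.
  rewrite /csum (bigD1_seq n) /= ?iota_uniq ?mem_index_iota //; first by rewrite eqxx mulr1 big1 ?addr0 // => k /negPf ->; rewrite mulr0.
pose v2 t : R[i] := u * cexp ('i * (- 2 * Th t)%:C) * conjc (L t) * cpow n ('i * t%:C).
(* Conjugation turns k^(-it) into k^(it), which is why log k enters with a plus sign. The second
   derivative of the phase is - 2 dtheta, of order 1/t. *)
have M2 : avg v2 @ \oo --> (0 : R[i]).
  apply: (@avg_series R (fun k => u * conjc (A k)) (fun=> 0) BA (fun k t => (ln n%:R + ln k%:R) * t + - 2 * Th t) 0 v2).
  - by move=> N; apply: le_trans (AB N); apply: ler_sum => k _; rewrite normcM_ u1 mul1r normc_conjc.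
  - move=> k t; apply: cvgD; apply: cvgM; [exact: cvg_cst|exact: cvg_id|exact: cvg_cst|exact: cTh].
  - move=> t t0; have h : (fun N => u * cexp ('i * (- 2 * Th t)%:C) * conjc (csum (fun k => A k * cpow k (- ('i * t%:C))) N)
        * cpow n ('i * t%:C)) @ \oo --> v2 t.
      apply: cvgM; last exact: cvg_cst.
      by apply: cvgM; [exact: cvg_cst|apply: cvg_conjc; exact: Lser].
    apply: cvg_ext h => N; rewrite conjc_csum /csum mulr_sumr mulr_suml; apply: eq_bigr => k _.
    rewrite conjcM !cpowE -cexp_conjc conjcM conjcN conjc_i !conjc_rC.
    rewrite rCD; set X := (- 2 * Th t)%:C; rewrite rCM rCD.
    have -> : 'i * (((ln n%:R)%:C + (ln k%:R)%:C) * t%:C + X) =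
      'i * X + - - ('i * t%:C) * (ln k%:R)%:C + 'i * t%:C * (ln n%:R)%:C by ring.
    by rewrite !cexpD; ring.
  - by move=> k; rewrite normc0_.
  - move=> k; rewrite mulf_eq0 negb_or => /andP[_ cAk]; have k0 : (0 < k)%N.
      by apply: A0n; rewrite -normc_gt0 -normc_conjc normc_gt0.
    have [T1 HT1] := sep k k0.
    apply: (@avg_osc R _ (fun t => ln n%:R + ln k%:R + - 2 * th t) (fun t => - 2 * dtheta K t) 1 (2 * C) T1 ltr01).
    + by rewrite mulr_ge0.
    + move=> t; have h := rderivZ (ln n%:R + ln k%:R) (rderiv_id t); rewrite mulr1 in h.
      by apply: rderivD h _; apply: rderivZ; exact: (Theta_derive kp).
    + move=> t; have h := rderivD (rderiv_cst (ln n%:R + ln k%:R) t) (rderivZ (- 2) (theta_derive kp (Re (f 1%N)) t)).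
      by rewrite add0r in h.
    + by move=> t; apply: cvgM; [exact: cvg_cst|exact: dtheta_continuous].
    + by move=> t /HT1; rewrite mulNr.
    + by move=> t /HC h; rewrite mulNr normrN normrM (ger0_norm (ler0n _ 2)) -[2 * C / t]mulrA; apply: ler_wpM2l.
  by apply: cvg_ext (cvg_cst _) => N; rewrite /csum big1 // => k _; rewrite mulr0.
have M3 : avg v @ \oo --> (0 : R[i]).
  apply: cvg_trans M2; apply: near_eq_cvg; exists (Num.truncn T0) => // N /= NT.
  rewrite /avg; congr (_ * _); apply: eq_cint => t; rewrite /seg /= in_itv /= => /andP[t1 _].
  rewrite /v /v2 -refl //; apply: le_trans t1; apply: ltW; apply: lt_le_trans (truncnS_gt _) _.
  by rewrite ler_nat.
exact: (cvgc_unique M1 M3).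
Qed.

End Reflection.

(** The twist by n^(-1/2) takes the coefficients of L to the summable sequence [A], and removes the
    factor n^(1/2) from their convolution identity. *)
Lemma L_coef_finite (R : realType) (f : nat -> R[i]) (K : R -> R[i]) (m : R[i] -> R) : L_datum f K m ->
  (\sum_(1 <= n <oo) (normc (L_coef f n) / Num.sqrt (n%:R : R))%:E < +oo)%E ->
  exists N, forall n, (N < n)%N -> L_coef f n = 0.
Proof.
move=> F /nneseries_ltyP[|B HB]; first by move=> n; rewrite divr_ge0 ?normc_ge0 ?sqrtr_ge0.
have [A1 A2 _ _] := F; have [pr [pi kp]] := kernel_partsP A2.
pose A k : R[i] := if k is 0%N then 0 else L_coef f k * cpow k (- 2^-1).
have nA k : (0 < k)%N -> normc (A k) = normc (L_coef f k) / Num.sqrt k%:R.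
  case: k => // k _; rewrite /A normcM_; congr (_ * _).
  have e2 : Re (- 2^-1 : R[i]) = - 2^-1 by rewrite ReN (_ : 2^-1 = (2^-1)%:C) // rCV rmorph_nat.
  by rewrite normc_cpow e2 mulNr expRN -powR12_sqrt ?ler0n // /powR pnatr_eq0.
have AB N : \sum_(0 <= k < N) normc (A k) <= B.
  case: N => [|N]; first by have := HB 1%N; rewrite !big_geq.
  rewrite big_ltn // normc0_ add0r; apply: le_trans (HB N.+1).
  by apply: le_of_eq; apply: eq_big_nat => k /andP[k1 _]; exact: nA.
have Aconv n : (0 < n)%N -> (ln (n%:R : R))%:C * A n = dconv (fun k => if k == 1%N then 0 else f k) A n.
  move=> n0; have -> : A n = L_coef f n * cpow n (- 2^-1) by case: n n0.
  rewrite mulrA L_coef_conv //.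
  have T := @dconv_twist _ (fun d => cpow d (- 2^-1)) (fun m => if m == 1%N then 0 else f m * cpow m 2^-1) (L_coef f) n
    (fun d e d0 e0 => cpowM _ d0 e0).
  cbv beta in T; rewrite -T {T}.
  apply: eq_dconv => d /andP[d0 _]; last by case: d d0.
  case: eqP => _; first by rewrite mul0r.
  by rewrite -mulrA cpowE cpowE -cexpD mulNr addrN cexp0 mulr1.
have [N HN] := Bohr_mean F kp (erefl : A 0%N = 0) AB Aconv.
exists N => n nN; have := HN n nN; case: n nN => // n _ /eqP; rewrite /A mulf_eq0 (negPf (cpow_neq0 _ _)) orbF.
by move/eqP.
Qed.

(** * Negligible mass and the trivial datum *)

Section SmallMass.
Variable R : realType.
Notation pos := (`]0, +oo[%classic : set R).
Implicit Types (t x : R).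

Lemma derive1_affine (v : R -> R) (a b : R) : smooth v ->
  (fun x => v (a * x + b))^`()%classic = fun x => a * v^`()%classic (a * x + b).
Proof.
move=> sv; apply/funext => x; rewrite derive1E.
have h : is_derive (a * x + b) 1 v (v^`()%classic (a * x + b)).
  by rewrite derive1E; apply: derivableP; exact: smooth_derivable.
by have [_ ->] := is_derive_affine h.
Qed.

(** The smaller of [d] and 1 / (d x^2), which is the size of the transform of a bump of width
    [d]. *)
Definition spike_weight (d x : R) : R := if `|x| <= d^-1 then d else (d * x ^+ 2)^-1.

(** The term of the first shell |x| <= 2^k / d that contains [x] is enough: outside the previous
    shell, 1 / (d x^2) is at most [4 d / 4^k]. *)
Lemma dyadic_majorant (x d : R) M : 0 < d -> `|x| <= 2 ^+ M / d ->
  spike_weight d x <= \sum_(0 <= k < M.+1) (if `|x| <= 2 ^+ k / d then 4 * d / 4 ^+ k else 0).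
Proof.
move=> d0; elim: M => [|M IH] xM.
  have x1 : `|x| <= d^-1 by move: xM; rewrite expr0 mul1r.
  rewrite big_nat1 xM /spike_weight x1 !expr0 divr1; lra.
have pos k : 0 <= if `|x| <= 2 ^+ k / d then 4 * d / 4 ^+ k else 0.
  by case: ifP => // _; rewrite divr_ge0 ?exprn_ge0 // mulr_ge0 // ltW.
rewrite big_nat_recr //=; have [h|h] := leP `|x| (2 ^+ M / d).
  by apply: le_trans (IH h) _; rewrite lerDl.
rewrite xM; apply: le_trans (_ : 4 * d / 4 ^+ M.+1 <= _); last by rewrite lerDr; apply: sumr_ge0 => k _; exact: pos.
have p2 : 0 < 2 ^+ M :> R by rewrite exprn_gt0.
have q0 : 0 < 2 ^+ M / d by rewrite divr_gt0.
have x1 : (`|x| <= d^-1) = false.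
  apply/negbTE; rewrite -ltNge; apply: le_lt_trans h.
  by rewrite -[leLHS]mul1r ler_pM2r ?invr_gt0 // exprn_ege1 // ler1n.
rewrite /spike_weight x1.
have x2 : (2 ^+ M / d) ^+ 2 <= x ^+ 2.
  by rewrite -[x ^+ 2]real_normK ?num_real // ler_pXn2r ?nnegrE ?(ltW q0) ?(ltW h).
have -> : 4 * d / 4 ^+ M.+1 = (d * (2 ^+ M / d) ^+ 2)^-1.
  rewrite exprS (_ : 4 ^+ M = (2 ^+ M) ^+ 2 :> R); last by rewrite -exprM mulnC exprM; congr (_ ^+ M); ring.
  by field; rewrite !lt0r_neq0.
have q2 : 0 < (2 ^+ M / d) ^+ 2 by rewrite exprn_gt0.
by rewrite lef_pV2 ?posrE ?ler_pM2l // mulr_gt0 //; exact: lt_le_trans q2 x2.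
Qed.

(** The shell of radius 2^k / d has mass at most e 2^k / d and weight 4 d / 4^k; the products 4 e /
    2^k add up to at most [8 e]. The condition [d * T1 <= 1] puts even the first shell in the range
    of the mass bound. *)
Lemma mass_weighted (m : R[i] -> R) (zs : nat -> R[i]) (e T1 d : R) N : injective zs -> 0 <= e -> 0 < d -> d * T1 <= 1 ->
  (forall T, T1 <= T -> (mass_upto m T <= (e * T)%:E)%E) ->
  \sum_(0 <= j < N) `|m (zs j)| * spike_weight d (Re (zs j)) <= 8 * e.
Proof.
move=> zi e0 d0 dT mass.
have [M HM] : exists M, forall j, (j < N)%N -> `|Re (zs j)| <= 2 ^+ M / d.
  elim: N => [|N [M HM]]; first by exists 0%N.
  have [M' HM'] : exists M', `|Re (zs N)| <= 2 ^+ M' / d.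
    exists (Num.truncn (`|Re (zs N)| * d)).+1; rewrite ler_pdivlMr //; apply: ltW.
    apply: lt_trans (truncnS_gt _) _; rewrite -natrX ltr_nat; exact: ltn_expl.
  exists (maxn M M') => j; rewrite ltnS leq_eqVlt => /orP[/eqP ->|/HM h].
    by apply: le_trans HM' _; rewrite ler_pM2r ?invr_gt0 // ler_eXn2l ?leq_maxr // ltr1n.
  by apply: le_trans h _; rewrite ler_pM2r ?invr_gt0 // ler_eXn2l ?leq_maxl // ltr1n.
apply: le_trans (_ : \sum_(0 <= j < N) \sum_(0 <= k < M.+1)
    (if `|Re (zs j)| <= 2 ^+ k / d then 4 * d / 4 ^+ k else 0) * `|m (zs j)| <= _).
  rewrite big_nat [leRHS]big_nat; apply: ler_sum => j /andP[_ jN].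
  by rewrite mulrC -mulr_suml ler_wpM2r // dyadic_majorant // HM.
rewrite exchange_big /=.
apply: le_trans (_ : \sum_(0 <= k < M.+1) 4 * e / 2 ^+ k <= _).
  apply: ler_sum => k _; have p2 : 0 < 2 ^+ k :> R by rewrite exprn_gt0.
  have Tk : T1 <= 2 ^+ k / d.
    rewrite ler_pdivlMr // mulrC; apply: le_trans dT _; by rewrite exprn_ege1 // ler1n.
  have h := mass_enum N zi (mass _ Tk).
  have c0 : 0 <= 4 * d / 4 ^+ k by rewrite divr_ge0 ?exprn_ge0 // mulr_ge0 // ltW.
  have := ler_wpM2l c0 h.
  rewrite (_ : 4 * d / 4 ^+ k * (e * (2 ^+ k / d)) = 4 * e / 2 ^+ k); last first.
    rewrite (_ : 4 ^+ k = (2 ^+ k) ^+ 2 :> R); last by rewrite -exprM mulnC exprM; congr (_ ^+ k); ring.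
    by field; rewrite !lt0r_neq0.
  apply: le_trans; rewrite mulr_sumr [leRHS]big_mkcond; apply: ler_sum => j _.
  by case: ifP => _; rewrite ?mul0r.
have geo : \sum_(0 <= k < M.+1) (2 ^+ k)^-1 <= 2 :> R.
  suff -> : \sum_(0 <= k < M.+1) (2 ^+ k)^-1 = 2 - (2 ^+ M)^-1 :> R.
    by rewrite gerBl invr_ge0 exprn_ge0.
  elim: M {HM} => [|M IH]; first by rewrite big_nat1 expr0 invr1; ring.
  rewrite big_nat_recr //= IH exprS; have p2 : 2 ^+ M != 0 :> R by rewrite expf_neq0.
  by field.
rewrite -mulr_sumr; have := ler_wpM2l (mulr_ge0 (ler0n R 4) e0) geo; lra.
Qed.

Variables (f : nat -> R[i]) (K : R -> R[i]) (m : R[i] -> R).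
Hypothesis F : L_datum f K m.

(** The length of the support gives the bound by [d]; two integrations by parts gain (Re z)^(-2) at
    the cost of d^(-2). For [d <= 1] all supports lie within |lam| + 3 of the origin, so the
    exponential factor is uniform in [d]. *)
Lemma spike_transform_bound (lam y : R) : 0 <= y -> exists2 C, 0 <= C & forall (d : R) (z : R[i]), 0 < d -> d <= 1 ->
  `|Im z| <= y -> normc (lt (fun x => bump 1 ((x - lam) / d)) ('i * z)) <= C * spike_weight d (Re z).
Proof.
move=> y0; pose v := bump (1 : R); have sv : smooth v by exact: smooth_bump.
pose v2 := (v^`())^`()%classic.
have t0 := testfn_bump (1 : R); have t1 := testfn_derive t0; have t2 := testfn_derive t1.
have [S S0 HS] := testfn_bounded t2.
pose X := expR ((`|lam| + 3) * y).
exists (6 * (1 + S) * X).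
  by rewrite mulr_ge0 ?(expR_ge0 _) // mulr_ge0 // addr_ge0.
move=> d z d0 d1 zy; set w := 'i * z.
have wy : `|Re w| <= y by rewrite /w Re_iM normrN.
pose r x := v ((x - lam) / d).
have rE : r = fun x => v (d^-1 * x + - (lam / d)).
  by apply/funext => x; rewrite /r; congr v; ring.
have tr : testfn r (1 * d + `|lam|) by exact: (testfn_shift lam (testfn_scale d0 t0)).
have ad : 0 <= 1 * d + `|lam| by rewrite mul1r addr_ge0 // ltW.
have tr1 := testfn_derive tr.
have ad1 : 0 <= 1 * d + `|lam| + 1 by rewrite addr_ge0.
have X0 : 0 <= X := expR_ge0 _.
have ex c : 0 <= c -> c <= 3 -> expR ((`|lam| + c) * y) <= X by move=> c0 c3; rewrite ler_expR ler_wpM2r // lerD2l.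
have b1 : normc (lt r w) <= d * (6 * (1 + S) * X).
  have h := @lt_bound R r _ d lam 1 y w (ltW d0) tr _ _ wy.
  apply: le_trans (h _ _) _.
  - move=> x dx; rewrite /r /v bump_eq0 // normrM normfV (gtr0_norm d0) ler_pdivlMr // mul1r.
    by [].
  - by move=> x; rewrite ger0_norm ?bump_ge0 // bump_le1.
  have d3 : d <= 3 by lra.
  have e1 := ex d (ltW d0) d3.
  rewrite mulr1; apply: le_trans (ler_wpM2l _ e1) _; first by rewrite mulr_ge0 // ltW.
  have := mulr_ge0 (mulr_ge0 (ltW d0) S0) X0; have := mulr_ge0 (ltW d0) X0; lra.
have r2E : (r^`())^`()%classic = fun x => (d ^+ 2)^-1 * v2 ((x - lam) / d).
  rewrite rE derive1_affine //.
  have -> : (fun x => d^-1 * v^`()%classic (d^-1 * x + - (lam / d))) = fun x => d^-1 * ((fun x => v^`()%classic (d^-1 * x + - (lam / d))) x) by [].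
  have s1 : smooth v^`()%classic by exact: smooth_derive1.
  apply/funext => x; rewrite derive1E.
  have h : is_derive (d^-1 * x + - (lam / d)) 1 v^`()%classic (v2 (d^-1 * x + - (lam / d))).
    by rewrite /v2 [X in is_derive _ _ _ X]derive1E; apply: derivableP; exact: smooth_derivable.
  have [_ ->] := rderivZ d^-1 (is_derive_affine h).
  rewrite mulrA expr2 invfM; congr (_ * v2 _); ring.
have b2 : `|Re z| ^+ 2 * normc (lt r w) <= d^-1 * (6 * (1 + S) * X).
  have tr2 := testfn_derive tr1.
  have E : lt (r^`())^`()%classic w = w ^+ 2 * lt r w.
    by rewrite (lt_derive _ ad1 tr1) (lt_derive _ ad tr) expr2; ring.
  have h := @lt_bound R _ _ (3 * d) lam ((d ^+ 2)^-1 * S) y w _ tr2 _ _ wy.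
  have nw : `|Re z| <= normc w by apply: le_trans (ler_normc_Im w); rewrite /w Im_iM.
  apply: le_trans (_ : normc (lt (r^`())^`()%classic w) <= _).
    rewrite E normcM_; apply: ler_wpM2r; first exact: normc_ge0.
    have -> : normc (w ^+ 2) = normc w ^+ 2 by rewrite !expr2 normcM_.
    by rewrite ler_pXn2r // ?nnegrE //.
  apply: le_trans (h _ _ _) _.
  - by rewrite mulr_ge0 // ltW.
  - move=> x dx; rewrite r2E (_ : v2 _ = 0) ?mulr0 //; apply: (proj2 t2).
    rewrite normrM normfV (gtr0_norm d0) ler_pdivlMr //; apply: le_trans dx; rewrite ler_wpM2r ?(ltW d0) //; lra.
  - move=> x; rewrite r2E normrM ger0_norm ?invr_ge0 ?exprn_ge0 ?(ltW d0) // ler_wpM2l ?invr_ge0 ?exprn_ge0 ?(ltW d0) //.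
  have e1 := ex (3 * d) (mulr_ge0 (ler0n R 3) (ltW d0)) (ler_piMr (ler0n R 3) d1).
  apply: le_trans (ler_wpM2l _ e1) _; first by rewrite !mulr_ge0 ?invr_ge0 ?exprn_ge0 // ltW.
  rewrite (_ : 2 * (3 * d) * ((d ^+ 2)^-1 * S) * X = d^-1 * (6 * S * X)); last by field; rewrite lt0r_neq0.
  rewrite ler_wpM2l ?invr_ge0 ?(ltW d0) // ler_wpM2r // ler_wpM2l //; lra.
set B := 6 * (1 + S) * X; have B0 : 0 <= B by rewrite /B mulr_ge0 // mulr_ge0 // addr_ge0.
rewrite /spike_weight; case: ifPn => [_|]; first by rewrite mulrC.
rewrite -ltNge => zd; have z0 : 0 < `|Re z| by apply: lt_trans zd; rewrite invr_gt0.
have z2 : 0 < Re z ^+ 2 by rewrite exprn_even_gt0 //= -normr_gt0.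
rewrite ler_pdivlMr; last exact: mulr_gt0.
move: b2; rewrite real_normK ?num_real // -/B => h.
have := ler_wpM2l (ltW d0) h; rewrite [d * (d^-1 * B)]mulrA mulfV ?mul1r ?lt0r_neq0 // => h2.
by apply: le_trans h2; apply: le_of_eq; rewrite /r; ring.
Qed.

(** For a test function living on positive arguments away from 0, the central and the reflected term
    of [kin] disappear. *)
Lemma kin_window (r : R -> R) (a c d : R) : testfn r a -> 0 < d < c -> (forall x, d <= `|x - c| -> r x = 0) ->
  [/\ forall x, 0 <= x -> r (- x) = 0, forall x, 0 < x -> kin K r x = - (K x * (r x)%:C),
    cint pos (kin K r) = cint `[c - d, c + d] (kin K r) & cintb `[c - d, c + d] (kin K r)].
Proof.
move=> tr /andP[d0 dc] r0; have [_ A2 _ _] := F; have [pr [pi kp]] := kernel_partsP A2.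
have rneg x : 0 <= x -> r (- x) = 0 by move=> x0; apply: r0; rewrite ler0_norm; lra.
have kE x : 0 < x -> kin K r x = - (K x * (r x)%:C).
  move=> x0; have := rneg 0 (lexx _); rewrite oppr0 => rz.
  by rewrite /kin (rneg x (ltW x0)) rz !mulr0 sub0r subr0.
have Epos : `[c - d, c + d]%classic `<=` pos by move=> x; rewrite /= !in_itv /= andbT; lra.
split => //; last by (apply: cintb_sub Epos (kin_cintb kp tr); [exact: measurable_itv|exact: mpos]).
apply: cint_cut => // x; rewrite /= !in_itv /= andbT => x0 nE.
by rewrite kE // r0 ?mulr0 ?oppr0 // leNgt; apply/negP; rewrite ltr_norml => h; apply: nE; lra.
Qed.

(** With a bump of width [d] at log n0 the explicit formula isolates [f n0]: the sum over zeros is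
    O(e) by [mass_weighted], the kernel term is O(d), and no other log n lies within [d]. *)
Lemma negligible_mass_vanish n0 : (1 < n0)%N ->
  (forall e : R, 0 < e -> \forall T \near +oo%R, (mass_upto m T <= (e * T)%:E)%E) -> f n0 = 0.
Proof.
move=> n01 mass; have [_ A2 A3 _] := F; have [pr [pi kp]] := kernel_partsP A2.
have [y [zs [y0 zi zy zcov zlf]]] := supp_enumeration A3; have [CK CK0 HCK] := kernel_bounds kp.
set lam := ln (n0%:R : R); have n0p : 0 < n0%:R :> R by rewrite ltr0n ltnW.
have lam0 : 0 < lam by rewrite ln_gt0 // ltr1n.
have [C C0 HC] := spike_transform_bound lam y0.
pose N := (log_cutoff (1 + lam) + n0.+1)%N.
have HN n : (N <= n)%N -> 1 + lam <= ln (n%:R : R).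
  move=> Nn; have /log_cutoffP := leq_trans (leq_addr n0.+1 _) Nn; have := ler_norm (1 + lam); lra.
have n0N : (n0 < N)%N by rewrite /N leq_addl.
have [||gap /andP[gap0 gap1] Hgap] := @finite_min R (fun j e => (0 < j)%N -> j != n0 -> e <= `|ln (j%:R : R) - lam|) N.
- move=> j; have [->|j0] := posnP j; first by exists 1.
  have [->|jn] := eqVneq j n0; first by exists 1.
  exists `|ln (j%:R : R) - lam| => //; rewrite normr_gt0 subr_eq0; apply: contra jn => /eqP e.
  by rewrite -(eqr_nat R); apply/eqP; apply: ln_inj; rewrite ?posrE ?ltr0n ?(ltnW n01).
- by move=> j e e' _ ee h j0 jn; apply: le_trans ee (h j0 jn).
pose C2 := 2 * CK / lam * 2; have C20 : 0 <= C2 by rewrite mulr_ge0 // divr_ge0 ?mulr_ge0 // ltW.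
have b0 : 0 < bump (1 : R) 0 by rewrite bump_gt0 // normr0.
have key (e : R) : 0 < e -> normc (f n0) * bump 1 0 <= (8 * C + C2) * e.
  move=> e0; have [T1 [_ HT1]] := mass e e0.
  (* [gap] excludes the other logarithms, [lam / 2] keeps the support in positive arguments, [e]
     makes the kernel term small, and the last bound gives [d * (|T1| + 1) <= 1] for
     [mass_weighted]. *)
  pose d := Num.min (Num.min gap (lam / 2)) (Num.min e (`|T1| + 2)^-1).
  have T2 : 0 < `|T1| + 2 by have := normr_ge0 T1; lra.
  have d0 : 0 < d by rewrite !lt_min gap0 e0 invr_gt0 T2 divr_gt0.
  have dgap : d <= gap by rewrite !ge_min lexx.
  have dlam : d <= lam / 2 by rewrite !ge_min lexx orbT.
  have de : d <= e by rewrite !ge_min lexx !orbT.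
  have dT : d * (`|T1| + 1) <= 1.
    have h : d <= (`|T1| + 2)^-1 by rewrite !ge_min lexx !orbT.
    apply: le_trans (_ : d * (`|T1| + 2) <= _); first by rewrite ler_wpM2l ?(ltW d0) // lerD2l; lra.
    by rewrite -ler_pdivlMr // mul1r.
  have d1 : d <= 1 := le_trans dgap gap1.
  pose r x : R := bump 1 ((x - lam) / d).
  have tr : testfn r (1 * d + `|lam|) by exact: (testfn_shift lam (testfn_scale d0 (testfn_bump 1))).
  have r0 x : d <= `|x - lam| -> r x = 0.
    by move=> h; rewrite /r bump_eq0 // normrM normfV (gtr0_norm d0) ler_pdivlMr // mul1r.
  have dl : 0 < d < lam by rewrite d0; lra.
  have [rneg kE cE iE] := kin_window tr dl r0.
  have rlam : r lam = bump 1 0 by rewrite /r subrr mul0r.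
  have N0 : (0 < N)%N by rewrite /N addnS.
  have HN' n : (N <= n)%N -> 1 * d + `|lam| <= ln (n%:R : R).
    by move=> /HN; rewrite (gtr0_norm lam0); lra.
  have [lim _] := datum_csum F tr N0 HN' zi (fun z h => (zcov z h).1).
  have nD : normc (datum_value f K r N) <= 8 * C * e.
    have Hb M : normc (csum (fun j => (m (zs j))%:C * lt r ('i * zs j)) M) <= 8 * C * e.
      apply: le_trans (normc_csum _ _) _.
      have mw : \sum_(0 <= j < M) `|m (zs j)| * spike_weight d (Re (zs j)) <= 8 * e.
        apply: (@mass_weighted m zs e (`|T1| + 1) d M zi (ltW e0) d0 dT) => T hT.
        by apply: HT1; apply: lt_le_trans hT; have := ler_norm T1; lra.
      have := ler_wpM2l C0 mw; rewrite mulrA [C * 8]mulrC; apply: le_trans.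
      rewrite mulr_sumr; apply: ler_sum => j _; rewrite normcM_ normc_rC mulrCA ler_wpM2l //; exact: HC.
    exact: normc_lim_le Hb lim.
  have nK : normc (cint pos (kin K r)) <= C2 * e.
    pose E : set R := `[lam - d, lam + d]%classic.
    have mE : measurable E by exact: measurable_itv.
    have inE x : E x -> lam / 2 <= x.
      by rewrite /E /= in_itv /= => /andP[h1 _]; lra.
    rewrite cE.
    have bE x : E x -> normc (kin K r x) <= 2 * CK / lam.
      move=> Ex; have x2 := inE x Ex; have x0 : 0 < x by lra.
      rewrite kE // normcN normcM_ normc_rC ger0_norm ?bump_ge0 //.
      apply: le_trans (_ : normc (K x) <= _); first by rewrite ler_piMr // bump_le1.
      rewrite ler_pdivlMr //; have [h _] := HCK x x0; have k0 := normc_ge0 (K x).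
      have p1 : 1 <= (1 + x) ^+ 4 by apply: exprn_ege1; lra.
      have := ler_wpM2l (mulr_ge0 k0 (ltW x0)) p1; have := ler_wpM2l k0 x2; lra.
    have := cint_le mE iE bE (rint_segment_cst _ _ _).
    rewrite Rintegral_cst // segment_length; last by lra.
    move=> h; apply: le_trans h _; rewrite [leRHS](_ : _ = 2 * CK / lam * (2 * e)); last by rewrite /C2 mulrA.
    apply: ler_wpM2l; first by rewrite divr_ge0 ?mulr_ge0 // ltW.
    lra.
  have Ep : prime_sum f r N = f n0 * (bump 1 0)%:C.
    rewrite /prime_sum (bigD1_seq n0) ?iota_uniq ?mem_index_iota ?(ltnW n01) //=.
    have l0 n : (0 < n)%N -> 0 <= ln (n%:R : R) by move=> n1; rewrite ln_ge0 // ler1n.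
    rewrite rlam (rneg lam (ltW lam0)) mulr0 addr0 sum0_nat ?addr0 // => n nn /andP[n1 nN].
    rewrite (rneg _ (l0 n n1)) mulr0 addr0 r0 ?mulr0 //; exact: le_trans dgap (Hgap n nN n1 nn).
  have -> : normc (f n0) * bump 1 0 = normc (cint pos (kin K r) - datum_value f K r N).
    rewrite /datum_value opprB addrC subrK Ep normcM_ normc_rC ger0_norm //; exact: bump_ge0.
  by apply: le_trans (normcB _ _) _; rewrite mulrDl addrC; exact: lerD.
apply/eqP; rewrite -normc_eq0; apply/negPn/negP => fn.
have f0 : 0 < normc (f n0) by rewrite lt_def fn normc_ge0.
have q0 : 0 < normc (f n0) * bump 1 0 by rewrite mulr_gt0.
have c1 : 0 < 8 * C + C2 + 1 by rewrite ltr_wpDl // addr_ge0 // mulr_ge0.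
have := key _ (divr_gt0 q0 c1); move: q0; move: (normc (f n0) * bump 1 0) => q q0.
rewrite mulrA ler_pdivlMr // [leLHS]mulrC ler_pM2r //; lra.
Qed.

Lemma mass_zero : (forall z, m z = 0) -> forall e : R, 0 < e -> \forall T \near +oo%R, (mass_upto m T <= (e * T)%:E)%E.
Proof.
move=> m0 e e0; near=> T.
have -> : mass_upto m T = 0%E.
  by rewrite /mass_upto esum1 // => z _; rewrite m0 normr0.
rewrite lee_fin mulr_ge0 ?(ltW e0) //; apply: ltW; near: T; apply: nbhs_pinfty_gt; exact: num_real.
Unshelve. all: by end_near. Qed.

(** Without zeros one side of the explicit formula is 0. First [f n = 0] for [n >= 2] by
    [negligible_mass_vanish]; bumps near a point x0 then give K(x0) = 0 by continuity, and a bump at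
    0 finally gives [Re (f 1) = 0], while (A1) makes [f 1] real. *)
Lemma no_zeros_trivial : (forall z, m z = 0) ->
  [/\ forall n, (0 < n)%N -> f n = 0, forall x : R, 0 < x -> K x = 0 & forall z, m z = 0].
Proof.
move=> m0; have [[A1 _ _] A2 A3 _] := F; have [pr [pi kp]] := kernel_partsP A2.
have f2 n : (1 < n)%N -> f n = 0 by move=> n1; apply: (negligible_mass_vanish n1); exact: mass_zero.
have [y [zs [y0 zi zy zcov zlf]]] := supp_enumeration A3.
have D (r : R -> R) a : testfn r a -> cint pos (kin K r) = (2 * Re (f 1%N) * r 0)%:C.
  move=> tr; pose N := (log_cutoff a).+1.
  have HN n : (N <= n)%N -> a <= ln (n%:R : R).
    by move=> /ltnW /log_cutoffP; have := ler_norm a; lra.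
  have [lim _] := datum_csum F tr (isT : 0 < N)%N HN zi (fun z h => (zcov z h).1).
  have lim0 : csum (fun j => (m (zs j))%:C * lt r ('i * zs j)) @ \oo --> (0 : R[i]).
    by apply: cvg_ext (cvg_cst _) => M; rewrite /csum big1 // => j _; rewrite m0 mul0r.
  have /eqP dv : datum_value f K r N = 0 by exact: (cvgc_unique lim lim0).
  move: dv; rewrite /datum_value subr_eq0 => /eqP ->; rewrite /prime_sum big_ltn // sum0_nat ?addr0.
    rewrite ln1 oppr0; apply: complex_ext; rewrite ?ReD ?ImD ?Re_rCr ?Im_rCr ?Re_conjc ?Im_conjc /=; ring.
  by move=> n _ /andP[n1 _]; rewrite f2 // (conjc_rC 0) !mul0r addr0.
have K0 x0 : 0 < x0 -> K x0 = 0.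
  move=> x00; apply/eqP; rewrite -normc_eq0; apply/negPn/negP => Kn.
  have k0 : 0 < normc (K x0) by rewrite lt_def Kn normc_ge0.
  have k2 : 0 < normc (K x0) / 2 by rewrite divr_gt0.
  have /cvg_normcP /(_ _ k2) /nbhs_ballP [d' /= d'0 Hd'] := kernel_continuous kp x00.
  (* The support then lies to the right of 0 and inside the neighbourhood where K differs from K(x0)
     by less than |K(x0)| / 2. *)
  pose d := Num.min d' x0 / 2.
  have dm : 0 < Num.min d' x0 by rewrite lt_min d'0.
  have d0 : 0 < d by rewrite divr_gt0.
  have dd' : d < d'.
    have : Num.min d' x0 <= d' by rewrite ge_min lexx.
    rewrite /d; lra.
  have dx : 0 < d < x0; first rewrite d0 /=.
    have : Num.min d' x0 <= x0 by rewrite ge_min lexx orbT.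
    rewrite /d; lra.
  pose r x := bump d (x - x0).
  have tr := testfn_shift x0 (testfn_bump d).
  pose E : set R := `[x0 - d, x0 + d]%classic.
  have mE : measurable E by exact: measurable_itv.
  have inE x : E x -> 0 < x /\ `|x - x0| <= d.
    by rewrite /E /= in_itv /= ler_norml => /andP[h1 h2]; split; [|apply/andP; split]; lra.
  have r1 x : d <= `|x - x0| -> r x = 0 by exact: bump_eq0.
  have r0 x : ~ E x -> r x = 0.
    by move=> nE; apply: r1; rewrite leNgt; apply/negP; rewrite ltr_norml => h; apply: nE; rewrite /E /= in_itv /=; lra.
  have [rneg kE cE iE] := kin_window tr dx r1.
  have rz : r 0 = 0 by have := rneg 0 (lexx _); rewrite oppr0.
  have I0 : cint E (kin K r) = 0 by rewrite -cE (D r _ tr) rz mulr0.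
  have irr : rint setT r.
    apply: (rint_supp (D := E) mE) => //; apply: rint_segment; exact: testfn_continuous tr.
  have Ir : 0 < \int[mu]_(x in E) r x.
    have h : 0 < \int[mu]_x r x.
      apply: (@Rintegral_gt0 R r x0); [exact: testfn_continuous tr|exact: irr|by move=> x; exact: bump_ge0|].
      by rewrite /r subrr bump_gt0 // normr0.
    rewrite [ltRHS](_ : _ = \int[mu]_x r x) // [LHS]Rintegral_mkcond; apply: eq_Rintegral => x _.
    by rewrite patchE; case: ifPn => //; rewrite notin_setE => /r0.
  have irE : rint E r by apply: rint_sub irr.
  have iC : cintb E (fun x => K x0 * (r x)%:C) by apply: cintbZ => //; exact: cintb_rC.
  have e1 : cint E (fun x => kin K r x + K x0 * (r x)%:C) = K x0 * (\int[mu]_(x in E) r x)%:C.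
    rewrite (cintD mE iE iC) I0 add0r (cintZ _ mE); last exact: cintb_rC.
    congr (_ * _); apply: complex_ext; first by [].
    exact: (etrans (@Rintegral_cst _ _ R mu E mE 0) (mul0r _)).
  have b x : E x -> normc (kin K r x + K x0 * (r x)%:C) <= normc (K x0) / 2 * r x.
    move=> Ex; have [h1 h2] := inE x Ex.
    rewrite kE // addrC -mulrBl normcM_ normc_rC ger0_norm ?bump_ge0 // ler_wpM2r ?bump_ge0 //.
    apply: ltW; apply: Hd'; rewrite /ball /= distrC; exact: le_lt_trans h2 dd'.
  have := cint_le mE (cintbD mE iE iC) b (rintZ _ mE irE).
  rewrite e1 normcM_ normc_rC (gtr0_norm Ir) (RintZl _ mE irE) ler_pM2r //; lra.
have f1 : f 1%N = 0.
  have e := D _ _ (testfn_bump 1); have b0 : 0 < bump (1 : R) 0 by rewrite bump_gt0 // normr0.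
  have z : cint pos (kin K (bump 1)) = 0.
    rewrite (@eq_cint _ pos _ (fun=> 0)).
      have E0 := @Rintegral_cst _ _ R mu pos mpos 0.
      by apply: complex_ext; exact: (etrans E0 (mul0r _)).
    move=> x; rewrite /= in_itv /= andbT => x0; rewrite /kin K0 //.
    by rewrite (conjc_rC 0) !mul0r subr0 /= mulr0 mul0r subr0.
  move: e; rewrite z => /(congr1 (@complex.Re R)) /= /esym /eqP; rewrite mulf_eq0 (gt_eqF b0) orbF.
  rewrite mulf_eq0 pnatr_eq0 /= => /eqP h; apply: complex_ext => //.
split => // n n0; case: n n0 => [|[|n]] // _; exact: f2.
Qed.

End SmallMass.

Theorem theorem1p6 (R : realType) (f : nat -> R[i]) (K : R -> R[i])
    (m : R[i] -> R) (hF : L_datum f K m) :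
  [<-> [/\ forall n : nat, (0 < n)%N -> f n = 0,
           forall x : R, 0 < x -> K x = 0
         & forall z : R[i], m z = 0];
       (\sum_(2 <= n <oo) (normc (f n) / ln (n%:R : R))%:E < +oo)%E;
       (\sum_(1 <= n <oo) (normc (L_coef f n) / Num.sqrt (n%:R : R))%:E
          < +oo)%E;
       ratio_of_dirichlet_polys (L_function f);
       forall eps : R, 0 < eps ->
         \forall T \near +oo%R, (mass_upto m T <= (eps * T)%:E)%E].
Proof.
have u0 n : 0 <= normc (f n) / ln (n%:R : R) by rewrite divr_ge0 ?normc_ge0 ?ln_nat_ge0.
have vanish : (\sum_(2 <= n <oo) (normc (f n) / ln (n%:R : R))%:E < +oo)%E -> forall z, m z = 0.
  by move=> /(nneseries_ltyP _ u0) [B HB]; exact: summable_vanish hF HB.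
have [A1 _ _ _] := hF; tfae.
- move=> [f0 _ _]; apply/(nneseries_ltyP _ u0); exists 0 => N.
  rewrite sum0_nat // => n _ /andP[n2 _].
  by rewrite f0 ?normc0_ ?mul0r // ltnW.
- move=> /vanish /(no_zeros_trivial hF) [f0 _ _]; exact: L_coef_sum_trivial.
- by move=> /(L_coef_finite hF) [N HN]; exact: dirichlet_poly_ratio A1 HN.
- by move=> /(ratio_summable A1) /vanish; exact: mass_zero.
(* This closes the cycle through (ii): under (v) every [f n] with [n >= 2] is 0, so the sum in (ii)
   is bounded by 0 and [m] vanishes. *)
- move=> mass; apply: (no_zeros_trivial hF); apply: (@summable_vanish _ f K m 0 hF) => N.
  rewrite sum0_nat // => n _ /andP[n2 _].
  by rewrite (negligible_mass_vanish hF n2 mass) normc0_ mul0r.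
Qed.
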